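(* Let $\Bbbk$ be an algebraically closed field of arbitrary characteristic, and let $X=X_\Sigma$ be an $n$-dimensional smooth projective toric variety over $\Bbbk$. Assume that there is an ample vector bundle $\mathcal E$ on $X$ of rank $r>0$ admitting an injective morphism $\mathcal E\hookrightarrow T_X$ of locally free sheaves. Then $X\simeq\mathbb P^n_\Bbbk$. Moreover, under this isomorphism, either $\mathcal E\simeq\mathcal O_{\mathbb P^n_\Bbbk}(1)^{\oplus r}$, or $r=n$ and the given injective morphism is an isomorphism $\mathcal E\simeq T_X\simeq T_{\mathbb P^n_\Bbbk}$.
   Context: $X_\Sigma$ denotes the toric variety over $\Bbbk$ associated with a fan $\Sigma$, and $T_X$ is its tangent bundle. ''Injective morphism of locally free sheaves'' means injective as a morphism of sheaves; the quotient $T_X/\mathcal E$ is not assumed to be locally free. No torus-equivariant structure on $\mathcal E$ is assumed, and the injection is not required to be equivariant. A vector bundle $\mathcal E$ is ample if the tautological line bundle $\mathcal O_{\mathbb P(\mathcal E)}(1)$ on the projective bundle $\mathbb P(\mathcal E)$ of one-dimensional quotients is ample. *)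

(* Defs.v *)
From HB Require Import structures.
From mathcomp Require Import all_boot all_order all_algebra.
From mathcomp Require Import all_classical.

Set Implicit Arguments.
Unset Strict Implicit.
Unset Printing Implicit Defensive.

Import Order.TTheory GRing.Theory Num.Theory.
Local Open Scope classical_set_scope.
Local Open Scope ring_scope.

(* The ground field k is algebraically closed in the main statement, so
   varieties over k are taken in the classical sense: a space of (closed) points
   whose structure sheaf is a sheaf of k-valued functions.  The lattice of open
   sets and the structure sheaf are those of the corresponding reduced scheme,
   so sheaves of modules and k-morphisms are the same as for the scheme. *)

Section Spaces.
Variable k : fieldType.

Record space := Space {
  pt :> Type;
  opn : set (set pt);
  reg : set pt -> set (pt -> k);
  opnT : opn setT;
  opnI : forall U V, opn U -> opn V -> opn (U `&` V);
  opn_bigcup : forall F : set (set pt),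
    F `<=` opn -> opn (\bigcup_(U in F) U);
  reg_cst : forall U c, opn U -> reg U (cst c);
  regD : forall U f g, opn U -> reg U f -> reg U g -> reg U (f + g);
  regM : forall U f g, opn U -> reg U f -> reg U g -> reg U (f * g);
  reg_sub : forall U V f, opn U -> opn V -> V `<=` U -> reg U f -> reg V f;
  reg_glue : forall U f, opn U ->
    (forall x, U x -> exists V, [/\ opn V, V x, V `<=` U & reg V f]) ->
    reg U f;
  reg_eq : forall U f g, opn U -> {in U, f =1 g} -> reg U f -> reg U g;
  opn_neq0 : forall U f, opn U -> reg U f -> opn (U `&` [set x | f x != 0]);
  regV : forall U f, opn U -> reg U f -> (forall x, U x -> f x != 0) ->
    reg U (fun x => (f x)^-1)
}.

Definition smorphism (X Y : space) (phi : X -> Y) : Prop :=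
  forall V, opn V ->
    opn (phi @^-1` V) /\ forall f, reg V f -> reg (phi @^-1` V) (f \o phi).

Definition sisomorphism (X Y : space) (phi : X -> Y) : Prop :=
  smorphism phi /\
  exists psi : Y -> X, [/\ smorphism psi, cancel phi psi & cancel psi phi].

Definition closed_immersion (X Y : space) (phi : X -> Y) : Prop :=
  [/\ smorphism phi, injective phi, opn (~` range phi),
      (forall U, opn U -> exists2 V, opn V & U = phi @^-1` V) &
      (forall U f x, opn U -> reg U f -> U x ->
        exists V g, [/\ opn V, reg V g, V (phi x) &
                        forall y, U y -> V (phi y) -> f y = g (phi y)])].

(* Gluing charts: the i-th chart has domain dom i and its affine coordinate ring
   is generated by the functions gen i, of which only the values on dom i
   matter. *)
Section Atlas.
Variables (P I : Type) (dom : I -> set P) (gen : I -> set (P -> k)).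

Inductive galg (G : set (P -> k)) : set (P -> k) :=
| galg_cst c : galg G (cst c)
| galg_gen f : G f -> galg G f
| galgD f g : galg G f -> galg G g -> galg G (f + g)
| galgM f g : galg G f -> galg G g -> galg G (f * g).

Definition coords (V : set P) : set (P -> k) :=
  [set f | exists2 i, V `<=` dom i & gen i f].

Inductive zopen : set P -> Prop :=
| zopenT : zopen setT
| zopen_dom i : zopen (dom i)
| zopen_neq0 V a : zopen V -> galg (coords V) a ->
    zopen (V `&` [set x | a x != 0])
| zopenI U V : zopen U -> zopen V -> zopen (U `&` V)
| zopen_bigcup (F : set (set P)) : (forall U, F U -> zopen U) ->
    zopen (\bigcup_(U in F) U).

Definition zreg (U : set P) : set (P -> k) := [set f |
  forall x, U x -> exists V a b,
    [/\ zopen V, V x, V `<=` U, galg (coords V) a /\ galg (coords V) b &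
        forall y, V y -> b y != 0 /\ f y = a y / b y]].

Lemma galgS (G H : set (P -> k)) : G `<=` H -> galg G `<=` galg H.
Proof.
move=> GH f; elim=> [c|g /GH Hg|g h _ Hg _ Hh|g h _ Hg _ Hh].
- exact: galg_cst.
- exact: galg_gen.
- exact: galgD.
- exact: galgM.
Qed.

Lemma coordsS (U V : set P) : V `<=` U -> galg (coords U) `<=` galg (coords V).
Proof.
move=> VU; apply: galgS => f [i Ui gf]; exists i => //.
exact: subset_trans Ui.
Qed.

Lemma zreg_op (U : set P) (f g h : P -> k)
    (num den : (P -> k) -> (P -> k) -> (P -> k) -> (P -> k) -> P -> k) :
  (forall G a b a' b', galg G a -> galg G b -> galg G a' -> galg G b' ->
    galg G (num a b a' b') /\ galg G (den a b a' b')) ->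
  (forall a b a' b' y, b y != 0 -> b' y != 0 -> f y = a y / b y ->
    g y = a' y / b' y ->
    den a b a' b' y != 0 /\ h y = num a b a' b' y / den a b a' b' y) ->
  zreg U f -> zreg U g -> zreg U h.
Proof.
move=> Hal Hval Hf Hg x Ux.
have [V [a [b [oV Vx VU [aA bA] fE]]]] := Hf x Ux.
have [W [a' [b' [oW Wx WU [aA' bA'] gE]]]] := Hg x Ux.
have VWV : V `&` W `<=` V by move=> y [].
have VWW : V `&` W `<=` W by move=> y [].
have [nA dA] := Hal (coords (V `&` W)) a b a' b' (coordsS VWV aA)
  (coordsS VWV bA) (coordsS VWW aA') (coordsS VWW bA').
exists (V `&` W), (num a b a' b'), (den a b a' b'); split => //.
- exact: zopenI.
- by move=> y [/VU].
- move=> y [Vy Wy]; have [b0 fy] := fE y Vy; have [b0' gy] := gE y Wy.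
  exact: Hval.
Qed.

Lemma zreg_cst U c : zopen U -> zreg U (cst c).
Proof.
move=> oU x Ux; exists U, (cst c), (cst 1); split => //.
  by split; apply: galg_cst.
by move=> y _; rewrite /cst /= oner_neq0 divr1.
Qed.

Lemma zregD U f g : zopen U -> zreg U f -> zreg U g -> zreg U (f + g).
Proof.
move=> _; apply: (@zreg_op _ _ _ _ (fun a b a' b' => a * b' + a' * b)
  (fun _ b _ b' => b * b')) => [G a b a' b' ? ? ? ?|a b a' b' y b0 b0' fy gy].
  by split; [apply: galgD|]; apply: galgM.
split; first by rewrite mulf_neq0.
have -> : (f + g) y = f y + g y by [].
by rewrite fy gy addf_div.
Qed.

Lemma zregM U f g : zopen U -> zreg U f -> zreg U g -> zreg U (f * g).
Proof.
move=> _; apply: (@zreg_op _ _ _ _ (fun a _ a' _ => a * a')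
  (fun _ b _ b' => b * b')) => [G a b a' b' ? ? ? ?|a b a' b' y b0 b0' fy gy].
  by split; apply: galgM.
split; first by rewrite mulf_neq0.
have -> : (f * g) y = f y * g y by [].
by rewrite fy gy mulf_div.
Qed.

Lemma zreg_sub U V f : zopen U -> zopen V -> V `<=` U -> zreg U f -> zreg V f.
Proof.
move=> oU oV VU Hf x Vx; have [W [a [b [oW Wx WU [aA bA] fE]]]] := Hf x (VU x Vx).
have WVW : W `&` V `<=` W by move=> y [].
exists (W `&` V), a, b; split => //.
- exact: zopenI.
- by split; apply: (coordsS WVW).
- by move=> y [Wy _]; apply: fE.
Qed.

Lemma zreg_glue U f : zopen U ->
  (forall x, U x -> exists V, [/\ zopen V, V x, V `<=` U & zreg V f]) ->
  zreg U f.
Proof.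
move=> _ H x /H [V [oV Vx VU /(_ x Vx) [W [a [b [oW Wx WV ab fE]]]]]].
by exists W, a, b; split => //; apply: subset_trans VU.
Qed.

Lemma zreg_eq U f g : zopen U -> {in U, f =1 g} -> zreg U f -> zreg U g.
Proof.
move=> _ fg Hf x /Hf [V [a [b [oV Vx VU ab fE]]]].
exists V, a, b; split => // y Vy; have [b0 fy] := fE y Vy.
by rewrite -fg // inE; apply: VU.
Qed.

Lemma zreg_neq0 U f : zopen U -> zreg U f ->
  zopen (U `&` [set x | f x != 0]).
Proof.
move=> oU Hf.
set F := [set W | zopen W /\ W `<=` U `&` [set x | f x != 0]].
have -> : U `&` [set x | f x != 0] = \bigcup_(W in F) W.
  apply/seteqP; split => [x [Ux fx]|x [W [_ WU] /WU]] //.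
  have [V [a [b [oV Vx VU [aA bA] fE]]]] := Hf x Ux.
  exists (V `&` [set x | a x != 0]).
    split; first exact: zopen_neq0.
    move=> y [Vy /= ay]; split; first exact: VU.
    by have [b0 fy] := fE y Vy; rewrite /= fy mulf_neq0 ?invr_neq0.
  split=> //=; move: fx => /=; have [b0 ->] := fE x Vx.
  by apply: contraNneq => ->; rewrite mul0r.
by apply: zopen_bigcup => W [].
Qed.

Lemma zregV U f : zopen U -> zreg U f -> (forall x, U x -> f x != 0) ->
  zreg U (fun x => (f x)^-1).
Proof.
move=> _ Hf f0 x Ux; have [V [a [b [oV Vx VU [aA bA] fE]]]] := Hf x Ux.
exists V, b, a; split => // y Vy; have [b0 fy] := fE y Vy.
rewrite fy invf_div; split=> //.
by have := f0 y (VU y Vy); rewrite fy; apply: contraNneq => ->; rewrite mul0r.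
Qed.

Definition atlas_space : space :=
  @Space P zopen zreg zopenT zopenI zopen_bigcup zreg_cst zregD zregM zreg_sub
    zreg_glue zreg_eq zreg_neq0 zregV.

End Atlas.

Section Modules.
Variable X : space.

(* Only the values of res U V for open V `<=` U, and of act U f for regular f
   on an open U, are meaningful. *)
Record omodule := OModule {
  sec : set X -> zmodType;
  res : forall U V, sec U -> sec V;
  act : forall U, (X -> k) -> sec U -> sec U;
  resD : forall U V (s t : sec U), opn U -> opn V -> V `<=` U ->
    res V (s + t) = res V s + res V t;
  res_id : forall U (s : sec U), opn U -> res U s = s;
  res_comp : forall U V W (s : sec U), opn U -> opn V -> opn W ->
    V `<=` U -> W `<=` V -> res W (res V s) = res W s;
  act_eq : forall U f g (s : sec U), opn U -> reg U f -> {in U, f =1 g} ->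
    act f s = act g s;
  actDr : forall U f (s t : sec U), opn U -> reg U f ->
    act f (s + t) = act f s + act f t;
  actDl : forall U f g (s : sec U), opn U -> reg U f -> reg U g ->
    act (f + g) s = act f s + act g s;
  actM : forall U f g (s : sec U), opn U -> reg U f -> reg U g ->
    act (f * g) s = act f (act g s);
  act1 : forall U (s : sec U), opn U -> act 1 s = s;
  act_res : forall U V f (s : sec U), opn U -> opn V -> V `<=` U -> reg U f ->
    res V (act f s) = act f (res V s)
}.

Definition is_sheaf (F : omodule) : Prop :=
  forall (I : Type) (U : I -> set X) (s : forall i, sec F (U i)),
    (forall i, opn (U i)) ->
    (forall i j, res (U i `&` U j) (s i) = res (U i `&` U j) (s j)) ->
    exists! t : sec F (\bigcup_i U i), forall i, res (U i) t = s i.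

Definition is_frame (F : omodule) (U : set X) r (e : 'I_r -> sec F U) : Prop :=
  forall V, opn V -> V `<=` U ->
    (forall s : sec F V, exists2 f : 'I_r -> X -> k,
       forall i, reg V (f i) & s = \sum_i act (f i) (res V (e i))) /\
    (forall f : 'I_r -> X -> k, (forall i, reg V (f i)) ->
       \sum_i act (f i) (res V (e i)) = 0 ->
       forall i x, V x -> f i x = 0).

Definition locally_free (r : nat) (F : omodule) : Prop :=
  is_sheaf F /\
  forall x : X, exists U, [/\ opn U, U x &
    exists e : 'I_r -> sec F U, is_frame e].

Definition omorphism (F G : omodule) (h : forall U, sec F U -> sec G U) :=
  [/\ forall U (s t : sec F U), opn U -> h U (s + t) = h U s + h U t,
      forall U f (s : sec F U), opn U -> reg U f ->
        h U (act f s) = act f (h U s) &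
      forall U V (s : sec F U), opn U -> opn V -> V `<=` U ->
        h V (res V s) = res V (h U s)].

Definition oinjective (F G : omodule) (h : forall U, sec F U -> sec G U) :=
  forall U, opn U -> injective (h U).

Definition oisomorphism (F G : omodule) (h : forall U, sec F U -> sec G U) :=
  omorphism h /\ forall U, opn U -> bijective (h U).

Definition slot (m : nat) (T : Type) (s : {ffun 'I_m -> T}) i (a : T) :
  {ffun 'I_m -> T} := [ffun j => if j == i then a else s j].

Definition omultilinear (m : nat) (F G : omodule)
    (mu : forall U, {ffun 'I_m -> sec F U} -> sec G U) :=
  [/\ forall U (s : {ffun 'I_m -> sec F U}) i a b, opn U ->
        mu U (slot s i (a + b)) = mu U (slot s i a) + mu U (slot s i b),
      forall U (s : {ffun 'I_m -> sec F U}) i f a, opn U -> reg U f ->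
        mu U (slot s i (act f a)) = act f (mu U (slot s i a)) &
      forall U V (s : {ffun 'I_m -> sec F U}), opn U -> opn V -> V `<=` U ->
        mu V [ffun i => res V (s i)] = res V (mu U s)].

(* M is the tensor power of F of exponent m in the category of sheaves of
   O_X-modules. *)
Definition is_tensor_power (m : nat) (F M : omodule) : Prop :=
  is_sheaf M /\
  exists2 mu : forall U, {ffun 'I_m -> sec F U} -> sec M U, omultilinear mu &
  forall (G : omodule) (nu : forall U, {ffun 'I_m -> sec F U} -> sec G U),
    is_sheaf G -> omultilinear nu ->
    exists u : forall U, sec M U -> sec G U,
      [/\ omorphism u,
          forall U s, opn U -> u U (mu U s) = nu U s &
          forall v : forall U, sec M U -> sec G U, omorphism v ->
            (forall U s, opn U -> v U (mu U s) = nu U s) ->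
            forall U s, opn U -> v U s = u U s].

Section DirectSum.
Variables (r : nat) (F : omodule).

Let ores U V (s : {ffun 'I_r -> sec F U}) : {ffun 'I_r -> sec F V} :=
  [ffun i => res V (s i)].
Let oact U (f : X -> k) (s : {ffun 'I_r -> sec F U}) : {ffun 'I_r -> sec F U} :=
  [ffun i => act f (s i)].

Program Definition osum : omodule :=
  @OModule (fun U => {ffun 'I_r -> sec F U} : zmodType) ores oact _ _ _ _ _ _ _ _ _.
Next Obligation. by move=> *; apply/ffunP => i; rewrite !ffunE resD. Qed.
Next Obligation. by move=> *; apply/ffunP => i; rewrite !ffunE res_id. Qed.
Next Obligation. by move=> *; apply/ffunP => i; rewrite !ffunE res_comp. Qed.
Next Obligation. by move=> *; apply/ffunP => i; rewrite !ffunE; apply: act_eq. Qed.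
Next Obligation. by move=> *; apply/ffunP => i; rewrite !ffunE actDr. Qed.
Next Obligation. by move=> *; apply/ffunP => i; rewrite !ffunE actDl. Qed.
Next Obligation. by move=> *; apply/ffunP => i; rewrite !ffunE actM. Qed.
Next Obligation. by move=> *; apply/ffunP => i; rewrite !ffunE act1. Qed.
Next Obligation. by move=> *; apply/ffunP => i; rewrite !ffunE act_res. Qed.

End DirectSum.

(* Sheaves of k-valued functions on the total space of some T -> X; a section
   over U is a function on T that vanishes off the preimage of U. *)
Definition cutoff (T : Type) (pi : T -> X) (V : set X) (t : T -> k) : T -> k :=
  fun a => if pi a \in V then t a else 0.

Record fmodule := FModule {
  fmT : Type;
  fm_pi : fmT -> X;
  fm_sec : set X -> set (fmT -> k);
  fm0 : forall U, opn U -> fm_sec U 0;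
  fmB : forall U t u, opn U -> fm_sec U t -> fm_sec U u -> fm_sec U (t - u);
  fm_supp : forall U t a, opn U -> fm_sec U t -> ~ U (fm_pi a) -> t a = 0;
  fm_cutoff : forall U V t, opn U -> opn V -> V `<=` U -> fm_sec U t ->
    fm_sec V (cutoff fm_pi V t);
  fm_act : forall U f t, opn U -> reg U f -> fm_sec U t ->
    fm_sec U ((f \o fm_pi) * t)
}.

Section FunctionModule.
Variable F : fmodule.

(* Over a non-open U the only section is 0. *)
Definition fpred (U : set X) : {pred fmT F -> k} :=
  fun t => `[< (opn U -> @fm_sec F U t) /\ (~ opn U -> t = 0) >].

Lemma fpred_zmod U : zmod_closed (fpred U).
Proof.
split.
  by apply/asboolP; split=> // oU; apply: fm0.
move=> t u /asboolP[Ht Ht0] /asboolP[Hu Hu0]; apply/asboolP; split=> oU.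
  by apply: fmB => //; [apply: Ht|apply: Hu].
by rewrite Ht0 // Hu0 // subr0.
Qed.
HB.instance Definition _ U :=
  GRing.isZmodClosed.Build (fmT F -> k) (fpred U) (fpred_zmod U).

Record fsec (U : set X) := FSec { fval : fmT F -> k; fvalP : fval \in fpred U }.
HB.instance Definition _ U := [isSub for @fval U].
HB.instance Definition _ U := [Choice of fsec U by <:].
HB.instance Definition _ U := [SubChoice_isSubZmodule of fsec U by <:].

Let fres U V (s : fsec U) : fsec V := insubd 0 (cutoff (@fm_pi F) V (fval s)).
Let fact U (f : X -> k) (s : fsec U) : fsec U :=
  insubd 0 ((f \o @fm_pi F) * fval s).

Let fsecP U (s : fsec U) : opn U -> @fm_sec F U (fval s).
Proof. by move=> oU; have /asboolP[/(_ oU)] := fvalP s. Qed.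

Let fresE U V (s : fsec U) : opn U -> opn V -> V `<=` U ->
  fval (fres V s) = cutoff (@fm_pi F) V (fval s).
Proof.
move=> oU oV VU; apply: (@insubdK _ _ (fsec V)); apply/asboolP; split=> // _.
exact: fm_cutoff oU oV VU (fsecP s oU).
Qed.

Let factE U f (s : fsec U) : opn U -> reg U f ->
  fval (fact f s) = (f \o @fm_pi F) * fval s.
Proof.
move=> oU Hf; apply: (@insubdK _ _ (fsec U)); apply/asboolP; split=> // _.
exact: fm_act oU Hf (fsecP s oU).
Qed.

Let fval_inj U (s t : fsec U) : fval s =1 fval t -> s = t.
Proof. by move=> st; apply: val_inj; apply: funext. Qed.

Let fvalD U (s t : fsec U) : fval (s + t) = fval s + fval t.
Proof. exact: (raddfD (val : fsec U -> (fmT F -> k))). Qed.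

Program Definition omodule_of : omodule :=
  @OModule (fun U => fsec U : zmodType) fres fact _ _ _ _ _ _ _ _ _.
Next Obligation.
move=> U V s t oU oV VU; apply: fval_inj => a; rewrite fvalD !fresE // fvalD !fctE /cutoff.
by case: ifP; rewrite ?addr0.
Qed.
Next Obligation.
move=> U s oU; apply: fval_inj => a; rewrite fresE // /cutoff; case: ifPn => //.
by move=> /negP; rewrite inE => Ua; rewrite (fm_supp oU (fsecP s oU)).
Qed.
Next Obligation.
move=> U V W s oU oV oW VU WV; have WU := subset_trans WV VU.
apply: fval_inj => a; rewrite !fresE //.
rewrite /cutoff; case: ifP => //; rewrite inE => Wa.
by rewrite ifT // inE; apply: WV.
Qed.
Next Obligation.
move=> U f g s oU rf fg; have rg := reg_eq oU fg rf.
apply: fval_inj => a; rewrite !factE //.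
rewrite !fctE /=; have [Ua|Ua] := pselect (U (fm_pi a)).
  by rewrite fg // inE.
by rewrite (fm_supp oU (fsecP s oU)) // !mulr0.
Qed.
Next Obligation.
by move=> *; apply: fval_inj => a; rewrite fvalD !factE // fvalD !fctE mulrDr.
Qed.
Next Obligation.
move=> U f g s oU rf rg; have rfg := regD oU rf rg.
apply: fval_inj => a; rewrite fvalD !factE //.
by rewrite !fctE /= mulrDl.
Qed.
Next Obligation.
move=> U f g s oU rf rg; have rfg := regM oU rf rg.
apply: fval_inj => a; rewrite !factE //.
by rewrite !fctE /= mulrA.
Qed.
Next Obligation.
move=> U s oU; have r1 : reg U 1 := reg_cst 1 oU.
by apply: fval_inj => a; rewrite factE // !fctE /= mul1r.
Qed.
Next Obligation.
move=> U V f s oU oV VU rf; have rVf := reg_sub oU oV VU rf.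
apply: fval_inj => a; rewrite !(factE, fresE) // /cutoff !fctE.
by case: ifP; rewrite ?mulr0.
Qed.

End FunctionModule.

(* Derivations of the local ring at x into the residue field k; germs at x are
   represented by functions regular in a neighbourhood of x, and v is set to 0
   on all other functions. *)
Definition regular_at (x : X) (f : X -> k) : Prop :=
  exists U, [/\ opn U, U x & reg U f].

Definition point_derivation (x : X) (v : (X -> k) -> k) : Prop :=
  [/\ forall f, ~ regular_at x f -> v f = 0,
      forall U f g, opn U -> U x -> reg U f -> {in U, f =1 g} -> v f = v g,
      forall c, v (cst c) = 0,
      forall f g, regular_at x f -> regular_at x g -> v (f + g) = v f + v g &
      forall f g, regular_at x f -> regular_at x g ->
        v (f * g) = f x * v g + g x * v f].

Definition tangent_dim (x : X) (n : nat) : Prop :=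
  exists v : 'I_n -> (X -> k) -> k,
    (forall i, point_derivation x (v i)) /\
    forall w, point_derivation x w ->
      exists! c : 'rV[k]_n, forall f, w f = \sum_i c 0 i * v i f.

(* Derivations D of O_U, written as the vector fields x |-> (f |-> (D f) x). *)
Definition vector_field (U : set X) : set (X * (X -> k) -> k) := [set v |
  [/\ forall x f, ~ U x -> v (x, f) = 0,
      forall x, U x -> point_derivation x (fun f => v (x, f)) &
      forall V f, opn V -> V `<=` U -> reg V f -> reg V (fun x => v (x, f))]].

Lemma regN (U : set X) (f : X -> k) : opn U -> reg U f -> reg U (- f).
Proof.
move=> oU Hf; have -> : - f = cst (-1) * f.
  by apply: funext => x; rewrite !fctE mulN1r.
by apply: regM => //; apply: reg_cst.
Qed.

Lemma point_derivation_lin x c u v : point_derivation x u ->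
  point_derivation x v -> point_derivation x (fun f => c * u f + v f).
Proof.
move=> [u1 u2 u3 u4 u5] [v1 v2 v3 v4 v5]; split.
- by move=> f Hf; rewrite u1 // v1 // mulr0 addr0.
- by move=> U f g oU Ux rf fg; rewrite (u2 U f g) // (v2 U f g).
- by move=> d; rewrite u3 v3 mulr0 addr0.
- by move=> f g rf rg; rewrite u4 // v4 // mulrDr addrACA.
- move=> f g rf rg; rewrite u5 // v5 // !mulrDr addrACA.
  by congr (_ + _ + (_ + _)); rewrite mulrCA.
Qed.

Lemma point_derivation0 x : point_derivation x (fun=> 0).
Proof. by split=> // *; rewrite ?mulr0 ?addr0. Qed.

Program Definition tangent_fmodule : fmodule :=
  @FModule (X * (X -> k))%type fst vector_field _ _ _ _ _.
Next Obligation.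
by move=> U oU; split=> // *; [apply: point_derivation0|apply: (reg_cst 0)].
Qed.
Next Obligation.
move=> U t u oU [t1 t2 t3] [u1 u2 u3]; split.
- by move=> x f Ux; rewrite !fctE t1 // u1 // subr0.
- move=> x Ux; have := point_derivation_lin (-1) (u2 x Ux) (t2 x Ux).
  congr (point_derivation x); apply: funext => f.
  by rewrite !fctE mulN1r addrC.
- move=> V f oV VU rf; apply: (regD oV); first exact: t3.
  by apply: (regN oV); apply: u3.
Qed.
Next Obligation. by move=> U t [x f] oU [+ _ _] /=; apply. Qed.
Next Obligation.
move=> U V t oU oV VU [t1 t2 t3]; rewrite /cutoff; split.
- by move=> x f Vx /=; rewrite ifF //; apply/negbTE/negP; rewrite inE.
- by move=> x Vx /=; have /mem_set -> := Vx; apply: t2 (VU _ Vx).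
- move=> W f oW WV rf; apply: (reg_eq oW _ (t3 W f oW _ rf)).
    by move=> x /=; rewrite inE => /WV Vx; rewrite ifT // inE.
  exact: subset_trans VU.
Qed.
Next Obligation.
move=> U f t oU rf [t1 t2 t3]; split.
- by move=> x g Ux; rewrite !fctE /= t1 // mulr0.
- move=> x Ux; have := point_derivation_lin (f x) (t2 x Ux) (point_derivation0 x).
  by congr (point_derivation x); apply: funext => g; rewrite !fctE /= addr0.
- move=> V g oV VU rg; apply: (regM oV); last exact: t3.
  exact: reg_sub rf.
Qed.

Definition tangent : omodule := omodule_of tangent_fmodule.

End Modules.

Definition smooth (X : space) (n : nat) : Prop :=
  forall x : X, tangent_dim x n.

Definition comorphism (X Y : space) (phi : X -> Y) (F : omodule Y)
    (G : omodule X) (h : forall V, sec F V -> sec G (phi @^-1` V)) : Prop :=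
  [/\ forall V (s t : sec F V), opn V -> h V (s + t) = h V s + h V t,
      forall V f (s : sec F V), opn V -> reg V f ->
        h V (act f s) = act (f \o phi) (h V s) &
      forall V W (s : sec F V), opn V -> opn W -> W `<=` V ->
        h W (res W s) = res (phi @^-1` W) (h V s)].

(* E is isomorphic to phi^* F, phi^* being the left adjoint of phi_* on sheaves
   of modules. *)
Definition is_pullback (X Y : space) (phi : X -> Y) (F : omodule Y)
    (E : omodule X) : Prop :=
  is_sheaf E /\
  exists2 h : forall V, sec F V -> sec E (phi @^-1` V), comorphism h &
  forall (G : omodule X) (g : forall V, sec F V -> sec G (phi @^-1` V)),
    is_sheaf G -> comorphism g ->
    exists u : forall U, sec E U -> sec G U,
      [/\ omorphism u,
          forall V s, opn V -> u (phi @^-1` V) (h V s) = g V s &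
          forall v : forall U, sec E U -> sec G U, omorphism v ->
            (forall V s, opn V -> v (phi @^-1` V) (h V s) = g V s) ->
            forall U s, opn U -> v U s = u U s].

(* T is a set of nonzero vectors, scaled c a b means b = c a, and the lin j are
   linear coordinates, with lin j defined over dom j.  The points are the classes
   of T modulo scaling, and the chart lin j != 0 has coordinates lin i / lin j. *)
Section Projectivization.
Variables (T J : Type) (scaled : k -> T -> T -> Prop).
Variables (dom : J -> set T) (lin : J -> T -> k).

Definition pclass (a : T) : set T := [set b | exists2 c, c != 0 & scaled c a b].

Definition ppoint : Type := {C : set T | exists a, C = pclass a}.

Definition pproj (a : T) : ppoint :=
  exist (fun C : set T => exists a, C = pclass a) (pclass a)
    (ex_intro (fun a' => pclass a = pclass a') a erefl).

Definition prep (p : ppoint) : T := sval (cid (svalP p)).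

Definition pdom (j : J) : set ppoint :=
  [set p | dom j (prep p) /\ lin j (prep p) != 0].

Definition pgen (j : J) : set (ppoint -> k) :=
  [set f | exists2 i, dom j `<=` dom i &
           f = fun p => lin i (prep p) / lin j (prep p)].

Definition pspace : space := atlas_space pdom pgen.

(* O(1) is dual to the tautological line bundle: its sections are functions
   homogeneous of degree 1. *)
Definition psec (W : set pspace) : set (T -> k) := [set t |
  [/\ forall a, ~ W (pproj a) -> t a = 0,
      forall c a b, c != 0 -> scaled c a b -> t b = c * t a &
      forall j, reg (W `&` pdom j : set pspace)
                  (fun p : pspace => t (prep p) / lin j (prep p))]].

Lemma pprojK p : pproj (prep p) = p.
Proof.
case: p => C HC; rewrite /prep /=; apply: eq_exist.
by case: (cid _) => a /= ->.
Qed.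

Hypothesis scaled_pclass : forall c a b, c != 0 -> scaled c a b ->
  pclass a = pclass b.

Lemma pproj_scaled c a b : c != 0 -> scaled c a b -> pproj a = pproj b.
Proof. by move=> c0 ab; apply: eq_exist; apply: scaled_pclass c0 ab. Qed.

Lemma pdom_opn j : opn (pdom j : set pspace).
Proof. exact: zopen_dom. Qed.

Program Definition pfmodule : fmodule pspace :=
  @FModule pspace T pproj psec _ _ _ _ _.
Next Obligation.
move=> U oU; split=> [//|c a b _ _|j]; first exact/esym/mulr0.
have oUj := opnI oU (pdom_opn j).
apply: (reg_eq oUj _ (reg_cst 0 oUj)) => p _ /=.
by rewrite mul0r.
Qed.
Next Obligation.
move=> U t u oU [t1 t2 t3] [u1 u2 u3]; split.
- by move=> a Ua; rewrite !fctE t1 // u1 // subr0.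
- by move=> c a b c0 ab; rewrite !fctE (t2 c a b) // (u2 c a b) // mulrBr.
- move=> j; have oUj := opnI oU (pdom_opn j).
  have := regD oUj (t3 j) (regN oUj (u3 j)).
  by apply: (reg_eq oUj) => p _; rewrite !fctE mulrBl.
Qed.
Next Obligation. by move=> U t a oU [+ _ _]; apply. Qed.
Next Obligation.
move=> U V t oU oV VU [t1 t2 t3]; rewrite /cutoff; split.
- by move=> a Va; rewrite ifF //; apply/negbTE/negP; rewrite inE.
- move=> c a b c0 ab; rewrite -(pproj_scaled c0 ab).
  by case: ifP => _; [apply: t2|rewrite mulr0].
- move=> j; have oUj := opnI oU (pdom_opn j); have oVj := opnI oV (pdom_opn j).
  apply: (reg_eq oVj _ (reg_sub oUj oVj _ (t3 j))).
    by move=> p; rewrite inE => -[Vp _]; rewrite pprojK ifT // inE.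
  by move=> p [/VU].
Qed.
Next Obligation.
move=> U f t oU rf [t1 t2 t3]; split.
- by move=> a Ua; rewrite !fctE t1 // mulr0.
- move=> c a b c0 ab; rewrite !fctE /= -(pproj_scaled c0 ab) (t2 c a b) //.
  by rewrite mulrCA.
- move=> j; have oUj := opnI oU (pdom_opn j).
  have rfj : reg (U `&` pdom j : set pspace) f.
    by apply: reg_sub oU oUj _ rf => p [].
  have := regM oUj rfj (t3 j).
  by apply: (reg_eq oUj) => p _; rewrite !fctE /= pprojK mulrA.
Qed.

Definition pO1 : omodule pspace := omodule_of pfmodule.

End Projectivization.

Section ProjectiveSpace.
Variable N : nat.

Definition nzvec : Type := {v : 'rV[k]_N.+1 | v != 0}.
Definition nzvec_scaled (c : k) (v w : nzvec) : Prop := sval w = c *: sval v.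
Definition nzvec_lin (i : 'I_N.+1) (v : nzvec) : k := sval v 0 i.

Definition projective_space : space :=
  pspace nzvec_scaled (fun=> setT) nzvec_lin.

Lemma nzvec_class c a b : c != 0 -> nzvec_scaled c a b ->
  pclass nzvec_scaled a = pclass nzvec_scaled b.
Proof.
move=> c0 ab; apply/seteqP; split=> d [e e0 ed].
  exists (e / c); first by rewrite mulf_neq0 ?invr_neq0.
  by rewrite /nzvec_scaled ed ab scalerA mulfVK.
exists (e * c); first by rewrite mulf_neq0.
by rewrite /nzvec_scaled ed ab scalerA.
Qed.

Definition serre_twist : omodule projective_space :=
  pO1 (fun=> setT) nzvec_lin nzvec_class.

End ProjectiveSpace.

Definition projective (X : space) : Prop :=
  exists (N : nat) (iota : X -> projective_space N), closed_immersion iota.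

Definition very_ample (X : space) (M : omodule X) : Prop :=
  exists (N : nat) (iota : X -> projective_space N),
    closed_immersion iota /\ is_pullback iota (serre_twist N) M.

Definition ample_line (X : space) (L : omodule X) : Prop :=
  exists (m : nat) (M : omodule X),
    [/\ (0 < m)%N, is_tensor_power m L M & very_ample M].

Section ProjectiveBundle.
Variables (X : space) (E : omodule X).

(* The k-linear forms on the fibre of E at x, as families of maps on sections
   over neighbourhoods of x, set to 0 on all other subsets.  A one-dimensional
   quotient of the fibre is a nonzero form up to a scalar. *)
Definition fibre_form (x : X) (phi : forall U, sec E U -> k) : Prop :=
  [/\ forall U (s : sec E U), ~ (opn U /\ U x) -> phi U s = 0,
      forall U (s t : sec E U), opn U -> U x ->
        phi U (s + t) = phi U s + phi U t,
      forall U f (s : sec E U), opn U -> U x -> reg U f ->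
        phi U (act f s) = f x * phi U s &
      forall U V (s : sec E U), opn U -> opn V -> V `<=` U -> V x ->
        phi V (res V s) = phi U s].

Record nzform := NZForm {
  nzf_pt : X;
  nzf_form : forall U, sec E U -> k;
  nzf_fibre : fibre_form nzf_pt nzf_form;
  nzf_neq0 : exists U (s : sec E U), nzf_form s != 0
}.

Definition nzform_scaled (c : k) (a b : nzform) : Prop :=
  nzf_pt a = nzf_pt b /\
  forall U (s : sec E U), nzf_form b s = c * nzf_form a s.

Definition nzform_dom (j : {U : set X & sec E U}) : set nzform :=
  [set a | opn (projT1 j) /\ projT1 j (nzf_pt a)].

Definition nzform_lin (j : {U : set X & sec E U}) (a : nzform) : k :=
  nzf_form a (projT2 j).

Definition projective_bundle : space :=
  pspace nzform_scaled nzform_dom nzform_lin.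

Lemma nzform_class c a b : c != 0 -> nzform_scaled c a b ->
  pclass nzform_scaled a = pclass nzform_scaled b.
Proof.
move=> c0 [pab ab]; apply/seteqP; split=> d [e e0 [pd ed]].
  exists (e / c); first by rewrite mulf_neq0 ?invr_neq0.
  split; first by rewrite -pab.
  by move=> U s; rewrite ed ab mulrA mulfVK.
exists (e * c); first by rewrite mulf_neq0.
split; first by rewrite pab.
by move=> U s; rewrite ed ab mulrA.
Qed.

Definition tautological : omodule projective_bundle :=
  pO1 nzform_dom nzform_lin nzform_class.

Definition ample : Prop := ample_line tautological.

End ProjectiveBundle.

End Spaces.

(* M = Z^n and N_Q = Q^n; rational polyhedral cones are given by their rational
   points. *)
Section Toric.
Variable n : nat.
Local Notation cone := (set 'rV[rat]_n).

Definition pairing (m : 'rV[int]_n) (v : 'rV[rat]_n) : rat :=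
  \sum_i (m 0 i)%:~R * v 0 i.

Definition rational_polyhedral (sigma : cone) : Prop :=
  exists (d : nat) (u : 'I_d -> 'rV[int]_n),
    sigma = [set v | exists2 c : 'I_d -> rat, forall i, 0 <= c i &
                     v = \sum_i c i *: map_mx intr (u i)].

Definition strongly_convex (sigma : cone) : Prop :=
  forall v, sigma v -> sigma (- v) -> v = 0.

Definition dual (sigma : cone) : set 'rV[int]_n :=
  [set m | forall v, sigma v -> 0 <= pairing m v].

Definition is_face (tau sigma : cone) : Prop :=
  exists2 m, dual sigma m & tau = sigma `&` [set v | pairing m v = 0].

Definition is_fan (Sigma : set cone) : Prop :=
  [/\ Sigma !=set0, finite_set Sigma,
      forall sigma, Sigma sigma ->
        rational_polyhedral sigma /\ strongly_convex sigma,
      forall sigma tau, Sigma sigma -> is_face tau sigma -> Sigma tau &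
      forall sigma sigma', Sigma sigma -> Sigma sigma' ->
        is_face (sigma `&` sigma') sigma /\ is_face (sigma `&` sigma') sigma'].

Variables (k : fieldType) (Sigma : set cone).

(* The points of U_sigma = Spec k[dual sigma] are the monoid morphisms from
   dual sigma to (k, * ); the values of g off dual sigma are irrelevant. *)
Definition monoid_hom (S : set 'rV[int]_n) (g : 'rV[int]_n -> k) : Prop :=
  g 0 = 1 /\ forall m m', S m -> S m' -> g (m + m') = g m * g m'.

Definition chart_point (p : cone * ('rV[int]_n -> k)) : Prop :=
  Sigma p.1 /\ monoid_hom (dual p.1) p.2.

(* U_sigma and U_sigma' are glued along U_(sigma `&` sigma'). *)
Definition glued (p q : cone * ('rV[int]_n -> k)) : Prop :=
  [/\ chart_point p, chart_point q &
      exists g, [/\ monoid_hom (dual (p.1 `&` q.1)) g,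
                    {in dual p.1, g =1 p.2} & {in dual q.1, g =1 q.2}]].

Definition toric_point : Type :=
  {C : set (cone * ('rV[int]_n -> k)) |
    exists2 p, chart_point p & C = glued p}.

Definition toric_dom (sigma : cone) : set toric_point :=
  [set C | exists g, sval C (sigma, g)].

Definition chi (sigma : cone) (m : 'rV[int]_n) (C : toric_point) : k :=
  xget 0 [set c | exists2 g, sval C (sigma, g) & c = g m].

Definition toric_gen (sigma : cone) : set (toric_point -> k) :=
  [set f | exists2 m, dual sigma m & f = chi sigma m].

Definition toric_variety : space k := atlas_space toric_dom toric_gen.

End Toric.

(* Main.v *)
(** Ampleness gives, for some m > 0, a map H from the nonzero linear forms on
    the fibres of E to the nonzero vectors of a space k^(N+1); it is homogeneous
    of degree m, regular along arcs, and the class of H a determines the base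
    point of a.

    A vector mu of k^n gives at each torus point t the form
    s |-> mu(dlog (j s)) on the fibre of E at t, and its image F(t) under H is a
    Laurent polynomial in t.  Along the one-parameter subgroup of
    v = sum a_i u_i, with the u_i the rays of a maximal cone, F has order at
    least -m max {a_i : mu(u_i) != 0}, because j is defined on all of X.  On the
    other hand, if v is not in the span of the cone whose interior contains y,
    then v moves the limit points in the direction y, and since H separates them,
    the face of the Newton polytope of F that minimises y has width at least m
    in the direction v.  These two constraints leave only the fan whose
    rays are u_0, ..., u_n with sum 0, any n of which span a cone.

    On P^n = P(V) a tangent vector at [z] is a vector of V modulo z, so each
    linear form nu on V with nu(z) = 0 gives a form on the fibre of E at [z], of
    degree 1 in z.  Such a family of forms over a line that vanishes at one point
    vanishes on the line: otherwise H of it would be s^m times a constant vector,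
    and H would not separate points.  Therefore whether nu annihilates E at [z]
    does not depend on z.  Either no nonzero nu annihilates E anywhere, and then
    r = n and j is an isomorphism; or the annihilators cut out a subspace W of
    dimension r such that j lifts to a map from E to O(1) tensor W, which is an
    isomorphism by the same vanishing on lines. *)
Require Import Defs.
From mathcomp Require Import all_boot all_order all_algebra.
From mathcomp Require Import all_classical.
From mathcomp Require Import ring lra zify.

Set Implicit Arguments.
Unset Strict Implicit.
Unset Printing Implicit Defensive.

Import Order.TTheory GRing.Theory Num.Theory.
Local Open Scope classical_set_scope.
Local Open Scope ring_scope.

Local Notation space := Defs.space.

(** * Regular functions on the line and on affine space *)

(** [E] carries no torus action, so it has no weights at fixed points or along invariant curves; the
    exponents of F take their place. The bound m on the width comes from integrality. H has degree
    m, so along every one-parameter subgroup the extreme exponents of F are multiples of m. A face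
    of width less than m is therefore constant in that direction, its leading form is multiplied by
    a scalar, and distinct limit points get proportional images under H. The rank of [E] may be less
    than n, so a form mu matters only through its values on the log directions of [E]. The bound on
    the order of F holds for every mu' with the same values there, and the choice of mu' excludes
    rays outside the relation of sum 0. The characteristic is arbitrary: integer coefficients of
    relations between rays can vanish in k, so forms have to be chosen whose relevant coefficients
    survive. On a line in P^n, H of a family of degree 1 is polynomial of degree at most m in s, and
    a zero of the family at s = 0 makes it divisible by s^m; hence s^m times a constant. *)

Section OneVariable.
Variable k : closedFieldType.
Implicit Types (c s : k) (P Q : k -> Prop) (f g h : k -> k) (a b p : {poly k}).

Lemma poly_neq0_ex p : p != 0 -> exists s, p.[s] != 0.
Proof. by move=> /closed_nonrootP[s sp]; exists s. Qed.

(** Validity on a principal open neighbourhood of [c] in the affine line. A neighbourhood is given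
    by one polynomial, so finite intersections are products. *)
Definition nearc c P := exists2 b, b.[c] != 0 & forall s, b.[s] != 0 -> P s.

Lemma nearcT c P : (forall s, P s) -> nearc c P.
Proof. by move=> HP; exists 1 => //; rewrite hornerE oner_neq0. Qed.

Lemma nearcS c P Q : (forall s, P s -> Q s) -> nearc c P -> nearc c Q.
Proof. by move=> PQ [b bc H]; exists b => // s /H /PQ. Qed.

Lemma nearcI c P Q : nearc c P -> nearc c Q -> nearc c (fun s => P s /\ Q s).
Proof.
move=> [b bc HP] [b' b'c HQ]; exists (b * b'); first by rewrite hornerM mulf_neq0.
by move=> s; rewrite hornerM mulf_eq0 negb_or => /andP[/HP ? /HQ].
Qed.

Lemma nearcS2 c P Q R : (forall s, P s -> Q s -> R s) ->
  nearc c P -> nearc c Q -> nearc c R.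
Proof.
by move=> H HP HQ; apply: nearcS (nearcI HP HQ) => s [Ps Qs]; apply: H.
Qed.

Lemma nearc_at c P : nearc c P -> P c.
Proof. by move=> [b bc]; apply. Qed.

Lemma nearc_ne c c' : c != c' -> nearc c (fun s => s != c').
Proof.
move=> cc'; exists ('X - c'%:P); first by rewrite hornerXsubC subr_eq0.
by move=> s; rewrite hornerXsubC subr_eq0.
Qed.

Lemma nearc_all n c (P : 'I_n -> k -> Prop) :
  (forall i, nearc c (P i)) -> nearc c (fun s => forall i, P i s).
Proof.
elim: n P => [|n IH] P H; first by apply: nearcT => s [].
have /IH H2 : forall i, nearc c (P (lift ord0 i)) by move=> i.
apply: nearcS (nearcI (H ord0) H2) => s [Ps0 Ps] i.
case: (unliftP ord0 i) => [j ->|-> //]; exact: Ps.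
Qed.

Lemma nearc_poly c b : b.[c] != 0 -> nearc c (fun s => b.[s] != 0).
Proof. by move=> bc; exists b. Qed.

(** The field is infinite, so nonempty open subsets of the line meet, even around different centres
    and outside a given point. *)
Lemma nearc2_ex c c' c'' P Q : nearc c P -> nearc c' Q ->
  exists s, [/\ P s, Q s & s != c''].
Proof.
move=> [b bc HP] [b' bc' HQ].
have b0 : b != 0 by apply: contraNneq bc => ->; rewrite horner0.
have b'0 : b' != 0 by apply: contraNneq bc' => ->; rewrite horner0.
have : b * b' * ('X - c''%:P) != 0 by rewrite !mulf_neq0 // polyXsubC_eq0.
move=> /poly_neq0_ex[s]; rewrite !hornerM !mulf_eq0 !negb_or -andbA.
by rewrite hornerXsubC subr_eq0 => /and3P[/HP ? /HQ ? ?]; exists s.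
Qed.

Lemma nearc_ex c c' P : nearc c P -> exists2 s, P s & s != c'.
Proof. by move=> H; have [s []] := nearc2_ex c' H H; exists s. Qed.

Lemma poly_near0 c p : nearc c (fun s => s != c -> p.[s] = 0) -> p = 0.
Proof.
move=> [b bc H]; apply/eqP; apply: contraT => p0.
have b0 : b != 0 by apply: contraNneq bc => ->; rewrite horner0.
have : p * b * ('X - c%:P) != 0 by rewrite !mulf_neq0 // polyXsubC_eq0.
move=> /poly_neq0_ex[s]; rewrite !hornerM !mulf_eq0 !negb_or -andbA.
rewrite hornerXsubC subr_eq0 => /and3P[ps bs sc].
by rewrite H ?eqxx in ps.
Qed.

(** The germ at [c] of a regular function on the line. The equality is also required at [c] itself,
    so the value there is the value of the fraction. *)
Definition regc c f := exists a b, b.[c] != 0 /\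
  nearc c (fun s => f s = a.[s] / b.[s]).

Lemma regc_eq c f g : nearc c (fun s => f s = g s) -> regc c f -> regc c g.
Proof.
move=> fg [a [b [bc H]]]; exists a, b; split=> //.
by apply: nearcS2 fg H => s ->.
Qed.

Lemma regc_poly c p : regc c (fun s => p.[s]).
Proof.
exists p, 1; rewrite hornerE oner_neq0; split=> //.
by apply: nearcT => s; rewrite !hornerE divr1.
Qed.

Lemma regc_cst c x : regc c (fun=> x).
Proof. by apply: regc_eq (regc_poly c x%:P); apply: nearcT => s; rewrite hornerC. Qed.

Lemma regc_id c : regc c id.
Proof. by apply: regc_eq (regc_poly c 'X); apply: nearcT => s; rewrite hornerX. Qed.

Lemma regcD c f g : regc c f -> regc c g -> regc c (fun s => f s + g s).
Proof.
move=> [a [b [bc H]]] [a' [b' [bc' H']]]; exists (a * b' + a' * b), (b * b').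
split; first by rewrite hornerM mulf_neq0.
apply: nearcS2 (nearcI (nearc_poly bc) (nearc_poly bc')) (nearcI H H').
by move=> s [b0 b0'] [-> ->]; rewrite !hornerE addf_div.
Qed.

Lemma regcM c f g : regc c f -> regc c g -> regc c (fun s => f s * g s).
Proof.
move=> [a [b [bc H]]] [a' [b' [bc' H']]]; exists (a * a'), (b * b').
split; first by rewrite hornerM mulf_neq0.
apply: nearcS2 H H'.
by move=> s -> ->; rewrite mulf_div !hornerM.
Qed.

Lemma regcN c f : regc c f -> regc c (fun s => - f s).
Proof.
move=> H; apply: regc_eq (regcM (regc_cst c (-1)) H).
by apply: nearcT => s; rewrite mulN1r.
Qed.

Lemma regcB c f g : regc c f -> regc c g -> regc c (fun s => f s - g s).
Proof. by move=> Hf /regcN; apply: regcD. Qed.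

Lemma regc_exp c f e : regc c f -> regc c (fun s => f s ^+ e).
Proof.
move=> Hf; elim: e => [|e IH].
  by apply: regc_eq (regc_cst c 1); apply: nearcT => s; rewrite expr0.
by apply: regc_eq (regcM Hf IH); apply: nearcT => s; rewrite exprS.
Qed.

Lemma regc_sum I (r : seq I) (P : pred I) c (F : I -> k -> k) :
  (forall i, P i -> regc c (F i)) -> regc c (fun s => \sum_(i <- r | P i) F i s).
Proof.
move=> H; elim: r => [|i r IH].
  by apply: regc_eq (regc_cst c 0); apply: nearcT => s; rewrite big_nil.
have [Pi|nPi] := boolP (P i).
  apply: regc_eq (regcD (H i Pi) IH).
  by apply: nearcT => s; rewrite big_cons Pi.
by apply: regc_eq IH; apply: nearcT => s; rewrite big_cons (negPf nPi).
Qed.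

Lemma regc_prod I (r : seq I) (P : pred I) c (F : I -> k -> k) :
  (forall i, P i -> regc c (F i)) -> regc c (fun s => \prod_(i <- r | P i) F i s).
Proof.
move=> H; elim: r => [|i r IH].
  by apply: regc_eq (regc_cst c 1); apply: nearcT => s; rewrite big_nil.
have [Pi|nPi] := boolP (P i).
  apply: regc_eq (regcM (H i Pi) IH).
  by apply: nearcT => s; rewrite big_cons Pi.
by apply: regc_eq IH; apply: nearcT => s; rewrite big_cons (negPf nPi).
Qed.

Lemma regc_neq0 c f : regc c f -> f c != 0 -> nearc c (fun s => f s != 0).
Proof.
move=> [a [b [bc H]]] fc.
have ac : a.[c] != 0.
  by apply: contraNneq fc => ac; rewrite (nearc_at H) ac mul0r.
apply: nearcS2 (nearcI (nearc_poly ac) (nearc_poly bc)) H.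
by move=> s [? ?] ->; rewrite mulf_neq0 ?invr_neq0.
Qed.

Lemma regcV c f : regc c f -> f c != 0 -> regc c (fun s => (f s)^-1).
Proof.
move=> [a [b [bc H]]] fc; exists b, a.
split; first by apply: contraNneq fc => ac; rewrite (nearc_at H) ac mul0r.
by apply: nearcS H => s ->; rewrite invf_div.
Qed.

Lemma regc_exprz c f e : regc c f -> f c != 0 -> regc c (fun s => f s ^ e).
Proof.
move=> Hf f0; case: e => e; first exact: (regc_exp e Hf).
have H := regc_exp e.+1 Hf.
apply: regc_eq (regcV H _); first by apply: nearcT => s; rewrite NegzE -exprnN.
by rewrite expf_neq0.
Qed.

Lemma regc_uniq c f g : regc c f -> regc c g ->
  nearc c (fun s => s != c -> f s = g s) -> nearc c (fun s => f s = g s).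
Proof.
move=> [a [b [bc H]]] [a' [b' [bc' H']]] fg.
have E : a * b' - a' * b = 0.
  apply: (@poly_near0 c); apply: nearcS2 fg (nearcI (nearcI H H')
    (nearcI (nearc_poly bc) (nearc_poly bc'))) => s + [[fs gs] [bs bs']] sc.
  move=> /(_ sc); rewrite fs gs => /eqP; rewrite eqr_div // => /eqP E.
  by rewrite !hornerE E subrr.
apply: nearcS2 (nearcI H H') (nearcI (nearc_poly bc) (nearc_poly bc')).
move=> s [-> ->] [bs bs']; apply/eqP; rewrite eqr_div //.
have /(congr1 (horner^~ s)) := E; rewrite !hornerE => /eqP.
by rewrite subr_eq0.
Qed.

Lemma regc_uniq_at c f g : regc c f -> regc c g ->
  nearc c (fun s => s != c -> f s = g s) -> f c = g c.
Proof. by move=> Hf Hg /(regc_uniq Hf Hg)/nearc_at. Qed.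

Lemma regc_order c f : regc c f -> nearc c (fun s => f s = 0) \/
  exists o g, [/\ regc c g, g c != 0 & nearc c (fun s => f s = (s - c) ^+ o * g s)].
Proof.
move=> [a [b [bc H]]]; have [a0|a0] := eqVneq a 0.
  by left; apply: nearcS H => s ->; rewrite a0 horner0 mul0r.
right; have [o [q]] := multiplicity_XsubC a c.
rewrite a0 /= => qc aE; exists o, (fun s => q.[s] / b.[s]); split.
- by exists q, b; split=> //; apply: nearcT.
- by rewrite mulf_neq0 ?invr_neq0.
by apply: nearcS H => s ->; rewrite /= aE hornerM horner_exp hornerXsubC mulrA (mulrC (_ ^+ _)).
Qed.

(** Dividing by the smallest order of an entry leaves a vector that is nonzero at [c]. This is how
    arcs of points and of linear forms are extended over a missing parameter. *)
Lemma regc_vorder r c (f : 'I_r -> k -> k) : (forall l, regc c (f l)) ->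
  nearc c (fun s => forall l, f l s = 0) \/
  exists o (g : 'I_r -> k -> k), [/\ forall l, regc c (g l),
    exists l, g l c != 0 & nearc c (fun s => forall l, f l s = (s - c) ^+ o * g l s)].
Proof.
move=> Hf.
have [H0|/existsNP[l0 Hl0]] := pselect (forall l, nearc c (fun s => f l s = 0)).
  by left; apply: nearc_all.
right.
pose hasord o := `[< exists l g, [/\ regc c g, g c != 0 &
  nearc c (fun s => f l s = (s - c) ^+ o * g s)] >].
have ex : exists o, hasord o.
  have [//|[o [g Hg]]] := regc_order (Hf l0).
  by exists o; apply/asboolP; exists l0, g.
case: (ex_minnP ex) => o /asboolP[l [gl [Hgl glc El]]] omin.
have /choice[g Hg] : forall l', exists g, [/\ regc c g,
    nearc c (fun s => f l' s = (s - c) ^+ o * g s) & l' = l -> g c != 0].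
  move=> l'; have [->|ll'] := eqVneq l' l; first by exists gl.
  have [H0|[o' [g [Hg gc E]]]] := regc_order (Hf l').
    exists (fun=> 0); split; [exact: regc_cst| |by move=> e; rewrite e eqxx in ll'].
    by apply: nearcS H0 => s ->; rewrite mulr0.
  have oo' : (o <= o')%N by apply: omin; apply/asboolP; exists l', g.
  exists (fun s => (s - c) ^+ (o' - o) * g s); split.
  - by apply: regcM => //; apply: regc_exp; apply: regcB (regc_id _) (regc_cst _ _).
  - by apply: nearcS E => s ->; rewrite mulrA -exprD subnKC.
  - by move=> e; rewrite e eqxx in ll'.
exists o, g; split.
- by move=> l'; have [] := Hg l'.
- by exists l; have [_ _] := Hg l; apply.
- by apply: nearc_all => l'; have [] := Hg l'.
Qed.

(** The fraction at 0, in lowest terms, represents [f] near every other point as well; its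
    denominator has no root and is constant. *)
Lemma regc_all_poly f : (forall c, regc c f) -> exists p, forall s, f s = p.[s].
Proof.
move=> Hf; have [a [b [b0 H0]]] := Hf 0.
have bn0 : b != 0 by apply: contraNneq b0 => ->; rewrite horner0.
pose d := gcdp a b; pose a' := a %/ d; pose b' := b %/ d.
have d0 : d != 0 by rewrite gcdp_eq0 negb_and bn0 orbT.
have aE : a = a' * d by rewrite divpK // dvdp_gcdl.
have bE : b = b' * d by rewrite divpK // dvdp_gcdr.
have cop : coprimep a' b' by rewrite coprimep_div_gcd ?bn0 ?orbT.
have key c : b'.[c] != 0 /\ nearc c (fun s => f s * b'.[s] = a'.[s]).
  have [a2 [b2 [b2c H2]]] := Hf c.
  have E : a * b2 = a2 * b.
    apply/eqP; rewrite -subr_eq0; apply/eqP; apply: (@poly_near0 0).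
    have [p pc Hp] := nearcI (nearc_poly b2c) H2.
    have p0 : p != 0 by apply: contraNneq pc => ->; rewrite horner0.
    have : p * (a * b2 - a2 * b) = 0.
      apply: (@poly_near0 0); apply: nearcS (nearcI H0 (nearc_poly b0)).
      move=> s [fs bs] _; rewrite hornerM; have [->|/Hp[b2s]] := eqVneq p.[s] 0.
        by rewrite mul0r.
      rewrite fs => /eqP; rewrite eqr_div // !hornerE => /eqP ->.
      by rewrite subrr mulr0.
    move=> /eqP; rewrite mulf_eq0 (negPf p0) /= => /eqP E.
    by apply: nearcT => s _; rewrite E horner0.
  have E' : a' * b2 = a2 * b'.
    by apply: (mulIf d0); move: E; rewrite {1}aE {1}bE => E; rewrite mulrAC E mulrA.
  have b'c : b'.[c] != 0.
    apply: contraTneq cop => bc.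
    have : a'.[c] * b2.[c] = 0 by rewrite -hornerM E' hornerM bc mulr0.
    move/eqP; rewrite mulf_eq0 (negPf b2c) orbF => ac.
    apply/negP => cop; have := coprimep_root cop ac.
    by rewrite bc eqxx.
  split=> //; apply: nearcS (nearcI H2 (nearc_poly b2c)) => s [-> b2s].
  rewrite mulrAC; apply: (canLR (mulfK b2s)).
  by rewrite -!hornerM E'.
have [x b'E] : exists x, b' = x%:P.
  have [/eqP/size_poly1P[x _ ->]|/closed_rootP[x]] := eqVneq (size b') 1%N.
    by exists x.
  by rewrite /root; have [/negPf->] := key x.
have x0 : x != 0 by have [] := key 0; rewrite b'E hornerC.
exists (x^-1 *: a') => s; rewrite hornerZ; have [_ /nearc_at <-] := key s.
by rewrite b'E hornerC mulrC mulfK.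
Qed.

End OneVariable.

(** * Arcs and affine charts *)

Section Arcs.
Variable k : closedFieldType.

(** The germ at [c] of a morphism from the affine line to [X]; only the values of [gam] near [c]
    count. *)
Definition sarc (X : space k) (c : k) (gam : k -> X) : Prop :=
  (forall U, opn U -> U (gam c) -> nearc c (fun s => U (gam s))) /\
  (forall U f, opn U -> U (gam c) -> reg U f -> regc c (f \o gam)).

Lemma sarc_morph (X Y : space k) (phi : X -> Y) c gam :
  smorphism phi -> sarc c gam -> sarc c (phi \o gam).
Proof.
move=> Hphi [H1 H2]; split=> [U oU Uc|U f oU Uc rf].
  by have [oV _] := Hphi U oU; apply: (H1 (phi @^-1` U)).
by have [oV /(_ f rf) rV] := Hphi U oU; apply: (H2 (phi @^-1` U) (f \o phi)).
Qed.

Lemma sarc_eq (X : space k) c (gam del : k -> X) :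
  nearc c (fun s => gam s = del s) -> sarc c gam -> sarc c del.
Proof.
move=> E [H1 H2]; have Ec := nearc_at E; split=> [U oU|U f oU]; rewrite -Ec.
  by move=> /(H1 U oU) H; apply: nearcS2 E H => s ->.
move=> Uc rf; apply: regc_eq (H2 U f oU Uc rf).
by apply: nearcS E => s /= ->.
Qed.

(** Open sets and regular functions of an atlas space are generated from chart coordinates, so only
    the charts around the centre of the arc matter. *)
Lemma arc_sarc P I (dom : I -> set P) (gen : I -> set (P -> k)) c (gam : k -> P) :
  (forall i, dom i (gam c) -> nearc c (fun s => dom i (gam s)) /\
     forall f, gen i f -> regc c (f \o gam)) ->
  @sarc (atlas_space dom gen) c gam.
Proof.
move=> Hi.
have Hg V f : V (gam c) -> galg (coords dom gen V) f -> regc c (f \o gam).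
  move=> Vc; elim=> [x|g [i Vi gi]|g h _ Hg _ Hh|g h _ Hg _ Hh].
  - exact: regc_cst.
  - by have [_] := Hi i (Vi _ Vc); apply.
  - exact: regcD.
  - exact: regcM.
have HU U : zopen dom gen U -> U (gam c) -> nearc c (fun s => U (gam s)).
  elim=> [_|i /Hi[//]|V a _ IH Ha [Vc ac]|V W _ IV _ IW [Vc Wc]|F _ IF [V FV Vc]].
  - exact: nearcT.
  - exact: nearcI (IH Vc) (regc_neq0 (Hg V a Vc Ha) ac).
  - exact: nearcI (IV Vc) (IW Wc).
  - by apply: nearcS (IF V FV Vc) => s Vs; exists V.
split=> [U oU Uc|U f oU Uc rf]; first exact: HU.
have [V [a [b [oV Vc VU [aA bA] fE]]]] := rf _ Uc.
have [bc _] := fE _ Vc.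
apply: regc_eq (regcM (Hg _ _ Vc aA) (regcV (Hg _ _ Vc bA) bc)).
by apply: nearcS (HU _ oV Vc) => s /fE[_ /= ->].
Qed.

End Arcs.

Section Charts.
Variable k : closedFieldType.

Definition polyfun n : set ('rV[k]_n -> k) :=
  galg [set f | exists i, f = fun p : 'rV[k]_n => p 0 i].

Lemma polyfun_coord n i : @polyfun n (fun p => p 0 i).
Proof. by apply: galg_gen; exists i. Qed.

Lemma polyfun_cst n c : @polyfun n (fun=> c). Proof. exact: galg_cst. Qed.

Lemma polyfunD n f g : polyfun f -> polyfun g -> @polyfun n (fun p => f p + g p).
Proof. exact: galgD. Qed.

Lemma polyfunM n f g : polyfun f -> polyfun g -> @polyfun n (fun p => f p * g p).
Proof. exact: galgM. Qed.

Lemma polyfunN n f : polyfun f -> @polyfun n (fun p => - f p).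
Proof.
move=> Hf; have := polyfunM (polyfun_cst n (-1)) Hf.
by congr polyfun; apply: funext => p; rewrite mulN1r.
Qed.

Lemma polyfun_sum n I (r : seq I) (P : pred I) (F : I -> 'rV[k]_n -> k) :
  (forall i, P i -> polyfun (F i)) -> polyfun (fun p => \sum_(i <- r | P i) F i p).
Proof.
move=> H; elim: r => [|i r IH].
  by have := polyfun_cst n 0; congr polyfun; apply: funext => p; rewrite big_nil.
have [Pi|nPi] := boolP (P i).
  have := polyfunD (H i Pi) IH.
  by congr polyfun; apply: funext => p; rewrite big_cons Pi.
by move: IH; congr polyfun; apply: funext => p; rewrite big_cons (negPf nPi).
Qed.

Lemma polyfun_prod n I (r : seq I) (P : pred I) (F : I -> 'rV[k]_n -> k) :
  (forall i, P i -> polyfun (F i)) -> polyfun (fun p => \prod_(i <- r | P i) F i p).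
Proof.
move=> H; elim: r => [|i r IH].
  by have := polyfun_cst n 1; congr polyfun; apply: funext => p; rewrite big_nil.
have [Pi|nPi] := boolP (P i).
  have := polyfunM (H i Pi) IH.
  by congr polyfun; apply: funext => p; rewrite big_cons Pi.
by move: IH; congr polyfun; apply: funext => p; rewrite big_cons (negPf nPi).
Qed.

Lemma polyfun_comp n m f (x : 'rV[k]_m -> 'rV[k]_n) : polyfun f ->
  (forall i, polyfun (fun p => x p 0 i)) -> polyfun (f \o x).
Proof.
move=> Hf Hx; elim: Hf => [c|g [i ->]|g h _ Hg _ Hh|g h _ Hg _ Hh].
- exact: polyfun_cst.
- exact: Hx.
- exact: polyfunD.
- exact: polyfunM.
Qed.

Lemma polyfun_arc n f c (x : k -> 'rV[k]_n) : polyfun f ->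
  (forall i, regc c (fun s => x s 0 i)) -> regc c (f \o x).
Proof.
move=> Hf Hx; elim: Hf => [y|g [i ->]|g h _ Hg _ Hh|g h _ Hg _ Hh].
- exact: regc_cst.
- exact: Hx.
- exact: regcD.
- exact: regcM.
Qed.

Definition nearp n (p : 'rV[k]_n) (P : 'rV[k]_n -> Prop) :=
  exists2 C, polyfun C & C p != 0 /\ forall q, C q != 0 -> P q.

Lemma nearpT n p (P : 'rV[k]_n -> Prop) : (forall q, P q) -> nearp p P.
Proof. by move=> H; exists (fun=> 1); [apply: polyfun_cst|rewrite oner_neq0]. Qed.

Lemma nearpS n p (P Q : 'rV[k]_n -> Prop) : (forall q, P q -> Q q) ->
  nearp p P -> nearp p Q.
Proof. by move=> PQ [C HC [Cp H]]; exists C => //; split=> // q /H/PQ. Qed.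

Lemma nearpI n p (P Q : 'rV[k]_n -> Prop) : nearp p P -> nearp p Q ->
  nearp p (fun q => P q /\ Q q).
Proof.
move=> [C HC [Cp H]] [D HD [Dp H']]; exists (fun q => C q * D q).
  exact: polyfunM.
by rewrite mulf_neq0 //; split=> // q; rewrite mulf_eq0 negb_or => /andP[/H ? /H' ?].
Qed.

Lemma nearpS2 n p (P Q R : 'rV[k]_n -> Prop) : (forall q, P q -> Q q -> R q) ->
  nearp p P -> nearp p Q -> nearp p R.
Proof. by move=> H HP HQ; apply: nearpS (nearpI HP HQ) => q [Pq Qq]; apply: H. Qed.

Lemma nearp_at n p (P : 'rV[k]_n -> Prop) : nearp p P -> P p.
Proof. by move=> [C HC [Cp]]; apply. Qed.

Lemma nearp_all n p m (P : 'I_m -> 'rV[k]_n -> Prop) :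
  (forall i, nearp p (P i)) -> nearp p (fun s => forall i, P i s).
Proof.
elim: m P => [|m IH] P H; first by apply: nearpT => s [].
have /IH H2 : forall i, nearp p (P (lift ord0 i)) by move=> i.
apply: nearpS (nearpI (H ord0) H2) => s [Ps0 Ps] i.
case: (unliftP ord0 i) => [j ->|-> //]; exact: Ps.
Qed.

Lemma nearp_poly n p f : polyfun f -> f p != 0 ->
  nearp p (fun q : 'rV[k]_n => f q != 0).
Proof. by move=> Hf fp; exists f. Qed.

Lemma nearp_arc n (x : k -> 'rV[k]_n) c P : nearp (x c) P ->
  (forall i, regc c (fun s => x s 0 i)) -> nearc c (fun s => P (x s)).
Proof.
move=> [C HC [Cc H]] Hx.
by apply: nearcS (regc_neq0 (polyfun_arc HC Hx) Cc) => s /H.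
Qed.

Lemma regc_line n (p q : 'rV[k]_n) c i : regc c (fun s => (p + s *: q) 0 i).
Proof.
apply: regc_eq (regcD (regc_cst c (p 0 i)) (regcM (regc_id c) (regc_cst c (q 0 i)))).
by apply: nearcT => s; rewrite !mxE.
Qed.

(** Irreducibility of affine space, by restriction to the line through [p] and [q]. *)
Lemma nearp2_ex n (p q : 'rV[k]_n) P Q : nearp p P -> nearp q Q ->
  exists x, P x /\ Q x.
Proof.
move=> HP HQ; pose x s := p + s *: (q - p).
have x0 : x 0 = p by rewrite /x scale0r addr0.
have x1 : x 1 = q by rewrite /x scale1r addrC subrK.
rewrite -{}x0 in HP; rewrite -{}x1 in HQ.
have := nearp_arc HP (regc_line _ _ _); have := nearp_arc HQ (regc_line _ _ _).
by move=> H1 /(nearc2_ex 0 H1)[s [Ps Qs _]]; exists (x s).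
Qed.

Definition regp n (p : 'rV[k]_n) f := exists A C, [/\ polyfun A, polyfun C, C p != 0 &
  nearp p (fun q => f q = A q / C q)].

Lemma regp_eq n (p : 'rV[k]_n) f g : nearp p (fun q => f q = g q) -> regp p f ->
  regp p g.
Proof.
move=> fg [A [C [HA HC Cp H]]]; exists A, C; split=> //.
by apply: nearpS2 fg H => q ->.
Qed.

Lemma regp_poly n (p : 'rV[k]_n) f : polyfun f -> regp p f.
Proof.
move=> Hf; exists f, (fun=> 1); split=> //; first exact: polyfun_cst.
  by rewrite oner_neq0.
by apply: nearpT => q; rewrite divr1.
Qed.

Lemma regp_cst n (p : 'rV[k]_n) c : regp p (fun=> c).
Proof. exact/regp_poly/polyfun_cst. Qed.

Lemma regpD n (p : 'rV[k]_n) f g : regp p f -> regp p g -> regp p (fun q => f q + g q).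
Proof.
move=> [A [C [HA HC Cp H]]] [B [D [HB HD Dp H']]].
exists (fun q => A q * D q + B q * C q), (fun q => C q * D q); split.
- by apply: polyfunD; apply: polyfunM.
- exact: polyfunM.
- by rewrite mulf_neq0.
apply: nearpS2 (nearpI (nearp_poly HC Cp) (nearp_poly HD Dp)) (nearpI H H').
by move=> q [C0 D0] [-> ->]; rewrite addf_div.
Qed.

Lemma regpM n (p : 'rV[k]_n) f g : regp p f -> regp p g -> regp p (fun q => f q * g q).
Proof.
move=> [A [C [HA HC Cp H]]] [B [D [HB HD Dp H']]].
exists (fun q => A q * B q), (fun q => C q * D q); split; [exact: polyfunM..| |].
  by rewrite mulf_neq0.
by apply: nearpS2 H H' => q -> ->; rewrite mulf_div.
Qed.

Lemma regpN n (p : 'rV[k]_n) f : regp p f -> regp p (fun q => - f q).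
Proof.
move=> H; apply: regp_eq (regpM (regp_cst p (-1)) H).
by apply: nearpT => s; rewrite mulN1r.
Qed.

Lemma regpB n (p : 'rV[k]_n) f g : regp p f -> regp p g -> regp p (fun q => f q - g q).
Proof. by move=> Hf /regpN; apply: regpD. Qed.

Lemma regp_sum n (p : 'rV[k]_n) I (r : seq I) (P : pred I) (F : I -> 'rV[k]_n -> k) :
  (forall i, P i -> regp p (F i)) -> regp p (fun q => \sum_(i <- r | P i) F i q).
Proof.
move=> H; elim: r => [|i r IH].
  by apply: regp_eq (regp_cst p 0); apply: nearpT => s; rewrite big_nil.
have [Pi|nPi] := boolP (P i).
  apply: regp_eq (regpD (H i Pi) IH).
  by apply: nearpT => s; rewrite big_cons Pi.
by apply: regp_eq IH; apply: nearpT => s; rewrite big_cons (negPf nPi).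
Qed.

Lemma regp_prod n (p : 'rV[k]_n) I (r : seq I) (P : pred I) (F : I -> 'rV[k]_n -> k) :
  (forall i, P i -> regp p (F i)) -> regp p (fun q => \prod_(i <- r | P i) F i q).
Proof.
move=> H; elim: r => [|i r IH].
  by apply: regp_eq (regp_cst p 1); apply: nearpT => s; rewrite big_nil.
have [Pi|nPi] := boolP (P i).
  apply: regp_eq (regpM (H i Pi) IH).
  by apply: nearpT => s; rewrite big_cons Pi.
by apply: regp_eq IH; apply: nearpT => s; rewrite big_cons (negPf nPi).
Qed.

Lemma regp_neq0 n (p : 'rV[k]_n) f : regp p f -> f p != 0 ->
  nearp p (fun q => f q != 0).
Proof.
move=> [A [C [HA HC Cp H]]] fp.
have Ap : A p != 0.
  by apply: contraNneq fp => Ap; rewrite (nearp_at H) Ap mul0r.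
apply: nearpS2 (nearpI (nearp_poly HA Ap) (nearp_poly HC Cp)) H.
by move=> q [? ?] ->; rewrite mulf_neq0 ?invr_neq0.
Qed.

Lemma regpV n (p : 'rV[k]_n) f : regp p f -> f p != 0 -> regp p (fun q => (f q)^-1).
Proof.
move=> [A [C [HA HC Cp H]]] fp; exists C, A; split=> //.
  by apply: contraNneq fp => Ap; rewrite (nearp_at H) Ap mul0r.
by apply: nearpS H => q ->; rewrite invf_div.
Qed.

Lemma regp_arc n (x : k -> 'rV[k]_n) c f : regp (x c) f ->
  (forall i, regc c (fun s => x s 0 i)) -> regc c (f \o x).
Proof.
move=> [A [C [HA HC Cp H]]] Hx.
apply: regc_eq (regcM (polyfun_arc HA Hx) (regcV (polyfun_arc HC Hx) Cp)).
by apply: nearcS (nearp_arc H Hx) => s /= ->.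
Qed.

(** An open immersion of affine n-space, expressed through germs: neighbourhoods pull back,
    principal open sets have open images, and regular germs correspond both ways. *)
Record ischart (X : space k) n (kap : 'rV[k]_n -> X) : Prop := IsChart {
  ch_inj : injective kap;
  ch_near : forall p U, opn U -> U (kap p) -> nearp p (fun q => U (kap q));
  ch_open : forall C, polyfun C -> opn (kap @` [set q | C q != 0]);
  ch_reg : forall p U f, opn U -> U (kap p) -> reg U f -> regp p (f \o kap);
  ch_regV : forall p f, regp p (f \o kap) -> regular_at (kap p) f
}.

Lemma chart_sarc (X : space k) n (kap : 'rV[k]_n -> X) c (x : k -> 'rV[k]_n) :
  ischart kap -> (forall i, regc c (fun s => x s 0 i)) -> sarc c (kap \o x).
Proof.
move=> ch Hx; split=> [U oU Uc|U f oU Uc rf].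
  exact: (nearp_arc (ch_near ch oU Uc) Hx).
exact: (regp_arc (ch_reg ch oU Uc rf) Hx).
Qed.

Lemma nearp_open (X : space k) n (kap : 'rV[k]_n -> X) p P : ischart kap ->
  nearp p P -> exists U, [/\ opn U, U (kap p) & forall x, U x -> exists2 q, x = kap q & P q].
Proof.
move=> ch [C HC [Cp H]]; exists (kap @` [set q | C q != 0]); split.
- exact: ch_open.
- by exists p.
- by move=> x [q /H Pq <-]; exists q.
Qed.

(** Induction on the generation of open sets and of coordinate algebras reduces pulling back to the
    generators of single charts. In the other direction, [ext] realises polynomials on affine space
    by functions of the chart [i0]. *)
Lemma atlas_chart P I (dom : I -> set P) (gen : I -> set (P -> k)) n
    (kap : 'rV[k]_n -> P) i0 :
  injective kap -> (forall x, dom i0 x <-> exists p, x = kap p) ->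
  (forall l, exists2 f, gen i0 f & forall p, f (kap p) = p 0 l) ->
  (forall i p, dom i (kap p) -> nearp p (fun q => dom i (kap q)) /\
     forall f, gen i f -> regp p (f \o kap)) ->
  @ischart (atlas_space dom gen) n kap.
Proof.
move=> inj dom0 gen0 Hi.
have Hg V f p : V (kap p) -> galg (coords dom gen V) f -> regp p (f \o kap).
  move=> Vc; elim=> [x|g [i Vi gi]|g h _ Hg _ Hh|g h _ Hg _ Hh].
  - exact: regp_cst.
  - by have [_] := Hi i p (Vi _ Vc); apply.
  - exact: regpD.
  - exact: regpM.
have HU U p : zopen dom gen U -> U (kap p) -> nearp p (fun q => U (kap q)).
  move=> HU; elim: HU p => [p _|i p /Hi[//]|V a _ IH Ha p [Vc ac]
    |V W _ IV _ IW p [Vc Wc]|F _ IF p [V FV Vc]].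
  - exact: nearpT.
  - exact: nearpI (IH _ Vc) (regp_neq0 (Hg V a p Vc Ha) ac).
  - exact: nearpI (IV _ Vc) (IW _ Wc).
  - by apply: nearpS (IF V FV p Vc) => s Vs; exists V.
have ext C : polyfun C -> exists2 C', galg (coords dom gen (dom i0)) C' &
    forall q, C' (kap q) = C q.
  elim=> [c|g [i ->]|g h _ [g' Hg' Eg] _ [h' Hh' Eh]|g h _ [g' Hg' Eg] _ [h' Hh' Eh]].
  - by exists (cst c) => //; apply: galg_cst.
  - by have [f fg fE] := gen0 i; exists f => //; apply: galg_gen; exists i0.
  - by exists (g' + h') => [|q]; [apply: galgD|rewrite !fctE Eg Eh].
  - by exists (g' * h') => [|q]; [apply: galgM|rewrite !fctE Eg Eh].
have opC C : polyfun C -> zopen dom gen (kap @` [set q | C q != 0]).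
  move=> /ext[C' HC' CE].
  have -> : kap @` [set q | C q != 0] = dom i0 `&` [set x | C' x != 0].
    apply/seteqP; split=> x /=.
      by move=> [q Cq <-]; split; [apply/dom0; exists q|rewrite CE].
    by move=> [/dom0[q ->]]; rewrite CE => Cq; exists q.
  by apply: zopen_neq0 => //; apply: zopen_dom.
split=> //.
- by move=> p U oU Up; apply: HU.
- move=> p U f oU Up rf; have [V [a [b [oV Vc VU [aA bA] fE]]]] := rf _ Up.
  have [bc _] := fE _ Vc.
  apply: regp_eq (regpM (Hg _ _ _ Vc aA) (regpV (Hg _ _ _ Vc bA) bc)).
  by apply: nearpS (HU _ _ oV Vc) => s /fE[_ /= ->].
- move=> p f [A [C [HA HC Cp [D HD [Dp HE]]]]].
  pose U := kap @` [set q | C q * D q != 0].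
  have oU : zopen dom gen U by apply: opC; apply: polyfunM.
  exists U; split=> //; first by exists p => //=; rewrite mulf_neq0.
  have [A' HA' AE] := ext A HA; have [C' HC' CE] := ext C HC.
  have Ud : U `<=` dom i0 by move=> x [q _ <-]; apply/dom0; exists q.
  move=> x Ux; exists U, A', C'; split=> //; first by split; apply: (coordsS Ud).
  move=> y [q /=]; rewrite mulf_eq0 negb_or => /andP[Cq Dq] <-.
  by rewrite CE AE; split=> //; apply: (HE q).
Qed.

End Charts.

(** * Sheaves of functions and tautological sections *)

Section FunctionModules.
Variables (k : fieldType) (X : space k) (F : fmodule X).

Lemma fsec_sec U (s : sec (omodule_of F) U) : opn U -> fm_sec U (fval s).
Proof. by move=> oU; have /asboolP[+ _] := fvalP s; apply. Qed.

Lemma fsec_mk U (t : fmT F -> k) : opn U -> fm_sec U t ->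
  fval (insubd 0 t : fsec F U) = t.
Proof. by move=> oU Ht; apply: (@insubdK _ _ (fsec F U)); apply/asboolP. Qed.

Definition fsec_of U (t : fmT F -> k) : sec (omodule_of F) U := (insubd 0 t : fsec F U).

Lemma fsec_ofE U (t : fmT F -> k) : opn U -> fm_sec U t -> fval (fsec_of U t) = t.
Proof. exact: fsec_mk. Qed.

Lemma fsec_inj U (s t : sec (omodule_of F) U) : fval s =1 fval t -> s = t.
Proof. by move=> st; apply: val_inj; apply: funext. Qed.

Lemma fsec_add U (s t : sec (omodule_of F) U) a :
  fval (s + t) a = fval s a + fval t a.
Proof.
have -> // : fval (s + t) = fval s + fval t.
exact: (raddfD (val : fsec F U -> (fmT F -> k))).
Qed.

Lemma fsec_zero U a : fval (0 : sec (omodule_of F) U) a = 0.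
Proof.
have -> // : fval (0 : sec (omodule_of F) U) = 0.
exact: (raddf0 (val : fsec F U -> (fmT F -> k))).
Qed.

Lemma fsec_supp U (s : sec (omodule_of F) U) a : opn U -> ~ U (fm_pi a) -> fval s a = 0.
Proof. by move=> oU; apply: fm_supp (fsec_sec s oU). Qed.

Lemma fsec_res U V (s : sec (omodule_of F) U) a : opn U -> opn V -> V `<=` U ->
  V (fm_pi a) -> fval (res V s) a = fval s a.
Proof.
move=> oU oV VU Va; have /= -> := @fsec_mk V (cutoff (@fm_pi _ _ F) V (fval s)) oV
  (fm_cutoff oU oV VU (fsec_sec s oU)).
by rewrite /cutoff ifT // inE.
Qed.

Lemma fsec_act U f (s : sec (omodule_of F) U) a : opn U -> reg U f ->
  fval (act f s) a = f (fm_pi a) * fval s a.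
Proof.
move=> oU rf; have /= -> := @fsec_mk U ((f \o @fm_pi _ _ F) * fval s) oU
  (fm_act oU rf (fsec_sec s oU)).
by [].
Qed.

(** Functions glue pointwise, so a module of functions is a sheaf once membership is a local
    condition. *)
Lemma fm_sheaf : (forall (U : set X) t, opn U -> (forall a, ~ U (fm_pi a) -> t a = 0) ->
    (forall x, U x -> exists V, [/\ opn V, V x, V `<=` U &
       fm_sec V (cutoff (@fm_pi _ _ F) V t)]) -> fm_sec U t) ->
  is_sheaf (omodule_of F).
Proof.
move=> loc I U s oU Hs.
have oUU : opn (\bigcup_i U i).
  have -> : \bigcup_i U i = \bigcup_(V in range U) V by rewrite bigcup_image.
  by apply: opn_bigcup => _ [i _ <-].
have sub i : U i `<=` \bigcup_i U i by move=> x Ux; exists i.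
have agree i j a : U i (fm_pi a) -> U j (fm_pi a) -> fval (s i) a = fval (s j) a.
  move=> Ui Uj; have oij := opnI (oU i) (oU j).
  have := congr1 (fun t => fval t a) (Hs i j).
  by rewrite !fsec_res // => x [].
pose t a : k := if pselect (exists i, U i (fm_pi a)) is left h
  then fval (s (projT1 (cid h))) a else 0.
have tE i a : U i (fm_pi a) -> t a = fval (s i) a.
  move=> Ui; rewrite /t; case: pselect => [h|[]]; last by exists i.
  by apply: agree => //; case: (cid h).
have t0 a : ~ (\bigcup_i U i) (fm_pi a) -> t a = 0.
  by move=> Ha; rewrite /t; case: pselect => // -[i Ui]; case: Ha; exists i.
have cutE i : cutoff (@fm_pi _ _ F) (U i) t = fval (s i).
  apply: funext => a; rewrite /cutoff; case: ifPn => [|/negP]; rewrite inE => Ha.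
    exact: tE.
  by rewrite fsec_supp.
have Ht : fm_sec (\bigcup_i U i) t.
  apply: loc => // x [i _ Ui]; exists (U i); rewrite cutE; split=> //.
  exact: fsec_sec.
exists (fsec_of _ t); split=> [i|t' Ht'].
  apply: fsec_inj => a; have [Ua|Ua] := pselect (U i (fm_pi a)).
    by rewrite fsec_res // fsec_ofE // (tE i).
  by rewrite !fsec_supp.
apply: fsec_inj => a; rewrite fsec_ofE //.
have [[i _ Ui]|Ua] := pselect ((\bigcup_i U i) (fm_pi a)); last first.
  by rewrite t0 // fsec_supp.
by rewrite (tE i) // -(Ht' i) fsec_res.
Qed.

End FunctionModules.

Lemma reg_prod (k : fieldType) (X : space k) U I (r : seq I) (F : I -> X -> k) :
  opn U -> (forall i, reg U (F i)) -> reg U (fun x => \prod_(i <- r) F i x).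
Proof.
move=> oU H; elim: r => [|i r IH].
  apply: (reg_eq oU _ (reg_cst 1 oU)) => x _; by rewrite big_nil.
by apply: (reg_eq oU _ (regM oU (H i) IH)) => x _; rewrite big_cons.
Qed.

Section Twist.
Variables (k : fieldType) (T J : Type) (scaled : k -> T -> T -> Prop).
Variables (dom : J -> set T) (lin : J -> T -> k) (m : nat).
Hypothesis scaled_pclass : forall c a b, c != 0 -> scaled c a b ->
  pclass scaled a = pclass scaled b.
Local Notation PP := (pspace scaled dom lin).
Local Notation pj := (pproj scaled).
Local Notation pdm := (@pdom k T J scaled dom lin).

(** The analogue of [psec] in degree m, that is O(m). It is a concrete target for the universal
    property of the tensor power of O(1). *)
Definition pmsec (W : set PP) : set (T -> k) := [set t |
  [/\ forall a, ~ W (pj a) -> t a = 0,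
      forall c a b, c != 0 -> scaled c a b -> t b = c ^+ m * t a &
      forall j, reg (W `&` pdm j : set PP)
                  (fun p : PP => t (prep p) / lin j (prep p) ^+ m)]].

Lemma pdm_opn j : opn (pdm j : set PP).
Proof. exact: zopen_dom. Qed.

Program Definition pmfmodule : fmodule PP := @FModule k PP T pj pmsec _ _ _ _ _.
Next Obligation.
move=> U oU; split=> [//|c a b _ _|j]; first exact/esym/mulr0.
have oUj := opnI oU (pdm_opn j).
by apply: (reg_eq oUj _ (reg_cst 0 oUj)) => p _ /=; rewrite mul0r.
Qed.
Next Obligation.
move=> U t u oU [t1 t2 t3] [u1 u2 u3]; split.
- by move=> a Ua; rewrite !fctE t1 // u1 // subr0.
- by move=> c a b c0 ab; rewrite !fctE (t2 c a b) // (u2 c a b) // mulrBr.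
- move=> j; have oUj := opnI oU (pdm_opn j).
  have := regD oUj (t3 j) (regN oUj (u3 j)).
  by apply: (reg_eq oUj) => p _; rewrite !fctE mulrBl.
Qed.
Next Obligation. by move=> U t a oU [+ _ _]; apply. Qed.
Next Obligation.
move=> U V t oU oV VU [t1 t2 t3]; rewrite /cutoff; split.
- by move=> a Va; rewrite ifF //; apply/negbTE/negP; rewrite inE.
- move=> c a b c0 ab; rewrite -(pproj_scaled scaled_pclass c0 ab).
  by case: ifP => _; [apply: t2|rewrite mulr0].
- move=> j; have oUj := opnI oU (pdm_opn j); have oVj := opnI oV (pdm_opn j).
  apply: (reg_eq oVj _ (reg_sub oUj oVj _ (t3 j))).
    by move=> p; rewrite inE => -[Vp _]; rewrite pprojK ifT // inE.
  by move=> p [/VU].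
Qed.
Next Obligation.
move=> U f t oU rf [t1 t2 t3]; split.
- by move=> a Ua; rewrite !fctE t1 // mulr0.
- move=> c a b c0 ab; rewrite !fctE /= -(pproj_scaled scaled_pclass c0 ab).
  by rewrite (t2 c a b) // mulrCA.
- move=> j; have oUj := opnI oU (pdm_opn j).
  have rfj : reg (U `&` pdm j : set PP) f.
    by apply: reg_sub oU oUj _ rf => p [].
  have := regM oUj rfj (t3 j).
  by apply: (reg_eq oUj) => p _; rewrite !fctE /= pprojK mulrA.
Qed.

Definition pOm : omodule PP := omodule_of pmfmodule.

Lemma pOm_sheaf : is_sheaf pOm.
Proof.
apply: fm_sheaf => U t oU t0 loc; split=> //.
- move=> c a b c0 ab; have [Ua|Ua] := pselect (U (pj a)); last first.
    rewrite !t0 ?mulr0 //.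
    by move=> Ub; apply: Ua; rewrite /= (pproj_scaled scaled_pclass c0 ab).
  have [V [oV Va VU [_ + _]]] := loc _ Ua.
  move=> /(_ c a b c0 ab); rewrite /cutoff /= -(pproj_scaled scaled_pclass c0 ab).
  by have /mem_set -> := Va.
- move=> j; apply: reg_glue => [|p [Up pj]]; first exact: opnI (pdm_opn j).
  have [V [oV Vp VU [_ _ /(_ j) H]]] := loc _ Up.
  have oVj := opnI oV (pdm_opn j).
  exists (V `&` pdm j); split=> // [x [/VU]//|].
  apply: (reg_eq oVj _ H) => x; rewrite inE => -[Vx _].
  by rewrite /cutoff /= pprojK; have /mem_set -> := Vx.
Qed.

End Twist.

Section Skyscraper.
Variables (k : fieldType) (X : space k) (p : X).

(** The skyscraper with fibre k at [p]. Morphisms into it make the universal property of a pullback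
    speak about a single point. *)
Program Definition sky_fmodule : fmodule X :=
  @FModule k X unit (fun=> p) (fun U => [set t | ~ U p -> t tt = 0]) _ _ _ _ _.
Next Obligation. by []. Qed.
Next Obligation. by move=> U t u oU /= Ht Hu Up; rewrite !fctE Ht // Hu // subr0. Qed.
Next Obligation. by move=> U t [] oU. Qed.
Next Obligation.
move=> U V t oU oV VU /= Ht Vp; rewrite /cutoff ifF //.
by apply/negbTE/negP; rewrite inE.
Qed.
Next Obligation. by move=> U f t oU rf /= Ht Up; rewrite !fctE Ht // mulr0. Qed.

Definition sky : omodule X := omodule_of sky_fmodule.

Lemma sky_sheaf : is_sheaf sky.
Proof. by apply: fm_sheaf => U t oU t0 loc /=; apply: t0. Qed.

End Skyscraper.

Section SerreSections.
Variables (k : fieldType) (N : nat).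
Local Notation PN := (projective_space k N).

Definition pcoord (j : 'I_N.+1) : set PN :=
  @pdom k (nzvec k N) _ (@nzvec_scaled k N) (fun=> setT) (@nzvec_lin k N) j.

Lemma pcoord_opn j : opn (pcoord j). Proof. exact: zopen_dom. Qed.

Lemma nzvec_ex (v : nzvec k N) : exists j, sval v 0 j != 0.
Proof.
case: v => v v0 /=; apply/existsP; apply: contraNT v0 => /existsPn H.
by apply/eqP/rowP => j; rewrite mxE; apply/eqP; have := H j; rewrite negbK.
Qed.

Lemma pcoord_cover (p : PN) : exists j, pcoord j p.
Proof. by have [j Hj] := nzvec_ex (prep p); exists j. Qed.

Lemma prep_scaled (v : nzvec k N) : exists2 c, c != 0 &
  sval (prep (pproj (@nzvec_scaled k N) v)) = c *: sval v.
Proof.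
set q := pproj _ v; have /(congr1 (fun p => sval p)) /= E := pprojK q.
have : pclass (@nzvec_scaled k N) v (prep q).
  rewrite -E; exists 1; first exact: oner_neq0.
  by rewrite /nzvec_scaled scale1r.
by move=> [c c0 H]; exists c.
Qed.

Lemma pcoord_pproj j (v : nzvec k N) : pcoord j (pproj _ v) <-> sval v 0 j != 0.
Proof.
have [c c0 E] := prep_scaled v; rewrite /pcoord /pdom /= /nzvec_lin E mxE.
by rewrite mulf_eq0 (negPf c0) /=; split=> [[]|].
Qed.

Lemma ratio_reg i j : reg (pcoord j)
  (fun p : PN => nzvec_lin i (prep p) / nzvec_lin j (prep p)).
Proof.
move=> p Hp; exists (pcoord j), (fun p => nzvec_lin i (prep p) / nzvec_lin j (prep p)).
exists (cst 1); split=> //; first exact: zopen_dom.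
  split; last exact: galg_cst.
  by apply: galg_gen; exists j => //; exists i.
by move=> q _; rewrite /cst oner_neq0 divr1.
Qed.

Lemma psec_lin i : @psec k _ _ _ (fun=> setT) (@nzvec_lin k N) (setT : set PN) (nzvec_lin i).
Proof.
split=> [a []//|c a b c0 ab|j]; first by rewrite /nzvec_lin ab mxE.
have oj : opn (setT `&` pcoord j) by rewrite setTI; apply: pcoord_opn.
have sj : setT `&` pcoord j `<=` pcoord j by move=> x [].
exact: reg_sub (pcoord_opn j) oj sj (@ratio_reg i j).
Qed.

Definition serre_coord i : sec (serre_twist k N) setT :=
  fsec_of setT (nzvec_lin i : fmT (pfmodule _ _ (@nzvec_class k N)) -> k).

Lemma serre_coordE i : fval (serre_coord i) = nzvec_lin i.
Proof. apply: fsec_ofE; [exact: opnT|exact: psec_lin]. Qed.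

Lemma serre_gen V (s : sec (serre_twist k N) V) j : opn V ->
  exists2 f, reg (V `&` pcoord j) f &
    res (V `&` pcoord j) s = act f (res (V `&` pcoord j) (serre_coord j)).
Proof.
move=> oV; have oW := opnI oV (pcoord_opn j).
have [_ s2 /(_ j) s3] := fsec_sec s oV.
exists (fun p => fval s (prep p) / nzvec_lin j (prep p)) => //.
apply: fsec_inj => v; set p := pproj _ v : PN.
have [Wp|Wp] := pselect ((V `&` pcoord j) p); last by rewrite !fsec_supp.
rewrite fsec_act // !fsec_res // ?serre_coordE; last exact: opnT.
have [c c0 Ec] := prep_scaled v.
rewrite -[fm_pi v]/p (s2 c v (prep p)) // /nzvec_lin Ec mxE.
have vj : sval v 0 j != 0 by have [_ /pcoord_pproj] := Wp.
by rewrite -mulf_div divff // mul1r divfK.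
Qed.

Lemma serre_gen_coord i j :
  res (pcoord j) (serre_coord i) =
  act (fun p : PN => nzvec_lin i (prep p) / nzvec_lin j (prep p))
      (res (pcoord j) (serre_coord j)).
Proof.
have oT := opnT PN; have oj := pcoord_opn j.
apply: fsec_inj => v; set p := pproj _ v : PN.
have [Wp|Wp] := pselect (pcoord j p); last by rewrite !fsec_supp.
rewrite fsec_act //; last exact: (@ratio_reg i j).
rewrite !fsec_res // !serre_coordE.
have [c c0 Ec] := prep_scaled v.
rewrite -[fm_pi v]/p /nzvec_lin Ec !mxE.
have vj : sval v 0 j != 0 by move/pcoord_pproj: Wp.
by rewrite -mulf_div divff // mul1r divfK.
Qed.

End SerreSections.

(** * The homogeneous map attached to an ample bundle *)

Section Ample.
Variables (k : closedFieldType) (X : space k) (E : omodule X).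
Local Notation PE := (projective_bundle E).
Local Notation LE := (tautological E).
Local Notation pj := (pproj (@nzform_scaled k X E)).

(** All that is retained of ampleness. [amp_pt] recovers only the base point of a form, and
    [amp_arc] tests regularity on arcs, because the later arguments use one-parameter families
    only. *)
Record amp_data (m N : nat) (H : nzform E -> 'rV[k]_N.+1) : Prop := AmpData {
  amp_gt0 : (0 < m)%N;
  amp_scale : forall c a b, c != 0 -> nzform_scaled c a b -> H b = c ^+ m *: H a;
  amp_neq0 : forall a, H a != 0;
  amp_pt : forall a b c, H b = c *: H a -> nzf_pt a = nzf_pt b;
  amp_arc : forall c (a : k -> nzform E), sarc c (fun s => nzf_pt (a s)) ->
    (forall V (s0 : sec E V), opn V -> V (nzf_pt (a c)) ->
       regc c (fun s => nzf_form (a s) s0)) ->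
    forall i, regc c (fun s => H (a s) 0 i)
}.

Lemma nzform_prep (a : nzform E) : exists2 c, c != 0 & nzform_scaled c a (prep (pj a)).
Proof.
have /(congr1 (fun p => sval p)) /= Ep := pprojK (pj a).
have : pclass (@nzform_scaled k X E) a (prep (pj a)).
  rewrite -Ep; exists 1; first exact: oner_neq0.
  by split=> // U s; rewrite mul1r.
by move=> [c c0 H]; exists c.
Qed.

Lemma nzform_dom_lin (a : nzform E) V (s : sec E V) : nzf_form a s != 0 ->
  opn V /\ V (nzf_pt a).
Proof.
have [f1 _ _ _] := nzf_fibre a.
by move=> H; apply: contrapT => /f1 E0; rewrite E0 eqxx in H.
Qed.

Local Notation pdomE := (@pdom k (nzform E) _ (@nzform_scaled k X E)
  (@nzform_dom k X E) (@nzform_lin k X E)).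

Lemma pdomE_pj (a : nzform E) V (s : sec E V) :
  pdomE (existT _ V s) (pj a) <-> nzf_form a s != 0.
Proof.
have [c c0 [pab ab]] := nzform_prep a.
rewrite /pdom /= /nzform_lin /nzform_dom /= -pab ab mulf_eq0 (negPf c0) /=.
by split=> [[]//|H]; split=> //; apply: nzform_dom_lin H.
Qed.

(** A section [s] of [E] defines the function a |-> a(s) on forms, homogeneous of degree 1, here cut
    off to the open set where it does not vanish. *)
Lemma taut_sec V (s : sec E V) : opn V ->
  let W := pdomE (existT _ V s) : set PE in
  exists s0 : sec LE W, forall a, pdomE (existT _ V s) (pj a) -> fval s0 a = nzf_form a s.
Proof.
move=> oV W; have oW : opn W by exact: zopen_dom.
pose t a : k := if pj a \in W then nzf_form a s else 0.
suff Ht : @psec k _ _ _ (@nzform_dom k X E) (@nzform_lin k X E) W t.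
  exists (fsec_of W (t : fmT (pfmodule _ _ (@nzform_class k X E)) -> k)) => a Wa.
  rewrite fsec_ofE // /t.
  by move/mem_set: Wa => ->.
split.
- by move=> a Wa; rewrite /t ifF //; apply/negbTE/negP; rewrite inE.
- move=> c a b c0 ab; rewrite /t -(pproj_scaled (@nzform_class k X E) c0 ab).
  by case: ifP => _; [have [_ ->] := ab|rewrite mulr0].
- move=> [U u]; have oj : opn (pdomE (existT _ U u) : set PE) by exact: zopen_dom.
  have oWj := opnI oW oj.
  have [oU|noU] := pselect (opn U); last first.
    by move=> p [_ []]; rewrite /nzform_dom /= => -[].
  (* In a chart of the bundle, numerators must be defined wherever the denominator is; so [s] and
     [u] are both restricted to the intersection of their domains. *)
  pose j' := existT (sec E) (V `&` U) (res (V `&` U) u).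
  pose i' := existT (sec E) (V `&` U) (res (V `&` U) s).
  have oVU := opnI oV oU.
  have resE (a : nzform E) U1 (w : sec E U1) : opn U1 -> V `&` U `<=` U1 ->
      (V `&` U) (nzf_pt a) -> nzf_form a (res (V `&` U) w) = nzf_form a w.
    by move=> oU1 sU1 Ha; have [_ _ _ ->] := nzf_fibre a.
  move=> p [Wp jp].
  exists (W `&` pdomE (existT _ U u)),
    (fun p => nzform_lin i' (prep p) / nzform_lin j' (prep p)), (cst 1).
  split=> //.
    split; last exact: galg_cst.
    apply: galg_gen; exists j'; last by exists i'.
    move=> q [[[_ Vq] _] [[_ Uq] uq]].
    have VUq : (V `&` U) (nzf_pt (prep q)) by split.
    split; first by split.
    by rewrite /nzform_lin /= resE.
  move=> q [Wq jq]; rewrite /cst oner_neq0 divr1; split=> //.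
  have [[_ Vq] _] := Wq; have [[_ Uq] uq] := jq.
  have VUq : (V `&` U) (nzf_pt (prep q)) by split.
  rewrite /t pprojK; move/mem_set: (Wq) => ->.
  by rewrite /nzform_lin /= !resE.
Qed.

End Ample.

Section AmpleData.
Variables (k : closedFieldType) (X : space k) (E : omodule X).
Local Notation PE := (projective_bundle E).
Local Notation LE := (tautological E).
Local Notation pj := (pproj (@nzform_scaled k X E)).
Local Notation pdomE := (@pdom k (nzform E) _ (@nzform_scaled k X E)
  (@nzform_dom k X E) (@nzform_lin k X E)).
Local Notation OmE m := (pOm (@nzform_dom k X E) (@nzform_lin k X E) m (@nzform_class k X E)).

Section Power.
Variables (m : nat) (m_gt0 : (0 < m)%N).

Definition taut_mul U (s : {ffun 'I_m -> sec LE U}) : sec (OmE m) U :=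
  fsec_of U ((fun a => \prod_i fval (s i) a) : fmT (pmfmodule _ _ m (@nzform_class k X E)) -> k).

(** The support condition needs at least one factor, an empty product being 1 also off [U]; hence
    [m_gt0]. *)
Lemma taut_mulE U (s : {ffun 'I_m -> sec LE U}) a : opn U ->
  fval (taut_mul s) a = \prod_i fval (s i) a.
Proof.
move=> oU; rewrite fsec_ofE //; split.
- move=> b Ub; rewrite (bigD1 (Ordinal m_gt0)) //= fsec_supp ?mul0r //.
- move=> c b b' c0 bb'; rewrite -[in c ^+ m](card_ord m) -prodr_const -big_split /=.
  by apply: eq_bigr => i _; have [_ + _] := fsec_sec (s i) oU; apply.
- move=> j; have oj : opn (pdomE j : set PE) by exact: zopen_dom.
  have oUj := opnI oU oj.
  have Hr : reg (U `&` pdomE j : set PE)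
      (fun p : PE => \prod_(i < m) (fval (s i) (prep p) / nzform_lin j (prep p))).
    by apply: reg_prod => // i; have [_ _] := fsec_sec (s i) oU; apply.
  apply: (reg_eq oUj _ Hr) => p _.
  by rewrite prodf_div prodr_const card_ord.
Qed.

Lemma taut_mul_lin : omultilinear taut_mul.
Proof.
have sl U (s : {ffun 'I_m -> sec LE U}) i x a :
    \prod_j fval (slot s i x j) a = fval x a * \prod_(j | j != i) fval (s j) a.
  rewrite (bigD1 i) //= ffunE eqxx; congr (_ * _).
  by apply: eq_bigr => j /negPf ji; rewrite ffunE ji.
split.
- move=> U s i a b oU; apply: fsec_inj => x.
  by rewrite fsec_add !taut_mulE // !sl fsec_add mulrDl.
- move=> U s i f a oU rf; apply: fsec_inj => x.
  by rewrite fsec_act // !taut_mulE // !sl fsec_act // mulrA.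
- move=> U V s oU oV VU; apply: fsec_inj => x.
  have [Vx|Vx] := pselect (V (pj x)); last by rewrite !fsec_supp.
  rewrite fsec_res // !taut_mulE //; apply: eq_bigr => i _.
  by rewrite ffunE fsec_res.
Qed.

End Power.

(** Multiplication of m sections of O(1) factors through the tensor power M and gives [u] from M to
    O(m). The coordinates of projective space, pulled back to M and mapped by [u], are functions of
    degree m on nonzero forms: the entries of [H]. *)
Lemma ample_data : ample E -> exists m N H, @amp_data k X E m N H.
Proof.
move=> [m [M [m0 [shM [mu mu_lin mu_univ]] [N [iota [ci [_ [h [hD hA hR] huniv]]]]]]]].
have [iota_morph iota_inj _ _ _] := ci.
have [u [[uD uA uR] uE _]] := mu_univ _ _ (@pOm_sheaf _ _ _ _ _ _ _ _)
  (@taut_mul_lin m m0).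
have opre V : opn V -> opn (iota @^-1` V) by move=> oV; have [] := iota_morph V oV.
pose oT := opnT (projective_space k N).
pose Hi i := u (iota @^-1` setT) (h setT (serre_coord k i)).
pose H (a : nzform E) : 'rV[k]_N.+1 := \row_i fval (Hi i) a.
have pull V (s : sec (serre_twist k N) V) j f a : opn V ->
    reg (V `&` pcoord j) f ->
    res (V `&` pcoord j) s = act f (res (V `&` pcoord j) (serre_coord k j)) ->
    (iota @^-1` (V `&` pcoord j)) (pj a) ->
    fval (u _ (h V s)) a = f (iota (pj a)) * H a 0 j.
  move=> oV rf Es Wa; have oW := opnI oV (pcoord_opn k j).
  have WV : V `&` pcoord j `<=` V by move=> x [].
  have rf' : reg (iota @^-1` (V `&` pcoord j)) (f \o iota).
    by have [_] := iota_morph _ oW; apply.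
  have := congr1 (fun t => fval (u _ (h _ t)) a) Es.
  have oV' := opre V oV; have oW' := opre _ oW; have oT' := opre _ oT.
  have WV' : iota @^-1` (V `&` pcoord j) `<=` iota @^-1` V by move=> x /WV.
  rewrite hR // uR // fsec_res // => ->; rewrite hA // uA // fsec_act //.
  by rewrite hR // uR // fsec_res // mxE.
have Hratio i j a : pcoord j (iota (pj a)) ->
    H a 0 i = nzvec_lin i (prep (iota (pj a))) / nzvec_lin j (prep (iota (pj a))) * H a 0 j.
  move=> ja; have := @pull setT (serre_coord k i) j
    (fun p : projective_space k N => nzvec_lin i (prep p) / nzvec_lin j (prep p)) a oT.
  rewrite setTI => P; rewrite -P ?mxE //; first exact: (@ratio_reg k N i j).
  exact: serre_gen_coord.
(* [H a] is a multiple of the homogeneous coordinates of the embedded class of [a]; with the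
   injectivity of [iota] this gives [amp_pt]. *)
have Hprop a : exists2 z, z != 0 -> True & H a = z *: sval (prep (iota (pj a))).
  have [j ja] := pcoord_cover (iota (pj a)).
  have [_ zj] := ja.
  exists (H a 0 j / nzvec_lin j (prep (iota (pj a)))) => //.
  by apply/rowP => i; rewrite [RHS]mxE (Hratio i j a ja) [LHS]mulrAC [RHS]mulrAC (mulrC (H a 0 j)).
(* If [H a] is 0, then evaluation of [u] at [a] and the zero map, both from the pullback M to the
   skyscraper at the class of [a], agree on pulled back sections, hence are equal. But the m-th
   power of a section that [a] does not kill has nonzero value. *)
have Hneq0 a : H a != 0.
  apply/eqP => Ha0.
  pose SK := sky (pj a : PE).
  pose v1 U (s : sec M U) : sec SK U :=
    fsec_of U ((fun=> fval (u U s) a) : fmT (sky_fmodule (pj a : PE)) -> k).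
  have v1E U s : opn U -> fval (v1 U s) tt = fval (u U s) a.
    by move=> oU; rewrite fsec_ofE //= => Ua; rewrite fsec_supp.
  pose v0 U (s : sec M U) : sec SK U := 0.
  have v1_mor : omorphism v1.
    split.
    - move=> U s t oU; apply: fsec_inj => -[].
      by rewrite fsec_add !v1E // uD // fsec_add.
    - move=> U f s oU rf; apply: fsec_inj => -[].
      by rewrite fsec_act // !v1E // uA // fsec_act.
    - move=> U V s oU oV VU; apply: fsec_inj => -[].
      have [Va|Va] := pselect (V (pj a)); last by rewrite !fsec_supp.
      by rewrite fsec_res // !v1E // uR // fsec_res.
  have v0_mor : omorphism v0.
    split=> [U s t oU|U f s oU rf|U V s oU oV VU]; apply: fsec_inj => -[].
    - by rewrite fsec_add !fsec_zero addr0.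
    - by rewrite fsec_act // !fsec_zero mulr0.
    - have [Va|Va] := pselect (V (pj a)); last by rewrite !fsec_supp.
      by rewrite fsec_res // !fsec_zero.
  pose g V (s : sec (serre_twist k N) V) : sec SK (iota @^-1` V) := 0.
  have g_co : comorphism g.
    split=> [V s t oV|V f s oV rf|V W s oV oW WV]; apply: fsec_inj => -[].
    - by rewrite fsec_add !fsec_zero addr0.
    - rewrite fsec_act ?fsec_zero ?mulr0 //; first exact: opre.
      by have [_] := iota_morph _ oV; apply.
    - have [Va|Va] := pselect (W (iota (pj a))); last first.
        by rewrite !fsec_supp //; apply: opre.
      rewrite fsec_res ?fsec_zero //; [exact: opre|exact: opre|].
      by move=> x; apply: WV.
  have [w [_ _ wuniq]] := huniv _ _ (@sky_sheaf _ _ (pj a : PE)) g_co.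
  have v1h V s : opn V -> v1 (iota @^-1` V) (h V s) = g V s.
    move=> oV; apply: fsec_inj => -[]; rewrite fsec_zero v1E; last exact: opre.
    have [Va|Va] := pselect (V (iota (pj a))); last first.
      by rewrite fsec_supp //; apply: opre.
    have [j ja] := pcoord_cover (iota (pj a)).
    have [f rf fE] := serre_gen s j oV.
    by rewrite (pull V s j f) // Ha0 mxE mulr0.
  have v0h V s : opn V -> v0 (iota @^-1` V) (h V s) = g V s by [].
  have v10 U s : opn U -> v1 U s = 0.
    by move=> oU; rewrite (wuniq v1 v1_mor v1h) // -(wuniq v0 v0_mor v0h).
  have [V [s s0]] := nzf_neq0 a.
  have [oV Va] := nzform_dom_lin s0.
  have [t tE] := taut_sec s oV.
  have Wa : pdomE (existT _ V s) (pj a) by apply/pdomE_pj.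
  have oW : opn (pdomE (existT _ V s) : set PE) by exact: zopen_dom.
  have := congr1 (fun x : fsec (sky_fmodule (pj a : PE)) _ => fval x tt) (v10 _ (mu _ [ffun=> t]) oW).
  rewrite fsec_zero v1E // uE // taut_mulE // => /eqP.
  rewrite prodf_seq_eq0 => /hasP[i _] /=.
  by rewrite ffunE tE // (negPf s0).
exists m, N, H; split=> //.
- move=> c a b c0 ab; apply/rowP => i; rewrite !mxE.
  by have [_ + _] := fsec_sec (Hi i) (opre _ oT); apply.
- move=> a b c Hab.
  have [za _ Ea] := Hprop a; have [zb _ Eb] := Hprop b.
  have za0 : za != 0 by apply: contraNneq (Hneq0 a) => z0; rewrite Ea z0 scale0r.
  have zb0 : zb != 0 by apply: contraNneq (Hneq0 b) => z0; rewrite Eb z0 scale0r.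
  have c0 : c != 0 by apply: contraNneq (Hneq0 b) => c0; rewrite Hab c0 scale0r.
  have Eab : sval (prep (iota (pj b))) = (zb^-1 * c * za) *: sval (prep (iota (pj a))).
    by rewrite -scalerA -Ea -scalerA -Hab Eb scalerA mulVf // scale1r.
  have : iota (pj b) = iota (pj a).
    rewrite -[iota (pj b)]pprojK -[iota (pj a)]pprojK; apply/esym.
    apply: (pproj_scaled (@nzvec_class k N) _ Eab).
    by rewrite !mulf_neq0 ?invr_neq0.
  move/iota_inj => /(congr1 (fun p => sval p)) /= Epj.
  have : pclass (@nzform_scaled k X E) a b.
    rewrite -Epj; exists 1; first exact: oner_neq0.
    by split=> // U s; rewrite mul1r.
  by move=> [d _ []].
- move=> c a sa Ha i; rewrite -/(regc _ _).
  have [V [s s0]] := nzf_neq0 (a c).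
  have [oV Va] := nzform_dom_lin s0.
  have arcP : @sarc k PE c (fun s => pj (a s)).
    apply: arc_sarc => -[U w] jc.
    have [[/= oU Uc] _] := jc.
    have [x x0 [pax _]] := nzform_prep (a c).
    rewrite -pax in Uc; move/pdomE_pj: jc => wc.
    have rw := Ha _ w oU Uc.
    split; first by apply: nearcS (regc_neq0 rw wc) => t wt; apply/pdomE_pj.
    move=> f [[U' w'] /= sub ->].
    have [oU' U'c] : opn U' /\ U' (nzf_pt (a c)) by apply: (sub (a c)).
    apply: regc_eq (regcM (Ha _ w' oU' U'c) (regcV rw wc)).
    apply: nearcS (regc_neq0 rw wc) => t wt /=.
    have [y y0 [_ Ey]] := nzform_prep (a t).
    rewrite /nzform_lin /= !Ey -mulf_div divff // mul1r //.
  (* Regularity is known for the entry divided by the m-th power of the nonvanishing a(s); that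
     power is multiplied back. *)
  have [_ _ /(_ (existT _ V s)) HR] := fsec_sec (Hi i) (opre _ oT).
  have oW := opnI (opre _ oT) (zopen_dom _ _ (existT _ V s) : opn (pdomE (existT _ V s) : set PE)).
  have [_ /(_ _ _ oW _ HR) R] := arcP.
  have {}R := R (conj I (proj2 (pdomE_pj (a c) s) s0)).
  apply: regc_eq (regcM R (regc_exp m (Ha _ s oV Va))).
  apply: nearcS (regc_neq0 (Ha _ s oV Va) s0) => t st /=.
  rewrite mxE /nzform_lin /=; set q := prep _.
  have [y y0 Hy] := nzform_prep (a t).
  have [_ + _] := fsec_sec (Hi i) (opre _ oT) => /(_ _ _ _ y0 Hy) ->.
  have [_ ->] := Hy.
  rewrite exprMn invfM mulrACA divff ?mul1r ?expf_neq0 //.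
  by rewrite divfK // expf_neq0.
Qed.

End AmpleData.

(** * Lattice cones *)

Section IntegerVectors.
Variable n : nat.
Implicit Types (m w v : 'rV[int]_n).

Definition zdot w v : int := \sum_i w 0 i * v 0 i.
Definition qv v : 'rV[rat]_n := map_mx intr v.

Lemma zdotC w v : zdot w v = zdot v w.
Proof. by apply: eq_bigr => i _; rewrite mulrC. Qed.
Lemma zdotDr w v v' : zdot w (v + v') = zdot w v + zdot w v'.
Proof. by rewrite -big_split; apply: eq_bigr => i _; rewrite mxE mulrDr. Qed.
Lemma zdotDl w w' v : zdot (w + w') v = zdot w v + zdot w' v.
Proof. by rewrite zdotC zdotDr !(zdotC v). Qed.
Lemma zdotZr w (c : int) v : zdot w (c *: v) = c * zdot w v.
Proof. by rewrite mulr_sumr; apply: eq_bigr => i _; rewrite mxE mulrCA. Qed.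
Lemma zdotZl w (c : int) v : zdot (c *: w) v = c * zdot w v.
Proof. by rewrite zdotC zdotZr zdotC. Qed.
Lemma zdotNr w v : zdot w (- v) = - zdot w v.
Proof. by rewrite -scaleN1r zdotZr mulN1r. Qed.
Lemma zdotNl w v : zdot (- w) v = - zdot w v.
Proof. by rewrite zdotC zdotNr zdotC. Qed.
Lemma zdot0r w : zdot w 0 = 0.
Proof. by rewrite -(scale0r 0) zdotZr mul0r. Qed.
Lemma zdot0l v : zdot 0 v = 0. Proof. by rewrite zdotC zdot0r. Qed.
Lemma zdotBr w v v' : zdot w (v - v') = zdot w v - zdot w v'.
Proof. by rewrite zdotDr zdotNr. Qed.
Lemma zdotBl w w' v : zdot (w - w') v = zdot w v - zdot w' v.
Proof. by rewrite zdotDl zdotNl. Qed.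
Lemma zdot_sumr w I (r : seq I) P (F : I -> 'rV[int]_n) :
  zdot w (\sum_(i <- r | P i) F i) = \sum_(i <- r | P i) zdot w (F i).
Proof. by apply: (big_morph (zdot w)) => [x y|]; rewrite ?zdotDr ?zdot0r. Qed.
Lemma zdot_suml v I (r : seq I) P (F : I -> 'rV[int]_n) :
  zdot (\sum_(i <- r | P i) F i) v = \sum_(i <- r | P i) zdot (F i) v.
Proof. by rewrite zdotC zdot_sumr; apply: eq_bigr => i _; rewrite zdotC. Qed.

Lemma zdot_delta w i : zdot w (delta_mx 0 i) = w 0 i.
Proof.
rewrite /zdot (bigD1 i) //= mxE !eqxx mulr1 big1 ?addr0 // => j ji.
by rewrite mxE (negPf ji) andbF mulr0.
Qed.

Lemma zdot_sq v : v != 0 -> 0 < zdot v v.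
Proof.
move=> v0; rewrite lt_neqAle eq_sym sumr_ge0 ?andbT => [|i _]; last first.
  by rewrite -expr2 sqr_ge0.
apply: contraNneq v0 => /eqP; rewrite psumr_eq0 => [|i _]; last first.
  by rewrite -expr2 sqr_ge0.
move=> /allP H; apply/eqP/rowP => i; rewrite mxE.
by have := H i; rewrite mem_index_enum mulf_eq0 orbb => /(_ isT)/eqP.
Qed.

(** If the vector [v] that serves for the other hyperplanes lies on that of [d], then K v + d with K
    large leaves it and stays off the others. *)
Lemma generic_vec (s : seq 'rV[int]_n) : (forall d, d \in s -> d != 0) ->
  exists v, forall d, d \in s -> zdot d v != 0.
Proof.
elim: s => [|d s IH] H; first by exists 0.
have [|v Hv] := IH; first by move=> e es; apply: H; rewrite inE es orbT.
have [dv|dv] := eqVneq (zdot d v) 0; last first.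
  by exists v => e; rewrite inE => /orP[/eqP->|/Hv].
pose K : int := 1 + \sum_(e <- s) `|zdot e d|.
exists (K *: v + d) => e; rewrite inE zdotDr zdotZr => /orP[/eqP->|es].
  by rewrite dv mulr0 add0r gt_eqF // zdot_sq // H // inE eqxx.
have := Hv e es => ev.
have Ke : `|zdot e d| < K.
  rewrite /K (big_rem e) //=; have : 0 <= \sum_(y <- rem e s) `|zdot y d|.
    by apply: sumr_ge0.
  by move: (\sum_(_ <- _) _) => S S0; rewrite addrCA ltrDl ltr_pwDl.
have : K <= `|K * zdot e v|.
  rewrite normrM; have : 1 <= `|zdot e v| by lia.
  have : 0 <= K by lia.
  by move=> K0 e1; have := ler_wpM2l K0 e1; rewrite mulr1 ger0_norm.
move: Ke; move: (zdot e d) (K * zdot e v) (K) => y x L.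
lia.
Qed.

Lemma pairing_qv w v : pairing w (qv v) = (zdot w v)%:~R.
Proof.
rewrite /pairing /zdot rmorph_sum /=; apply: eq_bigr => i _.
by rewrite mxE rmorphM.
Qed.

Lemma pairingDl m m' (v : 'rV[rat]_n) : pairing (m + m') v = pairing m v + pairing m' v.
Proof. by rewrite -big_split; apply: eq_bigr => i _; rewrite mxE rmorphD mulrDl. Qed.
Lemma pairingDr m (v v' : 'rV[rat]_n) : pairing m (v + v') = pairing m v + pairing m v'.
Proof. by rewrite -big_split; apply: eq_bigr => i _; rewrite mxE mulrDr. Qed.
Lemma pairingZr m c (v : 'rV[rat]_n) : pairing m (c *: v) = c * pairing m v.
Proof. by rewrite mulr_sumr; apply: eq_bigr => i _; rewrite mxE mulrCA. Qed.
Lemma pairingNl m (v : 'rV[rat]_n) : pairing (- m) v = - pairing m v.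
Proof. by rewrite -sumrN; apply: eq_bigr => i _; rewrite mxE rmorphN mulNr. Qed.
Lemma pairing0l (v : 'rV[rat]_n) : pairing 0 v = 0.
Proof. by apply: big1 => i _; rewrite mxE mul0r. Qed.
Lemma pairing0r m : pairing m (0 : 'rV[rat]_n) = 0.
Proof. by rewrite -(scale0r 0) pairingZr mul0r. Qed.
Lemma pairing_sumr m I (r : seq I) P (F : I -> 'rV[rat]_n) :
  pairing m (\sum_(i <- r | P i) F i) = \sum_(i <- r | P i) pairing m (F i).
Proof. by apply: (big_morph (pairing m)) => [x y|]; rewrite ?pairingDr ?pairing0r. Qed.

Lemma qvD v w : qv (v + w) = qv v + qv w.
Proof. by apply/rowP => i; rewrite !mxE rmorphD. Qed.
Lemma qvN v : qv (- v) = - qv v.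
Proof. by apply/rowP => i; rewrite !mxE rmorphN. Qed.
Lemma qv0 : qv 0 = 0.
Proof. by apply/rowP => i; rewrite !mxE. Qed.
Lemma clear_denoms (x : 'rV[rat]_n) : exists2 w : 'rV[int]_n,
  True & exists2 q : rat, 0 < q & qv w = q *: x.
Proof.
pose D := \prod_j denq (x 0 j).
exists (\row_i (numq (x 0 i) * \prod_(j | j != i) denq (x 0 j))) => //.
exists D%:~R; first by rewrite ltr0z; apply: prodr_gt0 => j _; apply: denq_gt0.
apply/rowP => i; rewrite !mxE intrM numqE.
have -> : D = denq (x 0 i) * \prod_(j | j != i) denq (x 0 j) by rewrite /D (bigD1 i).
rewrite intrM.
by rewrite [RHS]mulrAC; congr (_ * _); rewrite mulrC.
Qed.

End IntegerVectors.

(** * Duality of rational cones *)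

Section Farkas.
Variable n : nat.

Local Notation dq := (fun m v : 'rV[rat]_n => (m *m v^T) 0 0).

(** Induction on the number of generators. If the form that separates [b] from the other generators
    is negative on the first one, [a], everything is projected along [a] to the kernel of that form,
    and the induction hypothesis is used again. *)
Lemma farkas d (u : 'I_d -> 'rV[rat]_n) b :
  (exists2 c : 'I_d -> rat, forall i, 0 <= c i & b = \sum_i c i *: u i) \/
  (exists2 m, forall i, 0 <= dq m (u i) & dq m b < 0).
Proof.
have dqD m x y : dq m (x + y) = dq m x + dq m y.
  by rewrite linearD /= mulmxDr mxE.
have dqZ m c x : dq m (c *: x) = c * dq m x.
  by rewrite linearZ /= -scalemxAr mxE.
have dqDl m m' x : dq (m + m') x = dq m x + dq m' x by rewrite mulmxDl mxE.
have dqZl m c x : dq (c *: m) x = c * dq m x by rewrite -scalemxAl mxE.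
elim: d u b => [|d IH] u b.
  have [->|b0] := eqVneq b 0.
    by left; exists (fun=> 0) => //; rewrite big_ord0.
  right; exists (- b) => [[]//|].
  rewrite mulNmx mxE oppr_lt0 mxE lt_neqAle eq_sym sumr_ge0 ?andbT => [|i _]; last first.
    by rewrite mxE -expr2 sqr_ge0.
  apply: contraNneq b0 => /eqP; rewrite psumr_eq0 => [|i _]; last first.
    by rewrite mxE -expr2 sqr_ge0.
  move=> /allP H; apply/eqP/rowP => i; rewrite mxE.
  by have := H i; rewrite mem_index_enum mxE mulf_eq0 orbb => /(_ isT)/eqP.
pose a := u ord0; pose u' i := u (lift ord0 i).
have [[c c0 bE]|[m mu mb]] := IH u' b.
  left; exists (fun i => if unlift ord0 i is Some j then c j else 0).
    by move=> i; case: unlift.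
  rewrite big_ord_recl unlift_none scale0r add0r bE.
  by apply: eq_bigr => i _; rewrite liftK.
have [ma|ma] := leP 0 (dq m a).
  right; exists m => // i; case: (unliftP ord0 i) => [j|] -> //; exact: mu.
(* [al] and [be] are the multiples of [a] removed by the projection; their signs make the
   coefficient of [a] nonnegative when the combination is lifted back. *)
pose al i := dq m (u' i) / dq m a; pose be := dq m b / dq m a.
have al0 i : al i <= 0 by rewrite /al mulr_ge0_le0 ?mu // invr_le0 ltW.
have be0 : 0 <= be by rewrite /be mulr_le0 ?invr_le0 ?ltW.
have [[c c0 bE]|[m' mu' mb']] := IH (fun i => u' i - al i *: a) (b - be *: a).
  left; exists (fun i => if unlift ord0 i is Some j then c j
    else be - \sum_i c i * al i).
    move=> i; case: unlift => // ; rewrite subr_ge0.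
    by apply: le_trans be0; apply: sumr_le0 => j _; rewrite mulr_ge0_le0.
  rewrite big_ord_recl unlift_none.
  rewrite [X in _ = _ + X](eq_bigr (fun i => c i *: u' i)); last first.
    by move=> i _; rewrite liftK.
  have E : \sum_i c i *: (u' i - al i *: a) =
      \sum_i c i *: u' i - (\sum_i c i * al i) *: a.
    rewrite scaler_suml -sumrB; apply: eq_bigr => i _.
    by rewrite scalerBr scalerA.
  move/eqP: bE; rewrite subr_eq E => /eqP ->.
  by rewrite scalerBl [RHS]addrC [RHS]addrA [LHS]addrAC.
(* The corrected form vanishes on [a], so its value on a vector is that of [m'] on the
   projection. *)
right; exists (m' - (dq m' a / dq m a) *: m).
  have ma0 : dq m a != 0 by rewrite lt_eqF.
  move=> i; case: (unliftP ord0 i) => [j|] ->; last first.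
    by rewrite dqDl -scaleNr dqZl mulNr divfK // subrr.
  have := mu' j; rewrite dqD -scaleNr dqZ dqDl -scaleNr dqZl -/(u' j) /al.
  have E (X Y Z : rat) : - (Y / Z) * X = - (X / Z) * Y.
    by rewrite !mulNr mulrAC [X / Z * Y]mulrAC (mulrC X).
  by rewrite E.
move: mb'; rewrite dqD -scaleNr dqZ dqDl -scaleNr dqZl /be.
have E (X Y Z : rat) : - (Y / Z) * X = - (X / Z) * Y.
  by rewrite !mulNr mulrAC [X / Z * Y]mulrAC (mulrC X).
by rewrite E.
Qed.

End Farkas.

Section Cones.
Variable n : nat.
Implicit Types (sigma tau : set 'rV[rat]_n).

(** Farkas' lemma, with denominators cleared to obtain a lattice form. *)
Lemma dual_dual sigma v : rational_polyhedral sigma ->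
  (forall m, dual sigma m -> 0 <= pairing m v) -> sigma v.
Proof.
move=> [d [u ->]] H.
have [[c c0 vE]|[m mu mv]] := farkas (fun i => qv (u i)) v; first by exists c.
have [w _ [q q0 wE]] := clear_denoms m.
have pE x : pairing w x = q * (m *m x^T) 0 0.
  rewrite mxE mulr_sumr; apply: eq_bigr => i _.
  by have /rowP/(_ i) := wE; rewrite !mxE mulrA => ->.
have : dual [set v | exists2 c : 'I_d -> rat, forall i, 0 <= c i &
         v = \sum_i c i *: map_mx intr (u i)] w.
  move=> x [c c0 ->]; rewrite pairing_sumr; apply: sumr_ge0 => i _.
  by rewrite pairingZr mulr_ge0 // pE mulr_ge0 ?(ltW q0) // mu.
by move/H; rewrite pE pmulr_rge0 // leNgt mv.
Qed.

Lemma dual0 sigma : dual sigma 0.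
Proof. by move=> v _; rewrite pairing0l. Qed.

Lemma dualD sigma m m' : dual sigma m -> dual sigma m' -> dual sigma (m + m').
Proof. by move=> Hm Hm' v Hv; rewrite pairingDl addr_ge0 ?Hm ?Hm'. Qed.

Lemma dualM sigma m (c : nat) : dual sigma m -> dual sigma (c%:Z *: m).
Proof.
move=> Hm; elim: c => [|c IH]; first by rewrite scale0r; apply: dual0.
by rewrite intS scalerDl scale1r; apply: dualD.
Qed.

Lemma dual_sum sigma I (r : seq I) (P : pred I) (F : I -> 'rV[int]_n) :
  (forall i, P i -> dual sigma (F i)) -> dual sigma (\sum_(i <- r | P i) F i).
Proof.
move=> H; elim/big_ind: _ => //; [exact: dual0|exact: dualD].
Qed.

Lemma dualS sigma tau : sigma `<=` tau -> dual tau `<=` dual sigma.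
Proof. by move=> st m Hm v /st /Hm. Qed.

Lemma dual_gens d (u : 'I_d -> 'rV[int]_n) m :
  (forall i, 0 <= zdot m (u i)) -> dual [set v | exists2 c : 'I_d -> rat,
    forall i, 0 <= c i & v = \sum_i c i *: map_mx intr (u i)] m.
Proof.
move=> H _ [c c0 ->]; rewrite pairing_sumr; apply: sumr_ge0 => i _.
by rewrite pairingZr mulr_ge0 // -/(qv (u i)) pairing_qv ler0z.
Qed.

Lemma gens_in d (u : 'I_d -> 'rV[int]_n) i :
  [set v | exists2 c : 'I_d -> rat, forall i, 0 <= c i &
     v = \sum_i c i *: map_mx intr (u i)] (qv (u i)).
Proof.
exists (fun j => (j == i)%:R) => [j|]; first exact: ler0n.
rewrite (bigD1 i) //= eqxx scale1r big1 ?addr0 // => j /negPf ->.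
by rewrite scale0r.
Qed.

(** If the whole dual vanished on a nonzero generator, the opposite vector would be in the bidual,
    hence in [sigma]. So each nonzero generator has a positive form, and the sum of these forms
    works for all. *)
Lemma dual_interior sigma : rational_polyhedral sigma -> strongly_convex sigma ->
  exists2 m, dual sigma m & forall v, sigma v -> v != 0 -> 0 < pairing m v.
Proof.
move=> rp sc; have [d [u sE]] := rp.
have /choice[M HM] : forall i, exists m, dual sigma m /\ (u i != 0 -> 0 < zdot m (u i)).
  move=> i; have [->|u0] := eqVneq (u i) 0; first by exists 0; split=> //; apply: dual0.
  apply: contrapT => Hn.
  have si : sigma (qv (u i)) by rewrite sE; apply: gens_in.
  have : sigma (- qv (u i)).
    apply: (dual_dual rp) => m Hm; have := Hm _ si.
    rewrite -qvN !pairing_qv !ler0z zdotNr oppr_ge0 => Hi.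
    by rewrite leNgt; apply/negP => Hlt; apply: Hn; exists m.
  move/(sc _ si) => /rowP E; case/eqP: u0; apply/rowP => j; have := E j.
  by rewrite !mxE => /eqP; rewrite intr_eq0 => /eqP.
exists (\sum_i M i); first by apply: dual_sum => i _; have [] := HM i.
move=> v; rewrite sE => -[c c0 vE] v0.
have ge i j : 0 <= zdot (M j) (u i).
  have := (HM j).1 (qv (u i)); rewrite pairing_qv ler0z; apply.
  by rewrite sE; apply: gens_in.
have pos i : u i != 0 -> 0 < zdot (\sum_i M i) (u i).
  move=> u0; rewrite zdot_suml (bigD1 i) //= ltr_pwDl ?(HM i).2 //.
  by apply: sumr_ge0 => j _; apply: ge.
have [i Hi] : exists i, c i * (zdot (\sum_i M i) (u i))%:~R != 0.
  apply: contrapT => Hn; case/eqP: v0; rewrite vE big1 // => i _.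
  have [->|u0] := eqVneq (u i) 0; first by rewrite -/(qv 0) qv0 scaler0.
  have [->|ci] := eqVneq (c i) 0; first by rewrite scale0r.
  case: Hn; exists i; rewrite mulf_neq0 // intr_eq0 gt_eqF //; exact: pos.
rewrite vE pairing_sumr (bigD1 i) //= pairingZr -/(qv (u i)) pairing_qv ltr_pwDl //.
  rewrite lt_neqAle eq_sym Hi /= mulr_ge0 // ler0z zdot_suml.
  by apply: sumr_ge0 => j _; apply: ge.
apply: sumr_ge0 => j _; rewrite pairingZr -/(qv (u j)) pairing_qv mulr_ge0 //.
by rewrite ler0z zdot_suml; apply: sumr_ge0 => l _; apply: ge.
Qed.

(* Strong convexity makes the dual cone full-dimensional, so that it generates the lattice. *)
Lemma dual_generates sigma m : rational_polyhedral sigma -> strongly_convex sigma ->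
  exists m1 m2, [/\ dual sigma m1, dual sigma m2 & m + m2 = m1].
Proof.
move=> rp sc; have [p Hp pos] := dual_interior rp sc; have [d [u sE]] := rp.
pose K := (\sum_i `|zdot m (u i)|)%N.
exists (m + K%:Z *: p), (K%:Z *: p); split=> //; last exact: dualM.
rewrite sE; apply: dual_gens => i; rewrite zdotDl zdotZl.
have [->|u0] := eqVneq (u i) 0; first by rewrite !zdot0r mulr0.
have : 0 < zdot p (u i).
  have := pos (qv (u i)); rewrite pairing_qv ltr0z; apply.
    by rewrite sE; apply: gens_in.
  apply: contraNneq u0 => /rowP E; apply/eqP/rowP => j; have := E j.
  by rewrite !mxE => /eqP; rewrite intr_eq0 => /eqP.
have : (`|zdot m (u i)| <= K)%N by rewrite /K (bigD1 i) //= leq_addr.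
by move=> H1 H2; nia.
Qed.

(** The monoid of the face is that of the cone with [-m] adjoined: off the face [m] is at least 1 on
    generators, so a large multiple of it compensates [m']. *)
Lemma face_unit sigma tau m : rational_polyhedral sigma -> dual sigma m ->
  tau = sigma `&` [set v | pairing m v = 0] ->
  forall m', dual tau m' -> exists K : nat, dual sigma (m' + K%:Z *: m).
Proof.
move=> [d [u sE]] Hm tE m' Hm'.
pose K := (\sum_i `|zdot m' (u i)|)%N.
exists K; rewrite sE; apply: dual_gens => i; rewrite zdotDl zdotZl.
have si : sigma (qv (u i)) by rewrite sE; apply: gens_in.
have : (`|zdot m' (u i)| <= K)%N by rewrite /K (bigD1 i) //= leq_addr.
have := Hm _ si; rewrite pairing_qv ler0z le_eqVlt => /orP[/eqP E|H1 H2]; last by nia.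
rewrite -E mulr0 addr0 => _.
have := Hm' (qv (u i)); rewrite pairing_qv ler0z; apply.
by rewrite tE; split=> //=; rewrite pairing_qv -E.
Qed.

Lemma face_neg sigma tau m : tau = sigma `&` [set v | pairing m v = 0] -> dual tau (- m).
Proof. by move=> -> v [_ /= E]; rewrite pairingNl E oppr0. Qed.

End Cones.

(** * Points and charts of a toric variety *)

Section Monomials.
Variable k : closedFieldType.

Definition mon n (x : 'rV[k]_n) (e : 'rV[int]_n) : k := \prod_i (x 0 i) ^ (e 0 i).

Definition intorus n (t : 'rV[k]_n) : Prop := forall i, t 0 i != 0.

(** The one-parameter subgroup of [v] at [s], acting on [t]. *)
Definition lam n (v : 'rV[int]_n) (s : k) (t : 'rV[k]_n) : 'rV[k]_n :=
  \row_i (s ^ (v 0 i) * t 0 i).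

Variable n : nat.
Implicit Types (x t : 'rV[k]_n) (e m v w : 'rV[int]_n).

Lemma mon0 x : mon x 0 = 1.
Proof. by apply: big1 => i _; rewrite mxE expr0z. Qed.

(** Negative powers of 0 are 0 by convention, so adding exponents at 0 can fail unless both are
    nonnegative. *)
Lemma expz_addge0 (y : k) (a b : int) : (y = 0 -> 0 <= a /\ 0 <= b) ->
  y ^ (a + b) = y ^ a * y ^ b.
Proof.
have [->|y0] := eqVneq y 0; last by rewrite expfzDr.
case=> //; case: a b => a [] b // _ _; exact: exprD.
Qed.

Lemma monD x m m' : (forall i, x 0 i = 0 -> 0 <= m 0 i /\ 0 <= m' 0 i) ->
  mon x (m + m') = mon x m * mon x m'.
Proof.
move=> H; rewrite /mon -big_split; apply: eq_bigr => i _ /=.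
by rewrite mxE expz_addge0 //; apply: H.
Qed.

Lemma mon_neq0 x m : (forall i, x 0 i = 0 -> m 0 i = 0) -> mon x m != 0.
Proof.
move=> H; apply/prodf_neq0 => i _; have [x0|x0] := eqVneq (x 0 i) 0.
  by rewrite H // expr0z oner_neq0.
by rewrite expfz_neq0.
Qed.

Lemma monDt t m m' : intorus t -> mon t (m + m') = mon t m * mon t m'.
Proof. by move=> Ht; apply: monD => i ti; have := Ht i; rewrite ti eqxx. Qed.

Lemma mon_tneq0 t m : intorus t -> mon t m != 0.
Proof. by move=> Ht; apply: mon_neq0 => i ti; have := Ht i; rewrite ti eqxx. Qed.

Lemma lam_torus v s t : s != 0 -> intorus t -> intorus (lam v s t).
Proof. by move=> s0 Ht i; rewrite mxE mulf_neq0 ?expfz_neq0. Qed.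

Lemma mon_lam v s t m : s != 0 -> mon (lam v s t) m = s ^ (zdot m v) * mon t m.
Proof.
move=> s0; have -> : s ^ zdot m v = \prod_i s ^ (m 0 i * v 0 i).
  by rewrite /zdot (big_morph (exprz s) (fun a b => expfzDr a b s0) (expr0z s)).
rewrite -big_split; apply: eq_bigr => i _ /=.
by rewrite mxE expfzMl exprz_exp (mulrC (v 0 i)).
Qed.

Lemma mon_monoid (S : set 'rV[int]_n) t : intorus t -> monoid_hom S (mon t).
Proof. by move=> Ht; split=> [|m m' _ _]; [apply: mon0|apply: monDt]. Qed.

End Monomials.

Section PointsOfProjectiveSpace.
Variables (k : closedFieldType) (N : nat).

(** The class of [v], with the class of (1, ..., 1) as default for [v] = 0. *)
Definition mkP (v : 'rV[k]_N.+1) : projective_space k N :=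
  if pselect (v != 0) is left h then pproj (@nzvec_scaled k N) (exist _ v h)
  else pproj _ (exist (fun v : 'rV[k]_N.+1 => v != 0) (const_mx 1)
    (ssrbool.introN eqP (fun E => elimN eqP (oner_neq0 k)
       (eq_trans (esym (mxE _ _ 0 0)) (eq_trans (congr1 (fun x : 'rV[k]_N.+1 => x 0 0) E) (mxE _ _ 0 0)))))).

Lemma mkPE v (h : v != 0) : mkP v = pproj (@nzvec_scaled k N) (exist _ v h).
Proof.
by rewrite /mkP; case: pselect => [h'|//]; rewrite (eq_irrelevance h h').
Qed.

Lemma mkP_prep (v : 'rV[k]_N.+1) : v != 0 -> exists2 c, c != 0 & sval (prep (mkP v)) = c *: v.
Proof. by move=> h; rewrite (mkPE h); apply: (prep_scaled (exist _ v h)). Qed.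

Lemma mkP_scale (v : 'rV[k]_N.+1) c : c != 0 -> v != 0 -> mkP (c *: v) = mkP v.
Proof.
move=> c0 v0; have cv0 : c *: v != 0 by rewrite scaler_eq0 negb_or c0.
rewrite (mkPE cv0) (mkPE v0); apply/esym.
have H : nzvec_scaled c (exist _ v v0) (exist (fun v : 'rV[k]_N.+1 => v != 0) _ cv0) by [].
by have -> := pproj_scaled (@nzvec_class k N) c0 H.
Qed.

Lemma prep_mkP (p : projective_space k N) : mkP (sval (prep p)) = p.
Proof.
have E (x : nzvec k N) : exist (fun v : 'rV[k]_N.+1 => v != 0) (sval x) (svalP x) = x.
  case: x => v h.
  exact: (congr1 (fun h' => exist (fun v : 'rV[k]_N.+1 => v != 0) v h') (eq_irrelevance _ h)).
by rewrite (mkPE (svalP (prep p))) E pprojK.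
Qed.

Lemma mkP_inj (v w : 'rV[k]_N.+1) : v != 0 -> w != 0 -> mkP v = mkP w ->
  exists2 c, c != 0 & w = c *: v.
Proof.
move=> v0 w0 E; have [c c0 Ec] := mkP_prep v0; have [d d0 Ed] := mkP_prep w0.
exists (d^-1 * c); first by rewrite mulf_neq0 ?invr_neq0.
by rewrite -scalerA -Ec E Ed scalerA mulVf // scale1r.
Qed.

Lemma pcoord_mkP j v : v != 0 -> pcoord j (mkP v) <-> v 0 j != 0.
Proof. by move=> v0; rewrite (mkPE v0) pcoord_pproj. Qed.

Lemma mkP_arc c (g : k -> 'rV[k]_N.+1) : (forall l, regc c (fun s => g s 0 l)) ->
  g c != 0 -> sarc c (fun s => mkP (g s)).
Proof.
move=> Hg gc; have near0 : nearc c (fun s => g s != 0).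
  have [l gl] : exists l, g c 0 l != 0.
    apply/existsP; apply: contraNT gc => /existsPn H.
    by apply/eqP/rowP => l; rewrite mxE; apply/eqP; have := H l; rewrite negbK.
  apply: nearcS (regc_neq0 (Hg l) gl) => s; apply: contraNneq => ->.
  by rewrite mxE.
apply: arc_sarc => j /= jc.
have gj : g c 0 j != 0 by apply/(pcoord_mkP j gc).
split; first by apply: nearcS2 near0 (regc_neq0 (Hg j) gj) => s s0 sj; apply/pcoord_mkP.
move=> f [i _ ->]; apply: regc_eq (regcM (Hg i) (regcV (Hg j) gj)).
apply: nearcS2 near0 (regc_neq0 (Hg j) gj) => s s0 sj /=.
have [d d0 E] := mkP_prep s0.
by rewrite /nzvec_lin E !mxE -mulf_div divff // mul1r.
Qed.

End PointsOfProjectiveSpace.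

Lemma poly_near_neq0 (k : closedFieldType) (c : k) (p : {poly k}) : p != 0 ->
  nearc c (fun s => s != c -> p.[s] != 0).
Proof.
move=> p0; have [H|[o [g [rg gc H]]]] := regc_order (regc_poly c p).
  by case/eqP: p0; apply: (@poly_near0 _ c); apply: nearcS H.
apply: nearcS2 H (regc_neq0 rg gc) => s -> gs sc.
by rewrite mulf_neq0 // expf_neq0 // subr_eq0.
Qed.

Section ToricPoints.
Variables (n : nat) (k : closedFieldType) (Sigma : set (set 'rV[rat]_n)).
Hypothesis fan_Sigma : is_fan Sigma.
Local Notation X := (toric_variety k Sigma).
Local Notation chart_pt := (chart_point (k:=k) Sigma).
Local Notation gl := (glued (k:=k) Sigma).
Implicit Types (sigma tau : set 'rV[rat]_n).

Lemma fan_rp sigma : Sigma sigma -> rational_polyhedral sigma.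
Proof. by case: fan_Sigma => _ _ + _ _ => H /H[]. Qed.

Lemma fan_sc sigma : Sigma sigma -> strongly_convex sigma.
Proof. by case: fan_Sigma => _ _ + _ _ => H /H[]. Qed.

Lemma fan_face sigma tau : Sigma sigma -> Sigma tau ->
  exists2 m, dual sigma m & sigma `&` tau = sigma `&` [set v | pairing m v = 0].
Proof. by case: fan_Sigma => _ _ _ _ H s t; have [[m ? ?] _] := H _ _ s t; exists m. Qed.

Lemma fan_ex : exists sigma, Sigma sigma.
Proof. by case: fan_Sigma. Qed.

Lemma one_monoid sigma : monoid_hom (dual sigma) (fun=> 1 : k).
Proof. by split=> // *; rewrite mulr1. Qed.

Lemma glued_class p : chart_pt p -> exists2 q, chart_pt q & gl p = gl q.
Proof. by exists p. Qed.

Lemma one_chart_pt : chart_pt (sval (cid fan_ex), fun=> 1).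
Proof. by split; [apply: svalP|apply: one_monoid]. Qed.

Definition mkpt (p : set 'rV[rat]_n * ('rV[int]_n -> k)) : X :=
  if pselect (chart_pt p) is left h then exist _ (gl p) (glued_class h) : toric_point k Sigma
  else exist _ (gl _) (glued_class one_chart_pt) : toric_point k Sigma.

Lemma mkptE p : chart_pt p -> sval (mkpt p : toric_point k Sigma) = gl p.
Proof. by move=> hp; rewrite /mkpt; case: pselect. Qed.

Lemma mkpt_eq p q : chart_pt p -> chart_pt q -> gl p = gl q -> mkpt p = mkpt q.
Proof.
move=> hp hq E; rewrite /mkpt; case: pselect => // h; case: pselect => // h'.
exact: eq_exist.
Qed.

Lemma mkpt_surj (C : X) : exists2 p, chart_pt p & C = mkpt p.
Proof.
case: C => C HC; case: (HC) => p hp E; exists p => //.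
by rewrite /mkpt; case: pselect => // h; apply: eq_exist.
Qed.

Lemma glued_refl p : chart_pt p -> gl p p.
Proof.
by case=> [Sp hp]; split=> //; exists p.2; rewrite setIid.
Qed.

(** By [face_unit], the monoid of the common face arises from that of [sigma] by inverting one
    element, so a homomorphism on it is determined on the smaller monoid. *)
Lemma ext_uniq sigma tau (g g' : 'rV[int]_n -> k) : Sigma sigma -> Sigma tau ->
  monoid_hom (dual (sigma `&` tau)) g -> monoid_hom (dual (sigma `&` tau)) g' ->
  {in dual sigma, g =1 g'} -> {in dual (sigma `&` tau), g =1 g'}.
Proof.
move=> Ss St [g1 gM] [g1' gM'] gg m'; rewrite inE => Hm'.
have [m Hm tE] := fan_face Ss St.
have [K HK] := face_unit (fan_rp Ss) Hm tE Hm'.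
have sub : dual sigma `<=` dual (sigma `&` tau) by apply: dualS => v [].
have Km : dual sigma (K%:Z *: m) by apply: dualM.
have KmN : dual (sigma `&` tau) (- (K%:Z *: m)).
  by rewrite -scalerN; apply: dualM; apply: face_neg tE.
have Km' := sub _ Km.
have Em : g (K%:Z *: m) = g' (K%:Z *: m) by apply: gg; rewrite inE.
have gK : g (K%:Z *: m) != 0.
  apply/eqP => E; have := gM _ _ Km' KmN; rewrite subrr g1 E mul0r => /eqP.
  by rewrite oner_eq0.
apply: (mulIf gK); rewrite {2}Em -gM // -gM' //.
by apply: gg; rewrite inE.
Qed.

Lemma glued_uniq p sigma g g' : gl p (sigma, g) -> gl p (sigma, g') ->
  {in dual sigma, g =1 g'}.
Proof.
move=> [[Sp _] [/= Ss _] [G [/= HG Gp Gg]]] [_ _ [G' [/= HG' Gp' Gg']]] m Hm.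
rewrite -Gg // -Gg' //; apply: (ext_uniq Sp Ss) => //.
  by move=> x Hx; rewrite Gp // Gp'.
by move: Hm; rewrite !inE; apply: dualS => v [].
Qed.

Lemma toric_domE sigma p : chart_pt p ->
  @toric_dom n k Sigma sigma (mkpt p) <-> exists g, gl p (sigma, g).
Proof. by move=> hp; rewrite /toric_dom /= mkptE. Qed.

Lemma chiE sigma p g m : chart_pt p -> gl p (sigma, g) -> dual sigma m ->
  chi sigma m (mkpt p : toric_point k Sigma) = g m.
Proof.
move=> hp Hg Hm; rewrite /chi mkptE //; apply: xget_unique; first by exists g.
by move=> y [g' Hg' ->]; apply: (glued_uniq Hg' Hg); rewrite inE.
Qed.

Definition tp (t : 'rV[k]_n) : X := mkpt (sval (cid fan_ex), mon t).

Lemma tp_chart sigma t : Sigma sigma -> intorus t -> chart_pt (sigma, mon t).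
Proof. by move=> Ss Ht; split=> //; apply: mon_monoid. Qed.

Lemma glued_torus sigma t q : Sigma sigma -> intorus t ->
  gl (sigma, mon t) q <-> chart_pt q /\ {in dual q.1, q.2 =1 mon t}.
Proof.
move=> Ss Ht; have hp := tp_chart Ss Ht; split=> [[_ hq [g [Hg gp gq]]]|[hq E]].
  split=> // m Hm; rewrite -gq //; apply: (ext_uniq Ss hq.1 Hg).
  - exact: mon_monoid.
  - exact: gp.
  - by move: Hm; rewrite !inE; apply: dualS => v [].
split=> //; exists (mon t); split=> //; first exact: mon_monoid.
by move=> m Hm; rewrite E.
Qed.

Lemma tpE sigma t : Sigma sigma -> intorus t -> tp t = mkpt (sigma, mon t).
Proof.
move=> Ss Ht; have S0 := svalP (cid fan_ex).
apply: mkpt_eq; [exact: tp_chart|exact: tp_chart|].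
by apply/seteqP; split=> q /glued_torus -/(_ _ Ht) H; apply/glued_torus => //; apply: H.
Qed.

Lemma tp_dom sigma t : Sigma sigma -> intorus t -> @toric_dom n k Sigma sigma (tp t).
Proof.
move=> Ss Ht; rewrite (tpE Ss Ht); apply/toric_domE; first exact: tp_chart.
by exists (mon t); apply/glued_refl/tp_chart.
Qed.

Lemma tp_chi sigma t m : Sigma sigma -> intorus t -> dual sigma m ->
  chi sigma m (tp t : toric_point k Sigma) = mon t m.
Proof.
move=> Ss Ht Hm; rewrite (tpE Ss Ht) (chiE _ (g := mon t)) //; first exact: tp_chart.
by apply/glued_refl/tp_chart.
Qed.

Lemma dom_fan sigma (C : X) : @toric_dom n k Sigma sigma C -> Sigma sigma.
Proof.
have [p hp ->] := mkpt_surj C.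
by move=> /toric_domE -/(_ hp)[g [_ []]].
Qed.

Lemma mon_arc c (x : k -> 'rV[k]_n) m : (forall i, regc c (fun s => x s 0 i)) ->
  intorus (x c) -> regc c (fun s => mon (x s) m).
Proof. by move=> Hx xc; apply: regc_prod => i _; apply: regc_exprz. Qed.

Lemma near_torus c (x : k -> 'rV[k]_n) : (forall i, regc c (fun s => x s 0 i)) ->
  intorus (x c) -> nearc c (fun s => intorus (x s)).
Proof. by move=> Hx xc; apply: nearc_all => i; apply: regc_neq0. Qed.

Lemma tp_arc c (x : k -> 'rV[k]_n) : (forall i, regc c (fun s => x s 0 i)) ->
  intorus (x c) -> sarc c (fun s => tp (x s)).
Proof.
move=> Hx xc; have near := near_torus Hx xc.
apply: arc_sarc => sigma /= /dom_fan Ss; split.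
  by apply: nearcS near => s; apply: tp_dom.
move=> f [m Hm ->]; apply: regc_eq (mon_arc m Hx xc).
by apply: nearcS near => s Hs /=; rewrite tp_chi.
Qed.

Lemma lam_arc (c : k) v (t : 'rV[k]_n) i : c != 0 -> regc c (fun s => lam v s t 0 i).
Proof.
move=> c0; apply: regc_eq (regcM (regc_exprz (v 0 i) (regc_id c) c0) (regc_cst c (t 0 i))).
by apply: nearcT => s; rewrite mxE.
Qed.

Lemma chi_reg sigma m : Sigma sigma -> dual sigma m ->
  reg (@toric_dom n k Sigma sigma : set X) (chi sigma m).
Proof.
move=> Ss Hm C HC; exists (@toric_dom n k Sigma sigma), (chi sigma m), (cst 1).
split=> //; first exact: zopen_dom.
  by split; [apply: galg_gen; exists sigma => //; exists m|apply: galg_cst].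
by move=> D _; rewrite /cst oner_neq0 divr1.
Qed.

Lemma dom_opn sigma : opn (@toric_dom n k Sigma sigma : set X).
Proof. exact: zopen_dom. Qed.

(* The limit of the one-parameter subgroup of v at 0 exists in projective
   space, hence in X. *)
Lemma fan_complete (v : 'rV[int]_n) : projective X -> exists2 sigma, Sigma sigma & sigma (qv v).
Proof.
move=> [N [iota ci]]; have [iota_morph iota_inj closed _ ext] := ci.
pose t1 : 'rV[k]_n := const_mx 1.
have Ht1 : intorus t1 by move=> i; rewrite mxE oner_neq0.
pose x s := lam v s t1; pose gam s := tp (x s).
have x1 : intorus (x 1) by apply: lam_torus => //; apply: oner_neq0.
have arc1 : sarc 1 gam by apply: tp_arc => // i; apply: lam_arc; apply: oner_neq0.
have [j ja] := pcoord_cover (iota (gam 1)).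
have arci := sarc_morph iota_morph arc1.
(* Near s = 1 the embedded orbit has rational coordinates. Over a common denominator they form a
   polynomial vector [A], valid wherever the nonzero polynomial [d] does not vanish, in particular
   on a punctured neighbourhood of 0. *)
have /choice[ab Hab] : forall i, exists ab : {poly k} * {poly k}, ab.2.[1] != 0 /\
    nearc 1 (fun s => nzvec_lin i (prep (iota (gam s))) / nzvec_lin j (prep (iota (gam s)))
      = ab.1.[s] / ab.2.[s]).
  move=> i; have [_ /(_ _ _ (pcoord_opn k j) ja (@ratio_reg k N i j))[a [b [b1 H]]]] := arci.
  by exists (a, b).
pose b := \prod_i (ab i).2; pose A i := (ab i).1 * \prod_(l | l != i) (ab l).2.
have [d d1 Hd] : nearc 1 (fun s => [/\ b.[s] != 0, pcoord j (iota (gam s)) &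
    forall i, nzvec_lin i (prep (iota (gam s))) / nzvec_lin j (prep (iota (gam s)))
      = (A i).[s] / b.[s]]).
  have nb : nearc 1 (fun s => forall i, (ab i).2.[s] != 0).
    by apply: nearc_all => i; apply: nearc_poly; have [] := Hab i.
  have [nj _] := arci; have {}nj := nj _ (pcoord_opn k j) ja.
  have nE := nearc_all (fun i => (Hab i).2).
  apply: nearcS2 (nearcI nb nj) nE => s [bs js] Es; split=> //.
    by rewrite horner_prod; apply/prodf_neq0 => i _.
  have bE i : b = (ab i).2 * \prod_(l | l != i) (ab l).2 by rewrite /b (bigD1 i).
  move=> i; rewrite Es /A (bE i) !hornerM -mulf_div divff ?mulr1 //.
  by rewrite horner_prod; apply/prodf_neq0 => l _.
have d0 : d != 0 by apply: contraNneq d1 => ->; rewrite horner0.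
have nd := poly_near_neq0 0 d0.
have AE s : d.[s] != 0 -> exists2 c, c != 0 &
    (\row_i (A i).[s]) = c *: sval (prep (iota (gam s))).
  move=> /Hd[bs [_ js] E]; exists (b.[s] / nzvec_lin j (prep (iota (gam s)))).
    by rewrite mulf_neq0 ?invr_neq0.
  apply/rowP => i; rewrite !mxE; apply: (mulIf (invr_neq0 bs)); rewrite -E.
  by rewrite mulrAC [X in _ = X * _]mulrAC divff // mul1r mulrC.
(* Removing the common power of s from [A] extends the orbit over s = 0; since the image of [iota]
   is closed, the limit comes from a point of [X]. *)
have [H0|[o [g [rg [l gl] H]]]] := regc_vorder (fun i => regc_poly 0 (A i)).
  have [s [As ds] s0] := nearc_ex 0 (nearcI H0 nd).
  have [c c0 E] := AE s (ds s0).
  have [i] := nzvec_ex (prep (iota (gam s))); move/rowP/(_ i) : E.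
  by rewrite !mxE As => /esym/eqP; rewrite mulf_eq0 (negPf c0) /= => /eqP ->; rewrite eqxx.
pose G s := \row_i g i s; pose del s := mkP (G s).
have G0 : G 0 != 0 by apply: contraNneq gl => /rowP/(_ l); rewrite !mxE => ->.
have rG i : regc 0 (fun s => G s 0 i).
  by apply: regc_eq (rg i); apply: nearcT => s; rewrite mxE.
have arcd : sarc 0 del by apply: mkP_arc.
have delE : nearc 0 (fun s => s != 0 -> del s = iota (gam s)).
  apply: nearcS2 H nd => s HA ds s0; have [c c0 E] := AE s (ds s0).
  have sv0 := svalP (prep (iota (gam s))).
  have so : (s - 0) ^+ o != 0 by rewrite expf_neq0 // subr0.
  have EG : G s = (((s - 0) ^+ o)^-1 * c) *: sval (prep (iota (gam s))).
    rewrite -scalerA -E; apply/rowP => i; rewrite !mxE HA mulKf //.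
  by rewrite /del EG mkP_scale ?prep_mkP // mulf_neq0 ?invr_neq0.
have [x0 _ x0E] : range iota (del 0).
  apply: contrapT => Hn; have [nr _] := arcd.
  have [s [Hs Es] s0] := nearc_ex 0 (nearcI (nr _ closed Hn) delE).
  by apply: Hs; exists (gam s) => //; rewrite Es.
have [[sigma g0] hp x0p] := mkpt_surj x0; have Ss := hp.1; exists sigma => //.
apply: (dual_dual (fan_rp Ss)) => m Hm; rewrite pairing_qv ler0z.
have x0d : @toric_dom n k Sigma sigma x0.
  by rewrite x0p; apply/toric_domE => //; exists g0; apply: glued_refl.
have [V [f [oV rf Vx0 fE]]] := ext _ _ _ (@dom_opn sigma) (chi_reg Ss Hm) x0d.
rewrite x0E in Vx0.
have rfd : regc 0 (f \o del) by have [_] := arcd; apply; [exact: oV| |].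
(* The character [m] is regular at the limit point and has value s^(m, v) along the orbit, so the
   exponent cannot be negative. *)
have key : nearc 0 (fun s => s != 0 -> s ^ zdot m v = f (del s)).
  have [nV _] := arcd; apply: nearcS2 (nV _ oV Vx0) delE => s Vs Es s0.
  have Hx : intorus (x s) by apply: lam_torus.
  rewrite Es // -fE; last by rewrite -Es.
    by rewrite /gam tp_chi // mon_lam // /mon big1 ?mulr1 // => i _; rewrite mxE exp1rz.
  exact: tp_dom.
rewrite leNgt; apply/negP; case E : (zdot m v) => [e|e] // _.
have : 1 = (0 : k) ^+ e.+1 * f (del 0).
  apply: (@regc_uniq_at _ 0 (fun=> 1) (fun s => s ^+ e.+1 * f (del s))).
  - exact: regc_cst.
  - by apply: regcM => //; apply: regc_exp; apply: regc_id.
  - apply: nearcS key => s Hs s0; rewrite -(Hs s0) E NegzE -exprnN mulfV //.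
    by rewrite expf_neq0.
by rewrite expr0n mul0r => /eqP; rewrite oner_eq0.
Qed.

End ToricPoints.

(** * Characters and smooth cones of full dimension *)

Section Characters.
Variables (k : closedFieldType) (n : nat).

(** On a one-parameter subgroup that separates the exponents, the relation becomes a polynomial
    identity with distinct powers. *)
Lemma char_indep (s : seq 'rV[int]_n) (c : 'rV[int]_n -> k) : uniq s ->
  (forall t, intorus t -> \sum_(w <- s) c w * mon t w = 0) ->
  forall w, w \in s -> c w = 0.
Proof.
move=> us H w0 w0s.
have [|v Hv] := @generic_vec n [seq d <- [seq x - y | x <- s, y <- s] | d != 0].
  by move=> d; rewrite mem_filter => /andP[].
have sep w w' : w \in s -> w' \in s -> zdot w v = zdot w' v -> w = w'.
  move=> ws ws' E; apply/eqP; rewrite -subr_eq0; apply: contraT => d0.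
  have := Hv (w - w'); rewrite mem_filter d0 (allpairs_f (fun x y => x - y) ws ws') zdotBl E subrr eqxx.
  by move=> /(_ isT).
(* The shift by [K] makes all exponents nonnegative. *)
pose K := (\sum_(w <- s) `|zdot w v|)%N.
have Kb w : w \in s -> 0 <= zdot w v + K%:Z.
  move=> ws; have : (`|zdot w v| <= K)%N by rewrite /K (big_rem w) //= leq_addr.
  lia.
pose e w := absz (zdot w v + K%:Z).
pose p : {poly k} := \sum_(w <- s) c w *: 'X^(e w).
have p0 : p = 0.
  apply: (@poly_near0 _ 0); apply: nearcT => x x0; rewrite horner_sum.
  have Ht : intorus (lam v x (const_mx 1)).
    by apply: lam_torus => // i; rewrite mxE oner_neq0.
  transitivity (x ^ K%:Z * \sum_(w <- s) c w * mon (lam v x (const_mx 1)) w); last first.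
    by rewrite H // mulr0.
  rewrite mulr_sumr; apply: eq_big_seq => w ws; rewrite hornerZ hornerXn mon_lam // mulrCA; congr (_ * _).
  have -> : mon (const_mx 1) w = 1 :> k by apply: big1 => i _; rewrite mxE exp1rz.
  rewrite mulr1 mulrC -expfzDr // -[LHS]/(x ^ (e w : int)) gez0_abs //; exact: Kb.
have := congr1 (fun p : {poly k} => p`_(e w0)) p0.
rewrite coef0 coef_sum (bigD1_seq w0) //= coefZ coefXn eqxx mulr1 big_seq_cond.
rewrite big1 ?addr0 // => w /andP[ws ww0]; rewrite coefZ coefXn.
case: eqP => [E|]; last by rewrite mulr0.
case/eqP: ww0; apply: sep => //; have := Kb _ ws; have := Kb _ w0s.
by move: E; rewrite /e; lia.
Qed.

Definition lcoef (L : seq (k * 'rV[int]_n)) m : k := \sum_(p <- L | p.2 == m) p.1.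

Lemma lcoef_indep L : (forall t, intorus t -> \sum_(p <- L) p.1 * mon t p.2 = 0) ->
  forall m, lcoef L m = 0.
Proof.
move=> H m; have [ms|ms] := boolP (m \in undup [seq p.2 | p <- L]); last first.
  rewrite /lcoef big_seq_cond big1 // => p /andP[pL /eqP pm]; case/negP: ms.
  by rewrite mem_undup; apply/mapP; exists p.
apply: (char_indep (undup_uniq _) _ ms) => t Ht.
transitivity (\sum_(p <- L) p.1 * mon t p.2); last exact: H.
under eq_bigr do rewrite mulr_suml.
rewrite (exchange_big_dep xpredT) //=; apply: eq_big_seq => p pL.
rewrite -big_filter (_ : [seq _ <- _ | _] = [:: p.2]).
  by rewrite big_seq1.
rewrite (eq_filter (a2 := pred1 p.2)) => [|x]; last by rewrite /= eq_sym.
rewrite filter_pred1_uniq ?undup_uniq // mem_undup.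
by apply/mapP; exists p.
Qed.

Lemma lcoef_cat L L' m : lcoef (L ++ L') m = lcoef L m + lcoef L' m.
Proof. by rewrite /lcoef big_cat. Qed.

Definition lmul (L L' : seq (k * 'rV[int]_n)) := [seq (p.1 * q.1, p.2 + q.2) | p <- L, q <- L'].
Definition lopp (L : seq (k * 'rV[int]_n)) := [seq (- p.1, p.2) | p <- L].

Lemma lcoef_opp L m : lcoef (lopp L) m = - lcoef L m.
Proof. by rewrite /lcoef big_map /= sumrN. Qed.

Lemma lcoef1 c w m : lcoef [:: (c, w)] m = if w == m then c else 0.
Proof. by rewrite /lcoef big_cons big_nil /=; case: ifP; rewrite ?addr0. Qed.

Lemma lcoef_mul L L' m : lcoef (lmul L L') m =
  \sum_(p <- L) \sum_(q <- L' | p.2 + q.2 == m) p.1 * q.1.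
Proof. by rewrite /lcoef big_mkcond big_allpairs_dep /=; apply: eq_bigr => p _; rewrite -big_mkcond. Qed.

Definition irred (S : set 'rV[int]_n) m := [/\ S m, m != 0 &
  forall a b, S a -> S b -> a + b = m -> a = 0 \/ b = 0].

(** An irreducible exponent splits only as 0 + m and m + 0. So its coefficient satisfies the Leibniz
    rule at the fixed point, where evaluation is the coefficient of 0. *)
Lemma lcoef_mul_irr S L L' m : irred S m -> S 0 ->
  (forall p, p \in L -> S p.2) -> (forall p, p \in L' -> S p.2) ->
  lcoef (lmul L L') m = lcoef L 0 * lcoef L' m + lcoef L m * lcoef L' 0.
Proof.
move=> [Sm m0 irr] S0 HL HL'; rewrite lcoef_mul /lcoef !mulr_suml.
rewrite [X in X + _]big_mkcond [X in _ + X]big_mkcond -big_split /=.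
apply: eq_big_seq => p pL.
have [->|p0] := eqVneq p.2 0.
  rewrite [in RHS]eq_sym (negPf m0) addr0 mulr_sumr.
  by apply: eq_bigl => q; rewrite add0r.
have [->|pm] := eqVneq p.2 m.
  rewrite add0r mulr_sumr; apply: eq_bigl => q.
  by rewrite -[X in _ == X]addr0 (inj_eq (addrI _)).
rewrite addr0 big_seq_cond big1 // => q /andP[qL /eqP E].
have [E0|E0] := irr _ _ (HL _ pL) (HL' _ qL) E; first by rewrite E0 eqxx in p0.
by rewrite -E E0 addr0 eqxx in pm.
Qed.

(** By positivity of [v], 0 is a sum of two exponents only as 0 + 0. *)
Lemma lcoef_mul0 (S : set 'rV[int]_n) L L' (v : 'rV[int]_n) : (forall m, S m -> m != 0 -> 0 < zdot m v) ->
  (forall p, p \in L -> S p.2) -> (forall p, p \in L' -> S p.2) ->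
  lcoef (lmul L L') 0 = lcoef L 0 * lcoef L' 0.
Proof.
move=> pos HL HL'; rewrite lcoef_mul /lcoef mulr_suml big_mkcond /=.
rewrite [RHS]big_mkcond /=.
have nn m : S m -> 0 <= zdot m v.
  by move=> Sm; have [->|m0] := eqVneq m 0; [rewrite zdot0l|apply/ltW/pos].
apply: eq_big_seq => p pL; have [->|p0] := eqVneq p.2 0.
  by rewrite mulr_sumr; apply: eq_bigl => q; rewrite add0r.
rewrite big_seq_cond big1 // => q /andP[qL /eqP E].
have := pos _ (HL _ pL) p0; have := nn _ (HL' _ qL).
have := congr1 (fun x : 'rV[int]_n => zdot x v) E; rewrite /= zdotDl zdot0l => Z1 Z2 Z3; have := ltr_pwDl Z3 Z2.
by rewrite Z1 ltxx.
Qed.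

End Characters.

Section Unimodular.
Variable n : nat.
Implicit Types (B : 'M[int]_n) (m v : 'rV[int]_n).

Definition ray B i : 'rV[int]_n := row i B.
Definition dray B i : 'rV[int]_n := row i (invmx B)^T.
(** Given by facet inequalities; for unimodular [B] it is the cone generated by the rows of [B], to
    which the [dray B i] are the dual basis. *)
Definition coneB B : set 'rV[rat]_n := [set v | forall i, 0 <= pairing (dray B i) v].

Lemma zdotE w v : zdot w v = (w *m v^T) 0 0.
Proof. by rewrite mxE; apply: eq_bigr => i _; rewrite mxE. Qed.

Lemma dray_ray B i j : B \in unitmx -> zdot (dray B i) (ray B j) = (i == j)%:R.
Proof.
move=> uB; rewrite zdotC zdotE /dray /ray -tr_col trmxK -row_mul.
have -> : (row j (B *m col i (invmx B))) 0 0 = (B *m invmx B) j i.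
  by rewrite !mxE; apply: eq_bigr => l _; rewrite !mxE.
by rewrite mulmxV // mxE eq_sym.
Qed.

Lemma zray_expand B v : B \in unitmx -> v = \sum_i zdot (dray B i) v *: ray B i.
Proof.
move=> uB; rewrite -{1}[v](mulmxKV uB) mulmx_sum_row; apply: eq_bigr => i _.
by congr (_ *: _); rewrite !mxE; apply: eq_bigr => l _; rewrite !mxE mulrC.
Qed.

Lemma dray_expand B m : B \in unitmx -> m = \sum_i zdot m (ray B i) *: dray B i.
Proof.
move=> uB; have uB' : (invmx B)^T \in unitmx by rewrite unitmx_tr unitmx_inv.
rewrite -{1}[m](mulmxKV uB') mulmx_sum_row; apply: eq_bigr => i _.
congr (_ *: _); rewrite trmx_inv invmxK !mxE; apply: eq_bigr => l _.
by rewrite !mxE.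
Qed.

Lemma zdot_expand B m v : B \in unitmx ->
  zdot m v = \sum_i zdot m (ray B i) * zdot (dray B i) v.
Proof.
move=> uB; rewrite {1}(zray_expand v uB) zdot_sumr; apply: eq_bigr => i _.
by rewrite zdotZr mulrC.
Qed.

Lemma pairing_expand B m (v : 'rV[rat]_n) : B \in unitmx ->
  pairing m v = \sum_i (zdot m (ray B i))%:~R * pairing (dray B i) v.
Proof.
move=> uB; rewrite {1}(dray_expand m uB) /pairing.
under [RHS]eq_bigr do rewrite mulr_sumr.
rewrite exchange_big /=; apply: eq_bigr => j _.
rewrite summxE rmorph_sum mulr_suml; apply: eq_bigr => i _.
by rewrite !mxE rmorphM mulrA.
Qed.

Lemma coneB_ray B i : B \in unitmx -> coneB B (qv (ray B i)).
Proof. by move=> uB j; rewrite pairing_qv dray_ray // ler0z; case: eqP. Qed.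

Lemma coneB_dual B m : B \in unitmx -> dual (coneB B) m <-> forall i, 0 <= zdot m (ray B i).
Proof.
move=> uB; split=> [H i|H v Hv].
  by have := H _ (coneB_ray i uB); rewrite pairing_qv ler0z.
rewrite (pairing_expand _ _ uB); apply: sumr_ge0 => i _.
by rewrite mulr_ge0 ?ler0z.
Qed.

Lemma coneB_qv B v : coneB B (qv v) <-> forall i, 0 <= zdot (dray B i) v.
Proof. by split=> H i; have := H i; rewrite pairing_qv ler0z. Qed.

End Unimodular.

Section SmoothCones.
Variables (n : nat) (k : closedFieldType) (Sigma : set (set 'rV[rat]_n)).
Hypothesis fan_Sigma : is_fan Sigma.
Local Notation X := (toric_variety k Sigma).
Local Notation chart_pt := (chart_point (k:=k) Sigma).
Local Notation gl := (glued (k:=k) Sigma).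
Local Notation tdom := (@toric_dom n k Sigma).
Local Notation mkpt := (mkpt fan_Sigma).
Local Notation tp := (tp fan_Sigma).

Definition fulldim (sigma : set 'rV[rat]_n) :=
  forall m : 'rV[int]_n, (forall v, sigma v -> pairing m v = 0) -> m = 0.

Lemma chi_hom sigma (C : X) : tdom sigma C -> exists2 g, monoid_hom (dual sigma) g &
  forall m, dual sigma m -> chi sigma m (C : toric_point k Sigma) = g m.
Proof.
have [p hp ->] := mkpt_surj fan_Sigma C.
move=> /toric_domE -/(_ hp)[g Hg]; have [_ [_ /= hg] _] := Hg.
by exists g => // m Hm; apply: chiE.
Qed.

Variables (sigma : set 'rV[rat]_n) (Ss : Sigma sigma) (fd : fulldim sigma).

Lemma fd_sum0 m m' : dual sigma m -> dual sigma m' -> m + m' = 0 -> m = 0.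
Proof.
move=> Hm Hm' E; apply: fd => v Hv; apply/eqP.
have := congr1 (fun x => pairing x v) E; rewrite pairingDl pairing0l => /eqP.
by rewrite paddr_eq0 ?Hm ?Hm' // => /andP[].
Qed.

Lemma fd_interior : exists2 v0 : 'rV[int]_n, sigma (qv v0) &
  forall m, dual sigma m -> m != 0 -> 0 < zdot m v0.
Proof.
have [d [u sE]] := fan_rp fan_Sigma Ss.
have si i : sigma (qv (u i)) by rewrite sE; apply: gens_in.
have ge m i : dual sigma m -> 0 <= zdot m (u i).
  by move=> /(_ _ (si i)); rewrite pairing_qv ler0z.
exists (\sum_i u i).
  apply: (dual_dual (fan_rp fan_Sigma Ss)) => m Hm; rewrite pairing_qv ler0z zdot_sumr.
  by apply: sumr_ge0 => i _; apply: ge.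
move=> m Hm m0; rewrite zdot_sumr lt_neqAle eq_sym sumr_ge0 ?andbT => [|i _]; last exact: ge.
apply: contraNneq m0 => /eqP; rewrite psumr_eq0 => [|i _]; last exact: ge.
move=> /allP H; apply/eqP/fd => v; rewrite sE => -[c _ ->].
rewrite pairing_sumr big1 // => i _; rewrite pairingZr -/(qv (u i)) pairing_qv.
by have := H i; rewrite mem_index_enum => /(_ isT)/eqP ->; rewrite mulr0.
Qed.

(** The torus-fixed point of the chart: every nonzero character vanishes. This is a homomorphism
    because full dimension leaves no unit but 0 in the dual monoid. *)
Definition vtx_fun (m : 'rV[int]_n) : k := (m == 0)%:R.
Definition vtx : X := mkpt (sigma, vtx_fun).

Lemma vtx_chart : chart_pt (sigma, vtx_fun).
Proof.
split=> //; split=> /= [|m m' Hm Hm']; first by rewrite /vtx_fun eqxx.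
rewrite /vtx_fun -natrM mulnb; congr (nat_of_bool _)%:R; apply/eqP/andP.
  move=> E; rewrite (fd_sum0 Hm Hm' E) eqxx; split=> //.
  by rewrite (fd_sum0 Hm' Hm) // addrC.
by move=> [/eqP-> /eqP->]; rewrite addr0.
Qed.

(** The character that cuts out the common face in [sigma] would be invertible at the fixed point;
    it is therefore 0 and [sigma] lies in [tau]. The character that cuts out [sigma] in [tau] then
    vanishes on [sigma], so it is 0 as well. *)
Lemma vtx_dom tau : tdom tau vtx -> tau = sigma.
Proof.
move=> /toric_domE -/(_ vtx_chart)[g [_ [/= St _] [G [[G0 GM] Gs Gt]]]].
have [m1 Hm1 E1] := fan_face fan_Sigma Ss St.
have [m2 Hm2 E2] := fan_face fan_Sigma St Ss.
have sub : sigma `<=` tau.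
  suff m10 : m1 = 0.
    move=> v Hv; have : (sigma `&` tau) v by rewrite E1 m10; split=> //=; apply: pairing0l.
    by case.
  have N1 := face_neg E1; apply/eqP; apply: contraT => m10.
  have P1 : dual (sigma `&` tau) m1 by apply: dualS Hm1 => v [].
  have := GM _ _ P1 N1; rewrite subrr G0 Gs ?inE // /= /vtx_fun (negPf m10) mul0r.
  by move/eqP; rewrite oner_eq0.
have m20 : m2 = 0.
  apply: fd => v Hv; have : (tau `&` sigma) v by split=> //; apply: sub.
  by rewrite E2 => -[].
apply/seteqP; split=> // v Hv.
have : (tau `&` sigma) v by rewrite E2 m20; split=> //=; apply: pairing0l.
by case.
Qed.

Lemma vtx_in : tdom sigma vtx.
Proof. by apply/toric_domE; [apply: vtx_chart|exists vtx_fun; apply/glued_refl/vtx_chart]. Qed.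

Lemma chi_vtx m : dual sigma m -> chi sigma m (vtx : toric_point k Sigma) = (m == 0)%:R.
Proof.
move=> Hm; rewrite (chiE fan_Sigma vtx_chart _ Hm (g := vtx_fun)) //.
exact/glued_refl/vtx_chart.
Qed.

Local Notation formal := (seq (k * 'rV[int]_n)).
Definition leval (L : formal) (x : X) : k :=
  \sum_(p <- L) p.1 * chi sigma p.2 (x : toric_point k Sigma).
Definition lgood (L : formal) := forall p, p \in L -> dual sigma p.2.

Lemma lgood_cat L L' : lgood L -> lgood L' -> lgood (L ++ L').
Proof. by move=> H H' p; rewrite mem_cat => /orP[/H|/H']. Qed.

Lemma lgood_mul L L' : lgood L -> lgood L' -> lgood (lmul L L').
Proof. by move=> H H' p /allpairsP[[x y] /= [/H ? /H' ? ->]]; apply: dualD. Qed.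

Lemma lgood_opp L : lgood L -> lgood (lopp L).
Proof. by move=> H p /mapP[x /H ? ->]. Qed.

Lemma lgood1 c m : dual sigma m -> lgood [:: (c, m)].
Proof. by move=> Hm p; rewrite inE => /eqP ->. Qed.

Lemma leval_cat L L' x : leval (L ++ L') x = leval L x + leval L' x.
Proof. by rewrite /leval big_cat. Qed.

Lemma leval_opp L x : leval (lopp L) x = - leval L x.
Proof. by rewrite /leval big_map /= -sumrN; apply: eq_bigr => p _; rewrite mulNr. Qed.

Lemma leval_mul L L' x : lgood L -> lgood L' -> tdom sigma x ->
  leval (lmul L L') x = leval L x * leval L' x.
Proof.
move=> HL HL' /chi_hom[g [g0 gM] gE]; rewrite /leval big_allpairs_dep mulr_suml /=.
apply: eq_big_seq => p pL; rewrite mulr_sumr; apply: eq_big_seq => q qL.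
have Hp := HL _ pL; have Hq := HL' _ qL.
by rewrite !gE ?gM //; [rewrite mulrACA|apply: dualD].
Qed.

Lemma leval1 c x : tdom sigma x -> leval [:: (c, 0)] x = c.
Proof.
move=> /chi_hom[g [g0 gM] gE]; rewrite /leval big_cons big_nil addr0 gE /=.
  by rewrite g0 mulr1.
exact: dual0.
Qed.

Lemma leval_vtx L : lgood L -> leval L vtx = lcoef L 0.
Proof.
move=> HL; rewrite /leval /lcoef [RHS]big_mkcond; apply: eq_big_seq => p pL.
rewrite chi_vtx; last exact: HL.
by case: (p.2 == 0); rewrite ?mulr1 ?mulr0.
Qed.

(** The chart of [sigma] is the only one around the fixed point, so all coordinates that occur are
    characters in its dual monoid. *)
Lemma galg_formal (V : set X) a : V vtx ->
  galg (coords tdom (@toric_gen n k Sigma) V) a ->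
  exists2 L, lgood L & forall x, V x -> tdom sigma x -> a x = leval L x.
Proof.
move=> VP; elim=> [c|f [tau Vt [m Hm ->]]|f g _ [L HL EL] _ [L' HL' EL']
    |f g _ [L HL EL] _ [L' HL' EL']].
- exists [:: (c, 0)] => [|x _ xd]; first exact/lgood1/dual0.
  by rewrite leval1.
- have E := vtx_dom (Vt _ VP); rewrite E in Hm *.
  exists [:: (1, m)] => [|x _ _]; first exact: lgood1.
  by rewrite /leval big_cons big_nil mul1r addr0.
- exists (L ++ L') => [|x Vx xd]; first exact: lgood_cat.
  by rewrite leval_cat -EL // -EL'.
- exists (lmul L L') => [|x Vx xd]; first exact: lgood_mul.
  by rewrite leval_mul // -EL // -EL'.
Qed.

(** An interior vector of the cone contracts a torus point t to the fixed point along an arc. On it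
    [L] is a polynomial in s that vanishes near 0, hence also at s = 1, where it is the value at
    t. *)
Lemma formal_indep (V : set X) L : opn V -> V vtx -> lgood L ->
  (forall x, V x -> tdom sigma x -> leval L x = 0) -> forall m, lcoef L m = 0.
Proof.
move=> oV VP HL H; apply: lcoef_indep => t Ht.
have [v0 _ pos] := fd_interior.
have nn m : dual sigma m -> 0 <= zdot m v0.
  by move=> Sm; have [->|m0] := eqVneq m 0; [rewrite zdot0l|apply/ltW/pos].
pose g s m : k := mon t m * s ^+ absz (zdot m v0).
have cg s : chart_pt (sigma, g s).
  split=> //; split=> /= [|m m' Hm Hm']; first by rewrite /g mon0 zdot0l expr0 mulr1.
  rewrite /g monDt // mulrACA -exprD zdotDl; congr (_ * _ ^+ _).
  by have := nn _ Hm; have := nn _ Hm'; lia.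
pose y s := mkpt (sigma, g s).
have ydom s : tdom sigma (y s).
  by apply/toric_domE => //; exists (g s); apply: glued_refl.
have ychi s m : dual sigma m -> chi sigma m (y s : toric_point k Sigma) = g s m.
  by move=> Hm; rewrite (chiE fan_Sigma (cg s) (glued_refl (cg s)) Hm).
have y0 : y 0 = vtx.
  apply: mkpt_eq; [exact: cg|exact: vtx_chart|].
  have gE : {in dual sigma, g 0 =1 vtx_fun}.
    move=> m; rewrite inE => Hm; rewrite /g /vtx_fun expr0n absz_eq0.
    have [->|m0] := eqVneq m 0; first by rewrite zdot0l eqxx mon0 mulr1.
    by rewrite gt_eqF ?mulr0 // pos.
  apply/seteqP; split=> q [_ hq [G [HG G1 G2]]]; split=> //; try exact: vtx_chart.
  - by exists G; split=> // m Hm; rewrite G1 //= gE.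
  - by exists G; split=> // m Hm; rewrite G1 //= -gE.
have arc0 : sarc 0 y.
  apply: arc_sarc => tau /=; rewrite y0 => /vtx_dom ->; split.
    by apply: nearcT => s; apply: ydom.
  move=> f [m Hm ->]; apply: regc_eq (regcM (regc_cst 0 (mon t m))
    (regc_exp (absz (zdot m v0)) (regc_id 0))).
  by apply: nearcT => s /=; rewrite ychi.
pose p : {poly k} := \sum_(q <- L) (q.1 * mon t q.2) *: 'X^(absz (zdot q.2 v0)).
have pE s : p.[s] = leval L (y s).
  rewrite horner_sum /leval; apply: eq_big_seq => q qL.
  by rewrite ychi; [rewrite hornerZ hornerXn mulrA|exact: HL].
have p0 : p = 0.
  apply: (@poly_near0 _ 0); have [nV _] := arc0.
  have := nV V oV; rewrite y0 => /(_ VP); apply: nearcS => s Vs _.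
  by rewrite pE H.
have := congr1 (fun p : {poly k} => p.[1]) p0; rewrite horner0 horner_sum => E.
apply: etrans E; by apply: eq_bigr => q _; rewrite hornerZ hornerXn expr1n mulr1.
Qed.

Definition frep (f : X -> k) (La Lb : formal) := [/\ lgood La, lgood Lb &
  exists V, [/\ opn V, V vtx & forall x, V x -> tdom sigma x ->
    leval Lb x != 0 /\ f x = leval La x / leval Lb x]].

Lemma frep_ex f : regular_at vtx f -> exists LL, frep f LL.1 LL.2.
Proof.
move=> [U [oU UP rf]]; have [V [a [b [oV VP VU [aA bA] fE]]]] := rf _ UP.
have [La HLa Ea] := galg_formal VP aA; have [Lb HLb Eb] := galg_formal VP bA.
exists (La, Lb); split=> //; exists V; split=> // x Vx xd.
by have [b0 ->] := fE _ Vx; rewrite -Ea // -Eb.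
Qed.

Lemma frep_vtx f La Lb : frep f La Lb ->
  lcoef Lb 0 != 0 /\ lcoef La 0 = f vtx * lcoef Lb 0.
Proof.
move=> [HLa HLb [V [oV VP H]]]; have [b0 E] := H _ VP vtx_in.
by rewrite -!leval_vtx // E divfK.
Qed.

Section Derivation.
Variables (m0 : 'rV[int]_n) (irr : irred (dual sigma) m0).

(** The quotient rule for La / Lb, when taking the coefficient of [m0] is the derivation and taking
    that of 0 is evaluation. *)
Definition fder (f : X -> k) (La Lb : formal) :=
  (lcoef La m0 - f vtx * lcoef Lb m0) / lcoef Lb 0.

Lemma lmul_m0 L L' : lgood L -> lgood L' ->
  lcoef (lmul L L') m0 = lcoef L 0 * lcoef L' m0 + lcoef L m0 * lcoef L' 0.
Proof. by move=> HL HL'; apply: (lcoef_mul_irr irr) => //; apply: dual0. Qed.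

Lemma lmul_0 L L' : lgood L -> lgood L' ->
  lcoef (lmul L L') 0 = lcoef L 0 * lcoef L' 0.
Proof. by move=> HL HL'; have [v0 _ pos] := fd_interior; apply: (lcoef_mul0 pos). Qed.

Lemma fder_uniq f La Lb La' Lb' : frep f La Lb -> frep f La' Lb' ->
  fder f La Lb = fder f La' Lb'.
Proof.
move=> R R'; have [b0 Ea] := frep_vtx R; have [b0' Ea'] := frep_vtx R'.
have [HLa HLb [V [oV VP H]]] := R; have [HLa' HLb' [V' [oV' VP' H']]] := R'.
have := @formal_indep (V `&` V') (lmul La Lb' ++ lopp (lmul La' Lb)) (opnI oV oV')
  (conj VP VP') _ _ m0.
rewrite lcoef_cat lcoef_opp !lmul_m0 // Ea Ea' => E.
rewrite /fder; apply/eqP; rewrite eqr_div // -subr_eq0; apply/eqP.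
rewrite -[RHS]E; first by ring.
  by apply: lgood_cat; [|apply: lgood_opp]; apply: lgood_mul.
move=> x [Vx Vx'] xd; have [bx fx] := H x Vx xd; have [bx' fx'] := H' x Vx' xd.
rewrite leval_cat leval_opp !leval_mul //; apply/eqP; rewrite subr_eq0.
by rewrite -eqr_div // -fx -fx'.
Qed.

Definition Dm0 (f : X -> k) : k :=
  if pselect (exists LL, frep f LL.1 LL.2) is left h
  then let LL := sval (cid h) in fder f LL.1 LL.2 else 0.

Lemma Dm0E f La Lb : frep f La Lb -> Dm0 f = fder f La Lb.
Proof.
move=> R; rewrite /Dm0; case: pselect => [h|[]]; last by exists (La, Lb).
by apply: fder_uniq => //; apply: (svalP (cid h)).
Qed.

Lemma Dm0_deriv : point_derivation vtx Dm0.
Proof.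
have [Sm0 m00 _] := irr; have S0 : dual sigma 0 by apply: dual0.
split.
- move=> f nf; rewrite /Dm0; case: pselect => // -[[La Lb] /= [HLa HLb [V [oV VP H]]]].
  case: nf; exists (V `&` tdom sigma); split=> //.
  + exact: opnI oV (@dom_opn n k Sigma sigma).
  + by split=> //; apply: vtx_in.
  have rl L : lgood L -> reg (tdom sigma : set X) (leval L).
    move=> HL; have oD := @dom_opn n k Sigma sigma.
    elim: L HL => [|p L IH] HL.
      by apply: (reg_eq oD _ (reg_cst 0 oD)) => x _; rewrite /leval big_nil.
    have Hp : reg (tdom sigma : set X) (chi sigma p.2).
      by apply: chi_reg => //; apply: HL; rewrite inE eqxx.
    have HL' : lgood L by move=> q qL; apply: HL; rewrite inE qL orbT.
    apply: (reg_eq oD _ (regD oD (regM oD (reg_cst p.1 oD) Hp) (IH HL'))) => x _.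
    by rewrite /leval big_cons.
  have oV' := opnI oV (@dom_opn n k Sigma sigma).
  have sub L : lgood L -> reg (V `&` tdom sigma) (leval L).
    by move=> /rl; apply: reg_sub; [exact: dom_opn|exact: oV'|move=> x []].
  have rV : reg (V `&` tdom sigma) (fun x => (leval Lb x)^-1).
    by apply: regV => //; [exact: sub|move=> x [Vx xd]; have [] := H _ Vx xd].
  apply: (reg_eq oV' _ (regM oV' (sub _ HLa) rV)) => x; rewrite inE => -[Vx xd].
  by have [_ ->] := H _ Vx xd.
- move=> U f g oU UP rf fg.
  have [|[La Lb] /= R] := @frep_ex f; first by exists U.
  have fgP : f vtx = g vtx by apply: fg; rewrite inE.
  have R' : frep g La Lb.
    have [HLa HLb [V [oV VP H]]] := R; split=> //; exists (V `&` U); split=> //.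
      exact: opnI.
    by move=> x [Vx Ux] xd; rewrite -fg ?inE //; apply: H.
  by rewrite (Dm0E R) (Dm0E R') /fder fgP.
- move=> c; have R : frep (cst c) [:: (c, 0)] [:: (1, 0)].
    split; [exact: lgood1|exact: lgood1|exists setT; split=> // [|x _ xd]].
      exact: opnT.
    by rewrite !leval1 // oner_neq0 divr1.
  by rewrite (Dm0E R) /fder !lcoef1 eq_sym (negPf m00) mulr0 subrr mul0r.
- move=> f g /frep_ex[[La Lb] /= R] /frep_ex[[La' Lb'] /= R'].
  have [b0 Ea] := frep_vtx R; have [b0' Ea'] := frep_vtx R'.
  have [HLa HLb [V [oV VP H]]] := R; have [HLa' HLb' [V' [oV' VP' H']]] := R'.
  have R2 : frep (f + g) (lmul La Lb' ++ lmul La' Lb) (lmul Lb Lb').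
    split; [by apply: lgood_cat; apply: lgood_mul|exact: lgood_mul|].
    exists (V `&` V'); split=> //; first exact: opnI.
    move=> x [Vx Vx'] xd; have [bx fx] := H x Vx xd; have [bx' fx'] := H' x Vx' xd.
    rewrite leval_cat !leval_mul // mulf_neq0 //; split=> //.
    by rewrite fctE fx fx' addf_div.
  rewrite (Dm0E R) (Dm0E R') (Dm0E R2) /fder lcoef_cat !lmul_m0 // lmul_0 // Ea Ea'.
  rewrite fctE addf_div //; congr (_ / _); ring.
- move=> f g /frep_ex[[La Lb] /= R] /frep_ex[[La' Lb'] /= R'].
  have [b0 Ea] := frep_vtx R; have [b0' Ea'] := frep_vtx R'.
  have [HLa HLb [V [oV VP H]]] := R; have [HLa' HLb' [V' [oV' VP' H']]] := R'.
  have R2 : frep (f * g) (lmul La La') (lmul Lb Lb').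
    split; [exact: lgood_mul|exact: lgood_mul|].
    exists (V `&` V'); split=> //; first exact: opnI.
    move=> x [Vx Vx'] xd; have [bx fx] := H x Vx xd; have [bx' fx'] := H' x Vx' xd.
    rewrite !leval_mul // mulf_neq0 //; split=> //.
    by rewrite fctE fx fx' mulf_div.
  rewrite (Dm0E R) (Dm0E R') (Dm0E R2) /fder !lmul_m0 // lmul_0 // Ea Ea'.
  rewrite fctE !mulrA addf_div //; congr (_ / _); ring.
Qed.

Lemma Dm0_chi m : dual sigma m -> Dm0 (chi sigma m) = (m == m0)%:R.
Proof.
move=> Hm; have [Sm0 m00 _] := irr; have S0 : dual sigma 0 by apply: dual0.
have R : frep (chi sigma m) [:: (1, m)] [:: (1, 0)].
  split; [exact: lgood1|exact: lgood1|exists setT; split=> // [|x _ xd]].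
    exact: opnT.
  by rewrite leval1 // oner_neq0 divr1 /leval big_cons big_nil mul1r addr0.
rewrite (Dm0E R) /fder !lcoef1 eqxx divr1 [0 == _]eq_sym (negPf m00) mulr0 subr0.
by case: eqP.
Qed.

End Derivation.

(** The derivations of the irreducible characters are dual to these characters, hence independent in
    a tangent space of dimension n. *)
Lemma irred_bound (s : seq 'rV[int]_n) : smooth X n -> uniq s ->
  (forall m, m \in s -> irred (dual sigma) m) -> (size s <= n)%N.
Proof.
move=> sm us Hs; have [v [_ Hv]] := sm vtx.
have irr (a : 'I_(size s)) : irred (dual sigma) (nth 0 s a) by apply/Hs/mem_nth.
have /choice[c Hc] : forall a : 'I_(size s), exists c : 'rV[k]_n,
    forall f, Dm0 (nth 0 s a) f = \sum_i c 0 i * v i f.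
  by move=> a; have [c [Hc _]] := Hv _ (Dm0_deriv (irr a)); exists c.
pose A : 'M[k]_(size s, n) := \matrix_(a, i) c a 0 i.
pose B : 'M[k]_(n, size s) := \matrix_(i, b) v i (chi sigma (nth 0 s b)).
apply: (@mulmx1_min _ _ _ A B); apply/matrixP => a b; rewrite !mxE.
transitivity (Dm0 (nth 0 s a) (chi sigma (nth 0 s b))).
  by rewrite Hc; apply: eq_bigr => i _; rewrite !mxE.
rewrite (Dm0_chi (irr a)); last by have [] := irr b.
by rewrite nth_uniq // eq_sym.
Qed.

(** Induction on the value at an interior vector, which is smaller on both terms of a
    decomposition. *)
Lemma irred_gen (s : seq 'rV[int]_n) : (forall m, irred (dual sigma) m -> m \in s) ->
  forall m, dual sigma m -> exists c : 'I_(size s) -> nat, m = \sum_i (c i)%:Z *: nth 0 s i.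
Proof.
move=> Hs m Hm; have [v0 _ pos] := fd_interior.
have [N] := ubnP (absz (zdot m v0)); elim: N m Hm => // N IH m Hm lN.
have [->|m0] := eqVneq m 0.
  by exists (fun=> 0%N); rewrite big1 // => i _; rewrite scale0r.
have [im|nim] := pselect (irred (dual sigma) m).
  have ms := Hs _ im; have lt : (index m s < size s)%N by rewrite index_mem.
  exists (fun i => (i == Ordinal lt)%N : nat); rewrite (bigD1 (Ordinal lt)) //= eqxx scale1r.
  rewrite nth_index // big1 ?addr0 // => i /negPf ->; by rewrite scale0r.
have [a [b [Ha Hb E a0 b0]]] : exists a b, [/\ dual sigma a, dual sigma b, a + b = m,
    a != 0 & b != 0].
  apply: contrapT => H; apply: nim; split=> // a b Ha Hb E.
  have [->|a0] := eqVneq a 0; first by left.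
  have [->|b0] := eqVneq b 0; first by right.
  by case: H; exists a, b.
have la := pos _ Ha a0; have lb := pos _ Hb b0.
have [|c1 E1] := IH a Ha; first by move: lN; rewrite -E zdotDl; lia.
have [|c2 E2] := IH b Hb; first by move: lN; rewrite -E zdotDl; lia.
exists (fun i => c1 i + c2 i)%N; rewrite -E E1 E2 -big_split; apply: eq_bigr => i _.
by rewrite PoszD scalerDl.
Qed.

(** There are at most n irreducible characters, by smoothness, and at least n, because they generate
    the lattice. They form a basis, and the rays are its dual basis. *)
Lemma fulldim_unimodular : smooth X n -> exists2 B, B \in unitmx & sigma = coneB B.
Proof.
move=> sm.
pose P N := `[< exists s : seq 'rV[int]_n, [/\ uniq s, size s = N &
  forall m, m \in s -> irred (dual sigma) m] >].
have exP : exists N, P N by exists 0%N; apply/asboolP; exists [::].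
have ubP N : P N -> (N <= n)%N.
  by move=> /asboolP[s [us <- Hs]]; apply: irred_bound.
case: (ex_maxnP exP ubP) => N /asboolP[s [us sN Hs]] maxN.
have all_s m : irred (dual sigma) m -> m \in s.
  move=> im; apply: contraT => ms; have : P N.+1.
    apply/asboolP; exists (m :: s); rewrite /= ms us sN; split=> // m'.
    by rewrite inE => /orP[/eqP->|/Hs].
  by move=> /maxN; rewrite ltnn.
have gen := irred_gen all_s.
pose A' : 'M[int]_(size s, n) := \matrix_(i < size s) nth 0 s i.
have genZ m : exists c : 'rV[int]_(size s), m = c *m A'.
  have [m1 [m2 [H1 H2 E]]] := dual_generates m (fan_rp fan_Sigma Ss) (fan_sc fan_Sigma Ss).
  have [c1 E1] := gen _ H1; have [c2 E2] := gen _ H2.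
  exists (\row_i (c1 i)%:Z - \row_i (c2 i)%:Z); rewrite mulmxBl !mulmx_sum_row.
  rewrite -[m](addrK m2) E E1 E2; congr (_ - _); apply: eq_bigr => i _;
    by rewrite mxE rowK.
have /choice[c Hc] : forall i : 'I_n, exists c : 'rV[int]_(size s), row i 1%:M = c *m A'.
  by move=> i; apply: genZ.
have CA : (\matrix_i c i) *m A' = 1%:M.
  by apply/row_matrixP => i; rewrite row_mul rowK -Hc.
have sn : size s = n.
  apply/eqP; rewrite eqn_leq (mulmx1_min CA) andbT.
  by apply: irred_bound.
pose A : 'M[int]_n := \matrix_(i < n) nth 0 s i.
have uA : A \in unitmx.
  have A'E : A' = \matrix_(i < size s) nth 0 s i by [].
  clear genZ; move: A' A'E c Hc CA; rewrite sn => A' A'E c _ CA.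
  by rewrite -[A]A'E; have [] := mulmx1_unit CA.
exists ((invmx A)^T); first by rewrite unitmx_tr unitmx_inv.
have drE i : dray (invmx A)^T i = nth 0 s i.
  by rewrite /dray trmx_inv trmxK invmxK rowK.
have Hd (i : 'I_n) : dual sigma (nth 0 s i).
  by have [] // : irred (dual sigma) (nth 0 s i); apply/Hs/mem_nth; rewrite sn.
apply/seteqP; split=> v Hv.
  by move=> i; rewrite drE; apply: Hd.
apply: (dual_dual (fan_rp fan_Sigma Ss)) => m /gen[e ->].
have pl : pairing (\sum_i (e i)%:Z *: nth 0 s i) v =
    \sum_i (e i)%:R * pairing (nth 0 s i) v.
  rewrite (big_morph (fun x => pairing x v) (fun x y => pairingDl x y v) (pairing0l v)).
  apply: eq_bigr => i _; rewrite /pairing mulr_sumr; apply: eq_bigr => l _.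
  by rewrite mxE rmorphM mulrA.
rewrite pl; apply: sumr_ge0 => i _; rewrite mulr_ge0 ?ler0n //.
have il : (i < n)%N by have := ltn_ord i; rewrite {2}sn.
by have := Hv (Ordinal il); rewrite drE.
Qed.

End SmoothCones.

(** * Maximal cones and the affine charts of the toric variety *)

Section ToricCharts.
Variables (n : nat) (k : closedFieldType) (Sigma : set (set 'rV[rat]_n)).
Hypothesis fan_Sigma : is_fan Sigma.
Local Notation X := (toric_variety k Sigma).
Local Notation chart_pt := (chart_point (k:=k) Sigma).
Local Notation gl := (glued (k:=k) Sigma).
Local Notation tdom := (@toric_dom n k Sigma).
Local Notation mkpt := (mkpt fan_Sigma).
Local Notation tp := (tp fan_Sigma).

Definition maxB (B : 'M[int]_n) : Prop := B \in unitmx /\ Sigma (coneB B).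

Lemma pigeon (P : set 'rV[rat]_n -> nat -> Prop) :
  (forall K, exists2 sigma, Sigma sigma & P sigma K) ->
  exists2 sigma, Sigma sigma & forall K0, exists2 K, (K0 <= K)%N & P sigma K.
Proof.
move=> H; have [_ /finite_seqP[s sE] _ _ _] := fan_Sigma.
apply: contrapT => Hn.
have /choice[b Hb] : forall sigma, exists b : nat, Sigma sigma -> forall K, P sigma K -> (K < b)%N.
  move=> sigma; apply: contrapT => Hs; apply: Hn; exists sigma.
    by apply: contrapT => nS; apply: Hs; exists 0%N.
  move=> K0; apply: contrapT => HK; apply: Hs; exists K0 => _ K PK.
  by rewrite ltnNge; apply/negP => le; apply: HK; exists K.
have [sigma Ss Ps] := H (\max_(x <- s) b x)%N.
have := Hb _ Ss _ Ps; rewrite ltnNge leq_bigmax_seq //.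
by move: Ss; rewrite sE.
Qed.

Section Covering.
Hypotheses (X_smooth : smooth X n) (X_projective : projective X).

Lemma maxB_fulldim sigma : Sigma sigma -> fulldim sigma -> exists2 B, maxB B & sigma = coneB B.
Proof.
move=> Ss fd; have [B uB E] := fulldim_unimodular fan_Sigma Ss fd X_smooth.
by exists B => //; split=> //; rewrite -E.
Qed.

(** For generic [z], a cone that is not of full dimension contains at most one of the vectors K v +
    z. Some cone contains them for arbitrarily large K; it has full dimension and, being closed,
    contains [v]. *)
Lemma maxB_cover v : exists2 B, maxB B & coneB B (qv v).
Proof.
have [_ /finite_seqP[s sE] _ _ _] := fan_Sigma.
have /choice[D HD] : forall sigma : set 'rV[rat]_n, exists d : seq 'rV[int]_n,
    (forall x, x \in d -> x != 0) /\ (~ fulldim sigma ->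
      exists2 m, m \in d & forall v, sigma v -> pairing m v = 0).
  move=> sigma; have [fd|/existsNP[m /not_implyP[Hm m0]]] := pselect (fulldim sigma).
    by exists [::].
  exists [:: m]; split=> [x|_]; first by rewrite inE => /eqP ->; apply/eqP.
  by exists m; rewrite ?inE.
have [|z Hz] := @generic_vec n (flatten [seq D x | x <- s]).
  by move=> d /flatten_mapP[x _]; apply: (HD x).1.
have [|sigma Ss Hs] := @pigeon (fun sigma K => sigma (qv (K%:Z *: v + z))).
  by move=> K; apply: (fan_complete fan_Sigma _ X_projective).
have fd : fulldim sigma.
  apply: contrapT => /(HD sigma).2[m mD Hm].
  have /negP[] : zdot m z != 0.
    by apply: Hz; apply/flatten_mapP; exists sigma => //; move: Ss; rewrite sE.
  have [K1 _ H1] := Hs 0%N; have [K2 K12 H2] := Hs K1.+1.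
  have := Hm _ H1; have := Hm _ H2; rewrite !pairing_qv => /eqP + /eqP.
  rewrite !intr_eq0 !zdotDr !zdotZr => /eqP E2 /eqP E1.
  have : (K2%:Z - K1%:Z) * zdot m v = 0 by rewrite mulrBl -[RHS](subrr 0) -{1}E2 -E1; ring.
  move=> /eqP; rewrite mulf_eq0 => /orP[/eqP|/eqP E]; first by lia.
  by move: E1; rewrite E mulr0 add0r => ->; rewrite eqxx.
have [B mB sB] := maxB_fulldim Ss fd; exists B => //; rewrite -sB.
apply: (dual_dual (fan_rp fan_Sigma Ss)) => m Hm.
rewrite pairing_qv ler0z leNgt; apply/negP => neg.
have [K le HK] := Hs `|zdot m z|.+1%N.
have := Hm _ HK; rewrite pairing_qv ler0z zdotDr zdotZr; nia.
Qed.

Lemma maxB_cover2 a b : exists2 B, maxB B &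
  forall K0 : nat, exists2 K : nat, (K0 <= K)%N & coneB B (qv (K%:Z *: a + b)).
Proof.
have [|sigma Ss Hs] := @pigeon (fun sigma K => (exists2 B, maxB B & sigma = coneB B) /\
    sigma (qv (K%:Z *: a + b))).
  move=> K; have [B mB HB] := maxB_cover (K%:Z *: a + b).
  by exists (coneB B); [case: mB|split=> //; exists B].
have [_ _ [[B mB sB] _]] := Hs 0%N; exists B => // K0.
by have [K le [_ HK]] := Hs K0; exists K; rewrite -?sB.
Qed.

End Covering.

(** The two cones meet in a face of [coneB B], and a face that contains [v] contains each ray with
    positive coefficient in [v]. *)
Lemma fan_ray_in B sigma v i : maxB B -> Sigma sigma -> coneB B (qv v) -> sigma (qv v) ->
  0 < zdot (dray B i) v -> sigma (qv (ray B i)).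
Proof.
move=> [uB SB] Ss Bv sv vi.
have [m Hm E] := fan_face fan_Sigma SB Ss.
have mB l : 0 <= zdot m (ray B l) by move: l; apply/(coneB_dual _ uB).
have : (coneB B `&` sigma) (qv v) by [].
rewrite E => -[_ /= /eqP]; rewrite pairing_qv intr_eq0 (zdot_expand m v uB).
have Bv' l : 0 <= zdot (dray B l) v by have := Bv l; rewrite pairing_qv ler0z.
rewrite psumr_eq0 => [/allP /(_ i)|l _]; last by rewrite mulr_ge0.
rewrite mem_index_enum mulf_eq0 => /(_ isT)/orP[/eqP mi|]; last by rewrite gt_eqF.
have : (coneB B `&` sigma) (qv (ray B i)).
  by rewrite E; split; [apply: coneB_ray|rewrite /= pairing_qv mi].
by case.
Qed.

(** Expanded in the rays of [B'], the ray has nonnegative coefficients, and those rays of [B'] that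
    occur lie in [coneB B]. Coordinates in [B] show that they are multiples of the given ray, and
    integrality that one of them is equal to it. *)
Lemma ray_match B B' i : maxB B -> maxB B' -> coneB B' (qv (ray B i)) ->
  exists j, ray B' j = ray B i.
Proof.
move=> mB mB' Hu; have [uB SB] := mB; have [uB' SB'] := mB'.
set u := ray B i; pose e j := zdot (dray B' j) u; pose d l j := zdot (dray B l) (ray B' j).
have e0 j : 0 <= e j by have := Hu j; rewrite pairing_qv ler0z.
have in_cone j : 0 < e j -> forall l, 0 <= d l j.
  move=> ej l; have := fan_ray_in mB' SB Hu (coneB_ray i uB) ej.
  by move=> /(_ l); rewrite pairing_qv ler0z.
have sumE l : \sum_j e j * d l j = (l == i)%:R.
  rewrite -(dray_ray l i uB) -/u (zdot_expand _ u uB').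
  by apply: eq_bigr => j _; rewrite mulrC.
have ed0 l j : 0 <= e j * d l j.
  have [->|ej] := eqVneq (e j) 0; first by rewrite mul0r.
  by rewrite mulr_ge0 // in_cone // lt_neqAle eq_sym ej e0.
have [j Hj] : exists j, e j * d i j != 0.
  apply: contrapT => H; have := sumE i; rewrite eqxx big1 // => j _.
  by apply/eqP; apply: contraT => Hj; case: H; exists j.
have ej : 0 < e j by rewrite lt_neqAle eq_sym e0 andbT; apply: contraNneq Hj => ->; rewrite mul0r.
have dz l : l != i -> d l j = 0.
  move=> li; have := sumE l; rewrite (negPf li) => /eqP.
  rewrite psumr_eq0 // => /allP/(_ j); rewrite mem_index_enum mulf_eq0 => /(_ isT).
  by rewrite gt_eqF //= => /eqP.
have dij : d i j = 1.
  have le1 : e j * d i j <= 1.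
    rewrite -[X in _ <= X](_ : \sum_j e j * d i j = 1); last by rewrite sumE eqxx.
    by rewrite (bigD1 j) //= lerDl sumr_ge0.
  have := in_cone _ ej i; have := ed0 i j; move: Hj le1 ej; nia.
exists j; rewrite (zray_expand (ray B' j) uB) (bigD1 i) //= -/(d i j) dij scale1r.
by rewrite big1 ?addr0 // => l li; rewrite -/(d l j) dz // scale0r.
Qed.

Definition bexp (B : 'M[int]_n) (m : 'rV[int]_n) : 'rV[int]_n := \row_i zdot m (ray B i).
(** The character [m] in the affine coordinates [x] of the chart of [B]: its exponents are its
    values on the rays. *)
Definition ev B (x : 'rV[k]_n) (m : 'rV[int]_n) : k := mon x (bexp B m).

Lemma bexpD B m m' : bexp B (m + m') = bexp B m + bexp B m'.
Proof. by apply/rowP => i; rewrite !mxE zdotDl. Qed.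

Lemma ev0 B x : ev B x 0 = 1.
Proof. by rewrite /ev (_ : bexp B 0 = 0) ?mon0 //; apply/rowP => i; rewrite !mxE zdot0l. Qed.

Lemma evD B (x : 'rV[k]_n) m m' : (forall i, x 0 i = 0 -> 0 <= zdot m (ray B i) /\ 0 <= zdot m' (ray B i)) ->
  ev B x (m + m') = ev B x m * ev B x m'.
Proof. by move=> H; rewrite /ev bexpD monD // => i /H; rewrite !mxE. Qed.

Lemma ev_hom B (x : 'rV[k]_n) (tau : set 'rV[rat]_n) : (forall i, x 0 i = 0 -> tau (qv (ray B i))) ->
  monoid_hom (dual tau) (ev B x).
Proof.
move=> H; split=> [|m m' Hm Hm']; first exact: ev0.
apply: evD => i /H Hi; have := Hm _ Hi; have := Hm' _ Hi.
by rewrite !pairing_qv !ler0z.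
Qed.

Lemma ev_dray B x i : B \in unitmx -> ev B x (dray B i) = x 0 i.
Proof.
move=> uB; rewrite /ev /mon (bigD1 i) //= mxE dray_ray // eqxx expr1z.
rewrite big1 ?mulr1 // => j ji; rewrite mxE dray_ray // eq_sym (negPf ji).
by rewrite expr0z.
Qed.

Lemma ev_zero B (x : 'rV[k]_n) m i : x 0 i = 0 -> 0 < zdot m (ray B i) -> ev B x m = 0.
Proof.
move=> xi mi; rewrite /ev /mon (bigD1 i) //= mxE xi.
by case: (zdot m (ray B i)) mi => // -[|e] // _; rewrite -exprnP expr0n mul0r.
Qed.

(** The point lies in the chart of a cone exactly if the cone contains the rays whose coordinates
    are 0; otherwise a character that is 0 at the point would be invertible there. *)
Lemma glued_ev sigma g B (x : 'rV[k]_n) : Sigma sigma -> chart_pt (sigma, g) ->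
  (forall i, x 0 i = 0 -> sigma (qv (ray B i))) -> {in dual sigma, g =1 ev B x} ->
  forall r, gl (sigma, g) r <-> [/\ chart_pt r, forall i, x 0 i = 0 -> r.1 (qv (ray B i)) &
    {in dual r.1, r.2 =1 ev B x}].
Proof.
move=> Ss hp xs gE r; split; last first.
  move=> [hr xr rE]; split=> //; exists (ev B x); split.
  - by apply: ev_hom => i xi; split; [apply: xs|apply: xr].
  - by move=> m Hm; rewrite /= gE.
  - by move=> m Hm; rewrite rE.
move=> [_ hr [G [HG Gp Gr]]]; have [G0 GM] := HG.
have xr i : x 0 i = 0 -> r.1 (qv (ray B i)).
  move=> xi; apply: contrapT => nr.
  have [m1 Hm1 E] := fan_face fan_Sigma Ss hr.1.
  have m1i : 0 < zdot m1 (ray B i).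
    have := Hm1 _ (xs i xi); rewrite pairing_qv ler0z le_eqVlt => /orP[/eqP Ez|//].
    have : (sigma `&` r.1) (qv (ray B i)).
      by rewrite E; split; [apply: xs|rewrite /= pairing_qv -Ez].
    by case.
  have P1 : dual (sigma `&` r.1) m1 by apply: dualS Hm1 => v [].
  have := GM _ _ P1 (face_neg E); rewrite subrr G0 Gp ?inE //= gE ?inE //.
  by rewrite (ev_zero xi m1i) mul0r => /eqP; rewrite oner_eq0.
split=> // m Hm; rewrite -Gr //.
apply: (ext_uniq fan_Sigma Ss hr.1 HG) => //.
- by apply: ev_hom => i xi; split; [apply: xs|apply: xr].
- by move=> m' Hm'; rewrite Gp //= gE.
- by move: Hm; rewrite !inE; apply: dualS => v [].
Qed.

Lemma mkpt_ev sigma g sigma' g' B (x : 'rV[k]_n) : chart_pt (sigma, g) -> chart_pt (sigma', g') ->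
  (forall i, x 0 i = 0 -> sigma (qv (ray B i))) -> {in dual sigma, g =1 ev B x} ->
  (forall i, x 0 i = 0 -> sigma' (qv (ray B i))) -> {in dual sigma', g' =1 ev B x} ->
  mkpt (sigma, g) = mkpt (sigma', g').
Proof.
move=> hp hp' xs gE xs' gE'; apply: mkpt_eq => //.
have H1 := @glued_ev sigma g B x hp.1 hp xs gE.
have H2 := @glued_ev sigma' g' B x hp'.1 hp' xs' gE'.
by apply/seteqP; split=> r; [move/H1 => ?; apply/H2|move/H2 => ?; apply/H1].
Qed.

Definition kap B (x : 'rV[k]_n) : X := mkpt (coneB B, ev B x).

Lemma kap_chart B x : maxB B -> chart_pt (coneB B, ev B x).
Proof.
move=> [uB SB]; split=> //; apply: ev_hom => i _; exact: coneB_ray.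
Qed.

(** A ray outside [sigma] has an invertible coordinate on the chart of [sigma], so negative
    exponents are harmless there. *)
Lemma hom_ev sigma (g : 'rV[int]_n -> k) B : B \in unitmx -> monoid_hom (dual sigma) g ->
  sigma `<=` coneB B -> (forall i, ~ sigma (qv (ray B i)) -> dual sigma (- dray B i)) ->
  {in dual sigma, g =1 ev B (\row_i g (dray B i))}.
Proof.
move=> uB [g0 gM] sB neg m; rewrite inE => Hm.
have dB i : dual sigma (dray B i).
  by apply: (dualS sB); apply/(coneB_dual _ uB) => j; rewrite dray_ray // ler0n.
have gpow m' (c : nat) : dual sigma m' -> g (c%:Z *: m') = g m' ^+ c.
  move=> Hm'; elim: c => [|c IH]; first by rewrite scale0r g0.
  rewrite intS scalerDl scale1r gM ?IH ?exprS //; exact: dualM.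
have term i : dual sigma (zdot m (ray B i) *: dray B i) /\
    g (zdot m (ray B i) *: dray B i) = g (dray B i) ^ zdot m (ray B i).
  have [si|nsi] := pselect (sigma (qv (ray B i))).
    have := Hm _ si; rewrite pairing_qv ler0z.
    case: (zdot m (ray B i)) => // c _; split; first exact: dualM.
    by rewrite gpow.
  have dN := neg _ nsi; have := gM _ _ (dB i) dN; rewrite subrr g0 => E.
  have gi0 : g (dray B i) != 0.
    by apply/eqP => gi; move: E; rewrite gi mul0r => /eqP; rewrite oner_eq0.
  have gN : g (- dray B i) = (g (dray B i))^-1 by apply: (mulfI gi0); rewrite -E mulfV.
  case: (zdot m (ray B i)) => c; first by split; [apply: dualM|rewrite gpow].
  rewrite NegzE scaleNr -scalerN; split; first exact: dualM.
  by rewrite gpow // gN -exprnN exprVn.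
rewrite {1}(dray_expand m uB) /ev /mon.
have : dual sigma (\sum_i zdot m (ray B i) *: dray B i) /\
    g (\sum_i zdot m (ray B i) *: dray B i) = \prod_i g (dray B i) ^ zdot m (ray B i).
  apply: (big_rec2 (fun a b => dual sigma a /\ g a = b)); first by split=> //; apply: dual0.
  move=> i a b _ [Ha <-]; have [H1 H2] := term i; split; first exact: dualD.
  by rewrite gM // H2.
by move=> [_ ->]; apply: eq_bigr => i _; rewrite !mxE.
Qed.

End ToricCharts.

Section Kap.
Variables (n : nat) (k : closedFieldType) (Sigma : set (set 'rV[rat]_n)).
Hypothesis fan_Sigma : is_fan Sigma.
Local Notation X := (toric_variety k Sigma).
Local Notation chart_pt := (chart_point (k:=k) Sigma).
Local Notation gl := (glued (k:=k) Sigma).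
Local Notation tdom := (@toric_dom n k Sigma).
Local Notation mkpt := (mkpt fan_Sigma).
Local Notation tp := (tp fan_Sigma).
Local Notation maxB := (maxB Sigma).
Local Notation kap := (@kap n k Sigma fan_Sigma).
Implicit Types (x t : 'rV[k]_n) (B : 'M[int]_n).

Lemma chart_hom_ev B g : maxB B -> chart_pt (coneB B, g) ->
  exists x, mkpt (coneB B, g) = kap B x.
Proof.
move=> mB hp; have [uB SB] := mB; exists (\row_i g (dray B i)).
have cr i : coneB B (qv (ray B i)) by apply: coneB_ray.
apply: (@mkpt_ev _ _ _ _ _ _ _ _ B (\row_i g (dray B i))) => //.
- exact: kap_chart.
- exact: (hom_ev uB hp.2 (fun _ H => H) (fun i nc => False_ind _ (nc (cr i)))).
Qed.

Lemma kap_tdom B x sigma : maxB B ->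
  tdom sigma (kap B x) <-> Sigma sigma /\ forall i, x 0 i = 0 -> sigma (qv (ray B i)).
Proof.
move=> mB; have [uB SB] := mB; have hp := kap_chart x mB.
have H := @glued_ev _ _ _ fan_Sigma (coneB B) (ev B x) B x SB hp
  (fun i _ => coneB_ray i uB) (fun _ _ => erefl).
split.
  move=> /toric_domE -/(_ hp)[g /H[[/= Ss _] xs _]].
  by split.
move=> [Ss xs]; apply/toric_domE => //; exists (ev B x); apply/H; split=> //.
by split=> //; apply: ev_hom.
Qed.

Lemma kap_chi B x sigma m : maxB B -> Sigma sigma ->
  (forall i, x 0 i = 0 -> sigma (qv (ray B i))) -> dual sigma m ->
  chi sigma m (kap B x : toric_point k Sigma) = ev B x m.
Proof.
move=> mB Ss xs Hm; have [uB SB] := mB; have hp := kap_chart x mB.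
apply: (chiE fan_Sigma hp _ Hm).
apply/(@glued_ev _ _ _ fan_Sigma (coneB B) (ev B x) B x SB hp
  (fun i _ => coneB_ray i uB) (fun _ _ => erefl)); split=> //.
by split=> //; apply: ev_hom.
Qed.

Lemma kap_inj B : maxB B -> injective (kap B).
Proof.
move=> mB x y E; have [uB SB] := mB; apply/rowP => i.
have cr j : coneB B (qv (ray B j)) by apply: coneB_ray.
have dB : dual (coneB B) (dray B i).
  by apply/(coneB_dual _ uB) => j; rewrite dray_ray // ler0n.
rewrite -(ev_dray x i uB) -(ev_dray y i uB).
by rewrite -(kap_chi mB SB (fun j _ => cr j) dB) E (kap_chi mB SB (fun j _ => cr j) dB).
Qed.

Lemma regp_exprz m (p : 'rV[k]_m) f e : regp p f -> f p != 0 \/ 0 <= e ->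
  regp p (fun q => f q ^ e).
Proof.
move=> Hf; have Hn (c : nat) : regp p (fun q => f q ^+ c).
  elim: c => [|c IH].
    by apply: regp_eq (regp_cst p 1); apply: nearpT => q; rewrite expr0.
  by apply: regp_eq (regpM Hf IH); apply: nearpT => q; rewrite exprS.
case: e => c; first by move=> _; apply: Hn.
case=> // f0; apply: regp_eq (regpV (Hn c.+1) _); last by rewrite expf_neq0.
by apply: nearpT => q; rewrite NegzE -exprnN.
Qed.

Lemma ev_regp B x m : (forall i, x 0 i = 0 -> 0 <= zdot m (ray B i)) ->
  regp x (fun q => ev B q m).
Proof.
move=> H; apply: regp_prod => i _; apply: regp_exprz; first exact/regp_poly/polyfun_coord.
by have [xi|xi] := eqVneq (x 0 i) 0; [right; rewrite mxE; apply: H|left].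
Qed.

Lemma near_zeros x : nearp x (fun q => forall i, q 0 i = 0 -> x 0 i = 0).
Proof.
apply: nearp_all => i; have [xi|xi] := eqVneq (x 0 i) 0; first exact: nearpT.
apply: nearpS (nearp_poly (polyfun_coord k i) xi) => q qi E.
by rewrite E eqxx in qi.
Qed.

Section Cover.
Hypotheses (X_smooth : smooth X n) (X_projective : projective X).

(** The sum of the generators of [sigma] is in its interior, so [sigma] is a face of any maximal
    cone that contains this sum, and the chart of that cone contains the point. *)
Lemma kap_surj (C : X) : exists2 B, maxB B & exists x, C = kap B x.
Proof.
have [[sigma g] hp ->] := mkpt_surj fan_Sigma C; have [/= Ss hg] := hp.
have [d [u sE]] := fan_rp fan_Sigma Ss.
have su i : sigma (qv (u i)) by rewrite sE; apply: gens_in.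
have sv : sigma (qv (\sum_i u i)).
  apply: (dual_dual (fan_rp fan_Sigma Ss)) => m Hm; rewrite pairing_qv ler0z zdot_sumr.
  by apply: sumr_ge0 => i _; have := Hm _ (su i); rewrite pairing_qv ler0z.
have [B mB Bv] := maxB_cover fan_Sigma X_smooth X_projective (\sum_i u i).
have [uB SB] := mB; exists B => //.
have sB : sigma `<=` coneB B.
  have [m Hm E] := fan_face fan_Sigma Ss SB.
  have : (sigma `&` coneB B) (qv (\sum_i u i)) by [].
  rewrite E => -[_ /= /eqP]; rewrite pairing_qv intr_eq0 zdot_sumr.
  rewrite psumr_eq0 => [/allP H|i _]; last by have := Hm _ (su i); rewrite pairing_qv ler0z.
  move=> w sw; have : (sigma `&` coneB B) w; last by case.
  rewrite E; split=> //=; move: sw; rewrite sE => -[c _ ->].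
  rewrite pairing_sumr big1 // => i _; rewrite pairingZr -/(qv (u i)) pairing_qv.
  by have := H i; rewrite mem_index_enum => /(_ isT)/eqP ->; rewrite mulr0.
have neg i : ~ sigma (qv (ray B i)) -> dual sigma (- dray B i).
  move=> nsi; have [m Hm E] := fan_face fan_Sigma SB Ss.
  have mi l : 0 <= zdot m (ray B l) by move: l; apply/(coneB_dual _ uB).
  have mi0 : zdot m (ray B i) != 0.
    apply/eqP => mi0; apply: nsi; have : (coneB B `&` sigma) (qv (ray B i)); last by case.
    by rewrite E; split; [apply: coneB_ray|rewrite /= pairing_qv mi0].
  move=> w sw; have : (coneB B `&` sigma) w by split=> //; apply: sB.
  rewrite E => -[Bw /= /eqP]; rewrite (pairing_expand _ _ uB) psumr_eq0; last first.
    by move=> l _; rewrite mulr_ge0 // ?ler0z.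
  move=> /allP/(_ i); rewrite mem_index_enum mulf_eq0 intr_eq0 (negPf mi0) => /(_ isT) /= /eqP Ew.
  by rewrite pairingNl Ew oppr0.
have gE := hom_ev uB hg sB neg.
exists (\row_i g (dray B i)).
have dB i : dual sigma (dray B i).
  by apply: (dualS sB); apply/(coneB_dual _ uB) => j; rewrite dray_ray // ler0n.
apply: (@mkpt_ev _ _ _ _ _ _ _ _ B (\row_i g (dray B i))) => //.
- exact: kap_chart.
- move=> i; rewrite mxE => gi; apply: contrapT => nsi; have [g0 gM] := hg.
  have := gM _ _ (dB i) (neg _ nsi); rewrite subrr g0 gi mul0r => /eqP.
  by rewrite oner_eq0.
- by move=> i _; apply: coneB_ray.
Qed.

Lemma kap_dom B (C : X) : maxB B -> tdom (coneB B) C <-> exists x, C = kap B x.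
Proof.
move=> mB; have [uB SB] := mB; split; last first.
  by move=> [x ->]; apply/kap_tdom => //; split=> // i _; apply: coneB_ray.
have [B' mB' [x' ->]] := kap_surj C; have [uB' SB'] := mB'.
have hp := kap_chart x' mB'.
move=> /toric_domE -/(_ hp)[g Hg].
have /(@glued_ev _ _ _ fan_Sigma (coneB B') (ev B' x') B' x' SB' hp
  (fun i _ => coneB_ray i uB') (fun _ _ => erefl))[/= hr xr rE] := Hg.
have [x Ex] := chart_hom_ev mB hr; exists x; rewrite -Ex.
by apply: (@mkpt_ev _ _ _ _ _ _ _ _ B' x') => // i _; apply: coneB_ray.
Qed.

Lemma kap_ischart B : maxB B -> ischart (kap B).
Proof.
move=> mB; have [uB SB] := mB; have cr j : coneB B (qv (ray B j)) by apply: coneB_ray.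
apply: (atlas_chart (i0 := coneB B)).
- exact: kap_inj.
- by move=> C; apply: kap_dom.
- move=> l; have dB : dual (coneB B) (dray B l).
    by apply/(coneB_dual _ uB) => j; rewrite dray_ray // ler0n.
  exists (chi (coneB B) (dray B l)); first by exists (dray B l).
  by move=> p; rewrite (kap_chi mB SB (fun j _ => cr j) dB) ev_dray.
- move=> sigma p /(kap_tdom _ _ mB)[Ss xs].
  have near : nearp p (fun q => forall i, q 0 i = 0 -> sigma (qv (ray B i))).
    by apply: nearpS (near_zeros p) => q H i /H/xs.
  split; first by apply: nearpS near => q H; apply/kap_tdom.
  move=> f [m Hm ->].
  have R : regp p (fun q => ev B q m).
    by apply: ev_regp => i /xs/Hm; rewrite pairing_qv ler0z.
  by apply: regp_eq R; apply: nearpS near => q H /=; rewrite kap_chi.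
Qed.

End Cover.

(** Passage from the standard torus coordinates to those of the chart of [B]; [frm] goes back. *)
Definition tob B t : 'rV[k]_n := \row_i mon t (dray B i).
Definition frm B x : 'rV[k]_n := \row_l ev B x (delta_mx 0 l).

Lemma tob_torus B t : intorus t -> intorus (tob B t).
Proof. by move=> Ht i; rewrite mxE mon_tneq0. Qed.

Lemma tp_kap B t : maxB B -> intorus t -> tp t = kap B (tob B t).
Proof.
move=> mB Ht; have [uB SB] := mB; rewrite (tpE fan_Sigma SB Ht).
have tr := tob_torus B Ht; have hp := tp_chart SB Ht.
have cr j : coneB B (qv (ray B j)) by apply: coneB_ray.
apply: (@mkpt_ev _ _ _ _ _ _ _ _ B (tob B t)) => //.
- exact: kap_chart.
- exact: (hom_ev uB hp.2 (fun _ H => H) (fun i nc => False_ind _ (nc (cr i)))).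
Qed.

Lemma frm_torus B x : intorus x -> intorus (frm B x).
Proof. by move=> Hx i; rewrite mxE mon_tneq0. Qed.

Lemma mon_frm B x m : intorus x -> mon (frm B x) m = ev B x m.
Proof.
move=> Hx.
transitivity (\prod_l \prod_i x 0 i ^ (zdot (delta_mx 0 l) (ray B i) * m 0 l)).
  apply: eq_bigr => l _; rewrite mxE.
  have expM (I : Type) (r : seq I) (F : I -> k) (e : int) :
      (\prod_(i <- r) F i) ^ e = \prod_(i <- r) F i ^ e.
    apply: (big_morph (fun y => y ^ e)) => [a b|]; [exact: expfzMl|exact: exp1rz].
  rewrite /ev /mon expM; apply: eq_bigr => i _.
  by rewrite mxE exprz_exp.
rewrite exchange_big; apply: eq_bigr => i _ /=.
rewrite -(big_morph (exprz (x 0 i)) (fun a b => expfzDr a b (Hx i)) (expr0z (x 0 i))).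
congr (_ ^ _); rewrite mxE zdotC; apply: eq_bigr => l _.
by rewrite zdotC zdot_delta.
Qed.

Lemma tob_frm B x : B \in unitmx -> intorus x -> tob B (frm B x) = x.
Proof. by move=> uB Hx; apply/rowP => i; rewrite mxE mon_frm // ev_dray. Qed.

Lemma kap_tp B x : maxB B -> intorus x -> kap B x = tp (frm B x).
Proof.
move=> mB Hx; have [uB _] := mB.
by rewrite (tp_kap mB) ?tob_frm //; apply: frm_torus.
Qed.

Lemma tob_lam B v t s i : s != 0 ->
  tob B (lam v s t) 0 i = s ^ (zdot (dray B i) v) * tob B t 0 i.
Proof. by move=> s0; rewrite !mxE mon_lam. Qed.

(** The orbit of [t] in the coordinates of [B]. Absolute values make it polynomial in s for every
    [v]; if [v] is in the cone, it is the orbit, extended over s = 0. *)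
Definition limarc B (v : 'rV[int]_n) t (s : k) : 'rV[k]_n :=
  \row_i (s ^+ absz (zdot (dray B i) v) * tob B t 0 i).

Lemma limarcE B v t s : (forall i, 0 <= zdot (dray B i) v) -> s != 0 ->
  limarc B v t s = tob B (lam v s t).
Proof.
move=> Hv s0; apply/rowP => i; rewrite tob_lam // mxE.
by case: (zdot (dray B i) v) (Hv i).
Qed.

Lemma limarc_reg B v t c i : regc c (fun s => limarc B v t s 0 i).
Proof.
apply: regc_eq (regcM (regc_exp (absz (zdot (dray B i) v)) (regc_id c))
  (regc_cst c (tob B t 0 i))).
by apply: nearcT => s; rewrite [RHS]mxE.
Qed.

End Kap.

(** * Linear forms on the fibres of a vector bundle *)

Section Forms.
Variables (k : closedFieldType) (X : space k) (E : omodule X) (r : nat).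

Lemma act0 U (s : sec E U) : opn U -> act 0 s = 0.
Proof.
move=> oU; have r0 : reg U (0 : X -> k) := reg_cst 0 oU.
have := actDl s oU r0 r0; rewrite addr0 => /eqP.
by rewrite -[X in X == _]addr0 (inj_eq (addrI _)) => /eqP <-.
Qed.

Lemma actN U f (s : sec E U) : opn U -> reg U f -> act (- f) s = - act f s.
Proof.
move=> oU rf; apply/eqP; rewrite -addr_eq0 -actDl //; last exact: regN.
by rewrite addNr act0.
Qed.

Lemma res0 U V : opn U -> opn V -> V `<=` U -> res V (0 : sec E U) = 0.
Proof.
move=> oU oV VU; have := resD (0 : sec E U) 0 oU oV VU; rewrite addr0 => /eqP.
by rewrite -[X in X == _]addr0 (inj_eq (addrI _)) => /eqP <-.
Qed.

Lemma res_sum U V I (l : seq I) (P : pred I) (F : I -> sec E U) : opn U -> opn V -> V `<=` U ->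
  res V (\sum_(i <- l | P i) F i) = \sum_(i <- l | P i) res V (F i).
Proof.
move=> oU oV VU; apply: (big_morph (fun s : sec E U => res V s)) => [x y|].
  exact: resD.
exact: res0.
Qed.

Section Frame.
Variables (U : set X) (e : 'I_r -> sec E U).
Hypotheses (oU : opn U) (fr : is_frame e).

Definition in_frame V (s : sec E V) W (f : 'I_r -> X -> k) : Prop :=
  [/\ opn W, W `<=` V, W `<=` U, forall i, reg W (f i) &
      res W s = \sum_i act (f i) (res W (e i))].

Lemma in_frame_ex V (s : sec E V) : opn V -> exists f, in_frame s (V `&` U) f.
Proof.
move=> oV; have oW := opnI oV oU; have WU : V `&` U `<=` U by move=> x [].
have [H _] := fr oW WU; have [f rf Es] := H (res (V `&` U) s).
by exists f; split=> // x [].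
Qed.

Lemma in_frame_sub V (s : sec E V) W W' f : opn V -> opn W' -> W' `<=` W ->
  in_frame s W f -> in_frame s W' f.
Proof.
move=> oV oW' W'W [oW WV WU rf Es].
have W'V := subset_trans W'W WV; have W'U := subset_trans W'W WU.
split=> // [i|]; first exact: (reg_sub oW oW' W'W (rf i)).
rewrite -(res_comp s oV oW oW') // Es res_sum //.
by apply: eq_bigr => i _; rewrite act_res // res_comp.
Qed.

Lemma in_frame_uniq V (s : sec E V) W W' f f' x : opn V ->
  in_frame s W f -> in_frame s W' f' -> W x -> W' x -> forall i, f i x = f' i x.
Proof.
move=> oV Hf Hf' Wx Wx' i.
have [oW _ WU _ _] := Hf; have [oW' _ _ _ _] := Hf'.
have oWW := opnI oW oW'.
have [_ _ WWU rf Es] := in_frame_sub oV oWW (fun y (H : (W `&` W') y) => H.1) Hf.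
have [_ _ _ rf' Es'] := in_frame_sub oV oWW (fun y (H : (W `&` W') y) => H.2) Hf'.
have [_ H] := fr oWW WWU.
have rd j : reg (W `&` W') (f j + - f' j) by apply: regD => //; apply: regN.
have := H (fun j => f j + - f' j) rd _ i x (conj Wx Wx').
rewrite !fctE => E0; apply/eqP; rewrite -subr_eq0; apply/eqP/E0.
rewrite (eq_bigr (fun j => act (f j) (res (W `&` W') (e j)) - act (f' j) (res (W `&` W') (e j)))).
  by rewrite sumrB -Es -Es' subrr.
by move=> j _; rewrite actDl ?actN //; apply: regN.
Qed.

(** The form at [x] with values [xi] on the frame, and 0 on sets that are not neighbourhoods of [x],
    as [fibre_form] demands. *)
Definition formof (x : X) (xi : 'I_r -> k) (V : set X) (s : sec E V) : k :=
  if pselect ((opn V /\ V x) /\ exists f, in_frame s (V `&` U) f) is left h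
  then let f := sval (cid h.2) in \sum_i xi i * f i x else 0.

Lemma formofE x xi V (s : sec E V) W f : opn V -> in_frame s W f -> W x ->
  formof x xi s = \sum_i xi i * f i x.
Proof.
move=> oV Hf Wx; have [oW WV WU _ _] := Hf.
have Vx : V x by apply: WV.
rewrite /formof; case: pselect => [h|[]]; last first.
  by split=> //; apply: in_frame_ex.
apply: eq_bigr => i _; congr (_ * _).
apply: (in_frame_uniq oV (svalP (cid h.2)) Hf) => //.
by split=> //; apply: WU.
Qed.

Lemma in_frame_e l : in_frame (e l) U (fun i => cst (i == l)%:R).
Proof.
split=> // [i|]; first exact: reg_cst.
rewrite (bigD1 l) //= eqxx big1 ?addr0 => [|i /negPf ->]; last first.
  exact: act0.
by rewrite act1 // res_id.
Qed.

Lemma formof_e x xi l : U x -> formof x xi (e l) = xi l.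
Proof.
move=> Ux; rewrite (formofE xi oU (in_frame_e l) Ux) (bigD1 l) //=.
rewrite /cst eqxx mulr1 big1 ?addr0 // => i /negPf ->.
by rewrite mulr0.
Qed.

Lemma formof_fibre x xi : U x -> fibre_form x (formof x xi).
Proof.
move=> Ux; split.
- by move=> V s nV; rewrite /formof; case: pselect => // -[].
- move=> V s t oV Vx; have [f Hf] := in_frame_ex s oV; have [g Hg] := in_frame_ex t oV.
  have VUx : (V `&` U) x by [].
  rewrite (formofE xi oV Hf VUx) (formofE xi oV Hg VUx) -big_split /=.
  have Hfg : in_frame (s + t) (V `&` U) (fun i => f i + g i).
    have [oW WV WU rf Es] := Hf; have [_ _ _ rg Et] := Hg.
    split=> // [i|]; first exact: regD.
    rewrite resD // Es Et -big_split; apply: eq_bigr => i _ /=.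
    by rewrite actDl.
  rewrite (formofE xi oV Hfg VUx); apply: eq_bigr => i _; by rewrite fctE mulrDr.
- move=> V h s oV Vx rh; have [f Hf] := in_frame_ex s oV.
  have VUx : (V `&` U) x by [].
  rewrite (formofE xi oV Hf VUx) mulr_sumr.
  have Hfg : in_frame (act h s) (V `&` U) (fun i => h * f i).
    have [oW WV WU rf Es] := Hf; have rh' := reg_sub oV oW WV rh.
    split=> // [i|]; first exact: regM.
    rewrite act_res // Es (big_morph (fun u : sec E _ => act h u)
      (id1 := 0) (op1 := +%R)) => [|u v|]; last 2 first.
    + exact: actDr.
    + have := actDr 0 (0 : sec E (V `&` U)) oW rh'; rewrite addr0 => /eqP.
      by rewrite -[X in X == _]addr0 (inj_eq (addrI _)) => /eqP <-.
    by apply: eq_bigr => i _; rewrite actM.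
  rewrite (formofE xi oV Hfg VUx); apply: eq_bigr => i _.
  by rewrite fctE mulrCA.
- move=> V W s oV oW WV Wx; have [f Hf] := in_frame_ex s oV.
  have VUx : (V `&` U) x by split=> //; apply: WV.
  rewrite (formofE xi oV Hf VUx).
  have oWU := opnI oW oU.
  have WUV : W `&` U `<=` V `&` U by move=> y [Wy Uy]; split=> //; apply: WV.
  have [o1 o2 o3 o4 o5] := in_frame_sub oV oWU WUV Hf.
  have WUW : W `&` U `<=` W by move=> y [].
  have Hf' : in_frame (res W s) (W `&` U) f by split=> //; rewrite res_comp.
  by rewrite (formofE xi oW Hf' (conj Wx Ux)).
Qed.

Lemma form_expand x (phi : forall V, sec E V -> k) V (s : sec E V) : U x ->
  fibre_form x phi -> phi V s = formof x (fun l => phi U (e l)) s.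
Proof.
move=> Ux [p1 p2 p3 p4].
have [[oV Vx]|nV] := pselect (opn V /\ V x); last first.
  by rewrite p1 // /formof; case: pselect => // -[].
have [f Hf] := in_frame_ex s oV; have [oW WV WU rf Es] := Hf.
have Wx : (V `&` U) x by [].
rewrite (formofE _ oV Hf Wx) -(p4 _ _ _ oV oW WV Wx) Es.
have p0 : phi (V `&` U) 0 = 0.
  have := p2 _ 0 0 oW Wx; rewrite addr0 => /eqP.
  by rewrite -[X in X == _]addr0 (inj_eq (addrI _)) => /eqP <-.
rewrite (big_morph (phi (V `&` U)) (fun u v => p2 _ u v oW Wx) p0).
by apply: eq_bigr => i _; rewrite p3 // p4 // mulrC.
Qed.

Lemma formof_scale x c xi V (s : sec E V) :
  formof x (fun l => c * xi l) s = c * formof x xi s.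
Proof.
rewrite /formof; case: pselect => [h|_]; last by rewrite mulr0.
by rewrite mulr_sumr; apply: eq_bigr => i _; rewrite mulrA.
Qed.

Lemma formof_ext x xi xi' V (s : sec E V) : (forall l, xi l = xi' l) ->
  formof x xi s = formof x xi' s.
Proof.
move=> H; rewrite /formof; case: pselect => // h.
by apply: eq_bigr => i _; rewrite H.
Qed.

End Frame.

Variables (m N : nat) (H : nzform E -> 'rV[k]_N.+1) (amp : amp_data m H).

(** [H] for forms given as families of maps, with value 0 at the zero form, so that it applies along
    arcs on which the form may vanish. *)
Definition Hf (x : X) (phi : forall V, sec E V -> k) : 'rV[k]_N.+1 :=
  if pselect (exists a : nzform E, nzf_pt a = x /\ forall V (s : sec E V), nzf_form a s = phi V s)
  is left h then H (sval (cid h)) else 0.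

Lemma HfE (a : nzform E) phi : (forall V (s : sec E V), nzf_form a s = phi V s) ->
  Hf (nzf_pt a) phi = H a.
Proof.
move=> Ha; rewrite /Hf; case: pselect => [h|[]]; last by exists a.
have [Ex E1] := svalP (cid h).
have sc : nzform_scaled 1 a (sval (cid h)).
  by split=> // V s; rewrite mul1r E1 Ha.
by rewrite (amp_scale amp (oner_neq0 _) sc) expr1n scale1r.
Qed.

Lemma Hf_scaled (a : nzform E) phi c x : c != 0 -> nzf_pt a = x -> fibre_form x phi ->
  (forall V (s : sec E V), phi V s = c * nzf_form a s) -> Hf x phi = c ^+ m *: H a.
Proof.
move=> c0 ax ff Hphi.
have nz : exists V (s : sec E V), phi V s != 0.
  by have [V [s s0]] := nzf_neq0 a; exists V, s; rewrite Hphi mulf_neq0.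
pose b := NZForm ff nz.
have -> : Hf x phi = H b by rewrite -(@HfE b phi).
by apply: (amp_scale amp) => //; split.
Qed.

Lemma Hf0 x phi : (forall V (s : sec E V), phi V s = 0) -> Hf x phi = 0.
Proof.
move=> H0; rewrite /Hf; case: pselect => // -[a [ax Ha]].
by have [V [s]] := nzf_neq0 a; rewrite Ha H0 eqxx.
Qed.

(** Frame coefficients that are regular and not all 0 at [c] give nonzero forms near [c]. Elsewhere
    the form at [c] is used, since [amp_arc] takes a map on the whole line. *)
Lemma arc_core U (e : 'I_r -> sec E U) c (gam : k -> X) (g : 'I_r -> k -> k) :
  opn U -> is_frame e -> sarc c gam -> U (gam c) -> (forall l, regc c (g l)) ->
  (exists l, g l c != 0) ->
  exists a : k -> nzform E, [/\ nearc c (fun s => nzf_pt (a s) = gam s /\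
      forall V (s0 : sec E V), nzf_form (a s) s0 = formof e (gam s) (fun l => g l s) s0) &
    forall i, regc c (fun s => H (a s) 0 i)].
Proof.
move=> oU fr arc Uc rg [l0 gl0].
have nz s : U (gam s) -> g l0 s != 0 ->
    exists V (s0 : sec E V), formof e (gam s) (fun l => g l s) s0 != 0.
  by move=> Us gs; exists U, (e l0); rewrite formof_e.
pose ac := NZForm (formof_fibre oU fr _ Uc) (nz c Uc gl0).
pose a s := if pselect (U (gam s) /\ g l0 s != 0) is left h
  then NZForm (formof_fibre oU fr _ h.1) (nz s h.1 h.2) else ac.
have aE : nearc c (fun s => nzf_pt (a s) = gam s /\
    forall V (s0 : sec E V), nzf_form (a s) s0 = formof e (gam s) (fun l => g l s) s0).
  apply: nearcS2 (arc.1 _ oU Uc) (regc_neq0 (rg l0) gl0) => s Us gs.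
  by rewrite /a; case: pselect => // -[].
exists a; split=> //; have [ac1 ac2] := nearc_at aE.
apply: (amp_arc amp).
  by apply: sarc_eq arc; apply: nearcS aE => s [].
move=> V s0 oV; rewrite ac1 => Vc.
have [f Hff] := in_frame_ex oU fr s0 oV; have [oW WV WU rf Es] := Hff.
have Wc : (V `&` U) (gam c) by [].
have R : regc c (fun s => \sum_i g i s * f i (gam s)).
  apply: regc_sum => i _; apply: regcM => //; exact: (arc.2 _ _ oW Wc (rf i)).
apply: regc_eq R; apply: nearcS2 aE (arc.1 _ oW Wc) => s [_ E1] Ws.
by rewrite E1 (formofE oU fr _ oV Hff Ws).
Qed.

Hypothesis E_lf : locally_free r E.

Lemma frame_at (x : X) : exists U (e : 'I_r -> sec E U), [/\ opn U, U x & is_frame e].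
Proof. by have [_ /(_ x)[U [oU Ux [e fr]]]] := E_lf; exists U, e. Qed.

(** Clearing the pole of order at most B and dividing by the common order o of the frame
    coefficients, the forms extend to a nonzero form at [c]. Since [H] has degree m, both exponents
    are multiplied by m. *)
Lemma arc_lemma c (gam : k -> X) (phi : k -> forall V, sec E V -> k) (B : nat) :
  sarc c gam -> nearc c (fun s => s != c -> fibre_form (gam s) (phi s)) ->
  (forall V (s0 : sec E V), opn V -> V (gam c) -> exists2 f, regc c f &
     nearc c (fun s => s != c -> (s - c) ^+ B * phi s V s0 = f s)) ->
  nearc c (fun s => s != c -> Hf (gam s) (phi s) = 0) \/
  exists o (a : nzform E) (h : k -> 'rV[k]_N.+1), [/\ nzf_pt a = gam c,
    forall i, regc c (fun s => h s 0 i), h c = H a &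
    nearc c (fun s => s != c ->
      (s - c) ^+ (B * m) *: Hf (gam s) (phi s) = (s - c) ^+ (o * m) *: h s)].
Proof.
move=> arc ff Hreg; have [U [e [oU Uc fr]]] := frame_at (gam c).
have /choice[f Hff] : forall l, exists f, regc c f /\
    nearc c (fun s => s != c -> (s - c) ^+ B * phi s U (e l) = f s).
  by move=> l; have [f] := Hreg U (e l) oU Uc; exists f.
have nf := nearc_all (fun l => (Hff l).2).
have nU := arc.1 _ oU Uc.
have [H0|[o [g [rg gc gE]]]] := regc_vorder (fun l => (Hff l).1).
  left; apply: nearcS2 (nearcI H0 nf) (nearcI nU ff) => s [f0 fE] [Us /[swap] sc] /(_ sc) ffs.
  apply: Hf0 => V s0; rewrite (form_expand oU fr s0 Us ffs).
  rewrite (@formof_ext _ _ _ _ (fun=> 0 * 0)) => [|l].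
    by rewrite (formof_scale e (gam s) 0 (fun=> 0)) mul0r.
  have := fE l sc; rewrite f0 mulr0 => /eqP; rewrite mulf_eq0 expf_eq0 subr_eq0.
  by rewrite (negPf sc) andbF => /eqP.
right; have [a [aE aR]] := arc_core oU fr arc Uc rg gc.
have [ac _] := nearc_at aE.
exists o, (a c), (fun s => H (a s)); split=> //.
apply: nearcS2 (nearcI (nearcI gE nf) aE) (nearcI nU ff).
move=> s [[gs fE] [pa Ea]] [Us ffs] sc; have {}ffs := ffs sc.
have sc0 e' : (s - c) ^+ e' != 0 by rewrite expf_neq0 // subr_eq0.
rewrite (@Hf_scaled (a s) _ ((s - c) ^+ o / (s - c) ^+ B)) //; last first.
- move=> V s0; rewrite (form_expand oU fr s0 Us ffs) Ea -formof_scale.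
  apply: formof_ext => l; apply: (mulfI (sc0 B)).
  by rewrite fE // gs mulrCA -!mulrA mulKf.
- by rewrite mulf_neq0 ?invr_neq0.
by rewrite scalerA !exprM exprMn exprVn mulrCA divff ?mulr1 // expf_neq0.
Qed.

Lemma arc_reg c (gam : k -> X) (phi : k -> forall V, sec E V -> k) :
  sarc c gam -> nearc c (fun s => fibre_form (gam s) (phi s)) ->
  (forall V (s0 : sec E V), opn V -> V (gam c) -> regc c (fun s => phi s V s0)) ->
  forall i, regc c (fun s => Hf (gam s) (phi s) 0 i).
Proof.
move=> arc ff Hreg i; have [U [e [oU Uc fr]]] := frame_at (gam c).
have nU := arc.1 _ oU Uc.
have [H0|[o [g [rg gc gE]]]] := regc_vorder (fun l => Hreg U (e l) oU Uc).
  apply: regc_eq (regc_cst c 0).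
  apply: nearcS2 H0 (nearcI nU ff) => s f0 [Us ffs].
  rewrite Hf0 ?mxE // => V s0; rewrite (form_expand oU fr s0 Us ffs).
  rewrite (@formof_ext _ _ _ _ (fun=> 0 * 0)) => [|l].
    by rewrite (formof_scale e (gam s) 0 (fun=> 0)) mul0r.
  by rewrite f0 mulr0.
have [a [aE aR]] := arc_core oU fr arc Uc rg gc.
apply: regc_eq (regcM (regc_exp (o * m) (regcB (regc_id c) (regc_cst c c))) (aR i)).
apply: nearcS2 (nearcI gE aE) (nearcI nU ff).
move=> s [gs [pa Ea]] [Us ffs].
have sE V (s0 : sec E V) : phi s V s0 = (s - c) ^+ o * nzf_form (a s) s0.
  by rewrite (form_expand oU fr s0 Us ffs) Ea -formof_scale; apply: formof_ext.
have [E0|sc0] := eqVneq ((s - c) ^+ o) 0.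
  rewrite Hf0 ?mxE => [|V s0]; last by rewrite sE E0 mul0r.
  by rewrite exprM E0 expr0n gtn_eqF ?(amp_gt0 amp) // mul0r.
by rewrite (@Hf_scaled (a s) _ ((s - c) ^+ o)) // mxE exprM.
Qed.

End Forms.

(** * Logarithmic derivatives along the torus *)

Section TorusForms.
Variables (n : nat) (k : closedFieldType) (Sigma : set (set 'rV[rat]_n)).
Hypothesis fan_Sigma : is_fan Sigma.
Local Notation X := (toric_variety k Sigma).
Hypotheses (X_smooth : smooth X n) (X_projective : projective X).
Local Notation tp := (@tp n k Sigma fan_Sigma).
Local Notation maxB := (maxB Sigma).
Local Notation kap := (@kap n k Sigma fan_Sigma).
Variables (r : nat) (E : omodule X).
Hypothesis E_lf : locally_free r E.
Variable j : forall U : set X, sec E U -> sec (tangent X) U.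
Hypothesis j_mor : omorphism j.
Variables (m N : nat) (H : nzform E -> 'rV[k]_N.+1).
Hypothesis amp : amp_data m H.
Implicit Types (t : 'rV[k]_n) (B : 'M[int]_n) (w v : 'rV[int]_n).

Lemma tp_inj t t' : intorus t -> intorus t' -> tp t = tp t' -> t = t'.
Proof.
move=> Ht Ht' E'; have [B mB _] := maxB_cover fan_Sigma X_smooth X_projective 0.
have [uB SB] := mB; move: E'; rewrite !(tp_kap fan_Sigma mB) // => /(kap_inj mB) E'.
apply/rowP => i; rewrite -[t 0 i]/(t 0 i).
have mE t0 : intorus t0 -> mon t0 (delta_mx 0 i) = t0 0 i.
  move=> _; rewrite /mon (bigD1 i) //= mxE !eqxx expr1z big1 ?mulr1 // => l li.
  by rewrite mxE (negPf li) andbF expr0z.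
have evE t0 : intorus t0 -> mon t0 (delta_mx 0 i) = ev B (tob B t0) (delta_mx 0 i).
  move=> Ht0; rewrite (dray_expand (delta_mx 0 i) uB).
  set c := fun l => zdot (delta_mx 0 i) (ray B l).
  have -> : mon t0 (\sum_l c l *: dray B l) = \prod_l mon t0 (dray B l) ^ c l.
    rewrite (big_morph (mon t0) (fun a b => monDt a b Ht0) (mon0 t0)).
    apply: eq_bigr => l _; rewrite /mon.
    have expM (I : Type) (s : seq I) (G : I -> k) (e : int) :
        (\prod_(i <- s) G i) ^ e = \prod_(i <- s) G i ^ e.
      apply: (big_morph (fun y => y ^ e)) => [a b|]; [exact: expfzMl|exact: exp1rz].
    by rewrite expM; apply: eq_bigr => l' _; rewrite mxE exprz_exp mulrC.
  rewrite /ev /mon; apply: eq_bigr => l _; rewrite !mxE; congr (_ ^ _).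
  by rewrite -dray_expand.
by rewrite -(mE t) // -(mE t') // !evE // E'.
Qed.

Definition torset : set X := [set C | exists2 t, intorus t & C = tp t].

Lemma torset_opn : opn torset.
Proof.
have [B mB _] := maxB_cover fan_Sigma X_smooth X_projective 0; have [uB _] := mB.
have ch := kap_ischart fan_Sigma X_smooth X_projective mB.
have -> : torset = kap B @` [set q : 'rV[k]_n | \prod_i q 0 i != 0].
  apply/seteqP; split=> C.
    move=> [t Ht ->]; exists (tob B t); last by rewrite (tp_kap _ mB).
    by apply/prodf_neq0 => i _; apply: tob_torus.
  move=> [q /prodf_neq0 Hq <-].
  have iq : intorus q by move=> i; apply: Hq.
  by exists (frm B q); [apply: frm_torus|apply: kap_tp].
by apply: (ch_open ch); apply: polyfun_prod => i _; apply: polyfun_coord.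
Qed.

Definition Xm w (C : X) : k :=
  if pselect (torset C) is left h then mon (s2val (cid2 h)) w else 0.

Lemma XmE w t : intorus t -> Xm w (tp t) = mon t w.
Proof.
move=> Ht; rewrite /Xm; case: pselect => [h|[]]; last by exists t.
by congr (mon _ w); case: (cid2 h) => t' Ht' /= E'; apply: tp_inj.
Qed.

Lemma XmD w w' : Xm (w + w') = Xm w * Xm w'.
Proof.
apply: funext => C; rewrite fctE; have [[t Ht ->]|nC] := pselect (torset C).
  by rewrite !XmE // monDt.
by rewrite /Xm; case: pselect => // _; rewrite mul0r.
Qed.

Lemma Xm_reg w : reg torset (Xm w).
Proof.
have [B mB _] := maxB_cover fan_Sigma X_smooth X_projective 0; have [uB _] := mB.
have ch := kap_ischart fan_Sigma X_smooth X_projective mB.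
apply: reg_glue; first exact: torset_opn.
move=> _ [t Ht ->]; rewrite (tp_kap _ mB) //; set x := tob B t.
have Hx : intorus x by apply: tob_torus.
have R : regp x (Xm w \o kap B).
  apply: regp_eq (@ev_regp n k B x w _) => [|i xi]; last first.
    by have := Hx i; rewrite xi eqxx.
  apply: nearpS (nearp_all (fun i => nearp_poly (polyfun_coord k i) (Hx i))) => q Hq /=.
  have iq : intorus q by [].
  by rewrite kap_tp // XmE ?mon_frm //; apply: frm_torus.
have [U [oU Ux rU]] := ch_regV ch R.
exists (U `&` torset); split.
- exact: opnI oU torset_opn.
- by split=> //; rewrite /x -tp_kap //; exists t.
- by move=> C [].
- by apply: (reg_sub oU _ _ rU); [exact: opnI oU torset_opn|move=> C []].
Qed.

Lemma Xm_at w t : intorus t -> regular_at (tp t) (Xm w).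
Proof.
by move=> Ht; exists torset; split; [exact: torset_opn|exists t|exact: Xm_reg].
Qed.

Section LogDerivation.
Variables (t : 'rV[k]_n) (Ht : intorus t) (d : (X -> k) -> k).
Hypothesis Hd : point_derivation (tp t) d.

Definition dlog w : k := d (Xm w) / mon t w.

Lemma dlogE w : dlog w = d (Xm w) / mon t w. Proof. by []. Qed.

Lemma dlogD w w' : dlog (w + w') = dlog w + dlog w'.
Proof.
have [_ _ _ _ leib] := Hd; rewrite /dlog XmD leib; try exact: Xm_at.
have a0 := mon_tneq0 w Ht; have b0 := mon_tneq0 w' Ht.
by rewrite !XmE // monDt //; field; rewrite a0 b0.
Qed.

Lemma dlog0 : dlog 0 = 0.
Proof.
have := dlogD 0 0; rewrite addr0 => /eqP.
by rewrite -[X in X == _]addr0 (inj_eq (addrI _)) => /eqP <-.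
Qed.

Lemma dlogN w : dlog (- w) = - dlog w.
Proof. by apply/eqP; rewrite -addr_eq0 -dlogD addNr dlog0. Qed.

Lemma dlogZ (c : int) w : dlog (c *: w) = c%:~R * dlog w.
Proof.
have Hn (e : nat) : dlog (e%:Z *: w) = e%:R * dlog w.
  elim: e => [|e IH]; first by rewrite scale0r dlog0 mul0r.
  by rewrite intS scalerDl scale1r dlogD IH mulrS mulrDl mul1r.
case: c => e; first exact: Hn.
by rewrite NegzE scaleNr dlogN Hn mulrNz mulNr.
Qed.

Lemma dlog_sum I (s : seq I) (P : pred I) (G : I -> 'rV[int]_n) :
  dlog (\sum_(i <- s | P i) G i) = \sum_(i <- s | P i) dlog (G i).
Proof. exact: (big_morph dlog dlogD dlog0). Qed.

Lemma dlog_delta w : dlog w = \sum_l (w 0 l)%:~R * dlog (delta_mx 0 l).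
Proof.
rewrite {1}[w]row_sum_delta dlog_sum; apply: eq_bigr => l _.
by rewrite dlogZ.
Qed.

End LogDerivation.

Lemma fsec_nonopen (F : fmodule X) U (s : sec (omodule_of F) U) a : ~ opn U -> fval s a = 0.
Proof. by move=> nU; have /asboolP[_ /(_ nU) ->] := fvalP s. Qed.

Definition zmu (mu : 'rV[k]_n) (u : 'rV[int]_n) : k := \sum_l mu 0 l * (u 0 l)%:~R.

Definition phimu (mu t : 'rV[k]_n) (V : set X) (s : sec E V) : k :=
  \sum_l mu 0 l * dlog t (fun f => fval (j s) (tp t, f)) (delta_mx 0 l).

Lemma phimu_fibre mu t : intorus t -> fibre_form (tp t) (@phimu mu t).
Proof.
move=> Ht; have [jD jA jR] := j_mor; split.
- move=> V s nV; apply: big1 => l _; rewrite /dlog.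
  have -> : fval (j s) (tp t, Xm (delta_mx 0 l)) = 0; last by rewrite mul0r mulr0.
  have [oV|] := pselect (opn V); last exact: fsec_nonopen.
  by apply: fsec_supp => // Vt; apply: nV.
- move=> V s s' oV Vt; rewrite /phimu -big_split; apply: eq_bigr => l _ /=.
  rewrite /dlog jD // fsec_add.
  have aux (a b c e : k) : e * ((a + b) / c) = e * (a / c) + e * (b / c).
    by rewrite mulrDl mulrDr.
  exact: aux.
- move=> V f s oV Vt rf; rewrite /phimu mulr_sumr; apply: eq_bigr => l _.
  rewrite /dlog jA // fsec_act //=.
  have aux (a b c e : k) : e * ((a * b) / c) = a * (e * (b / c)).
    by rewrite !mulrA (mulrC a e).
  exact: aux.
- move=> V W s oV oW WV Wt; apply: eq_bigr => l _.
  by rewrite /dlog jR // fsec_res.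
Qed.

Lemma j_deriv V (s : sec E V) x : opn V -> V x ->
  point_derivation x (fun f => fval (j s) (x, f)).
Proof. by move=> oV Vx; have [_ H2 _] := fsec_sec (j s) oV; apply: H2. Qed.

Lemma j_reg V (s : sec E V) W f : opn V -> opn W -> W `<=` V -> reg W f ->
  reg W (fun x => fval (j s) (x, f)).
Proof. by move=> oV oW WV rf; have [_ _ H3] := fsec_sec (j s) oV; apply: H3. Qed.

(** In chart coordinates x_i the log form of [mu] is the sum of mu(u_i) dx_i / x_i, so only
    coordinates with mu(u_i) nonzero produce poles. *)
Lemma phimu_chart mu t V (s : sec E V) B : opn V -> V (tp t) -> intorus t -> maxB B ->
  phimu mu t s = \sum_i zmu mu (ray B i) *
    (fval (j s) (tp t, chi (coneB B) (dray B i)) / mon t (dray B i)).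
Proof.
move=> oV Vt Ht mB; have [uB SB] := mB; have dv := j_deriv s oV Vt.
have dB i : dual (coneB B) (dray B i).
  by apply/(coneB_dual _ uB) => l; rewrite dray_ray // ler0n.
have E1 i : fval (j s) (tp t, chi (coneB B) (dray B i)) / mon t (dray B i) =
    dlog t (fun f => fval (j s) (tp t, f)) (dray B i).
  rewrite /dlog; congr (_ / _); have [_ loc _ _ _] := dv.
  apply: (loc torset); [exact: torset_opn|by exists t| |].
    apply: reg_sub (chi_reg SB (dB i)); [exact: dom_opn|exact: torset_opn|].
    by move=> _ [t' Ht' ->]; apply: tp_dom.
  by move=> C; rewrite inE => -[t' Ht' ->]; rewrite tp_chi // XmE.
under eq_bigr do rewrite E1.
rewrite /phimu; under [RHS]eq_bigr do rewrite /zmu mulr_suml.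
rewrite exchange_big /=; apply: eq_bigr => l _.
rewrite {1}(dray_expand (delta_mx 0 l) uB) (dlog_sum Ht dv) mulr_sumr.
apply: eq_bigr => i _; rewrite (dlogZ Ht dv) mulrA; congr (_ * _ * _).
by rewrite zdotC zdot_delta.
Qed.

Definition Fmu mu t : 'rV[k]_N.+1 := Hf H (tp t) (@phimu mu t).

Lemma FmuE mu t : Fmu mu t = Hf H (tp t) (@phimu mu t). Proof. by []. Qed.

Lemma Fmu_arc mu c (x : k -> 'rV[k]_n) : (forall i, regc c (fun s => x s 0 i)) ->
  intorus (x c) -> forall i, regc c (fun s => Fmu mu (x s) 0 i).
Proof.
move=> Hx xc; have arc := tp_arc fan_Sigma Hx xc.
apply: (arc_reg amp E_lf arc).
  by apply: nearcS (near_torus Hx xc) => s Hs; apply: phimu_fibre.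
move=> V s0 oV Vc; apply: regc_sum => l _; apply: regcM; first exact: regc_cst.
apply: regcM; last first.
  by apply: regcV; [apply: mon_arc|apply: mon_tneq0].
have oW := opnI oV torset_opn.
have Wc : (V `&` torset) (tp (x c)) by split=> //; exists (x c).
have rX : reg (V `&` torset) (Xm (delta_mx 0 l)).
  by apply: reg_sub torset_opn oW _ (Xm_reg _) => C [].
by apply: (arc.2 _ _ oW Wc (j_reg s0 oV oW _ rX)) => C [].
Qed.

Lemma kap_limarc B v t s : maxB B -> intorus t -> (forall i, 0 <= zdot (dray B i) v) ->
  s != 0 -> kap B (limarc B v t s) = tp (lam v s t).
Proof.
move=> mB Ht Hv s0; have [uB _] := mB.
by rewrite limarcE // (tp_kap fan_Sigma mB) //; apply: lam_torus.
Qed.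

(** The vector field [j s] is regular at the limit point, so all poles come from the factors 1 / x_i
    with mu(u_i) nonzero; their order is the i-th coordinate of [v], at most [d]. *)
Lemma lim_lemma mu B v t (d : nat) : maxB B -> intorus t ->
  (forall i, 0 <= zdot (dray B i) v) ->
  (forall i, zmu mu (ray B i) != 0 -> zdot (dray B i) v <= d%:Z) ->
  nearc 0 (fun s => s != 0 -> Fmu mu (lam v s t) = 0) \/
  exists o (a : nzform E) (h : k -> 'rV[k]_N.+1), [/\ nzf_pt a = kap B (limarc B v t 0),
    forall i, regc 0 (fun s => h s 0 i), h 0 = H a &
    nearc 0 (fun s => s != 0 -> s ^+ (d * m) *: Fmu mu (lam v s t) = s ^+ (o * m) *: h s)].
Proof.
move=> mB Ht Hv Hd; have [uB SB] := mB.
have ch := kap_ischart fan_Sigma X_smooth X_projective mB.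
have arc : sarc 0 (fun s => kap B (limarc B v t s)).
  by apply: (chart_sarc ch) => i; apply: limarc_reg.
have gE s : s != 0 -> kap B (limarc B v t s) = tp (lam v s t) by apply: kap_limarc.
have Hs s : s != 0 -> intorus (lam v s t) by move=> s0; apply: lam_torus.
have [||L|[o [a [h [ha hr h0 hE]]]]] := arc_lemma amp E_lf (phi := fun s => @phimu mu (lam v s t)) (B := d) arc.
- by apply: nearcT => s s0; rewrite gE //; apply: phimu_fibre; apply: Hs.
- move=> V s0 oV V0.
  pose g i (C : X) := fval (j s0) (C, chi (coneB B) (dray B i)).
  have oW := opnI oV (@dom_opn n k Sigma (coneB B)).
  have W0 : (V `&` @toric_dom n k Sigma (coneB B)) (kap B (limarc B v t 0)).
    by split=> //; apply/kap_dom => //; exists (limarc B v t 0).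
  have dB i : dual (coneB B) (dray B i).
    by apply/(coneB_dual _ uB) => l; rewrite dray_ray // ler0n.
  have rg i : regc 0 (fun s => g i (kap B (limarc B v t s))).
    apply: (arc.2 _ _ oW W0); apply: (j_reg s0 oV oW (fun C (HC : (V `&` _) C) => HC.1)).
    by apply: (reg_sub (@dom_opn n k Sigma (coneB B)) oW _ (chi_reg SB (dB i))) => C [].
  exists (fun s => \sum_i zmu mu (ray B i) / mon t (dray B i) *
      (s ^+ (d - absz (zdot (dray B i) v)) * g i (kap B (limarc B v t s)))).
    apply: regc_sum => i _; apply: regcM; first exact: regc_cst.
    by apply: regcM => //; apply: regc_exp; apply: regc_id.
  apply: nearcS (arc.1 _ oV V0) => s Vs s_neq0; rewrite subr0.
  rewrite gE // in Vs.
  rewrite (phimu_chart mu s0 oV Vs (Hs s s_neq0) mB) mulr_sumr; apply: eq_bigr => i _.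
  have [->|mu0] := eqVneq (zmu mu (ray B i)) 0; first by rewrite !mul0r mulr0.
  rewrite /g gE // mon_lam //; have := Hd i mu0; have := Hv i.
  case: (zdot (dray B i) v) => // e _; rewrite lez_nat => ed /=.
  rewrite -{1}(subnK ed) exprD invfM; set y := fval _ _.
  have se : s ^+ e != 0 by rewrite expf_neq0.
  rewrite -exprnP; field; rewrite se /=.
  by rewrite andbT; apply: mon_tneq0.
- by left; apply: nearcS L => s L s0; move: (L s0); rewrite gE.
- right; exists o, a, h; split=> //; apply: nearcS hE => s hE s0.
  by move: (hE s0); rewrite subr0 gE.
Qed.

End TorusForms.

(** * Laurent expansion on the torus *)

Section Laurent.
Variable k : closedFieldType.

Lemma distinct_seq S : exists s : seq k, [/\ size s = S, uniq s & 0 \notin s].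
Proof.
elim: S => [|S [s [<- us s0]]]; first by exists [::].
have : 'X * \prod_(a <- s) ('X - a%:P) != 0 :> {poly k}.
  by rewrite mulf_neq0 ?polyX_eq0 //; apply/monic_neq0/monic_prod_XsubC.
move=> /poly_neq0_ex[a]; rewrite hornerM hornerX mulf_eq0 negb_or => /andP[a0].
rewrite -[_ != 0]/(~~ root _ a) root_prod_XsubC => Ha.
by exists (a :: s); rewrite /= Ha us in_cons eq_sym (negPf a0) s0.
Qed.

(** Lagrange interpolation, with nodes different from 0 because they serve as torus coordinates. *)
Lemma interpolation S : exists (x : 'I_S -> k) (l : 'I_S -> {poly k}),
  (forall i, x i != 0) /\
  forall p : {poly k}, (size p <= S)%N -> forall a, p.[a] = \sum_i p.[x i] * (l i).[a].
Proof.
have [s [sS us s0]] := distinct_seq S.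
have xi (i j : 'I_S) : (s`_i == s`_j) = (i == j) by rewrite nth_uniq ?sS.
pose W (i : 'I_S) : {poly k} := \prod_(j < S | j != i) ('X - (s`_j)%:P).
have W0 i : (W i).[s`_i] != 0.
  rewrite horner_prod; apply/prodf_neq0 => j ji.
  by rewrite hornerXsubC subr_eq0 xi eq_sym.
have Wj i j : j != i -> (W i).[s`_j] = 0.
  move=> ji; rewrite horner_prod (bigD1 j) //= hornerXsubC subrr.
  by rewrite mul0r.
have sW i : (size (W i) <= S)%N.
  rewrite /W -big_enum /= size_prod_XsubC -cardE cardC1 card_ord.
  by case: (S) i => // -[].
exists (fun i => s`_i), (fun i => (W i).[s`_i]^-1 *: W i); split.
  by move=> i; apply: contraNneq s0 => <-; rewrite mem_nth ?sS.
move=> p sp a; set q := \sum_(i < S) p.[s`_i] *: ((W i).[s`_i]^-1 *: W i).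
suff -> : p = q.
  rewrite [in LHS]/q horner_sum; apply: eq_bigr => i _; rewrite hornerZ; congr (_ * _).
  rewrite /q horner_sum (bigD1 i) //= big1 ?addr0 => [|j ji].
    by rewrite !hornerZ mulVf // mulr1.
  by rewrite !hornerZ (Wj j i) ?mulr0 // eq_sym.
apply/eqP; rewrite -subr_eq0; apply/eqP/(roots_geq_poly_eq0 (rs := s)) => //.
  apply/allP => y /(nthP 0)[i]; rewrite sS => iS <-.
  rewrite /root !hornerE horner_sum (bigD1 (Ordinal iS)) //= big1 ?addr0 => [|j ji].
    by rewrite !hornerZ mulVf ?(W0 (Ordinal iS)) // mulr1 subrr.
  by rewrite !hornerZ (Wj j (Ordinal iS)) ?mulr0 // eq_sym.
rewrite sS (leq_trans (size_polyD _ _)) // geq_max sp size_polyN.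
apply: (leq_trans (size_sum _ _ _)); apply/bigmax_leqP => i _.
exact: leq_trans (size_scale_leq _ _) (leq_trans (size_scale_leq _ _) (sW i)).
Qed.

Definition laurent n (G : 'rV[k]_n -> k) : Prop :=
  exists L : seq (k * 'rV[int]_n), forall t, intorus t ->
    G t = \sum_(p <- L) p.1 * mon t p.2.

Lemma laurent_eq n (G G' : 'rV[k]_n -> k) : (forall t, intorus t -> G t = G' t) ->
  laurent G -> laurent G'.
Proof. by move=> E [L HL]; exists L => t Ht; rewrite -E // HL. Qed.

Lemma laurent_cst n c : laurent (fun _ : 'rV[k]_n => c).
Proof. by exists [:: (c, 0)] => t Ht; rewrite big_seq1 mon0 mulr1. Qed.

Lemma laurent_mon n w : laurent (fun t : 'rV[k]_n => mon t w).
Proof. by exists [:: (1, w)] => t Ht; rewrite big_seq1 mul1r. Qed.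

Lemma laurentD n (G G' : 'rV[k]_n -> k) : laurent G -> laurent G' ->
  laurent (fun t => G t + G' t).
Proof. by move=> [L HL] [L' HL']; exists (L ++ L') => t Ht; rewrite big_cat HL // HL'. Qed.

Lemma laurentM n (G G' : 'rV[k]_n -> k) : laurent G -> laurent G' ->
  laurent (fun t => G t * G' t).
Proof.
move=> [L HL] [L' HL']; exists (lmul L L') => t Ht.
rewrite /lmul big_allpairs_dep /= HL // HL' // mulr_suml; apply: eq_bigr => p _.
by rewrite mulr_sumr; apply: eq_bigr => q _; rewrite /= monDt // mulrACA.
Qed.

Lemma laurent_sum n I (s : seq I) (G : I -> 'rV[k]_n -> k) : (forall i, laurent (G i)) ->
  laurent (fun t => \sum_(i <- s) G i t).
Proof.
move=> HG; elim: s => [|i s IH].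
  by apply: laurent_eq (laurent_cst n 0) => t _; rewrite big_nil.
by apply: laurent_eq (laurentD (HG i) IH) => t _; rewrite big_cons.
Qed.

Lemma mon_delta n (t : 'rV[k]_n) l (e : int) : mon t (e *: delta_mx 0 l) = t 0 l ^ e.
Proof.
rewrite /mon (bigD1 l) //= !mxE !eqxx mulr1 big1 ?mulr1 // => i il.
by rewrite !mxE (negPf il) andbF mulr0 expr0z.
Qed.

Lemma laurent_poly n (p : {poly k}) l : laurent (fun t : 'rV[k]_n => p.[t 0 l]).
Proof.
have H i : laurent (fun t : 'rV[k]_n => p`_i * t 0 l ^+ i).
  apply: laurentM (laurent_cst _ _) _.
  by apply: laurent_eq (laurent_mon (i%:Z *: delta_mx 0 l)) => t _; rewrite mon_delta.
apply: laurent_eq (laurent_sum (index_enum 'I_(size p)) (fun i => H i)) => t _.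
by rewrite horner_coef.
Qed.

(** Degree bounds in each variable, uniform in the others, suffice: interpolation expresses [G] by
    its values with one variable frozen at the nodes. In [mix j t b] the first j coordinates are
    those of t and the others those of b. *)
Lemma laurent_separate n (G : 'rV[k]_n -> k) :
  (forall l : 'I_n, exists d S : nat, forall t, intorus t -> exists2 p : {poly k},
     (size p <= S)%N &
     forall s, s != 0 -> s ^+ d * G (lam (delta_mx 0 l) s t) = p.[s]) ->
  laurent G.
Proof.
move=> HG; pose mix j (t b : 'rV[k]_n) : 'rV[k]_n := \row_i if (i < j)%N then t 0 i else b 0 i.
have mixt j t b : intorus t -> intorus b -> intorus (mix j t b).
  by move=> Ht Hb i; rewrite mxE; case: ifP.
suff H j : (j <= n)%N -> forall b, intorus b -> laurent (fun t => G (mix j t b)).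
  have H1 : intorus (const_mx 1 : 'rV[k]_n) by move=> i; rewrite mxE oner_neq0.
  apply: laurent_eq (H n (leqnn n) _ H1) => t _; congr G; apply/rowP => i.
  by rewrite mxE ltn_ord.
elim: j => [|j IH] jn b Hb.
  apply: laurent_eq (laurent_cst _ (G b)) => t _; congr G; apply/rowP => i.
  by rewrite mxE ltn0.
pose l := Ordinal jn; have [d [S HS]] := HG l.
have [x [c [x0 xc]]] := interpolation S.
pose upd (a : k) : 'rV[k]_n := \row_i if i == l then a else b 0 i.
have updt a : a != 0 -> intorus (upd a).
  by move=> a0 i; rewrite mxE; case: ifP.
have IHx i := IH (ltnW jn) (upd (x i)) (updt _ (x0 i)).
have lamE a t : lam (delta_mx 0 l) a (mix j t (upd 1)) = mix j t (upd a).
  apply/rowP => i; rewrite !mxE eqxx /=; have [->|il] := eqVneq i l.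
    by rewrite ltnn expr1z mulr1.
  by rewrite expr0z mul1r.
have mixS t : mix j.+1 t b = mix j t (upd (t 0 l)).
  apply/rowP => i; rewrite !mxE ltnS leq_eqVlt -[(i : nat) == j]/(i == l).
  by have [->|il] := eqVneq i l; rewrite ?ltnn.
have L i : laurent (fun t => x i ^+ d * G (mix j t (upd (x i))) * (c i).[t 0 l]).
  by apply: laurentM (laurent_poly _ _); apply: laurentM (laurent_cst _ _) (IHx i).
have L2 := laurentM (laurent_mon ((- d%:Z) *: delta_mx 0 l)) (laurent_sum (index_enum 'I_S) L).
apply: laurent_eq L2 => t Ht; rewrite mon_delta.
have [p sp pE] := HS _ (mixt j t _ Ht (updt 1 (oner_neq0 _))).
rewrite mixS -lamE -exprz_inv -exprnP; apply: (mulfI (expf_neq0 d (Ht l))).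
rewrite mulrA -exprMn mulfV ?Ht // expr1n mul1r pE ?Ht // xc //.
by apply: eq_bigr => i _; rewrite -pE // lamE.
Qed.

(** If the degree e of [p] exceeded D, then s^e p(1/s) would vanish at 0, but its value there is the
    leading coefficient of [p]. *)
Lemma poly_order_inf (p : {poly k}) D (R : k -> k) : regc 0 R ->
  nearc 0 (fun s => s != 0 -> s ^+ D * p.[s^-1] = R s) -> (size p <= D.+1)%N.
Proof.
move=> [a [b [b0 Hab]]] Hp; rewrite leqNgt; apply/negP => sp.
have p0 : p != 0 by rewrite -size_poly_eq0 -lt0n; apply: leq_trans sp.
pose e := (size p).-1; have De : (D < e)%N by rewrite /e -ltnS prednK // (leq_trans _ sp).
pose q : {poly k} := \poly_(i < e.+1) p`_(e - i).
have qE s : s != 0 -> q.[s] = s ^+ e * p.[s^-1].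
  move=> s0; rewrite horner_poly horner_coef mulr_sumr.
  rewrite -[size p]prednK ?size_poly_gt0 // -/e.
  rewrite [RHS](reindex_inj (@rev_ord_inj e.+1)).
  apply: eq_bigr => i _; have ie : (i <= e)%N by rewrite -ltnS.
  have -> : rev_ord i = (e - i)%N :> nat by rewrite /= subSS.
  rewrite mulrCA; congr (_ * _).
  rewrite -{2}(subnK (leq_subr i e)) exprD -mulrA exprVn mulfV ?expf_neq0 //.
  by rewrite mulr1 subKn.
have E : q * b - 'X^(e - D) * a = 0.
  apply: (@poly_near0 k 0); apply: nearcS2 (nearcI Hab Hp) (nearc_poly b0).
  move=> s [Rs ps] bs s0; rewrite !hornerE qE //.
  rewrite -(subnK (ltnW De)) exprD -mulrA ps // Rs addnK -mulrA mulfVK ?subrr //.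
  move: E => /(congr1 (fun p => p.[0])); rewrite !hornerE expr0n subn_eq0 leqNgt De /=.
rewrite mul0r subr0 => /eqP; rewrite mulf_eq0 (negPf b0) orbF.
rewrite horner_coef0 coef_poly /= subn0 -lead_coefE lead_coef_eq0 (negPf p0) //.
Qed.

End Laurent.

Section TorusExp.
Variables (n : nat) (k : closedFieldType) (Sigma : set (set 'rV[rat]_n)).
Hypothesis fan_Sigma : is_fan Sigma.
Local Notation X := (toric_variety k Sigma).
Hypotheses (X_smooth : smooth X n) (X_projective : projective X).
Local Notation tp := (@tp n k Sigma fan_Sigma).
Local Notation maxB := (maxB Sigma).
Local Notation kap := (@kap n k Sigma fan_Sigma).
Variables (r : nat) (E : omodule X).
Hypothesis E_lf : locally_free r E.
Variable j : forall U : set X, sec E U -> sec (tangent X) U.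
Hypothesis j_mor : omorphism j.
Variables (m N : nat) (H : nzform E -> 'rV[k]_N.+1).
Hypothesis amp : amp_data m H.
Implicit Types (t : 'rV[k]_n) (B : 'M[int]_n) (w v : 'rV[int]_n).

Local Notation Fmu := (@Fmu n k Sigma fan_Sigma E j N H).
Local Notation phimu := (@phimu n k Sigma fan_Sigma E j).

Lemma coord_bound B v : exists d : nat, forall i, zdot (dray B i) v <= d%:Z.
Proof.
exists (\sum_i absz (zdot (dray B i) v))%N => i.
apply: (le_trans (lez_abs _)); rewrite lez_nat (bigD1 i) //=.
exact: leq_addr.
Qed.

Lemma Fmu_pole mu v : exists d : nat, forall t, intorus t -> forall i,
  exists2 R, regc 0 R & nearc 0 (fun s => s != 0 -> s ^+ d * Fmu mu (lam v s t) 0 i = R s).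
Proof.
have [B mB /coneB_qv Hv] := maxB_cover fan_Sigma X_smooth X_projective v.
have [d Hd] := coord_bound B v; exists (d * m)%N => t Ht i.
have [L|[o [a [h [_ hr _ hE]]]]] :=
    lim_lemma fan_Sigma X_smooth X_projective E_lf j_mor amp mB Ht Hv (fun i (_ : zmu mu (ray B i) != 0) => Hd i).
  exists (fun=> 0); first exact: regc_cst.
  by apply: nearcS L => s L s0; rewrite L // mxE mulr0.
exists (fun s => s ^+ (o * m) * h s 0 i).
  by apply: regcM => //; apply: regc_exp; apply: regc_id.
by apply: nearcS hE => s hE s0; have /rowP/(_ i) := hE s0; rewrite !mxE.
Qed.

Lemma lam_inv v s t : lam v s^-1 t = lam (- v) s t.
Proof. by apply/rowP => i; rewrite !mxE exprz_inv. Qed.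

(** The limit for [v] bounds the pole at 0, the limit for [-v] the pole at infinity, and F is
    regular in between. Neither bound depends on t. *)
Lemma Fmu_line mu v : exists d S : nat, forall t, intorus t -> forall i,
  exists2 p : {poly k}, (size p <= S)%N &
    forall s, s != 0 -> s ^+ d * Fmu mu (lam v s t) 0 i = p.[s].
Proof.
have [d Hd] := Fmu_pole mu v; have [d' Hd'] := Fmu_pole mu (- v).
exists d, (d + d').+1 => t Ht i; have [R rR RE] := Hd t Ht i; have [R' rR' RE'] := Hd' t Ht i.
pose f s := if s == 0 then R 0 else s ^+ d * Fmu mu (lam v s t) 0 i.
have [c|p Hp] := @regc_all_poly k f.
  have [->|c0] := eqVneq c 0.
    apply: regc_eq rR; apply: nearcS RE => s; rewrite /f.
    by have [->|s0 ->] := eqVneq s 0.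
  have R2 : regc c (fun s => s ^+ d * Fmu mu (lam v s t) 0 i).
    apply: regcM; first by apply: regc_exp; apply: regc_id.
    apply: (Fmu_arc fan_Sigma X_smooth X_projective E_lf j_mor amp mu (x := fun s => lam v s t)) => [l|].
      exact: lam_arc.
    exact: lam_torus.
  by apply: regc_eq R2; apply: nearcS (nearc_ne c0) => s /negPf s0; rewrite /f s0.
have pE s : s != 0 -> s ^+ d * Fmu mu (lam v s t) 0 i = p.[s].
  by move=> /negPf s0; rewrite -Hp /f s0.
exists p => //; apply: (poly_order_inf rR'); apply: nearcS RE' => s H' s0.
rewrite -(H' s0) -pE ?invr_neq0 // lam_inv exprD -mulrA [X in _ * X]mulrA mulrA.
by rewrite -(mulrA (s ^+ d)) mulrCA exprVn !mulrA mulfVK // expf_neq0.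
Qed.

Definition laurent_exp (F : 'rV[k]_n -> 'rV[k]_N.+1) (Q : seq 'rV[int]_n)
    (h : 'rV[int]_n -> 'rV[k]_N.+1) :=
  [/\ uniq Q, forall w, w \in Q -> h w != 0 &
      forall t, intorus t -> F t = \sum_(w <- Q) mon t w *: h w].

Lemma lcoef_expand (L : seq (k * 'rV[int]_n)) (S : seq 'rV[int]_n) t : uniq S ->
  (forall p, p \in L -> p.2 \in S) ->
  \sum_(p <- L) p.1 * mon t p.2 = \sum_(w <- S) lcoef L w * mon t w.
Proof.
move=> uS HS; under [RHS]eq_bigr do rewrite mulr_suml.
rewrite (exchange_big_dep xpredT) //=; apply: eq_big_seq => p pL.
rewrite -big_filter (_ : [seq _ <- _ | _] = [:: p.2]) ?big_seq1 //.
rewrite (eq_filter (a2 := pred1 p.2)) => [|x]; last by rewrite /= eq_sym.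
by rewrite filter_pred1_uniq // HS.
Qed.

Lemma Fmu_laurent mu : exists Q h, laurent_exp (Fmu mu) Q h.
Proof.
have /choice[L HL] : forall i, exists L : seq (k * 'rV[int]_n), forall t, intorus t ->
    Fmu mu t 0 i = \sum_(p <- L) p.1 * mon t p.2.
  move=> i; apply: (@laurent_separate k n (fun t => Fmu mu t 0 i)) => l.
  have [d [S HS]] := Fmu_line mu (delta_mx 0 l).
  by exists d, S => t Ht; apply: HS.
pose h w : 'rV[k]_N.+1 := \row_i lcoef (L i) w.
pose S := undup (flatten [seq [seq p.2 | p <- L i] | i <- enum 'I_N.+1]).
have HS i p : p \in L i -> p.2 \in S.
  move=> pL; rewrite mem_undup; apply/flattenP.
  exists [seq p.2 | p <- L i]; last exact: map_f.
  by apply: map_f; rewrite mem_enum.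
exists [seq w <- S | h w != 0], h; split.
- exact/filter_uniq/undup_uniq.
- by move=> w; rewrite mem_filter => /andP[].
move=> t Ht; rewrite big_filter.
transitivity (\sum_(w <- S) mon t w *: h w); last first.
  rewrite [LHS](bigID (fun w => h w != 0)) /= [X in _ + X]big1 ?addr0 // => w.
  by rewrite negbK => /eqP ->; rewrite scaler0.
apply/rowP => i; rewrite HL // summxE (lcoef_expand _ (undup_uniq _) (HS i)).
by apply: eq_bigr => w _; rewrite !mxE mulrC.
Qed.

End TorusExp.

(** * Newton polytopes and the fan *)

Section MinFace.
Variable n : nat.
Implicit Types (w v y : 'rV[int]_n) (Q : seq 'rV[int]_n).

Definition Qmin Q v : seq 'rV[int]_n :=
  [seq w <- Q | all (fun w' => zdot w v <= zdot w' v) Q].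

Lemma QminP Q v w : reflect (w \in Q /\ forall w', w' \in Q -> zdot w v <= zdot w' v)
  (w \in Qmin Q v).
Proof.
rewrite mem_filter andbC; apply: (iffP andP) => -[wQ H]; split=> //.
  by move/allP: H.
by apply/allP.
Qed.

Lemma Qmin_ex Q v : Q != [::] -> exists w, w \in Qmin Q v.
Proof.
elim: Q => // a Q IH _; have [->|/IH[w /QminP[wQ Hw]]] := eqVneq Q [::].
  exists a; apply/QminP; split=> [|w']; first exact: mem_head.
  by rewrite mem_seq1 => /eqP ->.
have [H|H] := leP (zdot a v) (zdot w v).
  exists a; apply/QminP; split=> [|w']; first exact: mem_head.
  by rewrite in_cons => /orP[/eqP -> //|/Hw]; apply: le_trans.
exists w; apply/QminP; split=> [|w']; first by rewrite in_cons wQ orbT.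
by rewrite in_cons => /orP[/eqP ->|/Hw //]; apply: ltW.
Qed.

Lemma Qmin_eq Q v w w' : w \in Qmin Q v -> w' \in Qmin Q v -> zdot w v = zdot w' v.
Proof. by move=> /QminP[a b] /QminP[c d]; apply/eqP; rewrite eq_le b ?d. Qed.

Lemma Qmin_memS Q v w : w \in Qmin Q v -> w \in Q.
Proof. by move=> /QminP[]. Qed.

Lemma Qmin0 Q : Qmin Q 0 = Q.
Proof.
by apply/all_filterP/allP => w _; apply/allP => w' _; rewrite !zdot0r.
Qed.

Lemma seq_bound Q v : exists K : nat, forall w, w \in Q -> `|zdot w v| <= K%:Z.
Proof.
elim: Q => [|a Q [K HK]]; first by exists 0%N.
exists (K + absz (zdot a v))%N => w; rewrite in_cons PoszD => /orP[/eqP ->|/HK H].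
  by rewrite lerDr.
by rewrite ler_wpDr.
Qed.

(* For large K the linear form K y + v refines y by v. *)
Lemma Qmin_perturb Q y v : exists K0 : nat, forall K w, (K0 <= K)%N ->
  w \in Qmin (Qmin Q y) v -> w \in Qmin Q (K%:Z *: y + v).
Proof.
have [c Hc] := seq_bound Q v; exists (c + c).+1%N => K w HK.
have Kc : (c%:Z + c%:Z < K%:Z) by rewrite -PoszD ltz_nat.
move=> /QminP[wQy Hw]; have [wQ Hy] := QminP _ _ _ wQy.
apply/QminP; split=> // w' w'Q; rewrite !zdotDr !zdotZr.
have [E|E] := leP (zdot w' y) (zdot w y).
  have w'y : w' \in Qmin Q y.
    by apply/QminP; split=> // w2 /Hy; apply: le_trans.
  by rewrite (Qmin_eq wQy w'y) lerD2l; apply: Hw.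
have := Hc _ wQ; have := Hc _ w'Q; rewrite !ler_norml => /andP[h1 h2] /andP[h3 h4].
move: E; rewrite -lezD1 => E; have := ler_wpM2l (ltW (le_lt_trans _ Kc)) E.
rewrite mulrDr mulr1 => E2; apply: (le_trans (y := K%:Z * zdot w y + K%:Z - c%:Z)).
  by rewrite -addrA lerD2l; lia.
by apply: lerD => //; apply: E2; lia.
Qed.

End MinFace.

Lemma order_match (k : closedFieldType) N (e : int) (P h : k -> 'rV[k]_N) :
  (forall i, regc 0 (fun s => P s 0 i)) -> (forall i, regc 0 (fun s => h s 0 i)) ->
  P 0 != 0 -> h 0 != 0 -> nearc 0 (fun s => s != 0 -> s ^ e *: P s = h s) ->
  e = 0 /\ P 0 = h 0.
Proof.
move=> rP rh P0 h0 E; case: e E => e E.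
  have Ph : 0 ^+ e *: P 0 = h 0.
    apply/rowP => i; rewrite mxE.
    apply: (regc_uniq_at (regcM (regc_exp e (regc_id 0)) (rP i)) (rh i)).
    by apply: nearcS E => s E s0; rewrite -E // mxE.
  have [e0|e0] := eqVneq e 0%N; first by rewrite -Ph e0 expr0 scale1r.
  by move: h0; rewrite -Ph expr0n (negPf e0) scale0r eqxx.
have Ph : P 0 = 0 ^+ e.+1 *: h 0.
  apply/rowP => i; rewrite mxE.
  apply: (regc_uniq_at (rP i) (regcM (regc_exp e.+1 (regc_id 0)) (rh i))).
  apply: nearcS E => s E s0; rewrite -E // mxE NegzE -exprnN mulrA mulfV ?mul1r //.
  by rewrite expf_neq0.
by move: P0; rewrite Ph expr0n scale0r eqxx.
Qed.

(** * Leading forms and the two constraints on exponents *)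

Section TorusLead.
Variables (n : nat) (k : closedFieldType) (Sigma : set (set 'rV[rat]_n)).
Hypothesis fan_Sigma : is_fan Sigma.
Local Notation X := (toric_variety k Sigma).
Hypotheses (X_smooth : smooth X n) (X_projective : projective X).
Local Notation tp := (@tp n k Sigma fan_Sigma).
Local Notation maxB := (maxB Sigma).
Local Notation kap := (@kap n k Sigma fan_Sigma).
Variables (r : nat) (E : omodule X).
Hypothesis E_lf : locally_free r E.
Variable j : forall U : set X, sec E U -> sec (tangent X) U.
Hypothesis j_mor : omorphism j.
Variables (m N : nat) (H : nzform E -> 'rV[k]_N.+1).
Hypothesis amp : amp_data m H.
Implicit Types (t : 'rV[k]_n) (B : 'M[int]_n) (w v : 'rV[int]_n).

Local Notation Fmu := (@Fmu n k Sigma fan_Sigma E j N H).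
Local Notation phimu := (@phimu n k Sigma fan_Sigma E j).

(** The initial form of F: the coefficient of the lowest power of s in F(lam v s t), where this
    coefficient is not 0. *)
Definition leadF (Q : seq 'rV[int]_n) (h : 'rV[int]_n -> 'rV[k]_N.+1) v t : 'rV[k]_N.+1 :=
  \sum_(w <- Qmin Q v) mon t w *: h w.

Lemma leadF_neq0 F Q h v : laurent_exp F Q h -> Q != [::] ->
  exists2 t, intorus t & leadF Q h v t != 0.
Proof.
move=> [uQ h0 _] /(Qmin_ex v)[w0 w0Q]; apply: contrapT => Hn.
have /rV0Pn[i hi] := h0 _ (Qmin_memS w0Q).
have := @char_indep k n (Qmin Q v) (fun w => h w 0 i) (filter_uniq _ uQ) _ w0 w0Q.
move=> H0; move: hi; rewrite H0 ?eqxx // => t Ht.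
have : leadF Q h v t = 0.
  by apply/eqP; apply: contrapT => E0; apply: Hn; exists t => //; apply/negP.
move=> /rowP/(_ i); rewrite summxE mxE => E0; rewrite -[RHS]E0.
by apply: eq_bigr => w _; rewrite mxE mulrC.
Qed.

(** Along the orbit, F is a power of s times a germ with value [leadF] at 0, and by [lim_lemma] also
    a power of s times a germ with value [H] of a form at the limit point. Both values are nonzero,
    so the powers and the values agree. *)
Lemma lead_lemma mu Q h B v t d w0 : laurent_exp (Fmu mu) Q h -> maxB B -> intorus t ->
  (forall i, 0 <= zdot (dray B i) v) ->
  (forall i, zmu mu (ray B i) != 0 -> zdot (dray B i) v <= d%:Z) ->
  leadF Q h v t != 0 -> w0 \in Qmin Q v ->
  exists o (a : nzform E), [/\ zdot w0 v = (o * m)%:Z - (d * m)%:Z,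
    nzf_pt a = kap B (limarc B v t 0) & H a = leadF Q h v t].
Proof.
move=> [uQ h0 FE] mB Ht Hv Hd L0 w0Q.
have [w0Q' Hmin] := QminP _ _ _ w0Q.
set a0 := zdot w0 v.
pose P s := \sum_(w <- Q) (s ^+ absz (zdot w v - a0) * mon t w) *: h w.
have PE s : s != 0 -> Fmu mu (lam v s t) = s ^ a0 *: P s.
  move=> s0; rewrite FE; last exact: lam_torus.
  rewrite scaler_sumr; apply: eq_big_seq => w wQ; rewrite mon_lam // scalerA mulrA.
  congr (_ * _ *: _); rewrite exprnP gez0_abs ?subr_ge0 ?Hmin // -expfzDr //.
  by congr (_ ^ _); ring.
have P0 : P 0 = leadF Q h v t.
  rewrite /P /leadF /Qmin big_filter [RHS]big_mkcond /=; apply: eq_big_seq => w wQ.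
  rewrite expr0n absz_eq0 subr_eq0; case: ifP => [/allP Hall|Hall].
    by rewrite eq_le (Hall _ w0Q') Hmin // mul1r.
  suff /negPf -> : zdot w v != a0 by rewrite mul0r scale0r.
  by apply: contraFneq Hall => ->; apply/allP.
have rP i : regc 0 (fun s => P s 0 i).
  have R : regc 0 (fun s => \sum_(w <- Q) s ^+ absz (zdot w v - a0) * mon t w * h w 0 i).
    apply: regc_sum => w _; apply: regcM (regc_cst _ _); apply: regcM (regc_cst _ _).
    by apply: regc_exp; apply: regc_id.
  apply: regc_eq R; apply: nearcT => s; rewrite summxE.
  by apply: eq_bigr => w _; rewrite mxE.
have [L|[o [a [g [ga gr g0 gE]]]]] :=
    lim_lemma fan_Sigma X_smooth X_projective E_lf j_mor amp mB Ht Hv Hd.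
  have /eqP[] : P 0 != 0 by rewrite P0.
  apply/rowP => i; rewrite mxE; apply: (regc_uniq_at (rP i) (regc_cst 0 0)).
  apply: nearcS L => s L s0; have := L s0; rewrite PE // => /eqP.
  by rewrite scaler_eq0 expfz_eq0 (negPf s0) andbF /= => /eqP ->; rewrite mxE.
have [|||e0 Pg] := @order_match k N.+1 (a0 + (d * m)%:Z - (o * m)%:Z) P g rP gr.
- by rewrite P0.
- by rewrite g0; apply: (amp_neq0 amp).
- apply: nearcS gE => s gE s0; have := gE s0; rewrite PE // scalerA => E1.
  apply: (scalerI (expf_neq0 (o * m) s0)); rewrite -E1 scalerA; congr (_ *: _).
  by rewrite !exprnP -!expfzDr //; congr (_ ^ _); ring.
exists o, a; split=> //; last by rewrite -g0 -Pg.
by move: e0 => /eqP; rewrite subr_eq0 => /eqP <-; rewrite addrK.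
Qed.

Lemma root_unity_avoid (e : int) : e != 0 -> exists2 s : k, s != 0 & s ^ e != 1.
Proof.
move=> e0; have : 'X * ('X^(absz e) - 1) != 0 :> {poly k}.
  rewrite mulf_neq0 ?polyX_eq0 // -size_poly_eq0 size_XnsubC //.
  by rewrite absz_gt0.
move=> /poly_neq0_ex[s]; rewrite !hornerE mulf_eq0 negb_or subr_eq0 => /andP[s0 s1].
exists s => //; case: e s1 {e0} => e //= s1; rewrite NegzE -exprnN.
by apply: contraNneq s1 => /(congr1 (fun x => x^-1)); rewrite invrK invr1 => ->.
Qed.

(** The lower bound is the order of F, which is the same for each mu' inducing the same forms on
    [E]. For the width: extreme exponents are multiples of m, so a face narrower than m in the
    direction v is constant there, and the subgroup of v only rescales its leading form. By [amp_pt]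
    two limit points that differ in the coordinate i would then coincide. *)
Lemma Qdata mu : (exists t V (s : sec E V), intorus t /\ phimu mu t s != 0) ->
  exists Q : seq 'rV[int]_n, [/\ Q != [::],
    forall mu' B v d, (forall t V (s : sec E V), intorus t -> phimu mu' t s = phimu mu t s) ->
      maxB B -> (forall i, 0 <= zdot (dray B i) v) ->
      (forall i, zmu mu' (ray B i) != 0 -> zdot (dray B i) v <= d%:Z) ->
      forall w, w \in Q -> - (d * m)%:Z <= zdot w v &
    forall B y v i, maxB B -> (forall l, 0 <= zdot (dray B l) y) ->
      zdot (dray B i) y = 0 -> zdot (dray B i) v != 0 ->
      exists w1 w2, [/\ w1 \in Qmin Q y, w2 \in Qmin Q y & m%:Z <= zdot w1 v - zdot w2 v]].
Proof.
move=> [t0 [V0 [s0 [Ht0 nz]]]]; have [Q [h HQ]] := Fmu_laurent fan_Sigma X_smooth X_projective E_lf j_mor amp mu.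
have Q0 : Q != [::].
  apply: contra_neq nz => Q0.
  have nz' : ~ exists V (s : sec E V), phimu mu t0 s != 0.
    move=> nz; pose a := NZForm (phimu_fibre fan_Sigma j_mor mu Ht0) nz.
    have := amp_neq0 amp a; have <- : Fmu mu t0 = H a by rewrite FmuE (HfE amp (a := a)).
    by have [_ _ ->] := HQ; rewrite // Q0 big_nil eqxx.
  by apply/eqP; apply: contrapT => /negP E0; apply: nz'; exists V0, s0.
have div v w : w \in Qmin Q v -> exists c : int, zdot w v = c * m%:Z.
  move=> wQ; have [B mB /coneB_qv Hv] := maxB_cover fan_Sigma X_smooth X_projective v.
  have [d Hd] := coord_bound B v; have [t Ht L0] := leadF_neq0 v HQ Q0.
  have [o [a [-> _ _]]] := lead_lemma HQ mB Ht Hv (fun i _ => Hd i) L0 wQ.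
  by exists (o%:Z - d%:Z); rewrite !PoszM mulrBl.
exists Q; split=> //.
- move=> mu' B v d Hmu mB Hv Hd w wQ.
  have HQ' : laurent_exp (Fmu mu') Q h.
    have [a b c] := HQ; split=> // t Ht; rewrite -c //; congr Hf.
    by apply: functional_extensionality_dep => V; apply: funext => s; apply: Hmu.
  have [t Ht L0] := leadF_neq0 v HQ' Q0; have [w0 w0Q] := Qmin_ex v Q0.
  have [o [a [E0 _ _]]] := lead_lemma HQ' mB Ht Hv Hd L0 w0Q.
  have [_ /(_ w wQ)] := QminP _ _ _ w0Q; apply: le_trans.
  by rewrite E0 lerDr.
move=> B y v i mB Hy yi vi; apply: contrapT => Hn.
have [wy wyQ] := Qmin_ex y Q0.
have Qy0 : Qmin Q y != [::] by apply: contraTneq wyQ => ->.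
(* [div] is applied to y and to K0 y + v', which refines the face of y by v'. *)
have divy v' w : w \in Qmin (Qmin Q y) v' -> exists c : int, zdot w v' = c * m%:Z.
  move=> wQ; have [K0 HK] := Qmin_perturb Q y v'.
  have [c Ec] := div _ _ (HK K0 w (leqnn _) wQ); have [c' Ec'] := div _ _ (Qmin_memS wQ).
  exists (c - K0%:Z * c'); move: Ec; rewrite zdotDr zdotZr Ec' => Ec.
  by rewrite mulrBl -Ec; ring.
have [w1 w1Q] := Qmin_ex v Qy0; have [w2 w2Q] := Qmin_ex (- v) Qy0.
have [w1y min1] := QminP _ _ _ w1Q; have [w2y min2] := QminP _ _ _ w2Q.
have mp : 0 < m%:Z by rewrite ltz_nat (amp_gt0 amp).
have E12 : zdot w2 v = zdot w1 v.
  have [c1 e1] := divy _ _ w1Q; have [c2 e2] := divy _ _ w2Q.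
  have lt : zdot w2 v - zdot w1 v < m%:Z.
    by rewrite ltNge; apply/negP => le; apply: Hn; exists w2, w1.
  have ge : 0 <= zdot w2 v - zdot w1 v by rewrite subr_ge0 min1.
  have Ec : zdot w2 v - zdot w1 v = - (c1 + c2) * m%:Z.
    by rewrite mulNr mulrDl -e1 -e2 zdotNr; ring.
  move: lt ge; rewrite Ec -{2}[m%:Z]mul1r ltr_pM2r // pmulr_lge0 // => lt ge.
  have c0 : - (c1 + c2) = 0 by lia.
  by apply/eqP; rewrite -subr_eq0 Ec c0 mul0r.
have Qc w : w \in Qmin Q y -> zdot w v = zdot w1 v.
  move=> wQ; apply/eqP; rewrite eq_le min1 // andbT -E12.
  by have := min2 w wQ; rewrite !zdotNr lerN2.
have [t Ht L0] := leadF_neq0 y HQ Q0.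
(* The i-th coordinate of the limit point is a nonzero coordinate of t, as y has i-th coordinate 0.
   Acting by the subgroup of v at this s multiplies it by a factor other than 1. *)
have [s s_neq0 s1] := root_unity_avoid vi.
have Ht' : intorus (lam v s t) by apply: lam_torus.
have lead' : leadF Q h y (lam v s t) = s ^ zdot w1 v *: leadF Q h y t.
  rewrite /leadF scaler_sumr; apply: eq_big_seq => w wQ.
  by rewrite mon_lam // Qc // scalerA.
have L0' : leadF Q h y (lam v s t) != 0.
  by rewrite lead' scaler_eq0 negb_or L0 expfz_neq0.
have [d Hd] := coord_bound B y.
have [_ [a [_ pa Ha]]] := lead_lemma HQ mB Ht Hy (fun i _ => Hd i) L0 wyQ.
have [_ [a' [_ pa' Ha']]] := lead_lemma HQ mB Ht' Hy (fun i _ => Hd i) L0' wyQ.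
have Eq : nzf_pt a = nzf_pt a'.
  by apply: (amp_pt amp (c := s ^ zdot w1 v)); rewrite Ha Ha'.
move: Eq; rewrite pa pa' => /(kap_inj mB)/rowP/(_ i); rewrite !mxE yi !mul1r.
have tb := tob_torus B Ht i; have := tob_lam B v t i s_neq0; rewrite !mxE in tb * => ->.
by rewrite -[X in X = _]mul1r => /(mulIf tb) Es; rewrite -Es eqxx in s1.
Qed.

End TorusLead.

Section Bilinear.
Variables (k : fieldType) (n : nat).
Implicit Types (mu e : 'rV[k]_n) (v w : 'rV[int]_n) (B : 'M[int]_n).

Definition kv v : 'rV[k]_n := map_mx intr v.
Definition pair mu e : k := \sum_l mu 0 l * e 0 l.

Lemma pairC mu e : pair mu e = pair e mu.
Proof. by apply: eq_bigr => l _; rewrite mulrC. Qed.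

Lemma pairDr mu e e' : pair mu (e + e') = pair mu e + pair mu e'.
Proof. by rewrite -big_split; apply: eq_bigr => l _; rewrite mxE mulrDr. Qed.

Lemma pairZr mu c e : pair mu (c *: e) = c * pair mu e.
Proof. by rewrite mulr_sumr; apply: eq_bigr => l _; rewrite mxE mulrCA. Qed.

Lemma pair0r mu : pair mu 0 = 0.
Proof. by apply: big1 => l _; rewrite mxE mulr0. Qed.

Lemma pair_sumr mu I (s : seq I) (P : pred I) (F : I -> 'rV[k]_n) :
  pair mu (\sum_(i <- s | P i) F i) = \sum_(i <- s | P i) pair mu (F i).
Proof. exact: (big_morph (pair mu) (pairDr mu) (pair0r mu)). Qed.

Lemma pair_suml e I (s : seq I) (P : pred I) (F : I -> 'rV[k]_n) :
  pair (\sum_(i <- s | P i) F i) e = \sum_(i <- s | P i) pair (F i) e.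
Proof. by rewrite pairC pair_sumr; apply: eq_bigr => i _; rewrite pairC. Qed.

Lemma pairZl mu c e : pair (c *: mu) e = c * pair mu e.
Proof. by rewrite pairC pairZr pairC. Qed.

Lemma pair_kv w v : pair (kv w) (kv v) = (zdot w v)%:~R.
Proof. by rewrite rmorph_sum; apply: eq_bigr => l _; rewrite !mxE rmorphM. Qed.

Lemma pair_delta mu l : pair mu (delta_mx 0 l) = mu 0 l.
Proof.
rewrite /pair (bigD1 l) //= mxE !eqxx mulr1 big1 ?addr0 // => i /negPf il.
by rewrite mxE il andbF mulr0.
Qed.

Lemma kvN v : kv (- v) = - kv v.
Proof. by apply/rowP => i; rewrite !mxE rmorphN. Qed.

Lemma kvZ (c : int) v : kv (c *: v) = c%:~R *: kv v.
Proof. by apply/rowP => i; rewrite !mxE rmorphM. Qed.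

Lemma kv_sum I (s : seq I) (P : pred I) (F : I -> 'rV[int]_n) :
  kv (\sum_(i <- s | P i) F i) = \sum_(i <- s | P i) kv (F i).
Proof. by apply: big_morph => [v w|]; apply/rowP => i; rewrite !mxE ?rmorphD ?rmorph0. Qed.

Lemma kv_expand B e : B \in unitmx -> e = \sum_i pair (kv (dray B i)) e *: kv (ray B i).
Proof.
move=> uB; have H w : kv w = \sum_i pair (kv (dray B i)) (kv w) *: kv (ray B i).
  rewrite {1}(zray_expand w uB) kv_sum; apply: eq_bigr => i _.
  by rewrite kvZ pair_kv.
have kd l : kv (delta_mx 0 l) = delta_mx 0 l.
  by apply/rowP => i; rewrite !mxE; case: (_ && _).
rewrite {1}[e]row_sum_delta; under [RHS]eq_bigr => i _.
  rewrite {1}[e]row_sum_delta pair_sumr scaler_suml.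
  under eq_bigr do rewrite pairZr -scalerA.
  over.
rewrite exchange_big /=; apply: eq_bigr => l _.
by rewrite -scaler_sumr -kd -H.
Qed.

Lemma pair_expand B mu e : B \in unitmx ->
  pair mu e = \sum_i pair mu (kv (ray B i)) * pair (kv (dray B i)) e.
Proof.
move=> uB; rewrite {1}(kv_expand e uB) pair_sumr; apply: eq_bigr => i _.
by rewrite pairZr mulrC.
Qed.

Definition muB B (c : 'I_n -> k) : 'rV[k]_n := \sum_i c i *: kv (dray B i).

Lemma pair_muB B c e : pair (muB B c) e = \sum_i c i * pair (kv (dray B i)) e.
Proof. by rewrite pair_suml; apply: eq_bigr => i _; rewrite pairZl. Qed.

Lemma pair_muB_ray B c i : B \in unitmx -> pair (muB B c) (kv (ray B i)) = c i.
Proof.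
move=> uB; rewrite pair_muB (bigD1 i) //= pair_kv dray_ray // eqxx mulr1.
rewrite big1 ?addr0 // => l /negPf li.
by rewrite pair_kv dray_ray // li mulr0.
Qed.

End Bilinear.

Section Fan.
Variables (n : nat) (k : closedFieldType) (Sigma : set (set 'rV[rat]_n)).
Hypothesis fan_Sigma : is_fan Sigma.
Local Notation X := (toric_variety k Sigma).
Hypotheses (X_smooth : smooth X n) (X_projective : projective X).
Local Notation maxB := (maxB Sigma).
Implicit Types (a b v w y : 'rV[int]_n) (B : 'M[int]_n) (Q : seq 'rV[int]_n).

Definition cn B v := forall i, 0 <= zdot (dray B i) v.

Lemma cn_ray B i : B \in unitmx -> cn B (ray B i).
Proof. by move=> uB l; rewrite dray_ray // ler0n. Qed.

Lemma cnD B a b : cn B a -> cn B b -> cn B (a + b).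
Proof. by move=> Ha Hb i; rewrite zdotDr addr_ge0. Qed.

Lemma cn_sum B I (s : seq I) (P : pred I) (F : I -> 'rV[int]_n) :
  (forall i, P i -> cn B (F i)) -> cn B (\sum_(i <- s | P i) F i).
Proof. by move=> H i; rewrite zdot_sumr; apply: sumr_ge0 => l Pl; apply: H. Qed.

(** The cones meet in a face of [coneB B'], and a face contains the summands of its vectors. *)
Lemma face_in B B' a b : maxB B -> maxB B' -> cn B' a -> cn B' b -> cn B (a + b) -> cn B a.
Proof.
move=> [uB SB] [uB' SB'] /coneB_qv Ha /coneB_qv Hb /coneB_qv Hab.
have [p Hp E] := fan_face fan_Sigma SB' SB.
have : (coneB B' `&` coneB B) (qv (a + b)).
  by split=> //; apply/coneB_qv/cnD; apply/coneB_qv.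
rewrite E => -[_ /= ]; rewrite qvD pairingDr => E0.
have pa := Hp _ Ha; have pb := Hp _ Hb.
have : (coneB B' `&` coneB B) (qv a) by rewrite E; split=> //=; lra.
by case=> _ /coneB_qv.
Qed.

Lemma match_ray B B' i : maxB B -> maxB B' -> cn B' (ray B i) -> exists j, ray B' j = ray B i.
Proof. by move=> mB mB' /coneB_qv; apply: (ray_match fan_Sigma mB mB'). Qed.

Definition Qwide (m : nat) Q := forall B y v i, maxB B -> cn B y ->
  zdot (dray B i) y = 0 -> zdot (dray B i) v != 0 ->
  exists w1 w2, [/\ w1 \in Qmin Q y, w2 \in Qmin Q y & m%:Z <= zdot w1 v - zdot w2 v].

Lemma Qmin_comb Q a b w (c d : int) : 0 <= c -> 0 <= d -> w \in Qmin Q a -> w \in Qmin Q b ->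
  w \in Qmin Q (c *: a + d *: b).
Proof.
move=> c0 d0 /QminP[wQ Ha] /QminP[_ Hb]; apply/QminP; split=> // w' w'Q.
by rewrite !zdotDr !zdotZr lerD // ler_wpM2l // ?Ha ?Hb.
Qed.

Lemma cover_limit a b : exists B, [/\ maxB B, cn B a & exists K : nat, cn B (K%:Z *: a + b)].
Proof.
have [B mB HB] := maxB_cover2 fan_Sigma X_smooth X_projective a b.
exists B; split=> //; last by have [K _ /coneB_qv HK] := HB 0%N; exists K.
move=> i; rewrite leNgt; apply/negP => neg.
have [K le /coneB_qv/(_ i)] := HB (absz (zdot (dray B i) b)).+1.
rewrite zdotDr zdotZr; nia.
Qed.

(** Take a maximal cone with a and some K a + b. If b is outside, a positive combination z of a and
    b lies in the cone and on a facet. Exponents minimal on z are minimal on both a and b, so b - a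
    is constant on that face although it is transverse to the facet, against the width. *)
Lemma common_cone m Q a b w : (0 < m)%N -> Qwide m Q -> w \in Qmin Q a -> w \in Qmin Q b ->
  exists B, [/\ maxB B, cn B a & cn B b].
Proof.
move=> m0 QW wa wb; have [B [mB Ha [K HK]]] := cover_limit a b.
exists B; split=> // i0; rewrite leNgt; apply/negP => neg0.
pose A i : rat := (zdot (dray B i) a)%:~R; pose b' i : rat := (zdot (dray B i) b)%:~R.
have Apos i : zdot (dray B i) b < 0 -> 0 < zdot (dray B i) a.
  move=> neg; rewrite lt_neqAle Ha andbT; apply/eqP => E.
  by have := HK i; rewrite zdotDr zdotZr -E mulr0 add0r; lia.
(* The inequality of the facet [i] is the last one to become true when growing multiples of a are
   added to b. *)
have [i neg Hi] : exists2 i, zdot (dray B i) b < 0 & forall l, zdot (dray B l) b < 0 ->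
    - b' l / A l <= - b' i / A i.
  case: (@arg_maxP _ _ _ i0 (fun i => zdot (dray B i) b < 0) (fun i => - b' i / A i) neg0).
  by move=> i neg H; exists i.
set al := zdot (dray B i) a; set be := - zdot (dray B i) b.
have al0 : 0 < al by apply: Apos.
have be0 : 0 < be by rewrite oppr_gt0.
pose z := be *: a + al *: b.
have zi : zdot (dray B i) z = 0 by rewrite zdotDr !zdotZr -/al /be; ring.
have Hz : cn B z.
  move=> l; rewrite zdotDr !zdotZr; have al' := Ha l.
  have [bl|bl] := leP 0 (zdot (dray B l) b).
    by rewrite addr_ge0 // mulr_ge0 // ltW.
  have := Hi l bl; have al1 := Apos l bl.
  rewrite ler_pdivrMr ?ltr0z // mulrAC ler_pdivlMr ?ltr0z //.
  rewrite -!rmorphN -!rmorphM ler_int -/al -/be => E.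
  by rewrite -subr_ge0 -[X in X <= _](subrr (be * zdot (dray B l) a)); lia.
have vi : zdot (dray B i) (b - a) != 0.
  rewrite zdotBr -/al; have : zdot (dray B i) b = - be by rewrite /be opprK.
  by move=> ->; lia.
have wz : w \in Qmin Q z by apply: Qmin_comb => //; apply: ltW.
have [w1 [w2 [q1 q2 le]]] := QW B z (b - a) i mB Hz zi vi.
have cst w' : w' \in Qmin Q z -> zdot w' a = zdot w a /\ zdot w' b = zdot w b.
  move=> w'z; have := Qmin_eq wz w'z; have w'Q := Qmin_memS w'z.
  have [_ /(_ _ w'Q) la] := QminP _ _ _ wa; have [_ /(_ _ w'Q) lb] := QminP _ _ _ wb.
  rewrite !zdotDr !zdotZr => E; split; nia.
have [E1 E2] := cst _ q1; have [E3 E4] := cst _ q2.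
move: le; rewrite !zdotBr E1 E2 E3 E4; lia.
Qed.

(** Each a shares a cone with the sum of the other vectors; the cone that contains the total sum
    then contains a, by [face_in]. *)
Lemma common_all m Q w (l : seq 'rV[int]_n) : (0 < m)%N -> Qwide m Q ->
  (forall a, a \in l -> w \in Qmin Q a) -> w \in Q ->
  exists B, maxB B /\ forall a, a \in l -> cn B a.
Proof.
move=> m0 QW Hl wQ; pose A := \sum_(a <- l) a.
have [B mB /coneB_qv HB] := maxB_cover fan_Sigma X_smooth X_projective A.
exists B; split=> // a al.
have [l' Hl' sub] : exists2 l', A = a + \sum_(c <- l') c & {subset l' <= l}.
  exists (rem a l); last exact: mem_rem.
  by rewrite /A (perm_big _ (perm_to_rem al)) big_cons.
have w' : w \in Qmin Q (\sum_(c <- l') c).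
  elim: l' sub {Hl'} => [_|c l' IH sub]; first by rewrite big_nil Qmin0.
  rewrite big_cons -[c]scale1r -[\sum_(_ <- _) _]scale1r; apply: Qmin_comb => //.
    by apply/Hl/sub/mem_head.
  by apply: IH => c' c'l; apply: sub; rewrite in_cons c'l orbT.
have [B' [mB' Ba Bb]] := common_cone m0 QW (Hl a al) w'.
by apply: face_in mB mB' Ba Bb _; rewrite -Hl'.
Qed.

End Fan.

(** * The relation between a ray and the cone of its opposite *)

Section Combinatorics.
Variables (n : nat) (k : closedFieldType) (Sigma : set (set 'rV[rat]_n)).
Hypothesis fan_Sigma : is_fan Sigma.
Local Notation X := (toric_variety k Sigma).
Hypotheses (X_smooth : smooth X n) (X_projective : projective X).
Local Notation maxB := (maxB Sigma).
Implicit Types (a b v w y : 'rV[int]_n) (B : 'M[int]_n) (Q : seq 'rV[int]_n).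
Variables (m : nat) (D : set 'rV[k]_n).
Hypothesis m_gt0 : (0 < m)%N.

(** The bound on poles for every representative mu' of the restriction of mu to [D]; here [D] stands
    for the log directions of [E]. *)
Definition Qlow Q (mu : 'rV[k]_n) := forall (mu' : 'rV[k]_n) B v (d : nat),
  (forall e, D e -> pair mu' e = pair mu e) -> maxB B -> cn B v ->
  (forall i, pair mu' (kv k (ray B i)) != 0 -> zdot (dray B i) v <= d%:Z) ->
  forall w, w \in Q -> - (d * m)%:Z <= zdot w v.

Hypothesis QD : forall mu : 'rV[k]_n, (exists2 e, D e & pair mu e != 0) ->
  exists Q, [/\ Q != [::], Qlow Q mu & Qwide Sigma m Q].

Lemma Qlow_ray Q mu mu' B i w : (forall e, D e -> pair mu' e = pair mu e) -> Qlow Q mu ->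
  maxB B -> pair mu' (kv k (ray B i)) = 0 -> w \in Q -> 0 <= zdot w (ray B i).
Proof.
move=> E L mB mi wQ; have [uB _] := mB.
have := L mu' B (ray B i) 0%N E mB (cn_ray i uB) _ w wQ; rewrite mul0n oppr0; apply.
move=> l; rewrite dray_ray //; have [->|//] := eqVneq l i.
by rewrite mi eqxx.
Qed.

Lemma Qlow_ray1 Q mu B i w : Qlow Q mu -> maxB B -> w \in Q -> - m%:Z <= zdot w (ray B i).
Proof.
move=> L mB wQ; have [uB _] := mB.
have := L mu B (ray B i) 1%N (fun _ _ => erefl) mB (cn_ray i uB) _ w wQ.
by rewrite mul1n; apply=> l _; rewrite dray_ray //; case: eqP.
Qed.

(** The largest coordinate of a sum of two distinct rays is 1, so the bound is -m as for one ray,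
    and not -2m. *)
Lemma Qlow_ray2 Q mu B i l w : Qlow Q mu -> maxB B -> i != l -> w \in Q ->
  - m%:Z <= zdot w (ray B l + ray B i).
Proof.
move=> L mB il wQ; have [uB _] := mB.
have := L mu B (ray B l + ray B i) 1%N (fun _ _ => erefl) mB
  (cnD (cn_ray l uB) (cn_ray i uB)) _ w wQ.
rewrite mul1n; apply=> x _; rewrite zdotDr !dray_ray //.
have [->|_] := eqVneq x l; first by rewrite eq_sym (negPf il) addr0.
by rewrite add0r; case: eqP.
Qed.

(** The values of the exponents on the ray are at least -m and spread over at least m. *)
Lemma Qwide_ray Q mu B i w : Qlow Q mu -> Qwide Sigma m Q -> maxB B ->
  w \in Qmin Q (- ray B i) -> 0 <= zdot w (ray B i).
Proof.
move=> L W mB wQ; have [uB _] := mB.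
have [|||w1 [w2 []]] := W B 0 (ray B i) i mB.
- by move=> l; rewrite zdot0r.
- exact: zdot0r.
- by rewrite dray_ray // eqxx.
rewrite Qmin0 => w1Q w2Q; have := Qlow_ray1 i L mB w2Q.
by have [_ /(_ _ w1Q)] := QminP _ _ _ wQ; rewrite !zdotNr; lia.
Qed.

Lemma Qwide_ray0 Q mu B i w : Qlow Q mu -> Qwide Sigma m Q -> maxB B ->
  pair mu (kv k (ray B i)) = 0 ->
  w \in Qmin Q (- ray B i) -> m%:Z <= zdot w (ray B i).
Proof.
move=> L W mB mi wQ; have [uB _] := mB.
have [|||w1 [w2 []]] := W B 0 (ray B i) i mB.
- by move=> l; rewrite zdot0r.
- exact: zdot0r.
- by rewrite dray_ray // eqxx.
rewrite Qmin0 => w1Q w2Q; have := Qlow_ray (fun _ _ => erefl) L mB mi w2Q.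
by have [_ /(_ _ w1Q)] := QminP _ _ _ wQ; rewrite !zdotNr; lia.
Qed.

Section Opposite.
Variables (B0 B : 'M[int]_n) (i0 : 'I_n).
Hypotheses (mB0 : maxB B0) (mB : maxB B).
Let u0 := ray B0 i0.
Let u i := ray B i.
Let c i := zdot (dray B i) (- u0).
Hypothesis c_ge0 : forall i, 0 <= c i.
Let uB : B \in unitmx := proj1 mB.
Let uB0 : B0 \in unitmx := proj1 mB0.
Let ec i (e : 'rV[k]_n) := pair (kv k (dray B i)) e.

Lemma opp_rel w : zdot w u0 + \sum_i c i * zdot w (u i) = 0.
Proof.
apply/eqP; rewrite addrC addr_eq0 -zdotNr (zdot_expand w (- u0) uB).
by apply/eqP/eq_bigr => i _; rewrite mulrC.
Qed.

Lemma opp_kv mu : pair mu (kv k u0) = - \sum_i (c i)%:~R * pair mu (kv k (u i)).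
Proof.
rewrite -[u0]opprK kvN -scaleN1r pairZr mulN1r; congr (- _).
rewrite {1}(zray_expand (- u0) uB) kv_sum pair_sumr; apply: eq_bigr => i _.
by rewrite kvZ pairZr.
Qed.

(** The form dual to u_i vanishes on u_0 and on every ray in the relation. If it were nonzero on
    [D], all exponents would be nonnegative on these rays, the relation would make them 0 on u_0,
    and [Q] would have width 0 in that direction. *)
Lemma opp_span i e : D e -> c i = 0 -> ec i e = 0.
Proof.
move=> De ci; apply/eqP; apply: contraT => nz.
have [|Q [Q0 L W]] := @QD (kv k (dray B i)); first by exists e.
have mu_u l : l != i -> pair (kv k (dray B i)) (kv k (u l)) = 0.
  by move=> li; rewrite pair_kv dray_ray // eq_sym (negPf li).
have mu_u0 : pair (kv k (dray B i)) (kv k u0) = 0.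
  rewrite opp_kv big1 ?oppr0 // => l _; have [->|li] := eqVneq l i.
    by rewrite ci mul0r.
  by rewrite mu_u // mulr0.
have u0Q w : w \in Q -> zdot w u0 = 0.
  move=> wQ; have p0 := Qlow_ray (fun _ _ => erefl) L mB0 mu_u0 wQ.
  have pl : 0 <= \sum_l c l * zdot w (u l).
    apply: sumr_ge0 => l _; have [->|li] := eqVneq l i; first by rewrite ci mul0r.
    by rewrite mulr_ge0 //; apply: (Qlow_ray (fun _ _ => erefl) L mB (mu_u _ li) wQ).
  by have := opp_rel w; move: p0 pl; rewrite -/u0; lia.
have [|||w1 [w2 []]] := W B0 0 u0 i0 mB0.
- by move=> l; rewrite zdot0r.
- exact: zdot0r.
- by rewrite dray_ray // eqxx.
by rewrite Qmin0 => /u0Q -> /u0Q ->; rewrite subrr lez_nat leqNgt m_gt0.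
Qed.

Lemma u_neq_u0 x : u x <> u0.
Proof.
move=> E; have := c_ge0 x; rewrite /c zdotNr -E dray_ray // eqxx.
by [].
Qed.

(** The form dual to u_0 in [B'] kills the other rays of the relation, which leaves 1 plus c_i times
    an integer equal to 0. *)
Lemma opp_one i B' : maxB B' -> 0 < c i -> cn B' u0 -> cn B' (- u i) ->
  (forall x, x != i -> 0 < c x -> cn B' (u x)) -> c i = 1.
Proof.
move=> mB' ci h0 hi hx; have [uB' _] := mB'; have [q Eq] := match_ray fan_Sigma mB0 mB' h0.
have := opp_rel (dray B' q); rewrite (bigD1 i) //= [u0](esym Eq) dray_ray // eqxx.
rewrite [X in _ + (_ + X)]big1 => [|x xi]; last first.
  have [->|cx] := eqVneq (c x) 0; first by rewrite mul0r.
  have cx0 : 0 < c x by rewrite lt_neqAle eq_sym cx c_ge0.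
  have [q' Eq'] := match_ray fan_Sigma mB mB' (hx x xi cx0).
  rewrite /u -Eq' dray_ray //; have [E|] := eqVneq q q'; last by rewrite mulr0.
  by case: (@u_neq_u0 x); rewrite /u -Eq' -E Eq.
rewrite addr0; have := hi q; rewrite zdotNr.
move: (c i) ci (zdot (dray B' q) (u i)) => a a0 z z0 E.
have z1 : z <= -1 by nia.
suff : a <= 1 by lia.
rewrite -(ler_pM2r (x := - z)); nia.
Qed.

Section Pair.
Variables (i l : 'I_n) (e : 'rV[k]_n).
Hypotheses (il : i != l) (De : D e) (ci : 0 < c i) (cl : 0 < c l).
Let li : l != i. Proof. by rewrite eq_sym. Qed.
Hypothesis nz : (c l)%:~R * ec i e - (c i)%:~R * ec l e != 0.
(** By the choice of its two values this form also vanishes on u_0, and [nz] says that it does not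
    vanish on e. *)
Let mu : 'rV[k]_n := muB B (fun x => if x == i then (c l)%:~R else
  if x == l then - (c i)%:~R else 0 : k).

Lemma mu_nz : exists2 e, D e & pair mu e != 0.
Proof.
exists e => //; rewrite pair_muB (bigD1 i) //= (bigD1 l) ?li //= eqxx.
rewrite (negPf li) eqxx big1 ?addr0 ?mulNr // => x /andP[/negPf -> /negPf ->].
by rewrite mul0r.
Qed.

Lemma mu_ux x : x != i -> x != l -> pair mu (kv k (u x)) = 0.
Proof. by move=> /negPf xi /negPf xl; rewrite pair_muB_ray // xi xl. Qed.

Lemma mu_u0 : pair mu (kv k u0) = 0.
Proof.
rewrite opp_kv (bigD1 i) //= (bigD1 l) ?li //= !pair_muB_ray // eqxx.
rewrite (negPf li) eqxx big1 ?addr0; last first.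
  by move=> x /andP[xi xl]; rewrite mu_ux // mulr0.
by rewrite mulrN mulrC subrr oppr0.
Qed.

Lemma rel_split w : zdot w u0 + (c l * zdot w (u l) + c i * zdot w (u i)) +
  \sum_(x | (x != i) && (x != l)) c x * zdot w (u x) = 0.
Proof.
transitivity (zdot w u0 + \sum_x c x * zdot w (u x)); last exact: opp_rel.
rewrite [in RHS](bigD1 i) //= [in RHS](bigD1 l) ?li //=.
by rewrite -!addrA; congr (_ + _); rewrite addrCA.
Qed.

(** Let w be an exponent with maximal value M on u_i. The width, in the direction u_i, of the face
    minimal on u_l, and the bound -m on u_l + u_i, show that all exponents are at least -M on u_l.
    As c_l <= c_i, the relation at w has no slack, so w is minimal on u_0, on -u_i and on the other
    rays of the relation. *)
Lemma pair_i : c l <= c i -> exists B', [/\ maxB B', cn B' u0, cn B' (- u i) &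
  forall x, x != i -> 0 < c x -> cn B' (u x)].
Proof.
move=> cli; have [Q [Q0 L W]] := QD mu_nz; have [w wQi] := Qmin_ex (- u i) Q0.
have wQ := Qmin_memS wQi.
have M0 : 0 <= zdot w (u i) := Qwide_ray L W mB wQi.
have p0 : forall w', w' \in Q -> 0 <= zdot w' u0.
  by move=> w'; apply: (Qlow_ray (fun _ _ => erefl) L mB0 mu_u0).
have px x : x != i -> x != l -> forall w', w' \in Q -> 0 <= zdot w' (u x).
  by move=> xi xl w'; apply: (Qlow_ray (fun _ _ => erefl) L mB (mu_ux xi xl)).
have lowl w' : w' \in Q -> - zdot w (u i) <= zdot w' (u l).
  move=> w'Q; have [|||w1 [w2 [q1 q2 le]]] := W B (u l) (u i) i mB.
  - exact: cn_ray.
  - by rewrite dray_ray // (negPf il).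
  - by rewrite dray_ray // eqxx.
  have [w1Q _] := QminP _ _ _ q1; have [w2Q /(_ _ w'Q)] := QminP _ _ _ q2.
  apply: le_trans; have := Qlow_ray2 L mB il w2Q; rewrite zdotDr -/(u l) -/(u i).
  by have [_ /(_ _ w1Q)] := QminP _ _ _ wQi; rewrite !zdotNr; lia.
have sx : 0 <= \sum_(x | (x != i) && (x != l)) c x * zdot w (u x).
  by apply: sumr_ge0 => x /andP[xi xl]; rewrite mulr_ge0 //; apply: px.
have := rel_split w; have := p0 w wQ; have := lowl w wQ => h1 h2 h3.
have w0 : zdot w u0 = 0 by nia.
have wl : zdot w (u l) = - zdot w (u i) by nia.
have s0 : \sum_(x | (x != i) && (x != l)) c x * zdot w (u x) = 0 by nia.
have wx x : x != i -> x != l -> 0 < c x -> zdot w (u x) = 0.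
  move=> xi xl cx; move/eqP: s0; rewrite psumr_eq0 => [/allP/(_ x)|y /andP[yi yl]].
    by rewrite mem_index_enum xi xl mulf_eq0 gt_eqF //= => /(_ isT)/eqP.
  by rewrite mulr_ge0 //; apply: px.
have [|B' [mB' HB']] := common_all (l := [:: u0, - u i & [seq u x | x <- enum 'I_n & (x != i) && (0 < c x)]])
  fan_Sigma X_smooth X_projective m_gt0 W _ wQ; last first.
  exists B'; split=> //.
  - by apply: HB'; rewrite mem_head.
  - by apply: HB'; rewrite !in_cons eqxx orbT.
  - move=> x xi cx; apply: HB'; rewrite !in_cons; apply/orP; right; apply/orP; right.
    by apply: map_f; rewrite mem_filter xi cx mem_enum.
move=> a; rewrite !in_cons => /or3P[/eqP->|/eqP-> //|/mapP[x]].
  by apply/QminP; split=> // w'; rewrite w0; apply: p0.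
rewrite mem_filter => /andP[/andP[xi cx] _] ->; apply/QminP; split=> // w' w'Q.
have [->|xl] := eqVneq x l; first by rewrite wl; apply: lowl.
by rewrite wx //; apply: px.
Qed.

(** Here mu vanishes on u_j, so the maximum on u_j is at least m, while u_l + u_i contributes at
    least -m. The relation is tight: c_j = 1, and the maximising exponent is minimal on u_0, on u_l
    + u_i and on the other rays of the relation. *)
Lemma pair_j j : c i = 1 -> c l = 1 -> j != i -> j != l -> 0 < c j ->
  c j = 1 /\ exists B', [/\ maxB B', cn B' u0 & forall x, x != j -> 0 < c x -> cn B' (u x)].
Proof.
move=> ci1 cl1 ji jl cj; have [Q [Q0 L W]] := QD mu_nz; have [w wQj] := Qmin_ex (- u j) Q0.
have wQ := Qmin_memS wQj.
have M0 : m%:Z <= zdot w (u j) := Qwide_ray0 L W mB (mu_ux ji jl) wQj.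
have p0 : forall w', w' \in Q -> 0 <= zdot w' u0.
  by move=> w'; apply: (Qlow_ray (fun _ _ => erefl) L mB0 mu_u0).
have px x : x != i -> x != l -> forall w', w' \in Q -> 0 <= zdot w' (u x).
  by move=> xi xl w'; apply: (Qlow_ray (fun _ _ => erefl) L mB (mu_ux xi xl)).
have lowil w' : w' \in Q -> - m%:Z <= zdot w' (u l + u i) by apply: (Qlow_ray2 L mB il).
have := rel_split w; rewrite ci1 cl1 !mul1r -zdotDr.
rewrite (bigD1 j) ?ji ?jl //=; set s := \sum_(x | _) _.
have s_ge0 : 0 <= s.
  by apply: sumr_ge0 => x /andP[/andP[xi xl] _]; rewrite mulr_ge0 //; apply: px.
have := p0 w wQ; have := lowil w wQ => h1 h2 h3.
have mp : 0 < m%:Z by rewrite ltz_nat.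
have cj1 : c j = 1 by nia.
have w0 : zdot w u0 = 0 by nia.
have wil : zdot w (u l + u i) = - m%:Z by nia.
have s0 : s = 0 by nia.
split=> //.
have wx x : x != i -> x != l -> x != j -> 0 < c x -> zdot w (u x) = 0.
  move=> xi xl xj cx; move/eqP: s0; rewrite psumr_eq0 => [/allP/(_ x)|y /andP[/andP[yi yl] _]].
    by rewrite mem_index_enum xi xl xj mulf_eq0 gt_eqF //= => /(_ isT)/eqP.
  by rewrite mulr_ge0 //; apply: px.
have [|B' [mB' HB']] := common_all (l := [:: u0, u l + u i &
    [seq u x | x <- enum 'I_n & [&& x != i, x != l, x != j & 0 < c x]]])
  fan_Sigma X_smooth X_projective m_gt0 W _ wQ; last first.
  exists B'; split=> //.
    by apply: HB'; rewrite mem_head.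
  have Hli : cn B' (u l + u i) by apply: HB'; rewrite !in_cons eqxx orbT.
  move=> x xj cx; have [->|xi] := eqVneq x i.
    by apply: (face_in fan_Sigma mB' mB (cn_ray i uB) (cn_ray l uB)); rewrite addrC.
  have [->|xl] := eqVneq x l.
    exact: (face_in fan_Sigma mB' mB (cn_ray l uB) (cn_ray i uB)).
  apply: HB'; rewrite !in_cons; apply/orP; right; apply/orP; right.
  by apply: map_f; rewrite mem_filter xi xl xj cx mem_enum.
move=> a; rewrite !in_cons => /or3P[/eqP->|/eqP->|/mapP[x]].
- by apply/QminP; split=> // w'; rewrite w0; apply: p0.
- by apply/QminP; split=> // w'; rewrite wil; apply: lowil.
rewrite mem_filter => /andP[/and4P[xi xl xj cx] _] ->; apply/QminP; split=> // w' w'Q.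
by rewrite wx //; apply: px.
Qed.

End Pair.

End Opposite.

End Combinatorics.

Section FanPn.
Variables (n : nat) (k : closedFieldType) (Sigma : set (set 'rV[rat]_n)).
Hypothesis fan_Sigma : is_fan Sigma.
Local Notation X := (toric_variety k Sigma).
Hypotheses (X_smooth : smooth X n) (X_projective : projective X).
Local Notation maxB := (maxB Sigma).
Implicit Types (a b v w y : 'rV[int]_n) (B : 'M[int]_n) (Q : seq 'rV[int]_n).
Variables (m : nat) (D : set 'rV[k]_n).
Hypothesis m_gt0 : (0 < m)%N.
Hypothesis QD : forall mu : 'rV[k]_n, (exists2 e, D e & pair mu e != 0) ->
  exists Q, [/\ Q != [::], Qlow Sigma m D Q mu & Qwide Sigma m Q].
Hypothesis D_neq0 : exists2 e, D e & e != 0.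

Lemma coord_neq0 B (e : 'rV[k]_n) : B \in unitmx -> e != 0 ->
  exists i, pair (kv k (dray B i)) e != 0.
Proof.
move=> uB e0; apply: contrapT => H; move: e0; rewrite (kv_expand e uB) big1 ?eqxx // => i _.
have [->|nz] := eqVneq (pair (kv k (dray B i)) e) 0; first by rewrite scale0r.
by case: H; exists i.
Qed.

(** For n > 1 the index i0 can avoid a nonzero coordinate of e, so e is not proportional to u_0 over
    k. Some 2 x 2 minor of e against the coefficients c is then nonzero, and [pair_i] and [pair_j]
    apply, with the larger coefficient in the role of c_i. *)
Lemma fan_dependent : (1 < n)%N -> exists B0 i0 B, [/\ maxB B0, maxB B,
  forall i, zdot (dray B i) (- ray B0 i0) = 0 \/ zdot (dray B i) (- ray B0 i0) = 1 &
  forall i, zdot (dray B i) (- ray B0 i0) = 1 -> exists B', [/\ maxB B', cn B' (ray B0 i0) &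
    forall x, x != i -> 0 < zdot (dray B x) (- ray B0 i0) -> cn B' (ray B x)]].
Proof.
move=> n1; have [e De e0] := D_neq0.
have [B0 mB0 _] := maxB_cover fan_Sigma X_smooth X_projective 0; have [uB0 _] := mB0.
have [i' Hi'] := coord_neq0 uB0 e0.
have [i0 i0i'] : exists i0, i0 != i'.
  have : (0 < #|predC1 i'|)%N by rewrite cardC1 card_ord; lia.
  by move=> /card_gt0P[i0]; exists i0.
have [B mB /coneB_qv c0] := maxB_cover fan_Sigma X_smooth X_projective (- ray B0 i0).
have [uB _] := mB; exists B0, i0, B.
pose c i := zdot (dray B i) (- ray B0 i0); pose ec i := pair (kv k (dray B i)) e.
have span i : c i = 0 -> ec i = 0.
  exact: (opp_span m_gt0 QD mB0 mB c0 De).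
have [[i l] nz] : exists p : 'I_n * 'I_n, (c p.2)%:~R * ec p.1 - (c p.1)%:~R * ec p.2 != 0 :> k.
  apply: contrapT => H; have {}H i l : (c l)%:~R * ec i = (c i)%:~R * ec l :> k.
    apply/eqP; rewrite -subr_eq0; apply: contraT => Hn.
    by case: H; exists (i, l).
  (* Not all coefficients vanish in k: pairing the relation with the form dual to u_0 gives 1. *)
  have [x cx] : exists x, (c x)%:~R != 0 :> k.
    apply: contrapT => Hx; have := opp_kv B0 i0 mB (kv k (dray B0 i0)).
    rewrite pair_kv dray_ray // eqxx big1 ?oppr0 => [/eqP|x _].
      by rewrite oner_eq0.
    have [E|E] := eqVneq ((c x)%:~R : k) 0; first by rewrite /c in E; rewrite E mul0r.
    by case: Hx; exists x.
  have ecE i : ec i = (c i)%:~R * (ec x / (c x)%:~R).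
    by apply: (mulfI cx); rewrite H mulrCA; congr (_ * _); rewrite mulrC divfK.
  move: Hi'; rewrite (kv_expand e uB) -/(ec _).
  rewrite (eq_bigr (fun i => (ec x / (c x)%:~R) *: ((c i)%:~R *: kv k (ray B i)))); last first.
    by move=> i _; rewrite scalerA -/(ec i) ecE mulrC.
  rewrite -scaler_sumr pairZr.
  have -> : pair (kv k (dray B0 i')) (\sum_i (c i)%:~R *: kv k (ray B i)) =
      - pair (kv k (dray B0 i')) (kv k (ray B0 i0)).
    rewrite (opp_kv B0 i0 mB) opprK pair_sumr.
    by apply: eq_bigr => i _; rewrite pairZr.
  by rewrite pair_kv dray_ray // (eq_sym i') (negPf i0i') oppr0 mulr0 eqxx.
move: nz; rewrite /= => nz.
have c_pos x : c x != 0 -> 0 < c x by move=> cx; rewrite lt_neqAle eq_sym cx c0.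
have {i l nz} [i [l [nz cl ci cli il]]] : exists i l, [/\ (c l)%:~R * ec i - (c i)%:~R * ec l != 0,
    0 < c l, 0 < c i, c l <= c i & i != l].
  have il : i != l by apply: contraNneq nz => ->; rewrite subrr.
  have cl : 0 < c l.
    by apply: c_pos; apply: contraNneq nz => E; rewrite (span l) // E mul0r mulr0 subrr.
  have ci : 0 < c i.
    by apply: c_pos; apply: contraNneq nz => E; rewrite (span i) // E mul0r mulr0 subrr.
  have [le|lt] := leP (c l) (c i); first by exists i, l.
  exists l, i; split=> //; [|exact: ltW|by rewrite eq_sym].
  by rewrite -opprB oppr_eq0.
have li : l != i by rewrite eq_sym.
have [Bi [mBi h0 hi hx]] := pair_i fan_Sigma X_smooth X_projective m_gt0 QD mB0 mB c0 il De ci cl nz cli.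
have ci1 := opp_one fan_Sigma m_gt0 mB0 mB c0 mBi ci h0 hi hx.
have cl1 : c l = 1 by move: cl cli; rewrite /c ci1; lia.
have nz' : (c i)%:~R * ec l - (c l)%:~R * ec i != 0 by rewrite -opprB oppr_eq0.
have [|Bl [mBl g0 gl gx]] := pair_i fan_Sigma X_smooth X_projective m_gt0 QD mB0 mB c0 li De cl ci nz'.
  by rewrite -/(c i) -/(c l) cl1 /c ci1.
have Hj x := pair_j fan_Sigma X_smooth X_projective m_gt0 QD mB0 mB c0 il De ci cl nz (j := x) ci1 cl1.
have alt x : 0 < c x -> c x = 1 /\ exists B', [/\ maxB B', cn B' (ray B0 i0) &
    forall z, z != x -> 0 < c z -> cn B' (ray B z)].
  move=> cx; have [->|xi] := eqVneq x i; first by split=> //; exists Bi.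
  have [->|xl] := eqVneq x l; first by split=> //; exists Bl.
  exact: Hj.
split=> // x => [|cx].
  have [E|cx] := eqVneq (c x) 0; first by left.
  by right; have [] := alt x (c_pos x cx).
by have [] := alt x; rewrite /c cx.
Qed.

End FanPn.

Section FanFull.
Variables (n : nat) (k : closedFieldType) (Sigma : set (set 'rV[rat]_n)).
Hypothesis fan_Sigma : is_fan Sigma.
Local Notation X := (toric_variety k Sigma).
Hypotheses (X_smooth : smooth X n) (X_projective : projective X).
Local Notation maxB := (maxB Sigma).
Implicit Types (a b v w y : 'rV[int]_n) (B : 'M[int]_n) (Q : seq 'rV[int]_n).
Variables (m : nat) (D : set 'rV[k]_n).
Hypothesis m_gt0 : (0 < m)%N.
Hypothesis QD : forall mu : 'rV[k]_n, (exists2 e, D e & pair mu e != 0) ->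
  exists Q, [/\ Q != [::], Qlow Sigma m D Q mu & Qwide Sigma m Q].
Hypothesis D_neq0 : exists2 e, D e & e != 0.

Section Full.
Variables (B0 B : 'M[int]_n) (i0 : 'I_n).
Hypotheses (mB0 : maxB B0) (mB : maxB B).
Let u0 := ray B0 i0.
Let c i := zdot (dray B i) (- u0).
Hypothesis c01 : forall i, c i = 0 \/ c i = 1.
Hypothesis facet : forall i, c i = 1 -> exists B', [/\ maxB B', cn B' u0 &
  forall x, x != i -> 0 < c x -> cn B' (ray B x)].
Let uB : B \in unitmx := proj1 mB.
Let c_ge0 i : 0 <= c i. Proof. by case: (c01 i) => ->. Qed.

(** The circuit consists of the rays in the relation, all with coefficient 1: [None] is u_0 and
    [Some x] is the ray x of [B]. *)
Definition circuit_mem (o : option 'I_n) : bool := if o is Some x then c x == 1 else true.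
Definition circuit_ray (o : option 'I_n) : 'rV[int]_n := if o is Some x then ray B x else u0.
Local Notation T := circuit_mem.
Local Notation uu := circuit_ray.

Lemma circuit_sum w : zdot w u0 + \sum_(x | c x == 1) zdot w (ray B x) = 0.
Proof.
rewrite -[RHS](opp_rel B0 i0 mB w) [in RHS](bigID (fun x => c x == 1)) /=.
rewrite [X in _ = _ + (_ + X)]big1 ?addr0 => [|x].
  by congr (_ + _); apply: eq_bigr => x /eqP; rewrite /c => ->; rewrite mul1r.
by move=> cx; have [|E] := c01 x; [rewrite /c => ->; rewrite mul0r|rewrite E in cx].
Qed.

Lemma circuit_le0 i w : T i -> (forall o, T o -> o != i -> 0 <= zdot w (uu o)) ->
  zdot w (uu i) <= 0.
Proof.
move=> Ti H; have := circuit_sum w; case: i Ti H => [x cx|_] H /=.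
  rewrite (bigD1 x) //= => E; have h0 := H None isT isT.
  have : 0 <= \sum_(y | (c y == 1) && (y != x)) zdot w (ray B y).
    by apply: sumr_ge0 => y /andP[cy yx]; apply: (H (Some y)).
  move: h0 E; rewrite /circuit_ray -/u0.
  by move: (zdot w u0) (zdot w (ray B x)) (\sum_(y | _) _) => p q s; lia.
have : 0 <= \sum_(x | c x == 1) zdot w (ray B x).
  by apply: sumr_ge0 => x cx; apply: (H (Some x)).
by rewrite -/u0; move: (zdot w u0) (\sum_(x | _) _) => p s; lia.
Qed.

Lemma circuit_eq0 i w : T i -> (forall o, T o -> o != i -> zdot w (uu o) = 0) ->
  zdot w (uu i) = 0.
Proof.
move=> Ti H; apply/eqP; rewrite eq_le circuit_le0 //=; last by move=> o To oi; rewrite H.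
rewrite -oppr_le0 -zdotNl; apply: circuit_le0 => // o To oi.
by rewrite zdotNl H // oppr0.
Qed.

Lemma circuit_facet i : T i -> exists B', maxB B' /\
  forall o, T o -> o != i -> exists q, ray B' q = uu o.
Proof.
case: i => [x|_] /= => [/eqP cx|]; last first.
  by exists B; split=> // -[x|] //= _ _; exists x.
have [B' [mB' h0 hx]] := facet cx; exists B'; split=> // -[y|] /= => [/eqP cy yx|_ _].
  by apply: (match_ray fan_Sigma mB mB'); apply: hx => //; rewrite cy.
exact: (match_ray fan_Sigma mB0 mB').
Qed.

Lemma ray_neq (x z : 'I_n) : x != z -> ray B x != ray B z.
Proof.
move=> xy; apply: contra_neq xy => /(congr1 (zdot (dray B x))).
by rewrite !dray_ray // eqxx; case: eqP.
Qed.

(** Suppose v1 = u_i is outside the circuit. A relation between v1, the circuit and rays of a cone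
    [B2] is normalised to have nonnegative coefficients, with 0 at one circuit ray l0. A form that
    is nonzero on [D] and, within the circuit, only on l0 and one more ray io, makes all terms
    nonnegative at exponents maximal on the ray of io. So these are 0 on v1, against the width of
    that face. *)
Lemma circuit_full i : c i = 1.
Proof.
apply: contrapT => ci1; have ci : c i = 0 by case: (c01 i).
have [e De e0] := D_neq0.
have span x (e' : 'rV[k]_n) : D e' -> c x != 1 -> pair (kv k (dray B x)) e' = 0.
  move=> De' cx; apply: (opp_span m_gt0 QD mB0 mB c_ge0 De').
  by case: (c01 x) => // E; rewrite E in cx.
set v1 := ray B i.
(* [B2] contains -u_0, hence all rays of the circuit other than u_0, and also K (-u_0) - v1, whose
   coordinates there are [nn]. *)
have [B2 [mB2 H0 [K HK]]] := cover_limit fan_Sigma X_smooth X_projective (- u0) (- v1).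
have [uB2 _] := mB2.
have in2 x : c x = 1 -> cn B2 (ray B x).
  move=> cx; apply: (face_in fan_Sigma mB2 mB (cn_ray x uB) (b := - u0 - ray B x)).
    move=> l; rewrite zdotBr dray_ray //; have [->|lx] := eqVneq l x.
      by rewrite -/(c x) cx.
    by rewrite subr0; apply: c_ge0.
  by rewrite addrC subrK.
pose nn q := zdot (dray B2 q) (K%:Z *: - u0 - v1).
have nn0 q : 0 <= nn q := HK q.
pose R q := [exists x, (c x == 1) && (ray B2 q == ray B x)].
pose N x := \sum_(q | ray B2 q == ray B x) nn q.
have rel1 w : zdot w v1 + \sum_(q | ~~ R q) nn q * zdot w (ray B2 q) +
    \sum_(x | c x == 1) N x * zdot w (ray B x) = - (K%:Z * zdot w u0).
  have E1 : \sum_(x | c x == 1) N x * zdot w (ray B x) =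
      \sum_(q | R q) nn q * zdot w (ray B2 q).
    under eq_bigr do rewrite mulr_suml.
    rewrite (exchange_big_dep R) /= => [|x q cx E]; last by apply/existsP; exists x; rewrite cx.
    apply: eq_bigr => q /existsP[x /andP[cx /eqP E]]; rewrite (bigD1 x) /=; last by rewrite cx E eqxx.
    rewrite big1 ?addr0 ?E // => z /andP[/andP[_ /eqP E'] zx].
    by move: (ray_neq zx); rewrite E' eqxx.
  have E2 : \sum_q nn q * zdot w (ray B2 q) = zdot w (K%:Z *: - u0 - v1).
    by rewrite (zdot_expand w _ uB2); apply: eq_bigr => q _; rewrite mulrC.
  move: E2; rewrite (bigID R) /= -E1 zdotBr zdotZr zdotNr => E2.
  by rewrite -addrA [X in _ + X]addrC E2; ring.
pose kap0 o := if o is Some x then N x - K%:Z else 0.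
have [l0 Tl0 Hl0] : exists2 l0, T l0 & forall o, T o -> kap0 l0 <= kap0 o.
  case: (@arg_minP _ _ _ None T kap0 isT) => l0 T0 H; by exists l0.
(* Subtracting [kp] times the circuit relation makes the smallest coefficient, the one at l0, equal
   to 0. *)
set kp := kap0 l0.
have rel2 w : zdot w v1 + \sum_(q | ~~ R q) nn q * zdot w (ray B2 q) +
    (0 - kp) * zdot w u0 +
    \sum_(x | c x == 1) (N x - K%:Z - kp) * zdot w (ray B x) = 0.
  under [X in _ + X]eq_bigr do rewrite -addrA mulrDl.
  rewrite big_split /= -mulr_sumr.
  have -> : \sum_(x | c x == 1) zdot w (ray B x) = - zdot w u0.
    by apply/eqP; rewrite -addr_eq0 addrC circuit_sum.
  rewrite -[RHS](addNr (K%:Z * zdot w u0)) -rel1.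
  by ring.
have [Bl [mBl Hl]] := circuit_facet Tl0; have [uBl _] := mBl.
have [q Hq] := coord_neq0 uBl e0.
have [io [Tio iol Eio]] : exists o, [/\ T o, o != l0 & uu o = ray Bl q].
  apply: contrapT => Hn; move: Hq; suff -> : pair (kv k (dray Bl q)) e = 0 by rewrite eqxx.
  have H1 o : T o -> zdot (dray Bl q) (uu o) = 0.
    have H2 o' : T o' -> o' != l0 -> zdot (dray Bl q) (uu o') = 0.
      move=> To' ol; have [q' Eq'] := Hl o' To' ol; rewrite -Eq' dray_ray //.
      by have [Eq|//] := eqVneq q q'; case: Hn; exists o'; rewrite Eq Eq'.
    by move=> To; have [->|ol] := eqVneq o l0; [apply: circuit_eq0|apply: H2].
  rewrite (pair_expand _ _ uB) big1 // => x _; have [cx|cx] := eqVneq (c x) 1.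
    by rewrite pair_kv (H1 (Some x)) ?mul0r //= cx.
  by rewrite (span x) ?mulr0.
pose mu := kv k (dray Bl q).
have mu0 o : T o -> o != l0 -> o != io -> exists2 q', uu o = ray Bl q' & pair mu (kv k (ray Bl q')) = 0.
  move=> To ol oio; have [q' Eq'] := Hl o To ol; exists q' => //.
  rewrite pair_kv dray_ray //; have [Eq|//] := eqVneq q q'.
  have E : uu o = uu io by rewrite Eio Eq.
  case: o io To ol oio E {Eq' Eio Hl iol} Tio => [x|] [y|] //= cx _ xy E cy.
  - by have /eqP[] : ray B x != ray B y by apply: ray_neq; apply: contra_neq xy => ->.
  - by case: (u_neq_u0 mB c_ge0 E).
  - by case: (u_neq_u0 mB c_ge0 (esym E)).
have [|Q [Q0 L W]] := @QD mu; first by exists e.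
have v1_0 w : w \in Qmin Q (- uu io) -> zdot w v1 = 0.
  move=> wQi; have wQ := Qmin_memS wQi.
  have u_ge0 o : T o -> o != l0 -> 0 <= zdot w (uu o).
    move=> To ol; have [Eo|oio] := eqVneq o io.
      by rewrite Eo Eio; apply: (Qwide_ray m_gt0 L W mBl); rewrite -Eio.
    by have [q' -> E] := mu0 o To ol oio; apply: (Qlow_ray (fun _ _ => erefl) L mBl E).
  (* [D] lies in the span of the circuit, so mu may be changed to vanish on v1 without changing it
     on [D]; [q_ge0] does the same for rays of [B2] outside the circuit. *)
  have v1_ge0 : 0 <= zdot w v1.
    apply: (Qlow_ray (mu' := muB B (fun x => if c x == 1 then pair mu (kv k (ray B x)) else 0)) _ L mB) => //.
      move=> e' De'; rewrite pair_muB (pair_expand mu e' uB); apply: eq_bigr => x _.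
      by case: ifP => // /negbT cx; rewrite (span x) // !mulr0.
    by rewrite pair_muB_ray // ci.
  have q_ge0 p : ~~ R p -> 0 <= zdot w (ray B2 p).
    move=> Rp; apply: (Qlow_ray (mu' := muB B2 (fun p => if R p then pair mu (kv k (ray B2 p)) else 0)) _ L mB2) => //.
      move=> e' De'; rewrite pair_muB (pair_expand mu e' uB2); apply: eq_bigr => p' _.
      case: ifP => // /negbT Rp'; rewrite [X in _ = _ * X](_ : _ = 0) ?mulr0 ?mul0r //.
      rewrite (pair_expand _ _ uB) big1 // => x _; have [cx|cx] := eqVneq (c x) 1; last first.
        by rewrite (span x) ?mulr0.
      have [p2 Ep2] := match_ray fan_Sigma mB mB2 (in2 x cx).
      rewrite -Ep2 pair_kv dray_ray //; have [Ep|_] := eqVneq p' p2; last by rewrite mul0r.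
      by case/negP: Rp'; apply/existsP; exists x; rewrite Ep Ep2 cx !eqxx.
    by rewrite pair_muB_ray // (negPf Rp).
  have term o : T o -> 0 <= (kap0 o - kp) * zdot w (uu o).
    move=> To; have [->|ol] := eqVneq o l0; first by rewrite subrr mul0r.
    by rewrite mulr_ge0 ?subr_ge0 ?Hl0 ?u_ge0.
  have t0 := term None isT.
  have t1 : 0 <= \sum_(x | c x == 1) (N x - K%:Z - kp) * zdot w (ray B x).
    by apply: sumr_ge0 => x cx; apply: (term (Some x) cx).
  have t2 : 0 <= \sum_(q | ~~ R q) nn q * zdot w (ray B2 q).
    by apply: sumr_ge0 => p Rp; rewrite mulr_ge0 // q_ge0.
  by have := rel2 w; move: v1_ge0 t0 t1 t2 => /=; lia.
have [Bi [mBi Hi]] := circuit_facet Tio; have [uBi _] := mBi.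
have y_ge0 : cn Bi (- uu io).
  move=> p; rewrite zdotNr oppr_ge0; apply: circuit_le0 => // o To oio.
  by have [p' <-] := Hi o To oio; apply: cn_ray.
(* Otherwise v1 would have coordinates only along circuit rays in [Bi], but the form dual to u_i is
   0 on the circuit and 1 on v1. *)
have [p [p1 p2]] : exists p, zdot (dray Bi p) (- uu io) = 0 /\ zdot (dray Bi p) v1 != 0.
  apply: contrapT => Hn; have : zdot (dray B i) v1 = 1 by rewrite dray_ray // eqxx.
  rewrite (zdot_expand _ v1 uBi) big1 // => p _.
  have [y0|y0] := eqVneq (zdot (dray Bi p) (- uu io)) 0.
    have [->|v0] := eqVneq (zdot (dray Bi p) v1) 0; first by rewrite mulr0.
    by case: Hn; exists p.
  have [o [To oio Eo]] : exists o, [/\ T o, o != io & uu o = ray Bi p].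
    apply: contrapT => Ho; move: y0; rewrite zdotNr circuit_eq0 ?oppr0 ?eqxx // => o To oio.
    have [p' Ep] := Hi o To oio; rewrite -Ep dray_ray //.
    by have [E|//] := eqVneq p p'; case: Ho; exists o; rewrite E Ep.
  rewrite -Eo; case: o To {oio Eo} => [x|] /= cx.
    rewrite dray_ray //; have [E|] := eqVneq i x; last by rewrite mul0r.
    by rewrite -E ci in cx.
  by have := ci; rewrite /c zdotNr => /eqP; rewrite oppr_eq0 => /eqP ->; rewrite mul0r.
have [w1 [w2 [/v1_0 -> /v1_0 ->]]] := W Bi _ v1 p mBi y_ge0 p1 p2.
by rewrite subrr lez_nat leqNgt m_gt0.
Qed.

End Full.

End FanFull.

Section ChartDerivations.
Variables (k : closedFieldType) (X : space k) (n : nat) (kap : 'rV[k]_n -> X).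
Hypothesis ch : ischart kap.

Lemma deriv_local (x : X) d f g U : point_derivation x d -> regular_at x f -> opn U -> U x ->
  (forall y, U y -> f y = g y) -> d f = d g.
Proof.
move=> [_ loc _ _ _] [V [oV Vx rV]] oU Ux fg; have oW := opnI oU oV.
apply: (loc _ _ _ oW (conj Ux Vx)); first by apply: (reg_sub oV oW _ rV) => y [].
by move=> y; rewrite inE => -[/fg].
Qed.

Lemma regular_atM (x : X) f g : regular_at x f -> regular_at x g -> regular_at x (f * g).
Proof.
move=> [U [oU Ux rU]] [V [oV Vx rV]]; have oW := opnI oU oV.
exists (U `&` V); split=> //; apply: regM => //; first by apply: (reg_sub oU oW _ rU) => y [].
by apply: (reg_sub oV oW _ rV) => y [].
Qed.

Lemma regular_atD (x : X) f g : regular_at x f -> regular_at x g -> regular_at x (f + g).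
Proof.
move=> [U [oU Ux rU]] [V [oV Vx rV]]; have oW := opnI oU oV.
exists (U `&` V); split=> //; apply: regD => //; first by apply: (reg_sub oU oW _ rU) => y [].
by apply: (reg_sub oV oW _ rV) => y [].
Qed.

(** The Leibniz rule kills all polynomials in the coordinates, and a regular germ times its
    denominator is such a polynomial. *)
Lemma deriv_coords0 p d : point_derivation (kap p) d ->
  (forall i, exists c, [/\ regular_at (kap p) c, nearp p (fun q => c (kap q) = q 0 i) & d c = 0]) ->
  forall f, d f = 0.
Proof.
move=> Hd Hc; have [d1 _ d3 d4 d5] := Hd.
have poly A : polyfun A ->
    exists c, [/\ regular_at (kap p) c, nearp p (fun q => c (kap q) = A q) & d c = 0].
  elim=> [a|A' [i ->]|A1 A2 _ [c1 [r1 e1 z1]] _ [c2 [r2 e2 z2]]|A1 A2 _ [c1 [r1 e1 z1]] _ [c2 [r2 e2 z2]]].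
  - exists (cst a); split=> //; last exact: nearpT.
    by exists setT; split=> //; [exact: opnT|apply: reg_cst; exact: opnT].
  - exact: Hc.
  - exists (c1 + c2); split; first exact: regular_atD.
      by apply: nearpS2 e1 e2 => q; rewrite !fctE => -> ->.
    by rewrite d4 // z1 z2 addr0.
  - exists (c1 * c2); split; first exact: regular_atM.
      by apply: nearpS2 e1 e2 => q; rewrite !fctE => -> ->.
    by rewrite d5 // z1 z2 !mulr0 addr0.
move=> f; have [rf|/d1 //] := pselect (regular_at (kap p) f).
have [U [oU Up rU]] := rf; have [A [C [PA PC Cp fE]]] := ch_reg ch oU Up rU.
have [a [ra ea za]] := poly A PA; have [c [rc ec zc]] := poly C PC.
have [V [oV Vp HV]] := nearp_open ch (nearpI (nearpI fE (nearp_poly PC Cp)) (nearpI ea ec)).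
have : d (f * c) = d a.
  apply: (deriv_local Hd (regular_atM rf rc) oV Vp) => _ /HV[q -> [[/= fq Cq] [eq1 eq2]]].
  by rewrite fctE eq1 eq2 fq divfK.
rewrite d5 // za zc mulr0 add0r => /eqP; rewrite mulf_eq0 (nearp_at ec) (negPf Cp).
by move=> /eqP.
Qed.

End ChartDerivations.

(** * The fan of projective space *)

Section FanOfPn.
Variable n : nat.
Implicit Types (B : 'M[int]_n).

(** [B] with its j-th ray replaced by minus the sum of all its rays, the additional ray of the fan
    of P^n. *)
Definition Brep B j : 'M[int]_n :=
  \matrix_(i, l) if i == j then - \sum_x ray B x 0 l else B i l.

Lemma ray_Brep B j i : ray (Brep B j) i = if i == j then - \sum_x ray B x else ray B i.
Proof.
apply/rowP => l; rewrite !mxE; case: ifP => _; rewrite !mxE //.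
by rewrite summxE; congr (- _); apply: eq_bigr.
Qed.

Lemma rays_maxB (Sigma : set (set 'rV[rat]_n)) B B' : maxB Sigma B' -> injective (ray B) ->
  (forall i, exists q, ray B' q = ray B i) -> maxB Sigma B.
Proof.
move=> [uB' SB'] inj /choice[f Hf].
have f_inj : injective f by move=> i j E; apply: inj; rewrite -!Hf E.
have [g fK gK] := injF_bij f_inj.
have uB : B \in unitmx.
  suff /mulmx1_unit[] : B *m \matrix_(i, j) invmx B' i (f j) = 1%:M by [].
  apply/matrixP => i j; have /matrixP/(_ (f i) (f j)) := mulmxV uB'.
  rewrite !mxE (inj_eq f_inj) => <-; apply: eq_bigr => l _; rewrite !mxE.
  by have /rowP/(_ l) := Hf i; rewrite !mxE => ->.
split=> //; rewrite (_ : coneB B = coneB B') //.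
have dE i : dray B i = dray B' (f i).
  rewrite (dray_expand (dray B i) uB') (bigD1 (f i)) //= Hf dray_ray // eqxx scale1r.
  rewrite big1 ?addr0 // => l li; rewrite -(gK l) Hf dray_ray //.
  have [E|] := eqVneq i (g l); last by rewrite scale0r.
  by rewrite E gK eqxx in li.
apply/seteqP; split=> v Hv i; first by rewrite -(gK i) -dE; apply: Hv.
by rewrite dE; apply: Hv.
Qed.

Variables (k : closedFieldType) (Sigma : set (set 'rV[rat]_n)).
Hypothesis fan_Sigma : is_fan Sigma.
Local Notation X := (toric_variety k Sigma).
Hypotheses (X_smooth : smooth X n) (X_projective : projective X).
Variables (m : nat) (D : set 'rV[k]_n).
Hypothesis m_gt0 : (0 < m)%N.
Hypothesis QD : forall mu : 'rV[k]_n, (exists2 e, D e & pair mu e != 0) ->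
  exists Q, [/\ Q != [::], Qlow Sigma m D Q mu & Qwide Sigma m Q].
Hypothesis D_neq0 : exists2 e, D e & e != 0.

(** For n > 1 the relation has all coefficients 1, and each facet of the circuit is a cone of the
    fan. For n <= 1 there is no room for the index i0; the cone around the opposite of a ray is then
    generated by this opposite, by integrality. *)
Lemma fan_Pn : exists B, maxB Sigma B /\ forall j, maxB Sigma (Brep B j).
Proof.
have [n1|n1] := ltnP 1 n; last first.
  have [B mB _] := maxB_cover fan_Sigma X_smooth X_projective 0; have [uB _] := mB.
  exists B; split=> // j.
  have one i : i = j.
    by apply: val_inj => /=; move: (ltn_ord i) (ltn_ord j) n1; lia.
  have [B' mB' /coneB_qv H'] := maxB_cover fan_Sigma X_smooth X_projective (- ray B j).
  have [uB' _] := mB'.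
  apply: (rays_maxB mB') => [i l _|i]; first by rewrite (one i) (one l).
  exists j; rewrite ray_Brep (one i) eqxx (bigD1 j) //= big1 ?addr0; last first.
    by move=> l; rewrite (one l) eqxx.
  have E := zray_expand (- ray B j) uB'; rewrite (bigD1 j) //= big1 ?addr0 in E; last first.
    by move=> l; rewrite (one l) eqxx.
  set z := zdot (dray B' j) (- ray B j) in E; have z0 : 0 <= z by apply: H'.
  have := congr1 (zdot (dray B j)) E; rewrite zdotNr zdotZr dray_ray // eqxx => E2.
  have aux (a b : int) : 0 <= a -> -1 = a * b -> a = 1.
    move=> a0 E3; have b0 : b <= -1 by nia.
    suff : a <= 1 by nia.
    rewrite -(ler_pM2r (x := - b)); nia.
  have z1 : z = 1 := aux z _ z0 E2.
  by rewrite E z1 scale1r.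
have [B0 [i0 [B [mB0 mB c01 facet]]]] := fan_dependent fan_Sigma X_smooth X_projective m_gt0 QD D_neq0 n1.
have [uB _] := mB.
have c1 := circuit_full fan_Sigma X_smooth X_projective m_gt0 QD D_neq0 mB0 mB c01 facet.
have E0 : - \sum_x ray B x = ray B0 i0.
  rewrite -[RHS]opprK (zray_expand (- ray B0 i0) uB); congr (- _).
  by apply: eq_bigr => x _; rewrite c1 scale1r.
have c0 i : 0 <= zdot (dray B i) (- ray B0 i0) by rewrite c1.
exists B; split=> // j; have [B' [mB' h0 hx]] := facet j (c1 j).
apply: (rays_maxB mB') => [i l|i].
  rewrite !ray_Brep E0; case: eqP => [->|ij]; case: eqP => [->|lj] // E.
  - by case: (u_neq_u0 mB c0 (esym E)).
  - by case: (u_neq_u0 mB c0 E).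
  - by apply/eqP; apply: contraT => /(ray_neq mB) /eqP[].
rewrite ray_Brep E0; case: eqP => [_|/eqP ij]; first exact: (match_ray fan_Sigma mB0 mB').
by apply: (match_ray fan_Sigma mB mB'); apply: hx => //; rewrite c1.
Qed.

End FanOfPn.

Section FrameSection.
Variables (k : closedFieldType) (X : space k) (E : omodule X).

Lemma frame_neq0 (U : set X) r (e : 'I_r -> sec E U) x l : opn U -> U x -> is_frame e -> e l != 0.
Proof.
move=> oU Ux fr; have [_ H] := fr U oU (fun y Uy => Uy).
have rc i : reg U (cst (i == l)%:R : X -> k) by apply: reg_cst.
apply/eqP => E0; have /eqP : cst (l == l)%:R x = 0 :> k; last by rewrite /cst eqxx oner_eq0.
apply: (H _ rc _ l x Ux); rewrite big1 // => i _; rewrite res_id //.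
have [->|il] := eqVneq i l; last exact: act0.
by rewrite E0 [LHS]act1.
Qed.

Lemma omorphism0 (F : omodule X) (h : forall U : set X, sec E U -> sec F U) U : omorphism h ->
  opn U -> h U 0 = 0.
Proof.
move=> [hD _ _] oU; have := hD U 0 0 oU; rewrite addr0 => /eqP.
by rewrite -[X in X == _]addr0 (inj_eq (addrI _)) => /eqP <-.
Qed.

End FrameSection.

Section TorusFan.
Variables (n : nat) (k : closedFieldType) (Sigma : set (set 'rV[rat]_n)).
Hypothesis fan_Sigma : is_fan Sigma.
Local Notation X := (toric_variety k Sigma).
Hypotheses (X_smooth : smooth X n) (X_projective : projective X).
Local Notation tp := (@tp n k Sigma fan_Sigma).
Local Notation maxB := (maxB Sigma).
Local Notation kap := (@kap n k Sigma fan_Sigma).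
Variables (r : nat) (E : omodule X).
Hypothesis E_lf : locally_free r E.
Variable j : forall U : set X, sec E U -> sec (tangent X) U.
Hypothesis j_mor : omorphism j.
Variables (m N : nat) (H : nzform E -> 'rV[k]_N.+1).
Hypothesis amp : amp_data m H.
Implicit Types (t : 'rV[k]_n) (B : 'M[int]_n) (w v : 'rV[int]_n).

Local Notation Fmu := (@Fmu n k Sigma fan_Sigma E j N H).
Local Notation phimu := (@phimu n k Sigma fan_Sigma E j).

Hypotheses (r_gt0 : (0 < r)%N) (j_inj : oinjective j).
Local Notation dlog := (@dlog n k Sigma fan_Sigma).

Lemma torus_dense (O : set X) x : opn O -> O x -> exists2 t, intorus t & O (tp t).
Proof.
move=> oO; have [B mB [p ->]] := kap_surj fan_Sigma X_smooth X_projective x => Op.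
have ch := kap_ischart fan_Sigma X_smooth X_projective mB.
have P1 : nearp (const_mx 1 : 'rV[k]_n) (fun q => intorus q).
  by apply: nearp_all => i; apply: nearp_poly (polyfun_coord k i) _; rewrite mxE oner_neq0.
have [q [Oq tq]] := nearp2_ex (ch_near ch oO Op) P1.
by exists (frm B q); [apply: frm_torus|rewrite -kap_tp].
Qed.

(** Near a torus point the chart coordinates are characters, and they determine a derivation. *)
Lemma Xm_diff0 t d : intorus t -> point_derivation (tp t) d ->
  (forall l, dlog t d (delta_mx 0 l) = 0) -> forall f, d f = 0.
Proof.
move=> Ht Hd H0; have [B mB _] := maxB_cover fan_Sigma X_smooth X_projective 0; have [uB _] := mB.
have ch := kap_ischart fan_Sigma X_smooth X_projective mB.
have tE := tp_kap fan_Sigma mB Ht; have Hd' := Hd; rewrite tE in Hd'.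
apply: (deriv_coords0 ch Hd') => i; exists (Xm fan_Sigma (dray B i)); split.
- by rewrite -tE; apply: Xm_at.
- have Ht' : nearp (tob B t) (fun q => intorus q).
    by apply: nearp_all => l; apply: nearp_poly (polyfun_coord k l) _; apply: tob_torus.
  apply: nearpS Ht' => q Hq; rewrite kap_tp // XmE //; last exact: frm_torus.
  by rewrite mon_frm // ev_dray.
- have : dlog t d (dray B i) = 0.
    by rewrite (dlog_delta X_smooth X_projective Ht Hd) big1 // => l _; rewrite H0 mulr0.
  rewrite dlogE => /eqP; rewrite mulf_eq0 invr_eq0 (negPf (mon_tneq0 _ Ht)) orbF.
  by move=> /eqP.
Qed.

Definition logD : set 'rV[k]_n := [set e | exists t V (s : sec E V), intorus t /\
  e = \row_l dlog t (fun f => fval (j s) (tp t, f)) (delta_mx 0 l)].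

Lemma pair_phimu mu t V (s : sec E V) :
  phimu mu t s = pair mu (\row_l dlog t (fun f => fval (j s) (tp t, f)) (delta_mx 0 l)).
Proof. by apply: eq_bigr => l _; rewrite mxE. Qed.

(** The image of a frame section under [j] is not 0; as a vector field applied to some function it
    is nonzero on an open set, and this set meets the torus. *)
Lemma logD_neq0 : exists2 e, logD e & e != 0.
Proof.
have [U [e [oU Ux fr]]] := frame_at E_lf (tp (const_mx 1)).
pose l0 := Ordinal r_gt0; have e0 := frame_neq0 l0 oU Ux fr.
have je0 : j (e l0) != 0.
  by apply: contra_neq e0 => E0; apply: (j_inj oU); rewrite E0 (omorphism0 j_mor).
have [[x f] xf] : exists a, fval (j (e l0)) a != 0.
  apply: contrapT => Hn; move/eqP: je0; apply; apply: fsec_inj => a; rewrite fsec_zero.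
  by apply/eqP; apply: contraT => Ha; case: Hn; exists a.
have Uxx : U x.
  by apply: contrapT => nU; move: xf; rewrite (fsec_supp (j (e l0)) oU) ?eqxx.
have dx := j_deriv j (e l0) oU Uxx; have [dx1 _ _ _ _] := dx.
have [W [oW Wx rW]] : regular_at x f.
  by apply: contrapT => /dx1 E0; move: xf; rewrite E0 eqxx.
have oUW := opnI oU oW.
have rg : reg (U `&` W) (fun y => fval (j (e l0)) (y, f)).
  apply: (j_reg j (e l0) oU oUW) => [y []//|].
  by apply: (reg_sub oW oUW _ rW) => y [].
have [t Ht [[Ut Wt] /= ft]] := torus_dense (opn_neq0 oUW rg) (conj (conj Uxx Wx) xf).
exists (\row_l dlog t (fun f => fval (j (e l0)) (tp t, f)) (delta_mx 0 l)).
  by exists t, U, (e l0).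
apply: contraNneq ft => E0; apply/eqP.
apply: (Xm_diff0 Ht (j_deriv j (e l0) oU Ut)) => l.
by have /rowP/(_ l) := E0; rewrite !mxE.
Qed.

Lemma X_fan : exists B, maxB B /\ forall i, maxB (Brep B i).
Proof.
apply: (fan_Pn fan_Sigma X_smooth X_projective (amp_gt0 amp) _ logD_neq0) => mu.
move=> [_ [t [V [s [Ht ->]]]] nz].
have nz' : exists t V (s : sec E V), intorus t /\ phimu mu t s != 0.
  by exists t, V, s; rewrite pair_phimu.
have [Q [Q0 L W]] := Qdata X_smooth X_projective E_lf j_mor amp nz'.
exists Q; split=> //.
- move=> mu' B v d Hmu mB Hv Hd; apply: (L mu' B v d) => //.
    by move=> t' V' s' Ht'; rewrite !pair_phimu; apply: Hmu; exists t', V', s'.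
  move=> i Hi; apply: Hd; move: Hi; rewrite /zmu /pair.
  by under [X in _ -> X != 0]eq_bigr do rewrite mxE.
Qed.

Lemma n_gt0 : (0 < n)%N.
Proof.
have [e _ e0] := logD_neq0; case: (n) e e0 => // e.
by rewrite [e]thinmx0 eqxx.
Qed.

End TorusFan.

(** * Charts of projective space *)

Section Morphisms.
Variables (k : closedFieldType) (X Y : space k).

Lemma opn_local (U : set X) : (forall x, U x -> exists V, [/\ opn V, V x & V `<=` U]) -> opn U.
Proof.
move=> H; have -> : U = \bigcup_(V in [set V | opn V /\ V `<=` U]) V.
  apply/seteqP; split=> [x /H[V [oV Vx VU]]|x [V [_ VU] /VU]] //.
  by exists V.
by apply: opn_bigcup => V [].
Qed.

Lemma reg_local (U : set X) f : opn U -> (forall x, U x -> regular_at x f) -> reg U f.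
Proof.
move=> oU H; apply: reg_glue => // x Ux; have [V [oV Vx rV]] := H x Ux.
have oW := opnI oU oV; exists (U `&` V); split=> [//|//|y []//|].
by apply: (reg_sub oV oW _ rV) => y [].
Qed.

Lemma chart_morphism (phi : X -> Y) :
  (forall x, exists n (kap : 'rV[k]_n -> X) p, [/\ ischart kap, ischart (phi \o kap) & x = kap p]) ->
  smorphism phi.
Proof.
move=> H V oV; have oU : opn (phi @^-1` V).
  apply: opn_local => x Vx; have [n [kap [p [ch chY E]]]] := H x.
  rewrite E in Vx; have [U [oU Up HU]] := nearp_open ch (ch_near chY oV Vx).
  by exists U; split=> //; [rewrite E|move=> y /HU[q ->]].
split=> // f rf; apply: reg_local => // x Vx; have [n [kap [p [ch chY E]]]] := H x.
rewrite E in Vx *; apply: (ch_regV ch).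
exact: (ch_reg chY oV Vx rf).
Qed.

End Morphisms.

Lemma chart_isomorphism (k : closedFieldType) (X Y : space k) (phi : X -> Y) (psi : Y -> X) :
  cancel phi psi -> cancel psi phi ->
  (forall x, exists n (kap : 'rV[k]_n -> X) p, [/\ ischart kap, ischart (phi \o kap) & x = kap p]) ->
  sisomorphism phi.
Proof.
move=> pK qK H; split; first exact: chart_morphism.
exists psi; split=> //; apply: chart_morphism => y.
have [n [kap [p [ch chY E]]]] := H (psi y).
exists n, (phi \o kap), p; split=> //; last by rewrite /= -E qK.
by rewrite (_ : psi \o (phi \o kap) = kap) //; apply: funext => q /=; rewrite pK.
Qed.

Section StandardCharts.
Variables (k : closedFieldType) (n : nat).
Implicit Types (z : 'rV[k]_n.+1) (x : 'rV[k]_n) (j : 'I_n.+1).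

Definition hom j x : 'rV[k]_n.+1 := \row_o oapp (fun i => x 0 i) 1 (unlift j o).
Definition deh j z : 'rV[k]_n := \row_i (z 0 (lift j i) / z 0 j).
Definition stdchart j x : projective_space k n := mkP (hom j x).

Lemma hom_j j x : hom j x 0 j = 1. Proof. by rewrite mxE unlift_none. Qed.
Lemma hom_lift j x i : hom j x 0 (lift j i) = x 0 i. Proof. by rewrite mxE liftK. Qed.

Lemma hom_neq0 j x : hom j x != 0.
Proof. by apply/eqP => /rowP/(_ j)/eqP; rewrite hom_j mxE oner_eq0. Qed.

Lemma deh_hom j x : deh j (hom j x) = x.
Proof. by apply/rowP => i; rewrite mxE hom_lift hom_j divr1. Qed.

Lemma hom_deh j z : z 0 j != 0 -> z = z 0 j *: hom j (deh j z).
Proof.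
move=> zj; apply/rowP => o; rewrite [RHS]mxE.
have [i ->|->] := unliftP j o; last by rewrite hom_j mulr1.
by rewrite hom_lift mxE mulrC divfK.
Qed.

Lemma deh_scale j c z : c != 0 -> deh j (c *: z) = deh j z.
Proof. by move=> c0; apply/rowP => i; rewrite !mxE -mulf_div divff // mul1r. Qed.

Lemma polyfun_hom j o : polyfun (fun x => hom j x 0 o).
Proof.
have [i ->|->] := unliftP j o.
  rewrite (_ : (fun x => _) = (fun x => x 0 i)); first exact: polyfun_coord.
  by apply: funext => x; rewrite hom_lift.
rewrite (_ : (fun x => _) = (fun x => 1)); first exact: polyfun_cst.
by apply: funext => x; rewrite hom_j.
Qed.

Lemma mkP_stdchart j z : z 0 j != 0 -> mkP z = stdchart j (deh j z).
Proof. by move=> zj; rewrite {1}(hom_deh zj) mkP_scale // hom_neq0. Qed.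

Lemma lin_mkP z i j : z != 0 ->
  nzvec_lin i (prep (mkP z)) / nzvec_lin j (prep (mkP z)) = z 0 i / z 0 j.
Proof.
move=> z0; have [d d0 E] := mkP_prep z0.
by rewrite /nzvec_lin E !mxE -mulf_div divff // mul1r.
Qed.

Lemma stdchart_inj j : injective (stdchart j).
Proof.
move=> x y /(mkP_inj (hom_neq0 j x) (hom_neq0 j y))[c c0 E].
by rewrite -(deh_hom j x) -(deh_hom j y) E deh_scale.
Qed.

Lemma stdchart_dom j p : pcoord j p <-> exists x, p = stdchart j x.
Proof.
split=> [|[x ->]]; last by apply/(pcoord_mkP j (hom_neq0 j x)); rewrite hom_j oner_neq0.
have z0 := svalP (prep p); rewrite -(prep_mkP p) => /(pcoord_mkP j z0) zj.
by exists (deh j (sval (prep p))); apply: mkP_stdchart.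
Qed.

Lemma stdchart_ischart j : ischart (stdchart j).
Proof.
apply: (atlas_chart (i0 := j)).
- exact: stdchart_inj.
- exact: stdchart_dom.
- move=> l; exists (fun p => nzvec_lin (lift j l) (prep p) / nzvec_lin j (prep p)).
    by exists (lift j l).
  by move=> x; rewrite lin_mkP ?hom_neq0 // hom_j divr1 hom_lift.
- move=> i x Hi; have hi : hom j x 0 i != 0 by apply/(pcoord_mkP i (hom_neq0 j x)).
  split; first by apply: nearpS (nearp_poly (polyfun_hom j i) hi) => q Hq; apply/pcoord_mkP => //; apply: hom_neq0.
  move=> f [l _ ->].
  apply: regp_eq (regpM (regp_poly x (polyfun_hom j l)) (regpV (regp_poly x (polyfun_hom j i)) hi)).
  by apply: nearpT => q /=; rewrite lin_mkP ?hom_neq0.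
Qed.

Lemma stdchart_cover (p : projective_space k n) : exists j x, p = stdchart j x.
Proof. by have [j /stdchart_dom[x E]] := pcoord_cover p; exists j, x. Qed.

End StandardCharts.

Section ToricPn.
Variables (n : nat) (k : closedFieldType) (Sigma : set (set 'rV[rat]_n)).
Hypothesis fan_Sigma : is_fan Sigma.
Local Notation X := (toric_variety k Sigma).
Local Notation PN := (projective_space k n).
Hypotheses (X_smooth : smooth X n) (X_projective : projective X).
Local Notation maxB := (maxB Sigma).
Local Notation kap := (@kap n k Sigma fan_Sigma).
Implicit Types (v w : 'rV[int]_n) (B : 'M[int]_n) (z : 'rV[k]_n.+1).
Variable U : 'I_n.+1 -> 'rV[int]_n.

Definition Bmx j : 'M[int]_n := \matrix_i U (lift j i).

Hypotheses (U_sum : \sum_o U o = 0) (mU : forall j, maxB (Bmx j)).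

Lemma ray_Bmx j i : ray (Bmx j) i = U (lift j i). Proof. by rewrite /ray rowK. Qed.

Lemma sum_lift (V : nmodType) (F : 'I_n.+1 -> V) j :
  \sum_o F o = F j + \sum_i F (lift j i).
Proof. by rewrite (bigD1_ord j). Qed.

(** The rays have sum 0, so the smallest coefficient of [v] may be subtracted from all of them; the
    index that attains it is the ray to omit. *)
Lemma Bmx_cover v : exists j, cn (Bmx j) v.
Proof.
have [uB _] := mU ord0.
pose c o := if unlift ord0 o is Some i then zdot (dray (Bmx ord0) i) v else 0.
have c0 : c ord0 = 0 by rewrite /c unlift_none.
have vE : v = \sum_o c o *: U o.
  rewrite (sum_lift _ ord0) c0 scale0r add0r.
  rewrite {1}(zray_expand v uB); apply: eq_bigr => i _.
  by rewrite ray_Bmx /c liftK.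
have [j _ Hj] : exists2 j, true & forall o, true -> c j <= c o.
  by case: (@arg_minP _ _ _ ord0 xpredT c isT) => j _ H; exists j.
exists j => i; have [uj _] := mU j.
have -> : v = \sum_l (c (lift j l) - c j) *: ray (Bmx j) l.
  rewrite vE (sum_lift _ j); under [RHS]eq_bigr do rewrite scalerBl ray_Bmx.
  rewrite sumrB -scaler_sumr [RHS]addrC; congr (_ + _); apply/eqP.
  rewrite -subr_eq0 opprK -scalerDr.
  by rewrite -(sum_lift U j) U_sum scaler0.
rewrite zdot_sumr (bigD1 i) //= big1 ?addr0 => [|l li].
  by rewrite zdotZr dray_ray // eqxx mulr1 subr_ge0 Hj.
by rewrite zdotZr dray_ray // eq_sym (negPf li) mulr0.
Qed.

Lemma kap_Bmx_surj C : exists j x, C = kap (Bmx j) x.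
Proof.
have [B mB [x ->]] := kap_surj fan_Sigma X_smooth X_projective C; have [uB _] := mB.
pose v := \sum_(i | x 0 i == 0) ray B i; have [j Hj] := Bmx_cover v; exists j.
have [uj Sj] := mU j.
apply/(kap_dom fan_Sigma X_smooth X_projective _ (mU j)); apply/kap_tdom => //; split=> // i xi.
apply/coneB_qv; apply: (face_in fan_Sigma (mU j) mB (cn_ray i uB)
  (b := \sum_(l | (x 0 l == 0) && (l != i)) ray B l)).
  by apply: cn_sum => l _; apply: cn_ray.
by move: Hj; rewrite /v (bigD1 i) //= xi.
Qed.

Lemma prod_lift (F : 'I_n.+1 -> k) j : \prod_o F o = F j * \prod_i F (lift j i).
Proof. by rewrite (bigD1_ord j). Qed.

(** In homogeneous coordinates a character is a monomial of degree 0 whose exponents are its values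
    on the rays. The right-hand side does not mention the chart, which makes the charts glue. *)
Lemma ev_deh j z w : z 0 j != 0 -> ev (Bmx j) (deh j z) w = \prod_o z 0 o ^ (zdot w (U o)).
Proof.
move=> zj; rewrite (prod_lift _ j) /ev /mon.
under eq_bigr do rewrite !mxE ray_Bmx expfzMl.
rewrite big_split mulrC; congr (_ * _) => /=.
rewrite -(big_morph (exprz (z 0 j)^-1) (fun a b => expfzDr a b (invr_neq0 zj)) (expr0z _)).
rewrite exprz_inv; congr (_ ^ _); rewrite -zdot_sumr.
have := U_sum; rewrite (sum_lift _ j) => /eqP; rewrite addr_eq0 => /eqP ->.
by rewrite zdotNr.
Qed.

Lemma Bmx_zero j z i : z 0 j != 0 -> (deh j z) 0 i = 0 -> z 0 (lift j i) = 0.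
Proof.
move=> zj /eqP; rewrite mxE mulf_eq0 invr_eq0 (negPf zj) orbF.
by move=> /eqP.
Qed.

Lemma Bmx_cone j o : o != j -> coneB (Bmx j) (qv (U o)).
Proof.
move=> oj; have [uj _] := mU j; have [i ->|E] := unliftP j o; last by rewrite E eqxx in oj.
by rewrite -ray_Bmx; apply: coneB_ray.
Qed.

Lemma Bmx_cone_neg j : (0 < n)%N -> ~ coneB (Bmx j) (qv (U j)).
Proof.
move=> n0 /coneB_qv/(_ (Ordinal n0)); have [uj _] := mU j.
have := U_sum; rewrite (sum_lift _ j) => /eqP; rewrite addr_eq0 => /eqP ->.
rewrite zdotNr zdot_sumr (bigD1 (Ordinal n0)) //= big1 ?addr0 => [|l li].
  by rewrite -ray_Bmx dray_ray // eqxx.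
by rewrite -ray_Bmx dray_ray // eq_sym (negPf li).
Qed.

Lemma kap_deh j j' z : z 0 j != 0 -> z 0 j' != 0 ->
  kap (Bmx j) (deh j z) = kap (Bmx j') (deh j' z).
Proof.
move=> zj zj'; have [uj Sj] := mU j; have [uj' Sj'] := mU j'.
apply: (mkpt_ev fan_Sigma (B := Bmx j) (x := deh j z)); try exact: kap_chart.
- by move=> i _; apply: coneB_ray.
- by [].
- move=> i /(Bmx_zero zj) E; rewrite ray_Bmx; apply: Bmx_cone.
  by apply: contraNneq zj' => <-; rewrite E.
- by move=> w _; rewrite /= !ev_deh.
Qed.

Definition Pn_toric (p : PN) : X :=
  let z := sval (prep p) in let j := sval (cid (pcoord_cover p)) in kap (Bmx j) (deh j z).

Lemma Pn_toricE j x : Pn_toric (stdchart j x) = kap (Bmx j) x.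
Proof.
rewrite /Pn_toric; case: (cid _) => j' /= Hj'.
have [c c0 E] := mkP_prep (hom_neq0 j x).
rewrite -/(stdchart j x) in E; rewrite E deh_scale //.
have /(pcoord_mkP j' (hom_neq0 j x)) h' := Hj'.
by rewrite (kap_deh h' (j' := j)) ?hom_j ?oner_neq0 // deh_hom.
Qed.

(** For n > 0 the cone of the chart j omits the ray [U j], so a point with z_j = 0 is outside that
    chart; points of different charts are thereby kept apart. *)
Lemma Pn_toric_bij : (0 < n)%N -> bijective Pn_toric.
Proof.
move=> n0; have inj : injective Pn_toric.
  move=> p q; have [j [x ->]] := stdchart_cover p; have [l [y ->]] := stdchart_cover q.
  rewrite !Pn_toricE => E; have [uj Sj] := mU j; have [ul Sl] := mU l.
  have hj : hom l y 0 j != 0.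
    apply: contra_notN (@Bmx_cone_neg j n0) => /eqP H0.
    have : @toric_dom n k Sigma (coneB (Bmx j)) (kap (Bmx l) y).
      by apply/(kap_dom fan_Sigma X_smooth X_projective _ (mU j)); exists x.
    move=> /(kap_tdom fan_Sigma _ _ (mU l))[_]; have [i Ei|Ei] := unliftP l j.
      by move=> /(_ i); rewrite ray_Bmx -Ei; apply; rewrite -H0 Ei hom_lift.
    by move: H0; rewrite Ei hom_j => /eqP; rewrite oner_eq0.
  rewrite /stdchart (mkP_stdchart hj); congr stdchart; apply: (kap_inj (mU j)).
  by rewrite E -{1}(deh_hom l y); apply: kap_deh; rewrite ?hom_j ?oner_neq0.
have /choice[phi pK] : forall C, exists p, Pn_toric p = C.
  by move=> C; have [j [x ->]] := kap_Bmx_surj C; exists (stdchart j x); apply: Pn_toricE.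
by exists phi => // p; apply: inj; rewrite pK.
Qed.

Lemma toric_isomorphism : (0 < n)%N -> exists phi : X -> PN,
  [/\ sisomorphism phi, bijective phi & forall j x, phi (kap (Bmx j) x) = stdchart j x].
Proof.
move=> /Pn_toric_bij[phi pK qK]; exists phi.
have E j x : phi (kap (Bmx j) x) = stdchart j x by rewrite -Pn_toricE pK.
split=> //; last by exists Pn_toric.
apply: (chart_isomorphism qK pK) => C; have [j [x ->]] := kap_Bmx_surj C.
exists n, (kap (Bmx j)), x; split=> //; first exact: (kap_ischart fan_Sigma X_smooth X_projective (mU j)).
rewrite (_ : phi \o _ = stdchart j); first exact: stdchart_ischart.
by apply: funext => y; apply: E.
Qed.

End ToricPn.

(** * Sheaves and regular matrices *)

Section RegularFunctionsOnAffineSpace.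
Variables (k : closedFieldType) (n : nat).
Implicit Types p : 'rV[k]_n.

Lemma regp_mulmx p a b c (M : 'rV[k]_n -> 'M[k]_(a, b)) (M' : 'rV[k]_n -> 'M[k]_(b, c)) :
  (forall i l, regp p (fun q => M q i l)) -> (forall i l, regp p (fun q => M' q i l)) ->
  forall i l, regp p (fun q => (M q *m M' q) i l).
Proof.
move=> H H' i l; have R : regp p (fun q => \sum_x M q i x * M' q x l).
  by apply: regp_sum => x _; apply: regpM.
by apply: regp_eq R; apply: nearpT => q; rewrite mxE.
Qed.

Lemma regp_det p a (M : 'rV[k]_n -> 'M[k]_a) : (forall i l, regp p (fun q => M q i l)) ->
  regp p (fun q => \det (M q)).
Proof.
move=> H; rewrite /determinant; apply: regp_sum => s _; apply: regpM (regp_cst _ _) _.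
by apply: regp_prod => i _; apply: H.
Qed.

Lemma regp_adj p a (M : 'rV[k]_n -> 'M[k]_a) : (forall i l, regp p (fun q => M q i l)) ->
  forall i l, regp p (fun q => (\adj (M q)) i l).
Proof.
move=> H i l.
have R : regp p (fun q => cofactor (M q) l i).
  apply: regpM (regp_cst _ _) _; apply: regp_det => x y.
  by apply: regp_eq (H (lift l x) (lift i y)); apply: nearpT => q; rewrite !mxE.
by apply: regp_eq R; apply: nearpT => q; rewrite mxE.
Qed.

Lemma regp_solve p a (M : 'rV[k]_n -> 'M[k]_a) (b : 'rV[k]_n -> 'rV[k]_a) :
  (forall i l, regp p (fun q => M q i l)) -> (forall l, regp p (fun q => b q 0 l)) ->
  M p \in unitmx -> exists f : 'rV[k]_n -> 'rV[k]_a,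
    (forall l, regp p (fun q => f q 0 l)) /\ nearp p (fun q => f q *m M q = b q).
Proof.
move=> HM Hb Mp; have d0 : \det (M p) != 0 by rewrite -unitfE -unitmxE.
have Hd := regp_det HM.
exists (fun q => (\det (M q))^-1 *: (b q *m \adj (M q))); split.
  move=> l; have Hb' (i : 'I_1) x : regp p (fun q => b q i x) by rewrite ord1.
  have R := regpM (regpV Hd d0) (regp_mulmx Hb' (regp_adj HM) 0 l).
  by apply: regp_eq R; apply: nearpT => q; rewrite [RHS]mxE.
apply: nearpS (regp_neq0 Hd d0) => q dq.
by rewrite -scalemxAl -mulmxA mul_adj_mx mul_mx_scalar scalerA mulVf // scale1r.
Qed.

(** Inclusion of row spaces tested on annihilators; the columns of the cokernel matrix are forms
    enough. *)
Lemma annih_sub a b (A : 'M[k]_(a, n)) (B : 'M[k]_(b, n)) :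
  (forall nu : 'rV[k]_n, B *m nu^T = 0 -> A *m nu^T = 0) -> (A <= B)%MS.
Proof.
move=> H; rewrite submxE; apply/eqP/matrixP => i l.
have B0 : B *m col l (cokermx B) = 0 by rewrite colE mulmxA mulmx_coker mul0mx.
have := H (col l (cokermx B))^T; rewrite trmxK => /(_ B0)/matrixP/(_ i 0); rewrite !mxE => A0.
by rewrite -[RHS]A0; apply: eq_bigr => x _; congr (_ * _); rewrite [RHS]mxE.
Qed.

Lemma base_cast (A : 'M[k]_n) d : \rank A = d -> exists w : 'M[k]_(d, n),
  row_free w /\ (w :=: A)%MS.
Proof. by case: _ /; exists (row_base A); split; [apply: row_base_free|apply: eq_row_base]. Qed.

Lemma pair_mx (nu v : 'rV[k]_n) : v *m nu^T = (pair nu v)%:M.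
Proof.
by apply/rowP => i; rewrite !ord1 !mxE eqxx mulr1n; apply: eq_bigr => l _; rewrite mxE mulrC.
Qed.

Lemma pair_mx0 (nu v : 'rV[k]_n) : v *m nu^T = 0 <-> pair nu v = 0.
Proof.
rewrite pair_mx; split=> [/matrixP/(_ 0 0)|->]; last by rewrite raddf0.
by rewrite !mxE eqxx mulr1n.
Qed.

(** The invertible minor gives the rows of P A rank d, which is the most that [A] allows, so they
    span its row space. *)
Lemma rowsub_factor a (A : 'M[k]_(a, n)) d (P : 'M[k]_(d, a)) (Q : 'M[k]_(n, d)) :
  P *m A *m Q \in unitmx -> (\rank A <= d)%N -> exists Y, A = Y *m (P *m A).
Proof.
move=> uD rA; suff /submxP[Y YE] : (A <= P *m A)%MS by exists Y.
have sub : (P *m A <= A)%MS by apply: submxMl.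
have := mxrank_leqif_sup sub; move=> /leqifP; case: ifP => // _ lt.
have : (d <= \rank (P *m A))%N.
  by rewrite -{1}(mxrank_unit uD) mxrankM_maxl.
by move: lt rA; lia.
Qed.

Lemma rank_factor a (A : 'M[k]_(a, n)) d : \rank A = d -> exists P Q,
  (P : 'M[k]_(d, a)) *m A *m (Q : 'M[k]_(n, d)) = 1%:M.
Proof.
move=> dA; have E := mulmx_ebase A; rewrite dA in E.
have da : (d <= a)%N by rewrite -dA rank_leq_row.
have dn : (d <= n)%N by rewrite -dA rank_leq_col.
exists (pid_mx d *m invmx (col_ebase A)), (invmx (row_ebase A) *m pid_mx d).
transitivity (pid_mx d *m invmx (col_ebase A) *m (col_ebase A *m pid_mx d *m row_ebase A) *m
  (invmx (row_ebase A) *m pid_mx d) : 'M[k]_d); first by rewrite E.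
rewrite !mulmxA mulmxKV ?col_ebase_unit // mulmxK ?row_ebase_unit //.
by rewrite pid_mx_id // pid_mx_id // pid_mx_1.
Qed.

Lemma regp_near p f : regp p f -> nearp p (fun q => regp q f).
Proof.
move=> [A [C [PA PC Cp [D0 PD [Dp HD]]]]]; exists (fun q => C q * D0 q); first exact: polyfunM.
split=> [|q]; first by rewrite mulf_neq0.
rewrite mulf_eq0 negb_or => /andP[Cq Dq].
by exists A, C; split=> //; exists D0.
Qed.

Lemma regp_domain p u (l : 'rV[k]_n -> k) : regp p u -> polyfun l -> (exists q, l q != 0) ->
  nearp p (fun q => l q * u q = 0) -> nearp p (fun q => u q = 0).
Proof.
move=> [A [C [PA PC Cp uE]]] Pl [q0 lq0] lu.
have [D0 PD [Dp HD]] := nearpI (nearpI uE lu) (nearp_poly PC Cp).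
exists D0 => //; split=> // q Dq; have [[-> _] Cq] := HD q Dq.
suff -> : A q = 0 by rewrite mul0r.
apply/eqP; apply: contraT => Aq.
have [x [ADx lx]] := nearp2_ex (nearp_poly (polyfunM PA PD) (mulf_neq0 Aq Dq)) (nearp_poly Pl lq0).
move: ADx; rewrite mulf_eq0 negb_or => /andP[Ax Dx]; have [[ux lux] Cx] := HD x Dx.
move/eqP: lux; rewrite ux mulf_eq0 (negPf lx) /= mulf_eq0 (negPf Ax) invr_eq0.
by rewrite (negPf Cx).
Qed.

(* Modulo an affine function l, every polynomial is a polynomial on the zero
   set of l, so a regular function vanishing there is divisible by l. *)
Lemma regp_divide p f (l : 'rV[k]_n -> k) (a : 'rV[k]_n) c0 :
  (forall q, l q = c0 + \sum_i a 0 i * q 0 i) -> (exists q, l q != 0) -> regp p f ->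
  nearp p (fun q => l q = 0 -> f q = 0) ->
  exists g, regp p g /\ nearp p (fun q => f q = g q * l q).
Proof.
move=> lE [q0 lq0] rf Hf.
have Pl : polyfun l.
  rewrite (_ : l = fun q => c0 + \sum_i a 0 i * q 0 i); last exact: funext.
  apply: polyfunD; first exact: polyfun_cst.
  by apply: polyfun_sum => i _; apply: polyfunM (polyfun_cst _ _) (polyfun_coord _ _).
have [lp|lp] := eqVneq (l p) 0; last first.
  exists (fun q => f q * (l q)^-1); split; first exact: regpM rf (regpV (regp_poly p Pl) lp).
  by apply: nearpS (nearp_poly Pl lp) => q lq; rewrite divfK.
have [i ai] : exists i, a 0 i != 0.
  apply: contrapT => Hn; have a0 i : a 0 i = 0.
    by apply/eqP; apply: contraT => ai; case: Hn; exists i.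
  have l0 q : l q = c0 by rewrite lE big1 ?addr0 // => i _; rewrite a0 mul0r.
  by move: lq0; rewrite l0 -(l0 p) lp eqxx.
(* The projection to the zero set of [l] along the i-th axis. *)
pose pr (q : 'rV[k]_n) : 'rV[k]_n := q - (l q / a 0 i) *: delta_mx 0 i.
have lpr q : l (pr q) = 0.
  rewrite lE; under eq_bigr do rewrite !mxE mulrBr.
  rewrite sumrB addrA -lE (bigD1 i) //= !eqxx mulr1 mulrCA divff // mulr1.
  by rewrite big1 ?addr0 ?subrr // => y /negPf yi; rewrite yi ?andbF !mulr0.
have Ppr o : polyfun (fun q => pr q 0 o).
  have -> : (fun q => pr q 0 o) =
      (fun q => q 0 o + - (l q * ((a 0 i)^-1 * (delta_mx 0 i : 'rV[k]_n) 0 o))).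
    by apply: funext => q; rewrite !mxE mulrA.
  apply: polyfunD; first exact: polyfun_coord.
  by apply: polyfunN; apply: polyfunM => //; apply: polyfun_cst.
have diff A : polyfun A -> exists2 A1, polyfun A1 & forall q, A q - A (pr q) = l q * A1 q.
  elim=> [c|_ [o ->]|A1 A2 PA1 [B1 PB1 e1] PA2 [B2 PB2 e2]|A1 A2 PA1 [B1 PB1 e1] PA2 [B2 PB2 e2]].
  - exists (fun=> 0); first exact: polyfun_cst.
    by move=> q; rewrite /cst subrr mulr0.
  - exists (fun=> (a 0 i)^-1 * (delta_mx 0 i : 'rV[k]_n) 0 o); first exact: polyfun_cst.
    by move=> q; rewrite !mxE opprB addrCA subrr addr0 mulrA.
  - exists (fun q => B1 q + B2 q); first exact: polyfunD.
    by move=> q; rewrite mulrDr -e1 -e2 !fctE; ring.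
  - exists (fun q => B1 q * A2 q + A1 (pr q) * B2 q).
      by apply: polyfunD; apply: polyfunM => //; apply: (polyfun_comp (x := pr)).
    move=> q; rewrite mulrDr mulrA -e1 mulrCA -e2 !fctE; ring.
have prp : pr p = p by rewrite /pr lp mul0r scale0r subr0.
have [A [C [PA PC Cp fE]]] := rf.
have [D0 PD [Dp HD]] := nearpI (nearpI fE Hf) (nearp_poly PC Cp).
have [A1 PA1 A1E] := diff A PA.
exists (fun q => A1 q * (C q)^-1); split.
  exact: regpM (regp_poly p PA1) (regpV (regp_poly p PC) Cp).
exists (fun q => D0 q * D0 (pr q)).
  by apply: polyfunM => //; apply: (polyfun_comp (x := pr)).
split=> [|q]; first by rewrite prp mulf_neq0.
rewrite mulf_eq0 negb_or => /andP[Dq Dpq].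
have [[fq _] Cq] := HD q Dq; have [[fpq f0] Cpq] := HD _ Dpq.
have A0 : A (pr q) = 0.
  move: (f0 (lpr q)); rewrite fpq => /eqP; rewrite mulf_eq0 invr_eq0 (negPf Cpq) orbF.
  by move=> /eqP.
by rewrite fq -[A q]subr0 -A0 A1E [l q * _]mulrC mulrAC.
Qed.

End RegularFunctionsOnAffineSpace.

Section SheafGluing.
Variables (k : closedFieldType) (X : space k) (E : omodule X).
Hypothesis E_sheaf : is_sheaf E.

(** For solving locally a problem with unique solutions: uniqueness makes the local solutions agree
    on overlaps. *)
Lemma sheaf_glue (U0 : set X) (R : forall U, sec E U -> Prop) :
  (forall U V (s : sec E U), opn U -> opn V -> V `<=` U -> U `<=` U0 -> R U s -> R V (res V s)) ->
  (forall U (s s' : sec E U), opn U -> U `<=` U0 -> R U s -> R U s' -> s = s') ->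
  (forall x, U0 x -> exists V, [/\ opn V, V x, V `<=` U0 & exists s : sec E V, R V s]) ->
  opn U0 -> exists s : sec E U0, forall x, U0 x ->
    exists V, [/\ opn V, V x, V `<=` U0 & R V (res V s)].
Proof.
move=> Rres Runiq Rloc oU0; pose I := {x : X | U0 x}.
have /choice[p Hp] : forall x : I, exists p : {V : set X & sec E V},
    [/\ opn (projT1 p), projT1 p (sval x), projT1 p `<=` U0 & R _ (projT2 p)].
  by move=> [x Ux]; have [V [oV Vx VU [s Rs]]] := Rloc x Ux; exists (existT _ V s).
pose U (i : I) := projT1 (p i); pose s (i : I) : sec E (U i) := projT2 (p i).
have oU i : opn (U i) by have [] := Hp i.
have agree i j : res (U i `&` U j) (s i) = res (U i `&` U j) (s j).
  have [_ _ Ui Ri] := Hp i; have [_ _ Uj Rj] := Hp j.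
  have oW := opnI (oU i) (oU j).
  apply: Runiq => //; first by move=> x [/Ui].
    by apply: Rres => // x [].
  by apply: Rres => // x [].
have [t [tE _]] := E_sheaf oU agree.
have oUU : opn (\bigcup_i U i).
  have -> : \bigcup_i U i = \bigcup_(V in range U) V by rewrite bigcup_image.
  by apply: opn_bigcup => _ [i _ <-].
have sub : U0 `<=` \bigcup_i U i by move=> x Ux; exists (exist _ x Ux) => //; case: (Hp (exist _ x Ux)).
exists (res U0 t) => x Ux; pose i : I := exist _ x Ux.
have [oi xi Ui Ri] := Hp i; exists (U i); split=> //.
by rewrite res_comp // tE.
Qed.

End SheafGluing.

Section IsomorphismPullback.
Variables (k : closedFieldType) (X Y : space k) (phi : X -> Y) (psi : Y -> X).
Hypotheses (phiK : cancel phi psi) (psiK : cancel psi phi).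
Hypotheses (phi_m : smorphism phi) (psi_m : smorphism psi).

(** Along an isomorphism, pullback is transport of structure and morphisms factor through the
    inverse of [h]. A set U and its image under both preimages are equal but index different types
    of sections, so restriction maps pass between them. *)
Lemma iso_pullback (F : omodule Y) (E : omodule X)
    (h : forall V, sec F V -> sec E (phi @^-1` V)) :
  is_sheaf E -> comorphism h -> (forall V, opn V -> injective (h V)) ->
  (forall V e, opn V -> exists t, h V t = e) -> is_pullback phi F E.
Proof.
move=> E_sh h_co h_inj h_surj; split=> //; exists h => // G g G_sh g_co.
have [hD hA hR] := h_co; have [gD gA gR] := g_co.
pose hi V e : sec F V := if pselect (exists t, h V t = e) is left H then sval (cid H) else 0.
have hiK V e : opn V -> h V (hi V e) = e.
  by move=> oV; rewrite /hi; case: pselect => [H|[]]; [exact: svalP (cid H)|exact: h_surj].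
have hi_eq V e t : opn V -> h V t = e -> hi V e = t.
  by move=> oV ht; apply: (h_inj V oV); rewrite hiK.
pose P (U : set X) : set Y := psi @^-1` U.
have oP U : opn U -> opn (P U) by move=> oU; case: (psi_m oU).
have oI V : opn V -> opn (phi @^-1` V : set X) by move=> oV; case: (phi_m oV).
have PU U : phi @^-1` (P U) `<=` U by move=> x; rewrite /P /= phiK.
have UP U : U `<=` phi @^-1` (P U) by move=> x; rewrite /P /= phiK.
have rP U f : opn U -> reg U f -> reg (P U) (f \o psi) by move=> oU rf; have [_] := psi_m oU; apply.
pose u U (s : sec E U) : sec G U := res U (g (P U) (hi (P U) (res (phi @^-1` P U) s))).
have hires V W (e : sec E (phi @^-1` V)) : opn V -> opn W -> W `<=` V ->
    hi W (res (phi @^-1` W) e) = res W (hi V e).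
  by move=> oV oW WV; apply: hi_eq => //; rewrite hR // hiK.
exists u; split.
- split.
  + move=> U s t oU; rewrite /u -resD; [|exact: oI (oP _ oU)|exact: oU|exact: UP].
    congr (res U _); rewrite -gD; last exact: oP.
    congr (g _ _); apply: hi_eq; first exact: oP.
    by rewrite hD ?hiK ?resD //; [exact: oI (oP _ oU)|exact: oP|exact: oP|exact: oP].
  + move=> U f s oU rf; have oPU := oP _ oU; have oIU := oI _ oPU.
    have rf' := rP _ _ oU rf.
    have rff : reg (phi @^-1` P U) f := reg_sub oU oIU (PU U) rf.
    have ff : {in phi @^-1` P U, (f \o psi) \o phi =1 f} by move=> x _ /=; rewrite phiK.
    have rff' : reg (phi @^-1` P U) ((f \o psi) \o phi).
      by apply: (reg_eq oIU _ rff) => x xU; rewrite ff.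
    rewrite /u (_ : hi (P U) _ = act (f \o psi) (hi (P U) (res (phi @^-1` P U) s))); last first.
      by apply: hi_eq => //; rewrite hA // hiK // (act_eq _ oIU rff' ff) act_res.
    by rewrite gA // (act_eq _ oIU rff' ff) act_res.
  + move=> U V s oU oV VU; have oPU := oP _ oU; have oPV := oP _ oV.
    have oIU := oI _ oPU; have oIV := oI _ oPV.
    have PVU : P V `<=` P U by move=> y; apply: VU.
    have IVU : phi @^-1` P V `<=` phi @^-1` P U by move=> x; apply: PVU.
    rewrite /u (res_comp s oU oV oIV VU (PU V)) -(res_comp s oU oIU oIV (PU U) IVU).
    rewrite hires // gR // (res_comp _ oIU oIV oV IVU (UP V)).
    by rewrite (res_comp _ oIU oU oV (UP U) VU).
- move=> V s oV; have oIV := oI _ oV; have oPI := oP _ oIV; have oIPI := oI _ oPI.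
  have VP : P (phi @^-1` V) `<=` V by move=> y; rewrite /P /= psiK.
  rewrite /u -hR // (hi_eq _ _ (res (P (phi @^-1` V)) s)) // gR //.
  by rewrite res_comp // ?res_id.
- move=> v v_m v_h U s oU; have [_ _ vR] := v_m; have oPU := oP _ oU; have oIU := oI _ oPU.
  have -> : s = res U (res (phi @^-1` P U) s).
    by rewrite (res_comp s oU oIU oU (PU U) (UP U)) res_id.
  rewrite vR //.
  rewrite -[res (phi @^-1` P U) s in LHS](hiK _ _ oPU) v_h // /u.
  by rewrite (res_comp s oU oIU oU (PU U) (UP U)) res_id.
Qed.

End IsomorphismPullback.

Section TangentSheaf.
Variable k : closedFieldType.

Lemma tangent_sheaf (X : space k) : is_sheaf (tangent X).
Proof.
apply: fm_sheaf => U t oU t0 loc.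
have cutE (V : set X) x f : V x -> cutoff (@fst X (X -> k)) V t (x, f) = t (x, f).
  by move=> Vx; rewrite /cutoff ifT // inE.
split.
- by move=> x f nU; apply: t0.
- move=> x Ux; have [V [oV Vx VU [_ H2 _]]] := loc x Ux; have := H2 x Vx.
  by congr (point_derivation x); apply: funext => f; rewrite cutE.
- move=> W f oW WU rf; apply: reg_local => // x Wx.
  have [V [oV Vx VU [_ _ H3]]] := loc x (WU x Wx); have oVW := opnI oV oW.
  exists (V `&` W); split=> //.
  have VW1 : V `&` W `<=` V by move=> y [].
  have rf' : reg (V `&` W) f by apply: (reg_sub oW oVW _ rf) => y [].
  apply: (reg_eq oVW _ (H3 _ f oVW VW1 rf')) => y.
  by rewrite inE => -[Vy _]; rewrite cutE.
Qed.

Lemma regular_at_comp (X Y : space k) (phi : X -> Y) x f : smorphism phi ->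
  regular_at (phi x) f -> regular_at x (f \o phi).
Proof.
move=> phi_m [V [oV Vx rf]]; have [oU H] := phi_m V oV.
by exists (phi @^-1` V); split=> //; apply: H.
Qed.

Lemma vector_field_iso (X Y : space k) (phi : X -> Y) (psi : Y -> X) U V
    (t : Y * (Y -> k) -> k) : cancel phi psi -> cancel psi phi -> smorphism phi -> smorphism psi ->
  opn U -> opn V -> (forall x, U x <-> V (phi x)) -> vector_field V t ->
  vector_field U (fun a => t (phi a.1, a.2 \o psi)).
Proof.
move=> phiK psiK phi_m psi_m oU oV UV [t1 t2 t3].
have fK (f : X -> k) : (f \o psi) \o phi = f by apply: funext => x /=; rewrite phiK.
split=> /=.
- by move=> x f nU; apply: t1 => Vx; apply/nU/UV.
- move=> x /UV Vx; have [d1 d2 d3 d4 d5] := t2 _ Vx.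
  have ra f : regular_at x f -> regular_at (phi x) (f \o psi).
    by move=> rf; apply: (regular_at_comp psi_m); rewrite phiK.
  split.
  + move=> f nf; apply: d1 => rf; apply: nf; rewrite -(fK f).
    exact: (regular_at_comp phi_m rf).
  + move=> W f g oW Wx rf fg; have [oW' H] := psi_m W oW.
    apply: (d2 (psi @^-1` W)) => //=; first by rewrite phiK.
      exact: H.
    by move=> y; rewrite inE => Wy; apply: fg; rewrite inE.
  + by move=> c; apply: d3.
  + by move=> f g /ra rf /ra rg; apply: (d4 _ _ rf rg).
  + move=> f g /ra rf /ra rg; have := d5 _ _ rf rg.
    by rewrite /= phiK.
- move=> W f oW WU rf; have [oW' H] := psi_m W oW.
  have W'V : psi @^-1` W `<=` V by move=> y /= Wy; rewrite -(psiK y); apply/UV/WU.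
  have R := t3 _ _ oW' W'V (H f rf); have [oW'' H'] := phi_m _ oW'.
  have sub : W `<=` phi @^-1` (psi @^-1` W) by move=> x Wx /=; rewrite phiK.
  exact: (reg_sub oW'' oW sub (H' _ R)).
Qed.

End TangentSheaf.

(** * Ample subsheaves of the tangent bundle of projective space *)

Section OverPn.
Variables (k : closedFieldType) (n : nat) (X : space k).
Local Notation PN := (projective_space k n).
Variables (phi : X -> PN) (psi : PN -> X).
Hypotheses (phiK : cancel phi psi) (psiK : cancel psi phi).
Hypotheses (phi_m : smorphism phi) (psi_m : smorphism psi).
Variable K : 'I_n.+1 -> 'rV[k]_n -> X.
Hypotheses (chK : forall j, ischart (K j)) (KE : forall j x, phi (K j x) = stdchart j x).
Implicit Types (z nu : 'rV[k]_n.+1) (o i : 'I_n.+1).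

Definition Pi z : X := psi (mkP z).
Definition dm i : set X := phi @^-1` @pcoord k n i.
Definition rho o i (x : X) : k := nzvec_lin o (prep (phi x)) / nzvec_lin i (prep (phi x)).

Lemma dm_opn i : opn (dm i). Proof. by have [] := phi_m (pcoord_opn k i). Qed.

Lemma rho_reg o i : reg (dm i) (rho o i).
Proof. by have [_ H] := phi_m (pcoord_opn k i); exact: (H _ (@ratio_reg k n o i)). Qed.

Lemma Pi_dm i z : z != 0 -> dm i (Pi z) <-> z 0 i != 0.
Proof. by move=> z0; rewrite /dm /Pi /= psiK; apply: pcoord_mkP. Qed.

Lemma rhoE o i z : z != 0 -> rho o i (Pi z) = z 0 o / z 0 i.
Proof. by move=> z0; rewrite /rho /Pi psiK lin_mkP. Qed.

Lemma Pi_hom i x : Pi (hom i x) = K i x.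
Proof. by rewrite /Pi -/(stdchart i x) -KE phiK. Qed.

Lemma Pi_deh i z : z 0 i != 0 -> Pi z = K i (deh i z).
Proof. by move=> zi; rewrite /Pi (mkP_stdchart zi) -KE phiK. Qed.

Lemma Pi_scale c z : c != 0 -> z != 0 -> Pi (c *: z) = Pi z.
Proof. by move=> c0 z0; rewrite /Pi mkP_scale. Qed.

Lemma Pi_surj x : exists2 z, z != 0 & x = Pi z.
Proof.
exists (sval (prep (phi x))); first exact: (svalP (prep (phi x))).
by rewrite /Pi prep_mkP phiK.
Qed.

Lemma Pi_inj z z' : z != 0 -> z' != 0 -> Pi z = Pi z' -> exists2 c, c != 0 & z' = c *: z.
Proof. by move=> z0 z0' /(can_inj psiK); apply: mkP_inj. Qed.

Lemma Pi_arc c (z : k -> 'rV[k]_n.+1) : (forall o, regc c (fun s => z s 0 o)) -> z c != 0 ->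
  sarc c (fun s => Pi (z s)).
Proof. by move=> Hz zc; apply: (sarc_morph psi_m (mkP_arc Hz zc)). Qed.

Lemma rv_neq0P z : z != 0 -> exists i, z 0 i != 0.
Proof. by move=> /rV0Pn. Qed.

Lemma arc_neq0 c (z : k -> 'rV[k]_n.+1) : (forall o, regc c (fun s => z s 0 o)) -> z c != 0 ->
  nearc c (fun s => z s != 0).
Proof.
move=> Hz /rv_neq0P[i zi]; apply: nearcS (regc_neq0 (Hz i) zi) => s.
by apply: contraNneq => ->; rewrite mxE.
Qed.

Definition vec i z (d : (X -> k) -> k) : 'rV[k]_n.+1 := \row_o (z 0 i * d (rho o i)).

Lemma vec_scale c i z d : vec i (c *: z) d = c *: vec i z d.
Proof. by apply/rowP => o; rewrite !mxE mulrA. Qed.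

Lemma rho_at o i z : z 0 i != 0 -> z != 0 -> regular_at (Pi z) (rho o i).
Proof.
move=> zi z0; exists (dm i); split; [exact: dm_opn|exact/Pi_dm|exact: rho_reg].
Qed.

Lemma vec_i i z d : z != 0 -> z 0 i != 0 -> point_derivation (Pi z) d -> vec i z d 0 i = 0.
Proof.
move=> z0 zi Hd; rewrite mxE; have [_ _ d3 _ _] := Hd.
suff -> : d (rho i i) = 0 by rewrite mulr0.
rewrite -(d3 1); apply: (deriv_local Hd (rho_at i zi z0) (dm_opn i)); first exact/Pi_dm.
by move=> y /= [_ h]; rewrite /rho divff.
Qed.

Lemma vec_change i i' z d : z != 0 -> z 0 i != 0 -> z 0 i' != 0 -> point_derivation (Pi z) d ->
  exists a, vec i' z d = vec i z d + a *: z.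
Proof.
move=> z0 zi zi' Hd; exists (z 0 i' / z 0 i * d (rho i i')); apply/rowP => o; rewrite !mxE.
have -> : d (rho o i') = d (rho o i * rho i i').
  apply: (deriv_local Hd (rho_at o zi' z0) (opnI (dm_opn i) (dm_opn i'))).
    by split; apply/Pi_dm.
  move=> y [/= [_ hi] [_ hi']]; rewrite /rho fctE -/(nzvec_lin _ _) mulrA divfK //.
have [_ _ _ _ ->] := Hd; try exact: rho_at.
rewrite !rhoE //; field; by rewrite zi zi'.
Qed.

Lemma vec_eq0 i z d : z != 0 -> z 0 i != 0 -> point_derivation (Pi z) d -> vec i z d = 0 ->
  forall f, d f = 0.
Proof.
move=> z0 zi Hd V0; have Hd' := Hd; rewrite (Pi_deh zi) in Hd'.
apply: (deriv_coords0 (chK i) Hd') => l; exists (rho (lift i l) i); split.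
- by rewrite -Pi_deh //; apply: rho_at.
- apply: nearpT => q; rewrite -Pi_hom rhoE ?hom_neq0 //.
  by rewrite hom_lift hom_j divr1.
- by have /rowP/(_ (lift i l))/eqP := V0; rewrite !mxE mulf_eq0 (negPf zi) => /eqP.
Qed.

Variables (E : omodule X) (r : nat) (J : forall U : set X, sec E U -> sec (tangent X) U).
Hypothesis J_mor : omorphism J.
Hypothesis E_lf : locally_free r E.
Variables (m N : nat) (H : nzform E -> 'rV[k]_N.+1).
Hypothesis amp : amp_data m H.

Definition jvec i z U (s : sec E U) := vec i z (fun f => fval (J s) (Pi z, f)).

Lemma J_deriv U (s : sec E U) x : opn U -> U x -> point_derivation x (fun f => fval (J s) (x, f)).
Proof. by move=> oU Ux; have [_ H2 _] := fsec_sec (J s) oU; apply: H2. Qed.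

Lemma J_reg U (s : sec E U) V f : opn U -> opn V -> V `<=` U -> reg V f ->
  reg V (fun x => fval (J s) (x, f)).
Proof. by move=> oU oV VU rf; have [_ _ H3] := fsec_sec (J s) oU; apply: H3. Qed.

Lemma jvec_out i z U (s : sec E U) : ~ (opn U /\ U (Pi z)) -> jvec i z s = 0.
Proof.
move=> nU; apply/rowP => o; rewrite !mxE.
suff -> : fval (J s) (Pi z, rho o i) = 0 by rewrite mulr0.
have [oU|nO] := pselect (opn U).
  by apply: fsec_supp => // Ux; apply: nU.
by have /asboolP[_ /(_ nO) ->] := fvalP (J s).
Qed.

Lemma jvecD i z U (s t : sec E U) : opn U -> jvec i z (s + t) = jvec i z s + jvec i z t.
Proof.
move=> oU; have [jD _ _] := J_mor; apply/rowP => o; rewrite !mxE jD // fsec_add.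
exact: mulrDr.
Qed.

Lemma jvec_act i z U f (s : sec E U) : opn U -> reg U f ->
  jvec i z (act f s) = f (Pi z) *: jvec i z s.
Proof.
move=> oU rf; have [_ jA _] := J_mor; apply/rowP => o; rewrite !mxE jA // fsec_act //.
exact: mulrCA.
Qed.

Lemma jvec_res i z U V (s : sec E U) : opn U -> opn V -> V `<=` U -> V (Pi z) ->
  jvec i z (res V s) = jvec i z s.
Proof.
by move=> oU oV VU Vx; have [_ _ jR] := J_mor; apply/rowP => o; rewrite !mxE jR // fsec_res.
Qed.

Definition idx z : 'I_n.+1 := odflt ord0 [pick i | z 0 i != 0].

Lemma idxP z : z != 0 -> z 0 (idx z) != 0.
Proof.
move=> /rv_neq0P[i zi]; rewrite /idx; case: pickP => [//|/(_ i)].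
by rewrite zi.
Qed.

(** Meant for nu(z) = 0; then the chart index [idx z] may be replaced by any other, by
    [vec_change]. *)
Definition Psi nu z U (s : sec E U) : k := pair nu (jvec (idx z) z s).

Lemma PsiE nu z i U (s : sec E U) : pair nu z = 0 -> z 0 i != 0 ->
  Psi nu z s = pair nu (jvec i z s).
Proof.
move=> nz zi; have z0 : z != 0 by apply: contraNneq zi => ->; rewrite mxE.
have [[oU Ux]|nU] := pselect (opn U /\ U (Pi z)); last by rewrite /Psi !jvec_out.
have [a Ea] := vec_change z0 zi (idxP z0) (J_deriv s oU Ux).
by rewrite /Psi /jvec Ea pairDr pairZr nz mulr0 addr0.
Qed.

Lemma Psi_fibre nu z : z != 0 -> fibre_form (Pi z) (Psi nu z).
Proof.
move=> z0; split.
- by move=> U s nU; rewrite /Psi jvec_out // pair0r.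
- by move=> U s t oU Ux; rewrite /Psi jvecD // pairDr.
- by move=> U f s oU Ux rf; rewrite /Psi jvec_act // pairZr.
- by move=> U V s oU oV VU Vx; rewrite /Psi jvec_res.
Qed.

Lemma Psi_scale nu c z U (s : sec E U) : pair nu z = 0 -> c != 0 -> z != 0 ->
  Psi nu (c *: z) s = c * Psi nu z s.
Proof.
move=> nz c0 z0; have zi := idxP z0.
rewrite (PsiE (i := idx z)) ?pairZr ?nz ?mulr0 //; last by rewrite mxE mulf_neq0.
by rewrite /Psi -pairZr -vec_scale /jvec Pi_scale.
Qed.

Lemma PsiZl c nu z U (s : sec E U) : Psi (c *: nu) z s = c * Psi nu z s.
Proof. exact: pairZl. Qed.

Lemma jvec_arc i c (z : k -> 'rV[k]_n.+1) U (s0 : sec E U) o :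
  (forall o, regc c (fun s => z s 0 o)) -> z c 0 i != 0 -> opn U -> U (Pi (z c)) ->
  regc c (fun s => jvec i (z s) s0 0 o).
Proof.
move=> Hz zi oU Uc; have z0 : z c != 0 by apply: contraNneq zi => ->; rewrite mxE.
have arc := Pi_arc Hz z0; have oW := opnI oU (dm_opn i).
have rW : reg (U `&` dm i) (rho o i).
  by apply: (reg_sub (dm_opn i) oW _ (rho_reg o i)) => y [].
have Wc : (U `&` dm i) (Pi (z c)) by split=> //; apply/Pi_dm.
have R := arc.2 _ _ oW Wc (J_reg s0 oU oW (fun y (Hy : (U `&` dm i) y) => Hy.1) rW).
by apply: regc_eq (regcM (Hz i) R); apply: nearcT => s; rewrite mxE.
Qed.

Lemma Psi_arc nu c (z : k -> 'rV[k]_n.+1) U (s0 : sec E U) :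
  (forall o, regc c (fun s => z s 0 o)) -> z c != 0 -> (forall s, pair nu (z s) = 0) ->
  opn U -> U (Pi (z c)) -> regc c (fun s => Psi nu (z s) s0).
Proof.
move=> Hz zc nz oU Uc; have [i zi] := rv_neq0P zc.
have R : regc c (fun s => pair nu (jvec i (z s) s0)).
  by apply: regc_sum => o _; apply: regcM (regc_cst _ _) _; apply: jvec_arc.
apply: regc_eq R; apply: nearcS (regc_neq0 (Hz i) zi) => s si.
by rewrite (PsiE _ (nz s) si).
Qed.

Lemma Hf_scale x c (f : forall V, sec E V -> k) : c != 0 -> fibre_form x f ->
  Hf H x (fun V s => c * f V s) = c ^+ m *: Hf H x f.
Proof.
move=> c0 ff; have [nz|nz] := pselect (exists V (s : sec E V), f V s != 0).
  pose a := NZForm ff nz; have -> : Hf H x f = H a by rewrite -(HfE amp (a := a) (phi := f)).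
  have [f1 f2 f3 f4] := ff.
  apply: (Hf_scaled amp c0 (a := a)) => //; split.
  - by move=> V s nV; rewrite f1 // mulr0.
  - by move=> V s t oV Vx; rewrite f2 // mulrDr.
  - by move=> V g s oV Vx rg; rewrite f3 // mulrCA.
  - by move=> V W s oV oW WV Wx; rewrite f4.
have z V (s : sec E V) : f V s = 0.
  by apply/eqP; apply: contraT => Hs; case: nz; exists V, s.
rewrite !Hf0 ?scaler0 // => V s; by rewrite z ?mulr0.
Qed.

Lemma Hf_eq0 x (f : forall V, sec E V -> k) : fibre_form x f -> Hf H x f = 0 ->
  forall V (s : sec E V), f V s = 0.
Proof.
move=> ff H0 V s; apply/eqP; apply: contraT => Hs.
have nz : exists V (s : sec E V), f V s != 0 by exists V, s.
have := amp_neq0 amp (NZForm ff nz); rewrite -(HfE amp (a := NZForm ff nz) (phi := f)) //.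
by rewrite H0 eqxx.
Qed.

(** Degree at most d and order at least d at 0 leave a single monomial. *)
Lemma poly_vanish (p : {poly k}) d (h : k -> k) : regc 0 h ->
  nearc 0 (fun s => s != 0 -> p.[s] = s ^+ d * h s) -> (size p <= d.+1)%N ->
  forall s, p.[s] = p`_d * s ^+ d.
Proof.
move=> [A [B [B0 hE]]] pE sp.
have E0 : p * B - 'X^d * A = 0.
  apply: (@poly_near0 k 0); apply: nearcS2 (nearcI hE pE) (nearc_poly B0).
  by move=> s [h1 h2] Bs s0; rewrite !hornerE h2 // h1 -mulrA divfK // subrr.
have dv : 'X^d %| p.
  have cp : coprimep 'X^d B.
    apply: coprimep_expl; have -> : 'X = 'X - 0%:P :> {poly k} by rewrite subr0.
    by rewrite coprimep_sym coprimep_XsubC.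
  by rewrite -(Gauss_dvdpl _ cp); apply/dvdpP; exists A; rewrite [RHS]mulrC; apply/eqP; rewrite -subr_eq0 E0.
have lt (e : nat) : (e < d)%N -> p`_e = 0.
  by move=> id; have [q ->] := dvdpP _ _ dv; rewrite coefMXn id.
move=> s; rewrite (horner_coef_wide _ sp) big_ord_recr /= big1 ?add0r // => i _.
by rewrite lt ?mul0r.
Qed.

(** * Vanishing along lines *)

Section Line.
Variables (P : 'rV[k]_n.+1 -> Prop) (Phi : forall z U, sec E U -> k).
Hypotheses (PD : forall c x y, P x -> P y -> P (x + c *: y))
  (Phi_fib : forall z, P z -> z != 0 -> fibre_form (Pi z) (Phi z))
  (Phi_scale : forall c z U (s : sec E U), P z -> c != 0 -> z != 0 -> Phi (c *: z) s = c * Phi z s)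
  (Phi_reg : forall x y c, P x -> P y -> x + c *: y != 0 -> forall U (s0 : sec E U), opn U ->
     U (Pi (x + c *: y)) -> regc c (fun s => Phi (x + s *: y) s0)).

(** The entries of G, the image of the family under [H], have degree at most m and order at least m
    at the zero, so G(s) = s^m G(1). If G(1) is nonzero, two distinct points of the line have
    proportional images, against [amp_pt]. [P] and [Phi] are abstract to serve both for [Psi nu] on
    the kernel of nu and for [tform] on all vectors. *)
Lemma line_vanish a b : P a -> P b -> a != 0 -> b != 0 ->
  (forall U (s : sec E U), Phi a s = 0) -> forall U (s : sec E U), Phi b s = 0.
Proof.
move=> Pa Pb a0 b0 Za.
have [[c E0]|nab] := pselect (exists c, b = c *: a).
  move=> U s; have c0 : c != 0 by apply: contraNneq b0 => c0; rewrite E0 c0 scale0r.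
  by rewrite E0 Phi_scale // Za mulr0.
pose v := b - a; have Pv : P v by have := PD (-1) Pb Pa; rewrite scaleN1r.
have v0 : v != 0 by rewrite subr_eq0; apply: contra_notN nab => /eqP ->; exists 1; rewrite scale1r.
have zn s : a + s *: v != 0.
  apply: contra_notN nab => /eqP E0; have s0 : s != 0.
    by apply: contraNneq a0 => s0; move: E0; rewrite s0 scale0r addr0 => ->.
  exists (1 - s^-1); apply: (scalerI s0); rewrite scalerA mulrBr mulr1 divff // scalerBl scale1r.
  by apply/eqP; rewrite -subr_eq0 opprB addrCA -scalerBr E0.
have vn s : v + s *: a != 0.
  have [->|s0] := eqVneq s 0; first by rewrite scale0r addr0.
  have := zn s^-1; apply: contraNneq => E0; rewrite -[a](scalerK s0) -scalerDr addrC E0.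
  by rewrite scaler0.
pose G s := Hf H (Pi (a + s *: v)) (Phi (a + s *: v)).
have rz x y c o : regc c (fun s => (x + s *: y : 'rV[k]_n.+1) 0 o) by apply: regc_line.
have rG x y : P x -> P y -> (forall s, x + s *: y != 0) -> forall c (o : 'I_N.+1),
    regc c (fun s => Hf H (Pi (x + s *: y)) (Phi (x + s *: y)) 0 o).
  move=> Px Py nz c o; apply: (arc_reg amp E_lf (Pi_arc (rz x y c) (nz c))).
    by apply: nearcT => s; apply: Phi_fib => //; apply: PD.
  by move=> U s0 oU Uc; apply: Phi_reg.
have /choice[p pE] : forall o : 'I_N.+1, exists p : {poly k}, forall s, G s 0 o = p.[s].
  by move=> o; apply: regc_all_poly => c; apply: rG.
(* Passing to 1/s exchanges the roles of a and v and multiplies G by s^m, so the pole of G at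
   infinity has order at most m. *)
have sp (o : 'I_N.+1) : (size (p o) <= m.+1)%N.
  apply: (poly_order_inf (rG v a Pv Pa vn 0 o)); apply: nearcT => s s0.
  rewrite -pE /G; have E0 : v + s *: a = s *: (a + s^-1 *: v).
    by rewrite scalerDr scalerA divff // scale1r addrC.
  have Pz : P (a + s^-1 *: v) by apply: PD.
  have -> : Hf H (Pi (v + s *: a)) (Phi (v + s *: a)) =
      s ^+ m *: Hf H (Pi (a + s^-1 *: v)) (Phi (a + s^-1 *: v)).
    rewrite -(Hf_scale s0 (Phi_fib Pz (zn _))) E0 Pi_scale //.
    congr Hf; apply: functional_extensionality_dep => U; apply: funext => s1.
    exact: Phi_scale.
  by rewrite mxE.
have G0 : G 0 = 0 by apply: Hf0 => U s; rewrite scale0r addr0.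
suff GZ s : G s = 0.
  have -> : b = a + 1 *: v by rewrite scale1r addrC subrK.
  by apply: (Hf_eq0 (Phi_fib (PD 1 Pa Pv) (zn 1))); apply: GZ.
have [||L|[oo [f [h [_ hr h0 hE]]]]] := arc_lemma amp E_lf (B := 0%N)
    (phi := fun s => @Phi (a + s *: v)) (Pi_arc (rz a v 0) (zn 0)).
- by apply: nearcT => s' _; apply: Phi_fib => //; apply: PD.
- move=> U s0 oU Uc; exists (fun s => Phi (a + s *: v) s0); first exact: Phi_reg.
  by apply: nearcT => s' _; rewrite expr0 mul1r.
- apply/rowP => i; rewrite mxE pE.
  by rewrite (_ : p i = 0) ?horner0 //; apply: (@poly_near0 k 0); apply: nearcS L => s' L s0;
    rewrite -pE /G L // mxE.
(* For [oo] = 0 the value G(0) would be [H] of a nonzero form, but it is 0. *)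
- have o0 : oo != 0%N.
    apply: contraTneq (amp_neq0 amp f) => o0; rewrite -h0 negbK; apply/eqP/rowP => i; rewrite mxE.
    have := regc_uniq_at (hr i) (rG a v Pa Pv zn 0 i).
    rewrite -/(G 0) G0 mxE; apply; apply: nearcS hE => s' hE s0.
    by have := hE s0; rewrite o0 !mul0n expr0 !scale1r /G => ->.
  have pm (i : 'I_N.+1) s' : (p i).[s'] = (p i)`_m * s' ^+ m.
    apply: (poly_vanish (h := fun s => s ^+ (oo.-1 * m) * h s 0 i)) => //.
      by apply: regcM => //; apply: regc_exp; apply: regc_id.
    apply: nearcS hE => s1 hE s0; rewrite -pE /G.
    have /rowP/(_ i) := hE s0; rewrite subr0 mul0n expr0 scale1r mxE => ->.
    by rewrite mulrA -exprD -mulSn prednK // lt0n.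
  have Gs s' : G s' = s' ^+ m *: G 1.
    by apply/rowP => i; rewrite !mxE !pE !pm expr1n mulr1 mulrC.
  have [G1|G1] := eqVneq (G 1) 0; first by rewrite Gs G1 scaler0.
  have [t t0 t1] : exists2 t : k, t != 0 & t ^ (1 : int) != 1 by apply: root_unity_avoid.
  rewrite expr1z in t1.
  have nzf s' : s' != 0 -> exists V (s0 : sec E V), Phi (a + s' *: v) s0 != 0.
    move=> s0; apply: contrapT => nz; move: G1; have : G s' = 0.
      apply: Hf0 => V s1; apply/eqP; apply: contraT => Hs; case: nz; by exists V, s1.
    by rewrite Gs => /eqP; rewrite scaler_eq0 expf_eq0 (negPf s0) andbF => /eqP ->; rewrite eqxx.
  pose fa := NZForm (Phi_fib (PD 1 Pa Pv) (zn 1)) (nzf 1 (oner_neq0 _)).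
  pose fb := NZForm (Phi_fib (PD t Pa Pv) (zn t)) (nzf t t0).
  have Hfa : H fa = G 1 by rewrite -(HfE amp (a := fa) (phi := @Phi (a + 1 *: v))).
  have Hfb : H fb = G t by rewrite -(HfE amp (a := fb) (phi := @Phi (a + t *: v))).
  have := amp_pt amp (a := fa) (b := fb) (c := t ^+ m); rewrite Hfa Hfb -Gs => /(_ erefl) /=.
  move=> /(Pi_inj (zn 1) (zn t))[c c0]; rewrite scale1r [RHS]scalerDr => E1.
  have E2 : (1 - c) *: a = (c - t) *: v.
    by rewrite !scalerBl scale1r; apply/eqP; rewrite subr_eq [X in _ == X]addrC addrA -E1 addrK.
  case: nab; have [ct|ct] := eqVneq c t.
    move: E2; rewrite ct subrr scale0r => /eqP; rewrite scaler_eq0 (negPf a0) orbF subr_eq0.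
    by move=> /eqP E3; rewrite -E3 eqxx in t1.
  have d0 : c - t != 0 by rewrite subr_eq0.
  exists (1 + (c - t)^-1 * (1 - c)).
  by rewrite scalerDl scale1r -scalerA E2 scalerA mulVf // scale1r addrC subrK.
Qed.

End Line.

Lemma Psi_move nu a b : a != 0 -> b != 0 -> pair nu a = 0 -> pair nu b = 0 ->
  (forall U (s : sec E U), Psi nu a s = 0) -> forall U (s : sec E U), Psi nu b s = 0.
Proof.
move=> a0 b0 na nb; apply: (line_vanish (P := fun z => pair nu z = 0)) => //.
- by move=> c x y nx ny; rewrite pairDr pairZr nx ny mulr0 addr0.
- by move=> z _ z0; apply: Psi_fibre.
- by move=> c z U s nz c0 z0; apply: Psi_scale.
- move=> x y c nx ny nz U s0 oU Uc; apply: (Psi_arc (z := fun s => x + s *: y)) => //.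
    by move=> o; apply: regc_line.
  by move=> s; rewrite pairDr pairZr nx ny mulr0 addr0.
Qed.

Definition fmx i z U (e : 'I_r -> sec E U) : 'M[k]_(r, n.+1) := \matrix_l jvec i z (e l).

(** It says that z and the rows of [M] span the preimage in V of the image of the fibre of [E] at
    [z]. *)
Definition spans z (M : 'M[k]_(r, n.+1)) : Prop := forall nu, pair nu z = 0 ->
  ((forall U (s : sec E U), Psi nu z s = 0) <-> M *m nu^T = 0).

Lemma fmx_mul i z U (e : 'I_r -> sec E U) nu l : (fmx i z e *m nu^T) l 0 = pair nu (jvec i z (e l)).
Proof. by rewrite !mxE; apply: eq_bigr => o _; rewrite !mxE mulrC. Qed.

Lemma form_zero U (e : 'I_r -> sec E U) x (f : forall V, sec E V -> k) : opn U -> is_frame e ->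
  U x -> fibre_form x f -> (forall l, f U (e l) = 0) -> forall V (s : sec E V), f V s = 0.
Proof.
move=> oU fr Ux ff H0 V s; rewrite (form_expand oU fr s Ux ff).
rewrite (@formof_ext _ _ _ _ _ _ _ _ (fun=> 0 * 0)) => [|l]; last by rewrite H0 mulr0.
by rewrite (formof_scale e x 0 (fun=> 0)) mul0r.
Qed.

Lemma fmx_spans i z U (e : 'I_r -> sec E U) : opn U -> is_frame e -> U (Pi z) -> z 0 i != 0 ->
  spans z (fmx i z e).
Proof.
move=> oU fr Uz zi nu nz; split=> [H0|H0].
  by apply/matrixP => l x; rewrite ord1 fmx_mul -(PsiE _ nz zi) H0 mxE.
have z0 : z != 0 by apply: contraNneq zi => ->; rewrite mxE.
apply: (form_zero oU fr Uz (Psi_fibre nu z0)) => l.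
by rewrite (PsiE _ nz zi) -fmx_mul H0 mxE.
Qed.

Lemma spans_ex z : z != 0 -> exists M, spans z M.
Proof.
move=> z0; have [U [e [oU Uz fr]]] := frame_at E_lf (Pi z).
by exists (fmx (idx z) z e); apply: fmx_spans => //; apply: idxP.
Qed.

(** Dual to [Psi_move]: a form that kills a, b and the fibre at a kills the fibre at b. *)
Lemma spans_move a b A B : a != 0 -> b != 0 -> spans a A -> spans b B ->
  (col_mx b B <= col_mx (col_mx a A) b)%MS.
Proof.
move=> a0 b0 SA SB; apply: annih_sub => nu; rewrite !mul_col_mx => /eqP.
rewrite !col_mx_eq0 => /andP[/andP[/eqP/pair_mx0 na /eqP HA] /eqP nb].
have nb' := nb; move/pair_mx0: nb' => nb0.
apply/eqP; rewrite col_mx_eq0 nb eqxx /=; apply/eqP/(SB _ nb0).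
by apply: (Psi_move a0) => //; apply/SA.
Qed.

(** Let L_z be the span of z and the fibre at [z]. For r < n, W is the intersection of L_x0 and L_y
    with y outside L_x0: both have dimension r + 1 and their sum has dimension r + 2. For p in W the
    fibre at p lies in W, and a form that kills W moves from p to any z in its kernel. For r = n, W
    is the kernel of a form that kills [E] at some point, if there is one. *)
Lemma subspace_ex : (exists x0 M0, [/\ x0 != 0, spans x0 M0 & row_free (col_mx x0 M0)]) ->
  (0 < r)%N ->
  (r = n /\ forall z nu, z != 0 -> pair nu z = 0 -> (forall U (s : sec E U), Psi nu z s = 0) -> nu = 0)
  \/ exists w : 'M[k]_(r, n.+1), row_free w /\ forall z nu, z != 0 -> pair nu z = 0 ->
       w *m nu^T = 0 -> forall U (s : sec E U), Psi nu z s = 0.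
Proof.
move=> [x0 [M0 [x00 S0 F0]]] r0.
have rn : (r <= n)%N by have := rank_leq_col (col_mx x0 M0); rewrite (eqP F0).
have [rlt|rge] := ltnP r n; last first.
  have rE : r = n by apply/eqP; rewrite eqn_leq rn.
  have [H0|/existsNP[y /existsNP[mu]]] := pselect (forall z nu, z != 0 -> pair nu z = 0 ->
    (forall U (s : sec E U), Psi nu z s = 0) -> nu = 0); first by left.
  move=> /not_implyP[y0 /not_implyP[my /not_implyP[Hmu /eqP mu0]]]; right.
  have rk : \rank (kermx mu^T) = r.
    by rewrite mxrank_ker mxrank_tr rank_rV mu0 rE subSS subn0.
  have [w [wf wE]] := base_cast rk; exists w; split=> // z nu z0 nz wn.
  have /sub_rVP[c nuE] : (nu <= mu)%MS.
    apply: annih_sub => v vmu; have : (v <= w)%MS.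
      rewrite wE; apply/sub_kermxP; have := congr1 trmx vmu.
      by rewrite trmx_mul trmxK trmx0.
    move=> /submxP[Y ->]; rewrite -[LHS]trmxK trmx_mul trmxK -mulmxA wn mulmx0.
    by rewrite trmx0.
  have [c0|c0] := eqVneq c 0.
    by move=> U s; rewrite nuE c0 scale0r -(scale0r mu) PsiZl mul0r.
  move=> U s; rewrite nuE PsiZl; apply/eqP; rewrite mulf_eq0 (negPf c0) /=; apply/eqP.
  apply: (Psi_move y0 z0 my) => //; move: nz; rewrite nuE pairZl => /eqP.
  by rewrite mulf_eq0 (negPf c0) => /eqP.
right; set L := col_mx x0 M0; have rL : \rank L = r.+1 by apply/eqP.
have [y yL] : exists y : 'rV[k]_n.+1, ~~ (y <= L)%MS.
  apply: contrapT => Hy; have : (1%:M <= L)%MS.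
    apply/row_subP => i; apply: contraT => Hi; case: Hy; by exists (row i 1%:M).
  by move=> /mxrankS; rewrite mxrank1 rL ltnS leqNgt rlt.
have y0 : y != 0 by apply: contraNneq yL => ->; apply: sub0mx.
have [My Sy] := spans_ex y0; set Ly := col_mx y My.
have s1 := spans_move x00 y0 S0 Sy; have s2 := spans_move y0 x00 Sy S0.
rewrite -/L -/Ly in s1 s2.
have yLy : (y <= Ly)%MS by rewrite -addsmxE addsmxSl.
have rLy2 : \rank (L + y)%MS = r.+2.
  apply/eqP; rewrite eqn_leq; apply/andP; split.
    by apply: (leq_trans (mxrank_adds_leqif _ _).1); rewrite rL rank_rV y0 addn1.
  rewrite -rL; apply: rank_ltmx; rewrite ltmxE addsmxSl /=.
  by apply: contra yL => h; apply: submx_trans (addsmxSr L y) h.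
have sumE : (L + Ly :=: L + y)%MS.
  apply/eqmxP; rewrite !addsmx_sub !addsmxSl /= (submx_trans yLy (addsmxSr _ _)) andbT.
  by rewrite addsmxE.
have rLy : \rank Ly = r.+1.
  apply/eqP; rewrite eqn_leq (leq_trans (rank_leq_row _)) //=.
  have : (L + y <= Ly + x0)%MS.
    rewrite addsmx_sub (submx_trans yLy (addsmxSl _ _)) andbT.
    by rewrite addsmxE.
  move=> /mxrankS; rewrite rLy2 => h; have := leq_trans h (mxrank_adds_leqif _ _).1.
  by rewrite rank_rV x00 addn1 ltnS.
have rk : \rank (L :&: Ly)%MS = r.
  have := mxrank_sum_cap L Ly; rewrite sumE rLy2 rL rLy; lia.
have [w [wf wE]] := base_cast rk; exists w; split=> // z nu z0 nz wn.
pose p := row (Ordinal r0) w.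
have pw : (p <= w)%MS by apply: row_sub.
have p0 : p != 0 by move: wf => /row_freeP[w' ww']; apply/eqP => E0;
  have := congr1 (row (Ordinal r0)) ww'; rewrite row_mul -/p E0 mul0mx => /rowP/(_ (Ordinal r0));
  rewrite !mxE eqxx => /esym/eqP; rewrite oner_eq0.
have pL : (p <= L)%MS by rewrite (submx_trans pw) // wE capmxSl.
have pLy : (p <= Ly)%MS by rewrite (submx_trans pw) // wE capmxSr.
have [Mp Sp] := spans_ex p0.
have t1 : (Mp <= L)%MS.
  apply: submx_trans (submx_trans (spans_move x00 p0 S0 Sp) _).
    by rewrite -addsmxE addsmxSr.
  by rewrite -addsmxE addsmx_sub submx_refl.
have t2 : (Mp <= Ly)%MS.
  apply: submx_trans (submx_trans (spans_move y0 p0 Sy Sp) _).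
    by rewrite -addsmxE addsmxSr.
  by rewrite -addsmxE addsmx_sub submx_refl.
have kill v : (v <= w)%MS -> v *m nu^T = 0 :> 'M_(_, 1).
  by move=> /submxP[Y ->]; rewrite -mulmxA wn mulmx0.
have np : pair nu p = 0 by apply/pair_mx0/kill.
apply: (Psi_move p0 z0 np nz); apply/(Sp _ np).
have /submxP[Y ->] : (Mp <= w)%MS by rewrite wE sub_capmx t1.
by rewrite -mulmxA wn mulmx0.
Qed.

(** * Generic rank and vector fields *)

Hypotheses (r_gt0 : (0 < r)%N) (J_inj : oinjective J).

Lemma jvec_i i z U (s : sec E U) : z != 0 -> z 0 i != 0 -> opn U -> U (Pi z) -> jvec i z s 0 i = 0.
Proof. by move=> z0 zi oU Uz; apply: vec_i => //; apply: J_deriv. Qed.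

Lemma J_eq0 U (s : sec E U) : opn U ->
  (forall z, z != 0 -> U (Pi z) -> exists2 i, z 0 i != 0 & jvec i z s = 0) -> s = 0.
Proof.
move=> oU Hs; apply: (J_inj oU); rewrite (omorphism0 J_mor oU); apply: fsec_inj => -[x f].
rewrite fsec_zero; have [Ux|nU] := pselect (U x); last exact: fsec_supp.
have [z z0 xz] := Pi_surj x; rewrite xz in Ux *; have [i zi v0] := Hs z z0 Ux.
exact: (vec_eq0 z0 zi (J_deriv s oU Ux)).
Qed.

Lemma J_eq U (s t : sec E U) : opn U ->
  (forall z nu, z != 0 -> U (Pi z) -> pair nu z = 0 -> Psi nu z s = Psi nu z t) -> s = t.
Proof.
move=> oU Hst; apply/eqP; rewrite -subr_eq0; apply/eqP; apply: J_eq0 => // z z0 Uz.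
have zi := idxP z0; exists (idx z) => //; set d := jvec _ _ _.
have dE : jvec (idx z) z s = d + jvec (idx z) z t by rewrite -jvecD // subrK.
have /sub_rVP[c dc] : (d <= z)%MS.
  apply: annih_sub => nu /pair_mx0 nz; apply/pair_mx0.
  have := Hst z nu z0 Uz nz; rewrite /Psi dE pairDr => /eqP.
  by rewrite -[X in _ == X]add0r (inj_eq (addIr _)) => /eqP.
have := jvec_i (s - t) z0 zi oU Uz; rewrite -/d dc mxE => /eqP.
by rewrite mulf_eq0 (negPf zi) orbF => /eqP ->; rewrite scale0r.
Qed.

Lemma jvec_sum i z U (F : 'I_r -> sec E U) : opn U ->
  jvec i z (\sum_l F l) = \sum_l jvec i z (F l).
Proof.
move=> oU; apply: (big_morph (fun s : sec E U => jvec i z s)) => [s t|]; first exact: jvecD.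
have := jvecD i z (0 : sec E U) 0 oU; rewrite addr0 => /eqP.
by rewrite -[X in X == _]addr0 (inj_eq (addrI _)) => /eqP <-.
Qed.

Lemma dm_chart i x : dm i x -> exists q, x = K i q.
Proof.
by move=> /stdchart_dom[q E0]; exists q; apply: (can_inj phiK); rewrite E0 KE.
Qed.

Lemma reg_chart i U f : opn U -> U `<=` dm i ->
  (forall q, U (K i q) -> regp q (f \o K i)) -> reg U f.
Proof.
move=> oU Ud Hf; apply: reg_local => // x Ux; have [q xq] := dm_chart (Ud x Ux).
by rewrite xq in Ux *; apply: (ch_regV (chK i)); apply: Hf.
Qed.

Lemma jvec_hom i q U (s : sec E U) o :
  jvec i (hom i q) s 0 o = fval (J s) (K i q, rho o i).
Proof. by rewrite /jvec /vec mxE hom_j mul1r Pi_hom. Qed.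

Lemma jvec_regp i q U (s : sec E U) o : opn U -> U (K i q) ->
  regp q (fun q => fval (J s) (K i q, rho o i)).
Proof.
move=> oU Uq; have oW := opnI oU (dm_opn i).
have dq : dm i (K i q) by rewrite -Pi_hom; apply/Pi_dm; rewrite ?hom_neq0 ?hom_j ?oner_neq0.
have rW : reg (U `&` dm i) (rho o i).
  by apply: (reg_sub (dm_opn i) oW _ (rho_reg o i)) => y [].
have R := J_reg s oU oW (fun y (Hy : (U `&` dm i) y) => Hy.1) rW.
exact: (ch_reg (chK i) oW (conj Uq dq) R).
Qed.

Lemma spans_sub z A B : spans z A -> spans z B -> (col_mx z A <= col_mx z B)%MS.
Proof.
move=> SA SB; apply: annih_sub => nu; rewrite !mul_col_mx => /eqP.
rewrite !col_mx_eq0 => /andP[nz /eqP HB]; have nz0 : pair nu z = 0 by apply/pair_mx0/eqP.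
by apply/eqP; rewrite col_mx_eq0 nz /=; apply/eqP/(SA _ nz0)/(SB _ nz0).
Qed.

(* If the rank of E -> T were everywhere smaller than r, Cramer's rule would
   give a nonzero local section of E killed by J. *)
Lemma generic_rank : exists x0 M0, [/\ x0 != 0, spans x0 M0 & row_free (col_mx x0 M0)].
Proof.
pose i : 'I_n.+1 := ord0; have [U [e [oU U1 fr]]] := frame_at E_lf (K i 0).
pose A (x : X) : 'M[k]_(r, n) := \matrix_(l, o) fval (J (e l)) (x, rho (lift i o) i).
have oO := opnI oU (dm_opn i); set O := U `&` dm i in oO.
have inO q : U (K i q) -> O (K i q).
  by move=> Uq; split=> //; rewrite -Pi_hom; apply/Pi_dm; rewrite ?hom_neq0 ?hom_j ?oner_neq0.
have A_regp q l (o : 'I_n) : U (K i q) -> regp q (fun q => A (K i q) l o).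
  move=> Uq; apply: regp_eq (jvec_regp (e l) (lift i o) oU Uq).
  by apply: nearpT => q'; rewrite mxE.
pose Pd d := `[< exists x, O x /\ \rank (A x) = d >].
have exd : exists d, Pd d by exists (\rank (A (K i 0))); apply/asboolP; exists (K i 0); split=> //; apply: inO.
have ubd d : Pd d -> (d <= r)%N by move=> /asboolP[x [_ <-]]; apply: rank_leq_row.
case: (ex_maxnP exd ubd) => d /asboolP[x2 [Ox2 rk]] dmax.
have [rd|dr] := leqP r d.
  have [q xq] := dm_chart Ox2.2; rewrite xq in Ox2 rk.
  exists (hom i q), (fmx i (hom i q) e); split; first exact: hom_neq0.
    by apply: fmx_spans => //; rewrite ?Pi_hom ?hom_j ?oner_neq0 //; case: Ox2.
  have fA : row_free (A (K i q)) by rewrite /row_free rk eqn_leq rd ubd //; apply/asboolP; exists (K i q).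
  rewrite -kermx_eq0; apply/rowV0P => v /sub_kermxP.
  rewrite -[v]hsubmxK mul_row_col; move: (lsubmx v) (rsubmx v) => c u E0.
  have Oq := Ox2.1; have c0 : c = 0.
    apply/rowP => y; rewrite ord1 mxE; have /rowP/(_ i) := E0; rewrite mxE mxE big_ord1 hom_j mulr1.
    rewrite [X in _ + X]mxE big1 ?addr0 ?mxE // => l _.
    by rewrite [X in _ * X]mxE jvec_i ?mulr0 ?hom_neq0 ?hom_j ?oner_neq0 // Pi_hom.
  have u0 : u *m A (K i q) = 0.
    apply/rowP => o; have /rowP/(_ (lift i o)) := E0; rewrite c0 mul0mx add0r !mxE => E1.
    by rewrite -[RHS]E1; apply: eq_bigr => l _; rewrite [in RHS]mxE jvec_hom [in LHS]mxE.
  by rewrite c0; have [R AR] := row_freeP fA; rewrite -[u]mulmx1 -AR mulmxA u0 mul0mx row_mx0.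
have [P [Q PAQ]] := rank_factor rk.
pose Dm x : 'M[k]_d := P *m A x *m Q.
(* By Cramer's rule the rows of [Km] are relations between the rows of [A] as long as the rank is at
   most d. They are regular in x, and some entry at [x2] is nonzero because d < r. *)
pose Km x : 'M[k]_r := \det (Dm x) *: 1%:M - A x *m Q *m \adj (Dm x) *m P.
have D_regp q a b : U (K i q) -> regp q (fun q => Dm (K i q) a b).
  move=> Uq; apply: (@regp_mulmx k n q d n d (fun q => P *m A (K i q)) (fun=> Q)) => [x y|x y].
    apply: (@regp_mulmx k n q d r n (fun=> P) (fun q => A (K i q))) => [x' y'|x' y'].
      exact: regp_cst.
    exact: A_regp.
  exact: regp_cst.
have K_regp q a b : U (K i q) -> regp q (fun q => Km (K i q) a b).
  move=> Uq.
  have R : regp q (fun q => (A (K i q) *m Q *m \adj (Dm (K i q)) *m P) a b).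
    apply: (@regp_mulmx k n q r d r (fun q => A (K i q) *m Q *m \adj (Dm (K i q))) (fun=> P)) => x y; last exact: regp_cst.
    apply: (@regp_mulmx k n q r d d (fun q => A (K i q) *m Q) (fun q => \adj (Dm (K i q)))) => x' y'; last first.
      by apply: regp_adj => x'' y''; apply: D_regp.
    apply: (@regp_mulmx k n q r n d (fun q => A (K i q)) (fun=> Q)) => x'' y''; last exact: regp_cst.
    exact: A_regp.
  apply: regp_eq (regpB (regpM (regp_det (fun x y => D_regp q x y Uq)) (regp_cst q ((1%:M : 'M[k]_r) a b))) R).
  by apply: nearpT => q'; rewrite !mxE.
have Od : O `<=` dm i by move=> x [].
have oO1 : opn (O `&` [set x | \det (Dm x) != 0]).
  apply: opn_neq0 => //; apply: (reg_chart oO Od) => q [Uq _].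
  by apply: regp_det => x y; apply: D_regp.
set O1 := O `&` _ in oO1.
have D2 : Dm x2 = 1%:M by rewrite /Dm PAQ.
have O12 : O1 x2 by split=> //=; rewrite D2 det1 oner_neq0.
have O1U : O1 `<=` U by move=> x [[]].
have O1d : O1 `<=` dm i by move=> x [[]].
have KA x : O1 x -> Km x *m A x = 0.
  move=> [Ox Dx]; have uD : P *m A x *m Q \in unitmx by rewrite unitmxE unitfE.
  have [|Y YE] := rowsub_factor uD; first by apply: dmax; apply/asboolP; exists x.
  rewrite mulmxBl -scalemxAl mul1mx; apply/eqP; rewrite subr_eq0; apply/eqP.
  have E1 : A x *m Q *m \adj (Dm x) = \det (Dm x) *: Y.
    transitivity (Y *m (Dm x *m \adj (Dm x))); last by rewrite mul_mx_adj mul_mx_scalar.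
    by rewrite [X in X *m Q *m _]YE /Dm !mulmxA.
  by rewrite E1 -!scalemxAl -mulmxA -YE.
have [l [l' Kll]] : exists l l', Km x2 l l' != 0.
  apply: contrapT => Hn; have K0 : Km x2 = 0.
    apply/matrixP => a b; rewrite [RHS]mxE; apply/eqP; apply: contraT => Hab.
    by case: Hn; exists a, b.
  move/eqP: K0; rewrite /Km D2 det1 scale1r subr_eq0 => /eqP/(congr1 mxrank).
  rewrite mxrank1 => rE; move: dr; rewrite {1}rE ltnNge; apply/negP; rewrite negbK.
  exact: leq_trans (mxrankM_maxr _ _) (rank_leq_row _).
have Kreg b : reg O1 (fun x => Km x l b).
  apply: (reg_chart oO1 O1d) => q [[Uq _] _]; exact: K_regp.
have [_ uniq0] := fr O1 oO1 O1U.
case/negP: Kll; apply/eqP; apply: (uniq0 (fun b x => Km x l b) Kreg _ l' x2 O12).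
apply: J_eq0 => // z z0 O1z; have zi : z 0 i != 0 by apply/Pi_dm => //; apply: O1d.
exists i => //; apply/rowP => o; rewrite [RHS]mxE.
have [o' ->|->] := unliftP i o; last by apply: jvec_i.
rewrite jvec_sum // summxE.
rewrite (eq_bigr (fun b => z 0 i * (Km (Pi z) l b * A (Pi z) b o'))) => [|b _].
  rewrite -mulr_sumr; have /matrixP/(_ l o') := KA _ O1z; rewrite [LHS]mxE [RHS]mxE => ->.
  by rewrite mulr0.
rewrite jvec_act // jvec_res // [LHS]mxE [X in _ * X = _]mxE mulrCA.
by congr (_ * (_ * _)); rewrite [RHS]mxE.
Qed.

Lemma prep_stdchart i q : exists2 c, c != 0 &
  sval (prep (stdchart i q : PN)) = c *: hom i q.
Proof.
apply: mkP_inj; [exact: hom_neq0|exact: (svalP (prep (stdchart i q : PN)))|].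
by rewrite prep_mkP.
Qed.

(** * Lifting to a direct sum of copies of O(1) *)

Section Quotient.
Variable w : 'M[k]_(r, n.+1).
Hypotheses (w_free : row_free w)
  (w_sub : forall z nu, z != 0 -> pair nu z = 0 -> w *m nu^T = 0 ->
     forall U (s : sec E U), Psi nu z s = 0).

Lemma mu_ex : exists mu : 'rV[k]_n.+1, mu != 0 /\ w *m mu^T = 0.
Proof.
have rn : (r <= n)%N.
  by have [x0 [M0 [_ _ F0]]] := generic_rank; have := rank_leq_col (col_mx x0 M0); rewrite (eqP F0).
apply: contrapT => Hn; have : (1%:M <= w)%MS.
  apply: annih_sub => nu wnu; rewrite mul1mx; apply/eqP; rewrite trmx_eq0; apply: contraT => nu0.
  by case: Hn; exists nu.
by move=> /mxrankS; rewrite mxrank1 (eqP w_free) ltnNge rn.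
Qed.

(** [y *m w] is a vector of W that lifts the value of [J s] at [z]; it is unique only for z outside
    W. *)
Definition solves U (s : sec E U) z (y : 'rV[k]_r) : Prop :=
  forall nu, pair nu z = 0 -> Psi nu z s = pair nu (y *m w).

Lemma pair_comb (c d : k) (a b x : 'rV[k]_n.+1) :
  pair (c *: a - d *: b) x = c * pair a x - d * pair b x.
Proof. by rewrite pairC pairDr -scaleNr !pairZr mulNr !(pairC x). Qed.

(** Let mu kill W and l = mu(z). Where l = 0, mu kills [E], so l divides mu of the chart lift [y1],
    and subtracting the quotient times z gives a lift in the kernel of mu. It is in W where l is
    nonzero, hence everywhere since germs form a domain. *)
Lemma divide_local U (s : sec E U) i q0 : opn U -> U (K i q0) ->
  exists tau : 'rV[k]_n -> 'rV[k]_r, (forall l, regp q0 (fun q => tau q 0 l)) /\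
    nearp q0 (fun q => U (K i q) /\ solves s (hom i q) (tau q)).
Proof.
move=> oU Uq; have [mu [mu0 wmu]] := mu_ex.
pose y1 q : 'rV[k]_n.+1 := jvec i (hom i q) s.
have ry1 o : regp q0 (fun q => y1 q 0 o).
  by apply: regp_eq (jvec_regp s o oU Uq); apply: nearpT => q; rewrite jvec_hom.
pose l q := pair mu (hom i q).
have lE q : l q = mu 0 i + \sum_a (\row_a mu 0 (lift i a)) 0 a * q 0 a.
  rewrite /l /pair (sum_lift _ i) hom_j mulr1; congr (_ + _).
  by apply: eq_bigr => a _; rewrite hom_lift [in RHS]mxE.
have lnz : exists q, l q != 0.
  have [o muo] := rv_neq0P mu0; have [mi|mi] := eqVneq (mu 0 i) 0; last first.
    by exists 0; rewrite lE big1 ?addr0 // => a _; rewrite [X in _ * X]mxE mulr0.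
  have [a oa|oi] := unliftP i o; last by rewrite oi mi eqxx in muo.
  exists (delta_mx 0 a); rewrite lE mi add0r (bigD1 a) //= big1 ?addr0 => [|b /negPf ba].
    by rewrite !mxE !eqxx mulr1 -oa.
  by rewrite [X in _ * X]mxE ba andbF mulr0.
have Pl : polyfun l.
  by apply: polyfun_sum => o _; apply: polyfunM; [apply: polyfun_cst|apply: polyfun_hom].
have nU := ch_near (chK i) oU Uq.
have PsiH nu q : pair nu (hom i q) = 0 -> Psi nu (hom i q) s = pair nu (y1 q).
  by move=> nz; apply: PsiE => //; rewrite hom_j oner_neq0.
have rf : regp q0 (fun q => pair mu (y1 q)).
  by apply: regp_sum => o _; apply: regpM => //; apply: regp_cst.
have f0 : nearp q0 (fun q => l q = 0 -> pair mu (y1 q) = 0).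
  by apply: nearpT => q lq; rewrite -PsiH // w_sub // hom_neq0.
have [g [rg gE]] := regp_divide lE lnz rf f0.
pose y q := y1 q - g q *: hom i q.
have ry o : regp q0 (fun q => y q 0 o).
  have -> : (fun q => y q 0 o) = (fun q => y1 q 0 o - g q * hom i q 0 o).
    by apply: funext => q; rewrite /y !mxE.
  by apply: regpB => //; apply: regpM => //; apply: regp_poly; apply: polyfun_hom.
have pairy nu q : pair nu (y q) = pair nu (y1 q) - g q * pair nu (hom i q).
  by rewrite /y -scaleNr pairDr pairZr mulNr.
(* [Nu] is the combination of nu and mu that vanishes on z; as it kills W too, it kills [E]
   there. *)
have key nu q : pair mu (y1 q) = g q * l q -> w *m nu^T = 0 -> l q * pair nu (y q) = 0.
  move=> fE wnu; pose Nu := l q *: nu - pair nu (hom i q) *: mu.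
  have Nz : pair Nu (hom i q) = 0 by rewrite pair_comb -/(l q) mulrC subrr.
  have Nw : w *m Nu^T = 0.
    have wr (x : 'rV[k]_n.+1) c : (w *m x^T) c 0 = pair x (row c w).
      by rewrite mxE; apply: eq_bigr => o _; rewrite !mxE mulrC.
    by apply/colP => c; rewrite wr pair_comb -!wr wnu wmu !mxE !mulr0 subrr.
  have := w_sub (hom_neq0 i q) Nz Nw s; rewrite PsiH // pair_comb fE pairy => E0.
  by rewrite mulrBr -[RHS]E0; ring.
pose u c q := (y q *m cokermx w) 0 c.
have uz c : nearp q0 (fun q => u c q = 0).
  apply: (regp_domain (l := l)) => //.
    apply: (@regp_mulmx k n q0 1 n.+1 n.+1 y (fun=> cokermx w)) => [x o|x o]; last exact: regp_cst.
    by rewrite ord1.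
  apply: nearpS gE => q fE; rewrite -[RHS](key (col c (cokermx w))^T q fE).
    congr (_ * _); rewrite /u mxE /pair; apply: eq_bigr => o _; rewrite mulrC; congr (_ * _).
    by rewrite [RHS]mxE [RHS]mxE.
  by rewrite trmxK colE mulmxA mulmx_coker mul0mx.
have yw : nearp q0 (fun q => (y q <= w)%MS).
  apply: nearpS (nearp_all uz) => q Hq; rewrite submxE; apply/eqP/rowP => c.
  by rewrite [RHS]mxE; apply: Hq.
exists (fun q => y q *m pinvmx w); split=> [c|].
  apply: (@regp_mulmx k n q0 1 n.+1 r y (fun=> pinvmx w)) => [x o|x o]; last exact: regp_cst.
  by rewrite ord1.
apply: nearpS2 nU yw => q Uq' ywq; split=> // nu nz.
by rewrite PsiH // mulmxKpV // pairy nz mulr0 subr0.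
Qed.

(** Along a direction on which a form mu killing W is nonzero, mu(z + a v) is a nonzero polynomial
    in a, so z + a v is outside W for small nonzero a. *)
Lemma dir_ex : exists v : 'rV[k]_n.+1, forall z, nearc 0 (fun a => a != 0 ->
  forall c : k, (c *: (z + a *: v)%R <= w)%MS -> c = 0).
Proof.
have [mu [mu0 wmu]] := mu_ex; have [o muo] := rv_neq0P mu0.
exists (delta_mx 0 o) => z; pose p : {poly k} := (mu 0 o) *: 'X + (pair mu z)%:P.
have p0 : p != 0.
  apply: contraNneq muo => /(congr1 (fun p : {poly k} => p`_1)).
  by rewrite coefD coefZ coefX coefC mulr1 addr0 coef0 => ->.
apply: nearcS (poly_near_neq0 0 p0) => a Ha a0 c /submxP[Y cE].
have : pair mu (c *: (z + a *: delta_mx 0 o)) = 0.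
  by apply/pair_mx0; rewrite cE -mulmxA wmu mulmx0.
rewrite pairZr pairDr pairZr pair_delta => /eqP; rewrite mulf_eq0 => /orP[/eqP //|].
by have := Ha a0; rewrite !hornerE addrC [a * _]mulrC => /negPf ->.
Qed.

Let v := sval (cid dir_ex).

(** For z in W the lift is ambiguous, since z itself lifts 0. The value at z is taken as the limit
    of the lifts at z + a v, which are unique. *)
Definition tlim U (s : sec E U) z (y : 'rV[k]_r) : Prop := exists t : k -> 'rV[k]_r,
  [/\ forall l, regc 0 (fun a => t a 0 l), t 0 = y &
      nearc 0 (fun a => solves s (z + a *: v) (t a))].

Lemma tlim_uniq U (s : sec E U) z y y' : tlim s z y -> tlim s z y' -> y = y'.
Proof.
move=> [t [rt <- tE]] [t' [rt' <- tE']]; apply/rowP => l.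
apply: (regc_uniq_at (rt l) (rt' l)).
apply: nearcS2 (nearcI tE tE') (svalP (cid dir_ex) z) => a [Ha Ha'] Hc a0.
suff -> : t a = t' a by [].
apply: (row_free_inj w_free); apply/eqP; rewrite -subr_eq0 -mulmxBl; apply/eqP.
have /sub_rVP[c cE] : ((t a - t' a)%R *m w <= (z + a *: v)%R)%MS.
  apply: annih_sub => nu /pair_mx0 nz; apply/pair_mx0.
  by rewrite mulmxBl -scaleN1r pairDr pairZr -Ha // -Ha' // mulN1r subrr.
by rewrite cE (Hc a0 c) ?scale0r // -/v -cE submxMl.
Qed.

Lemma nearp_near (p : 'rV[k]_n) (P : 'rV[k]_n -> Prop) : nearp p P -> nearp p (fun q => nearp q P).
Proof. by move=> [C PC [Cp HC]]; exists C => //; split=> // q Cq; exists C. Qed.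

Lemma solves_scale U (s : sec E U) z y i : z 0 i != 0 -> solves s (hom i (deh i z)) y ->
  solves s z (z 0 i *: y).
Proof.
move=> zi Hs nu; rewrite (hom_deh zi) pairZr => /eqP; rewrite mulf_eq0 (negPf zi) => /eqP nz.
rewrite Psi_scale ?hom_neq0 // Hs // -scalemxAl pairZr.
by rewrite [in RHS]mxE hom_j mulr1.
Qed.

Lemma tlim_near U (s : sec E U) i q0 : opn U -> U (K i q0) ->
  exists tau : 'rV[k]_n -> 'rV[k]_r, (forall l, regp q0 (fun q => tau q 0 l)) /\
    nearp q0 (fun q => [/\ U (K i q), solves s (hom i q) (tau q) &
      forall z, z 0 i != 0 -> deh i z = q -> tlim s z (z 0 i *: tau q)]).
Proof.
move=> oU Uq; have [tau [rtau nt]] := divide_local s oU Uq; exists tau; split=> //.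
apply: nearpS2 (nearp_all (fun l => regp_near (rtau l))) (nearpI nt (nearp_near nt)).
move=> q rq [[Uq' Sq] Nq]; split=> // z zi zq.
have rz o : regc 0 (fun a => (z + a *: v) 0 o) by apply: regc_line.
have z0 : (z + 0 *: v) 0 i != 0 by rewrite scale0r addr0.
have rd l : regc 0 (fun a => deh i (z + a *: v) 0 l).
  apply: regc_eq (regcM (rz (lift i l)) (regcV (rz i) z0)).
  by apply: nearcT => a; rewrite [RHS]mxE.
have dq : deh i (z + 0 *: v) = q by rewrite scale0r addr0.
exists (fun a => (z + a *: v) 0 i *: tau (deh i (z + a *: v))); split.
- move=> l; have R : regc 0 ((fun q => tau q 0 l) \o (fun a => deh i (z + a *: v))).
    by apply: regp_arc => //; rewrite dq; apply: rq.
  by apply: regc_eq (regcM (rz i) R); apply: nearcT => a; rewrite [RHS]mxE.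
- by rewrite dq scale0r addr0.
have nq : nearp (deh i (z + 0 *: v)) (fun q => U (K i q) /\ solves s (hom i q) (tau q)) by rewrite dq.
apply: nearcS2 (nearp_arc nq rd) (regc_neq0 (rz i) z0) => a [_ Sa] ai.
exact: solves_scale.
Qed.

Definition tval U (s : sec E U) z : 'rV[k]_r :=
  if pselect (exists y, tlim s z y) is left h then sval (cid h) else 0.

Lemma tvalE U (s : sec E U) z y : tlim s z y -> tval s z = y.
Proof.
move=> H0; rewrite /tval; case: pselect => [h|[]]; last by exists y.
exact: tlim_uniq (svalP (cid h)) H0.
Qed.

Lemma tval_near U (s : sec E U) i q0 : opn U -> U (K i q0) ->
  exists tau : 'rV[k]_n -> 'rV[k]_r, (forall l, regp q0 (fun q => tau q 0 l)) /\
    nearp q0 (fun q => [/\ U (K i q), solves s (hom i q) (tau q) &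
      forall z, z 0 i != 0 -> deh i z = q -> tval s z = z 0 i *: tau q]).
Proof.
move=> oU Uq; have [tau [rt nt]] := tlim_near s oU Uq; exists tau; split=> //.
by apply: nearpS nt => q [h1 h2 h3]; split=> // z zi zq; apply/tvalE/h3.
Qed.

Lemma tlim_tval U (s : sec E U) z : opn U -> z != 0 -> U (Pi z) -> tlim s z (tval s z).
Proof.
move=> oU z0; have zi := idxP z0; rewrite (Pi_deh zi) => Uz.
have [tau [_ /nearp_at[_ _ Ht]]] := tlim_near s oU Uz.
by have H0 := Ht z zi erefl; rewrite (tvalE H0).
Qed.

Lemma tval_solves U (s : sec E U) z : opn U -> z != 0 -> U (Pi z) -> solves s z (tval s z).
Proof.
move=> oU z0; have zi := idxP z0; rewrite (Pi_deh zi) => Uz.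
have [tau [_ /nearp_at[_ Hs Ht]]] := tval_near s oU Uz.
by rewrite (Ht z zi erefl); apply: solves_scale.
Qed.

Lemma tval_scale U (s : sec E U) c z : opn U -> c != 0 -> z != 0 -> U (Pi z) ->
  tval s (c *: z) = c *: tval s z.
Proof.
move=> oU c0 z0; have zi := idxP z0; rewrite (Pi_deh zi) => Uz.
have [tau [_ /nearp_at[_ Hs Ht]]] := tval_near s oU Uz.
rewrite (Ht z zi erefl) (Ht (c *: z)) ?deh_scale // mxE ?scalerA //.
by rewrite mulf_neq0.
Qed.

Lemma near_line U z : opn U -> z != 0 -> U (Pi z) -> nearc 0 (fun a => z + a *: v != 0 /\ U (Pi (z + a *: v))).
Proof.
move=> oU z0 Uz; have z00 : z + 0 *: v != 0 by rewrite scale0r addr0.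
have rz o : regc 0 (fun a => (z + a *: v) 0 o) by apply: regc_line.
apply: nearcI; first exact: (arc_neq0 rz z00).
by apply: (Pi_arc rz z00).1; rewrite ?scale0r ?addr0.
Qed.

Lemma tvalD U (s t : sec E U) z : opn U -> z != 0 -> U (Pi z) ->
  tval (s + t) z = tval s z + tval t z.
Proof.
move=> oU z0 Uz; apply: tvalE.
have [f [rf <- Sf]] := tlim_tval s oU z0 Uz; have [g [rg <- Sg]] := tlim_tval t oU z0 Uz.
exists (fun a => f a + g a); split=> //.
  by move=> l; apply: regc_eq (regcD (rf l) (rg l)); apply: nearcT => a; rewrite [RHS]mxE.
apply: nearcS2 (nearcI Sf Sg) (near_line oU z0 Uz) => a [h1 h2] [za Ua] nu nz.
have [_ D0 _ _] := Psi_fibre nu za.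
by rewrite D0 // h1 // h2 // mulmxDl pairDr.
Qed.

Lemma tval_act U f (s : sec E U) z : opn U -> reg U f -> z != 0 -> U (Pi z) ->
  tval (act f s) z = f (Pi z) *: tval s z.
Proof.
move=> oU rf z0 Uz; apply: tvalE; have [g [rg <- Sg]] := tlim_tval s oU z0 Uz.
have z00 : z + 0 *: v != 0 by rewrite scale0r addr0.
have Uz0 : U (Pi (z + 0 *: v)) by rewrite scale0r addr0.
have R := (Pi_arc (fun o => regc_line z v 0 o) z00).2 _ _ oU Uz0 rf.
exists (fun a => f (Pi (z + a *: v)) *: g a); split=> //.
- by move=> l; apply: regc_eq (regcM R (rg l)); apply: nearcT => a; rewrite [RHS]mxE.
- by rewrite scale0r addr0.
apply: nearcS2 Sg (near_line oU z0 Uz) => a h1 [za Ua] nu nz.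
have [_ _ A0 _] := Psi_fibre nu za.
by rewrite A0 // h1 // -scalemxAl pairZr.
Qed.

Lemma tval_res U V (s : sec E U) z : opn U -> opn V -> V `<=` U -> z != 0 -> V (Pi z) ->
  tval (res V s) z = tval s z.
Proof.
move=> oU oV VU z0 Vz; apply: tvalE; have [g [rg <- Sg]] := tlim_tval s oU z0 (VU _ Vz).
exists g; split=> //.
apply: nearcS2 Sg (near_line oV z0 Vz) => a h1 [za Ua] nu nz.
by have [_ _ _ R0] := Psi_fibre nu za; rewrite R0 // h1.
Qed.

Lemma tval_arc c (z : k -> 'rV[k]_n.+1) U (s0 : sec E U) l :
  (forall o, regc c (fun a => z a 0 o)) -> z c != 0 -> opn U -> U (Pi (z c)) ->
  regc c (fun a => tval s0 (z a) 0 l).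
Proof.
move=> rz zc oU Uc; have zi := idxP zc; set i := idx (z c) in zi.
have Uc' : U (K i (deh i (z c))) by rewrite -Pi_deh.
have [tau [rt nt]] := tval_near s0 oU Uc'.
have rd (o : 'I_n) : regc c (fun a => deh i (z a) 0 o).
  apply: regc_eq (regcM (rz (lift i o)) (regcV (rz i) zi)).
  by apply: nearcT => a; rewrite [RHS]mxE.
apply: regc_eq (regcM (rz i) (regp_arc (x := fun a => deh i (z a)) (rt l) rd)).
apply: nearcS2 (nearp_arc (x := fun a => deh i (z a)) nt rd) (regc_neq0 (rz i) zi) => a [_ _ Ha] ai.
by rewrite (Ha (z a)) // [RHS]mxE.
Qed.

Definition tform (xi : 'rV[k]_r) z U (s : sec E U) : k :=
  if pselect (opn U /\ U (Pi z)) then pair xi (tval s z) else 0.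

Lemma tformE xi z U (s : sec E U) : opn U -> U (Pi z) -> tform xi z s = pair xi (tval s z).
Proof. by move=> oU Uz; rewrite /tform; case: pselect => // -[]. Qed.

Lemma tform_fibre xi z : z != 0 -> fibre_form (Pi z) (tform xi z).
Proof.
move=> z0; split.
- by move=> U s nU; rewrite /tform; case: pselect.
- by move=> U s t oU Uz; rewrite !tformE // tvalD // pairDr.
- by move=> U f s oU Uz rf; rewrite !tformE // tval_act // pairZr.
- by move=> U V s oU oV VU Vz; rewrite !tformE ?tval_res //; apply: VU.
Qed.

(** A relation gives xi with [tform xi] zero at z, hence everywhere by [line_vanish]. But at x0 the
    fibre has rank r modulo x0, so the lifts of a frame are independent there. *)
Lemma tval_free z U (e : 'I_r -> sec E U) : opn U -> is_frame e -> z != 0 -> U (Pi z) ->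
  (\matrix_l tval (e l) z : 'M[k]_r) \in unitmx.
Proof.
move=> oU fr z0 Uz; rewrite -row_free_unit -row_leq_rank -mxrank_tr row_leq_rank.
rewrite -kermx_eq0; apply/rowV0P => xi /sub_kermxP nuC.
have form0 U' (s : sec E U') : tform xi z s = 0.
  apply: (form_zero oU fr Uz (tform_fibre xi z0)) => l; rewrite tformE // pairC.
  apply/pair_mx0; have /rowP/(_ l) := nuC; rewrite [RHS]mxE => E0.
  apply/rowP => x; rewrite ord1 [RHS]mxE -[RHS]E0 !mxE; apply: eq_bigr => a _.
  by rewrite !mxE mulrC.
have [x0 [M0 [x00 S0 F0]]] := generic_rank.
have form1 : forall U' (s : sec E U'), tform xi x0 s = 0.
  apply: (line_vanish (P := fun=> True) (Phi := tform xi) _ _ _ _ I I z0 x00 form0) => //.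
  - by move=> z' _ z'0; apply: tform_fibre.
  - move=> c z' U' s _ c0 z'0; have [[oU' Uz']|nU] := pselect (opn U' /\ U' (Pi z')).
      by rewrite !tformE ?Pi_scale // tval_scale // pairZr.
    have [f1 _ _ _] := tform_fibre xi z'0; rewrite f1 // mulr0.
    have cz0 : c *: z' != 0 by rewrite scaler_eq0 negb_or c0.
    by have [f2 _ _ _] := tform_fibre xi cz0; apply: f2; rewrite Pi_scale.
  - move=> x y c _ _ nz U' s0 oU' Uc.
    have rl o : regc c (fun a => (x + a *: y) 0 o) by apply: regc_line.
    have R : regc c (fun a => pair xi (tval s0 (x + a *: y))).
      apply: regc_sum => l _; apply: regcM; first exact: regc_cst.
      by apply: (tval_arc (z := fun a => x + a *: y)).
    by apply: regc_eq R; apply: nearcS ((Pi_arc rl nz).1 _ oU' Uc) => a Ua; rewrite tformE.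
have [O [e' [oO Ox fr']]] := frame_at E_lf (Pi x0).
pose C : 'M[k]_r := \matrix_l tval (e' l) x0.
have Cnu : C *m xi^T = 0.
  apply/colP => l; rewrite [RHS]mxE; have := form1 O (e' l); rewrite tformE // => E0.
  by rewrite -[RHS]E0 mxE; apply: eq_bigr => a _; rewrite !mxE mulrC.
have xj := idxP x00; have S1 := fmx_spans oO fr' Ox xj.
have F1 : row_free (col_mx x0 (fmx (idx x0) x0 e')).
  by rewrite /row_free eqn_leq rank_leq_row -{1}(eqP F0) mxrankS // spans_sub.
suff /row_freeP[R CR] : row_free C^T by rewrite -[xi]mulmx1 -CR mulmxA -[xi]trmxK -trmx_mul Cnu trmx0 mul0mx.
rewrite -row_leq_rank mxrank_tr row_leq_rank -kermx_eq0; apply/rowV0P => u /sub_kermxP uC.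
have /sub_rVP[c cE] : (u *m fmx (idx x0) x0 e' <= x0)%MS.
  apply: annih_sub => nu /pair_mx0 nz.
  rewrite -mulmxA; have -> : fmx (idx x0) x0 e' *m nu^T = C *m (w *m nu^T).
    apply/colP => l; rewrite fmx_mul -(PsiE _ nz xj) (tval_solves (e' l) oO x00 Ox nz).
    have := pair_mx nu (tval (e' l) x0 *m w); rewrite -mulmxA => /matrixP/(_ 0 0).
    rewrite [RHS]mxE eqxx mulr1n => <-; rewrite [LHS]mxE [RHS]mxE.
    by apply: eq_bigr => a _; congr (_ * _); rewrite [RHS]mxE.
  by rewrite mulmxA uC mul0mx.
have [R FR] := row_freeP F1.
have : row_mx (- c%:M) u *m col_mx x0 (fmx (idx x0) x0 e') = 0.
  by rewrite mul_row_col mulNmx mul_scalar_mx cE addNr.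
move=> /(congr1 (mulmx^~ R)); rewrite mul0mx -mulmxA FR mulmx1 -[0]row_mx0.
by move=> /eq_row_mx[].
Qed.

Lemma tval_sum U z (F : 'I_r -> sec E U) : opn U -> z != 0 -> U (Pi z) ->
  tval (\sum_l F l) z = \sum_l tval (F l) z.
Proof.
move=> oU z0 Uz; apply: (big_morph (fun s : sec E U => tval s z)) => [s t|]; first exact: tvalD.
by apply: (@addrI _ (tval (0 : sec E U) z)); rewrite -tvalD // !addr0.
Qed.

Lemma tval_inj U (s s' : sec E U) : opn U ->
  (forall z, z != 0 -> U (Pi z) -> tval s z = tval s' z) -> s = s'.
Proof.
move=> oU Hs; apply: J_eq => // z nu z0 Uz nz.
by rewrite (tval_solves s oU z0 Uz nz) (tval_solves s' oU z0 Uz nz) Hs.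
Qed.

Lemma pproj_mkP (z : nzvec k n) : pproj (@nzvec_scaled k n) z = mkP (sval z).
Proof. by case: z => z z0; rewrite (mkPE z0). Qed.

Lemma pre_Pi (V : set PN) z : V (mkP z) = (phi @^-1` V) (Pi z).
Proof. by rewrite /Pi /= psiK. Qed.

Definition twist V (s : sec E (phi @^-1` V)) l (z : nzvec k n) : k :=
  if `[< V (mkP (sval z)) >] then tval s (sval z) 0 l else 0.

Lemma twistE V (s : sec E (phi @^-1` V)) l (z : nzvec k n) : V (mkP (sval z)) -> twist s l z = tval s (sval z) 0 l.
Proof. by move=> Vz; rewrite /twist; case: asboolP. Qed.

Lemma twist_sec V (s : sec E (phi @^-1` V)) l : opn V ->
  fm_sec (f0 := pfmodule (fun=> setT) (@nzvec_lin k n) (@nzvec_class k n)) V (twist s l).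
Proof.
move=> oV; have oU : opn (phi @^-1` V) by have [] := phi_m oV.
split.
- by move=> z; rewrite pproj_mkP /twist; case: asboolP.
- move=> c a b c0 ab; have a0 : sval a != 0 := svalP a.
  rewrite /twist ab mkP_scale //; case: asboolP => [Va|_]; last by rewrite mulr0.
  by rewrite tval_scale // ?[LHS]mxE // -pre_Pi.
- move=> i; have oi := opnI oV (pcoord_opn k i).
  apply: reg_local => // p [Vp /stdchart_dom[q pE]]; rewrite pE in Vp *.
  apply: (ch_regV (stdchart_ischart k i)).
  have Uq : (phi @^-1` V) (K i q) by rewrite /= KE.
  have [tau [rt nt]] := tval_near s oU Uq.
  apply: regp_eq (rt l); apply: nearpS nt => q' [Uq' _ H'] /=.
  have [c c0 zc] := prep_stdchart i q'; rewrite twistE; last first.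
    by rewrite prep_mkP -KE.
  have zi : sval (prep (stdchart i q' : PN)) 0 i = c by rewrite zc mxE hom_j mulr1.
  rewrite (H' (sval (prep _))); last 2 first.
  - by rewrite zi.
  - by rewrite zc deh_scale // deh_hom.
  by rewrite /nzvec_lin [X in X / _]mxE zi mulrAC divff // mul1r.
Qed.

Definition matches V (t : {ffun 'I_r -> sec (serre_twist k n) V}) U (s : sec E U) : Prop :=
  forall z : nzvec k n, U (Pi (sval z)) -> forall l, tval s (sval z) 0 l = fval (t l) z.

Lemma section_scale V (t : sec (serre_twist k n) V) (a b : nzvec k n) c : opn V -> c != 0 ->
  sval b = c *: sval a -> fval t b = c * fval t a.
Proof. by move=> oV c0 ab; have [_ H1 _] := fsec_sec t oV; apply: H1. Qed.

Definition nzhom i q : nzvec k n := exist _ (hom i q) (hom_neq0 i q).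

Lemma section_regp V (t : sec (serre_twist k n) V) i q : opn V -> V (stdchart i q) ->
  regp q (fun q => fval t (nzhom i q)).
Proof.
move=> oV Vq; have [_ _ /(_ i) H3] := fsec_sec t oV.
have oW := opnI oV (pcoord_opn k i).
have Wq : (V `&` pcoord i) (stdchart i q : PN).
  by split=> //; apply/stdchart_dom; exists q.
apply: regp_eq (ch_reg (stdchart_ischart k i) oW Wq H3).
apply: nearpT => q' /=; have [c c0 zc] := prep_stdchart i q'.
rewrite (section_scale t (a := nzhom i q') oV c0 zc).
by rewrite /nzvec_lin zc [X in _ / X]mxE hom_j mulr1 mulrAC divff // mul1r.
Qed.

Lemma tval_regp U (s : sec E U) i q l : opn U -> U (K i q) ->
  regp q (fun q => tval s (hom i q) 0 l).
Proof.
move=> oU Uq; have [tau [rt nt]] := tval_near s oU Uq.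
apply: regp_eq (rt l); apply: nearpS nt => q' [_ _ H'].
by rewrite (H' (hom i q')) ?hom_j ?oner_neq0 ?deh_hom // scale1r.
Qed.

(** The lifts of a frame form an invertible matrix by [tval_free], and Cramer's rule gives regular
    coefficients. *)
Lemma match_local V (t : {ffun 'I_r -> sec (serre_twist k n) V}) x : opn V -> V (phi x) ->
  exists W, [/\ opn W, W x, W `<=` phi @^-1` V & exists s : sec E W, matches t s].
Proof.
move=> oV Vx; have oU : opn (phi @^-1` V) by have [] := phi_m oV.
have [z0 z00 xE] := Pi_surj x; set i := idx z0; set q0 := deh i z0.
rewrite (Pi_deh (idxP z00)) -/i -/q0 in xE.
have [O [e [oO Ox fr]]] := frame_at E_lf x; rewrite xE in Vx Ox *.
pose C q : 'M[k]_r := \matrix_l tval (e l) (hom i q).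
pose b q : 'rV[k]_r := \row_l fval (t l) (nzhom i q).
have [|||f [rf fE]] := @regp_solve k n q0 r C b.
- by move=> l c; apply: regp_eq (tval_regp (e l) c oO Ox); apply: nearpT => q; rewrite mxE.
- move=> l; rewrite /= KE in Vx; apply: regp_eq (section_regp (t l) oV Vx).
  by apply: nearpT => q; rewrite mxE.
- by apply: tval_free fr _ _ => //; [exact: hom_neq0|rewrite Pi_hom].
have nW := nearpI (nearpI (ch_near (chK i) oO Ox) (ch_near (chK i) oU Vx))
  (nearpI (nearp_all (fun l => regp_near (rf l))) fE).
have [W [oW Wx HW]] := nearp_open (chK i) nW.
have WO : W `<=` O by move=> y /HW[q -> [[]]].
exists W; split=> //; first by move=> y /HW[q -> [[]]].
pose F l (y : X) : k := f (deh i (sval (prep (phi y)))) 0 l.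
have FE l q : F l (K i q) = f q 0 l.
  by rewrite /F KE; have [c c0 ->] := prep_stdchart i q; rewrite deh_scale // deh_hom.
have rF l : reg W (F l).
  apply: reg_local => // y /HW[q -> [_ [/(_ l) rq _]]]; apply: (ch_regV (chK i)).
  by apply: regp_eq rq; apply: nearpT => q' /=; rewrite FE.
exists (\sum_l act (F l) (res W (e l))) => z Wz l.
have [q zq [[Oq _] [_ fq]]] := HW _ Wz.
have [c c0 zc] : exists2 c, c != 0 & sval z = c *: hom i q.
  apply: Pi_inj; [exact: hom_neq0|exact: (svalP z)|by rewrite Pi_hom zq].
have Wq : W (Pi (hom i q)) by rewrite Pi_hom -zq.
rewrite (section_scale (t l) (a := nzhom i q) oV c0 zc) zc.
rewrite (tval_scale _ oW c0 (hom_neq0 i q) Wq) mxE; congr (_ * _).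
have -> : fval (t l) (nzhom i q) = b q 0 l by rewrite mxE.
rewrite -fq (tval_sum _ oW (hom_neq0 i q) Wq) summxE mxE; apply: eq_bigr => a _.
rewrite (tval_act _ oW (rF a) (hom_neq0 i q) Wq) mxE Pi_hom FE; congr (_ * _).
by rewrite (tval_res _ oO oW WO (hom_neq0 i q) Wq) [RHS]mxE.
Qed.

Lemma match_ex V (t : {ffun 'I_r -> sec (serre_twist k n) V}) : opn V ->
  exists s : sec E (phi @^-1` V), matches t s.
Proof.
move=> oV; have oU : opn (phi @^-1` V) by have [] := phi_m oV.
have [||x Ux||s Hs] := @sheaf_glue k X E E_lf.1 (phi @^-1` V) (fun U s => matches t s).
- move=> U W s oU' oW WU _ Hs z Wz l; rewrite tval_res // ?Hs //; last exact: (svalP z).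
  exact: WU.
- move=> U s s' oU' _ Hs Hs'; apply: tval_inj => // z z0 Uz; apply/rowP => l.
  exact: (etrans (Hs (exist _ z z0) Uz l) (esym (Hs' (exist _ z z0) Uz l))).
- exact: match_local.
- exact: oU.
exists s => z Vz l; have [W [oW Wz WV /(_ z Wz l) <-]] := Hs _ Vz.
by rewrite tval_res //; apply: (svalP z).
Qed.

Lemma twist_pullback : is_pullback phi (osum r (serre_twist k n)) E.
Proof.
have hex V (t : {ffun 'I_r -> sec (serre_twist k n) V}) :
    exists s : sec E (phi @^-1` V), opn V -> matches t s.
  have [oV|nV] := pselect (opn V); last by exists 0.
  by have [s Hs] := match_ex t oV; exists s.
pose h V (t : sec (osum r (serre_twist k n)) V) := sval (cid (hex V t)).
have hP V (t : {ffun 'I_r -> sec (serre_twist k n) V}) : opn V -> matches t (h V t) :=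
  svalP (cid (hex V t)).
have oP V : opn V -> opn (phi @^-1` V) by move=> oV; have [] := phi_m oV.
have huniq V (t : {ffun 'I_r -> sec (serre_twist k n) V}) s : opn V -> matches t s -> h V t = s.
  move=> oV Hs; apply: tval_inj => [|z z0 Uz]; first exact: oP.
  apply/rowP => l; exact: (etrans (hP V t oV (exist _ z z0) Uz l) (esym (Hs (exist _ z z0) Uz l))).
have nz (z : nzvec k n) : sval z != 0 := svalP z.
apply: (iso_pullback phiK psiK phi_m psi_m (h := h) E_lf.1).
- split.
  + move=> V s t oV; apply: huniq => // z Uz l; rewrite tvalD //; last exact: oP.
    by rewrite mxE !hP // ffunE fsec_add.
  + move=> V f s oV rf; have [_ /(_ f rf) rf'] := phi_m oV; apply: huniq => // z Uz l.
    rewrite tval_act //; last exact: oP.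
    by rewrite mxE hP // ffunE fsec_act //= pproj_mkP /Pi psiK.
  + move=> V W s oV oW WV; have WV' : phi @^-1` W `<=` phi @^-1` V by move=> y; apply: WV.
    apply: huniq => // z Uz l; rewrite tval_res //; try exact: oP.
    rewrite hP //; last exact: WV'.
    by rewrite ffunE fsec_res //= pproj_mkP pre_Pi.
- move=> V oV s t hst; apply/ffunP => l; apply: fsec_inj => z.
  have [Vz|nVz] := pselect (V (mkP (sval z))); last first.
    have nV : ~ V (pproj (@nzvec_scaled k n) z) by rewrite pproj_mkP.
    by rewrite (fsec_supp (s l) oV nV) (fsec_supp (t l) oV nV).
  by rewrite pre_Pi in Vz; rewrite -(hP V s oV z Vz l) -(hP V t oV z Vz l) hst.
- move=> V s oV; pose F := pfmodule (fun=> setT) (@nzvec_lin k n) (@nzvec_class k n).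
  pose t : {ffun 'I_r -> sec (serre_twist k n) V} := [ffun l => fsec_of (F := F) V (twist s l)].
  exists t; apply: huniq => // z Uz l; rewrite ffunE (fsec_ofE oV (twist_sec s l oV)).
  by rewrite twistE // pre_Pi.
Qed.

End Quotient.

(** A vector field is solved for in a frame by Cramer's rule: a kernel vector of the matrix would
    give a nonzero form that kills [E] at a point. The local solutions glue because [J] is
    injective. *)
Lemma J_iso : r = n -> (forall z nu, z != 0 -> pair nu z = 0 ->
    (forall U (s : sec E U), Psi nu z s = 0) -> nu = 0) -> oisomorphism J.
Proof.
move=> rn A0; split=> // U oU.
suff /choice[g gK] : forall th, exists s, J s = th :> sec (tangent X) U.
  by exists g => // s; apply: (J_inj oU).
move=> th; have [jD jA jR] := J_mor.
have [||x Ux||s Hs] := @sheaf_glue k X E E_lf.1 U (fun W s => J s = res W th).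
- by move=> W W' s oW oW' WW WU Hs; rewrite jR // Hs res_comp.
- by move=> W s s' oW _ Hs Hs'; apply: (J_inj oW); rewrite Hs.
- have [z0 z00 xE] := Pi_surj x; set i := idx z0; set q0 := deh i z0.
  rewrite (Pi_deh (idxP z00)) -/i -/q0 in xE.
  have [O [e [oO Ox fr]]] := frame_at E_lf x; rewrite xE in Ux Ox *.
  have dq q : dm i (K i q) by rewrite -Pi_hom; apply/Pi_dm; rewrite ?hom_neq0 ?hom_j ?oner_neq0.
  pose co (a : 'I_r) := lift i (cast_ord rn a).
  pose M q : 'M[k]_r := \matrix_(l, a) fval (J (e l)) (K i q, rho (co a) i).
  pose b q : 'rV[k]_r := \row_a fval th (K i q, rho (co a) i).
  have [|||f [rf fE]] := @regp_solve k n q0 r M b.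
  + by move=> l c; apply: regp_eq (jvec_regp (e l) (co c) oO Ox); apply: nearpT => q; rewrite mxE.
  + move=> c; have oW := opnI oU (dm_opn i); have [_ _ H3] := fsec_sec th oU.
    have sW : U `&` dm i `<=` U by move=> y [].
    have sd : U `&` dm i `<=` dm i by move=> y [].
    have R := H3 _ _ oW sW (reg_sub (dm_opn i) oW sd (@rho_reg (co c) i)).
    have Wq : (U `&` dm i) (K i q0) by split.
    by apply: regp_eq (ch_reg (chK i) oW Wq R); apply: nearpT => q; rewrite [RHS]mxE.
  + rewrite -unitmx_tr -row_free_unit -kermx_eq0; apply/rowV0P => u /sub_kermxP uM.
    (* The i-th entry of [nu] is chosen so that [nu] vanishes on the homogeneous vector of the
       point. *)
    pose c0 := - \sum_a u 0 a * hom i q0 0 (co a).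
    pose nu : 'rV[k]_n.+1 := \row_o (if unlift i o is Some a then u 0 (cast_ord (esym rn) a) else c0).
    have nu_co a : nu 0 (co a) = u 0 a by rewrite mxE liftK cast_ordK.
    have pairE (v : 'rV[k]_n.+1) : pair nu v = c0 * v 0 i + \sum_a u 0 a * v 0 (co a).
      rewrite /pair (sum_lift _ i); congr (_ + _); first by rewrite mxE unlift_none.
      rewrite (reindex (cast_ord rn)) /=; last first.
        by exists (cast_ord (esym rn)) => a _; rewrite ?cast_ordK ?cast_ordKV.
      by apply: eq_bigr => a _; rewrite nu_co.
    have nz : pair nu (hom i q0) = 0 by rewrite pairE hom_j mulr1 addNr.
    have hi : hom i q0 0 i != 0 by rewrite hom_j oner_neq0.
    have Oq : O (Pi (hom i q0)) by rewrite Pi_hom.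
    have nu0 : nu = 0.
      apply: (A0 _ _ (hom_neq0 i q0) nz) => U' s'.
      apply: (form_zero oO fr Oq (Psi_fibre nu (hom_neq0 i q0))) => l.
      rewrite (PsiE _ nz hi) pairE jvec_i // ?hom_neq0 // mulr0 add0r.
      have /rowP/(_ l) := uM; rewrite [RHS]mxE => E0; rewrite -[RHS]E0 mxE.
      by apply: eq_bigr => a _; rewrite jvec_hom !mxE.
    by apply/rowP => a; rewrite -nu_co nu0 !mxE.
  have nW := nearpI (nearpI (ch_near (chK i) oO Ox) (ch_near (chK i) oU Ux))
    (nearpI (nearp_all (fun l => regp_near (rf l))) fE).
  have [W [oW Wx HW]] := nearp_open (chK i) nW.
  have WO : W `<=` O by move=> y /HW[q -> [[]]].
  have WU : W `<=` U by move=> y /HW[q -> [[]]].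
  exists W; split=> //.
  pose F l (y : X) : k := f (deh i (sval (prep (phi y)))) 0 l.
  have FE l q : F l (K i q) = f q 0 l.
    by rewrite /F KE; have [c c0 ->] := prep_stdchart i q; rewrite deh_scale // deh_hom.
  have rF l : reg W (F l).
    apply: reg_local => // y /HW[q -> [_ [/(_ l) rq _]]]; apply: (ch_regV (chK i)).
    by apply: regp_eq rq; apply: nearpT => q' /=; rewrite FE.
  set s : sec E W := \sum_l act (F l) (res W (e l)); exists s; apply: fsec_inj => -[y g].
  have [Wy|nW'] := pselect (W y); last by rewrite !fsec_supp.
  rewrite [RHS]fsec_res //=; have [q yq [_ [_ fq]]] := HW _ Wy.
  have Wq : W (Pi (hom i q)) by rewrite Pi_hom -yq.
  have Ds := J_deriv s oW Wq; have [_ T2 _] := fsec_sec th oU; have Dt := T2 _ (WU _ Wq).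
  pose D g := -1 * fval (J s) (Pi (hom i q), g) + fval th (Pi (hom i q), g).
  have DD : point_derivation (Pi (hom i q)) D := point_derivation_lin (-1) Ds Dt.
  have hi : hom i q 0 i != 0 by rewrite hom_j oner_neq0.
  suff D0 : vec i (hom i q) D = 0.
    have := vec_eq0 (hom_neq0 i q) hi DD D0 g; rewrite /D Pi_hom -yq mulN1r addrC => /eqP.
    by rewrite subr_eq0 => /eqP.
  apply/rowP => o; rewrite [RHS]mxE; have [a oa|->] := unliftP i o; last first.
    by rewrite (vec_i (hom_neq0 i q) hi DD).
  rewrite mxE hom_j mul1r oa /D Pi_hom mulN1r -jvec_hom /s jvec_sum // summxE.
  have /rowP/(_ (cast_ord (esym rn) a)) := fq; rewrite !mxE /co cast_ordKV => <-.
  rewrite addrC; apply/eqP; rewrite subr_eq0; apply/eqP; apply: eq_bigr => l _.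
  rewrite jvec_act // jvec_res //.
  by rewrite [RHS]mxE jvec_hom Pi_hom FE [X in _ * X = _]mxE /co cast_ordKV.
- exact: oU.
exists s; apply: fsec_inj => -[x g]; have [Ux|nU] := pselect (U x); last by rewrite !fsec_supp.
have [V [oV Vx VU E0]] := Hs x Ux.
have E1 : fval (J (res V s)) (x, g) = fval (res V th) (x, g) by rewrite E0.
by rewrite jR // !fsec_res in E1.
Qed.

End OverPn.

(** * Transport of the tangent sheaf and conclusion *)

Section TangentPullback.
Variables (k : closedFieldType) (X Y : space k) (phi : X -> Y) (psi : Y -> X).
Hypotheses (phiK : cancel phi psi) (psiK : cancel psi phi).
Hypotheses (phi_m : smorphism phi) (psi_m : smorphism psi).

Lemma tangent_pullback : is_pullback phi (tangent Y) (tangent X).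
Proof.
pose h V (t : sec (tangent Y) V) : sec (tangent X) (phi @^-1` V) :=
  fsec_of (F := tangent_fmodule X) (phi @^-1` V) (fun a => fval t (phi a.1, a.2 \o psi)).
have oP V : opn V -> opn (phi @^-1` V) by move=> oV; have [] := phi_m oV.
have hE V (t : sec (tangent Y) V) x f : opn V -> fval (h V t) (x, f) = fval t (phi x, f \o psi).
  move=> oV; have VF : vector_field (phi @^-1` V) (fun a => fval t (phi a.1, a.2 \o psi)).
    exact: (vector_field_iso phiK psiK phi_m psi_m (oP _ oV) oV (fun x => iff_refl _) (fsec_sec t oV)).
  by rewrite /h (fsec_ofE (F := tangent_fmodule X) (oP _ oV) VF).
have fK (f : Y -> k) : (f \o phi) \o psi = f by apply: funext => y /=; rewrite psiK.
have gK (f : X -> k) : (f \o psi) \o phi = f by apply: funext => y /=; rewrite phiK.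
apply: (iso_pullback phiK psiK phi_m psi_m (h := h)); first exact: tangent_sheaf.
- split.
  + by move=> V s t oV; apply: fsec_inj => -[x f]; rewrite hE // !fsec_add !hE.
  + move=> V f s oV rf; have [_ /(_ f rf) rf'] := phi_m oV; have oU := oP _ oV.
    by apply: fsec_inj => -[x g]; rewrite hE // (fsec_act s _ oV rf) (fsec_act _ _ oU rf') hE.
  + move=> V W s oV oW WV; have oU := oP _ oV; have oU' := oP _ oW.
    have WV' : phi @^-1` W `<=` phi @^-1` V by move=> y; apply: WV.
    apply: fsec_inj => -[x f]; rewrite hE //.
    have [Wx|nW] := pselect (W (phi x)); last by rewrite !fsec_supp.
    by rewrite (@fsec_res k Y (tangent_fmodule Y) V W s (phi x, f \o psi) oV oW WV Wx) fsec_res // hE.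
- move=> V oV s t st; apply: fsec_inj => -[y f].
  by have := hE V s (psi y) (f \o phi) oV; rewrite st hE // psiK fK.
- move=> V e oV; have oU := oP _ oV.
  have VF : vector_field V (fun a => fval e (psi a.1, a.2 \o phi)).
    apply: (vector_field_iso psiK phiK psi_m phi_m oV oU _ (fsec_sec e oU)) => y.
    by rewrite /= psiK.
  exists (fsec_of (F := tangent_fmodule Y) V (fun a => fval e (psi a.1, a.2 \o phi))).
  apply: fsec_inj => -[x f]; rewrite hE //.
  by rewrite (fsec_ofE (F := tangent_fmodule Y) oV VF) /= phiK gK.
Qed.

End TangentPullback.

(** Omitting one of the n + 1 rays gives [B] or the rays of some [Brep B l] in another order, which
    [rays_maxB] allows. *)
Lemma simplex_rays n (Sigma : set (set 'rV[rat]_n)) (B : 'M[int]_n) :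
  maxB Sigma B -> (forall i, maxB Sigma (Brep B i)) ->
  exists U : 'I_n.+1 -> 'rV[int]_n, \sum_o U o = 0 /\ forall j, maxB Sigma (Bmx U j).
Proof.
move=> mB mBr; pose U (o : 'I_n.+1) := oapp (ray B) (- \sum_x ray B x) (unlift ord0 o).
have U0 : U ord0 = - \sum_x ray B x by rewrite /U unlift_none.
have UL i : U (lift ord0 i) = ray B i by rewrite /U liftK.
exists U; split; first by rewrite (sum_lift _ ord0) U0 (eq_bigr _ (fun i _ => UL i)) addNr.
move=> j; have [l ->|->] := unliftP ord0 j; last first.
  suff -> : Bmx U ord0 = B by [].
  by apply/row_matrixP => i; rewrite rowK UL.
have ray_inj : injective (ray (Brep B l)).
  move=> a b /(congr1 (mulmx^~ (invmx (Brep B l)))); have [uB _] := mBr l.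
  rewrite -!row_mul mulmxV // => /rowP/(_ a); rewrite !mxE eqxx.
  by case: eqVneq => [->|//].
pose f (o : 'I_n.+1) := odflt l (unlift ord0 o).
have Uf o : o != lift ord0 l -> ray (Brep B l) (f o) = U o.
  have [a ->|->] := unliftP ord0 o; rewrite ray_Brep /f.
    by rewrite liftK /= UL (inj_eq lift_inj) => /negPf ->.
  by rewrite unlift_none /= eqxx U0.
have nl i : lift (lift ord0 l) i != lift ord0 l by rewrite eq_sym neq_lift.
apply: (rays_maxB (mBr l)) => [a b|i]; last by exists (f (lift (lift ord0 l) i)); rewrite ray_Bmx Uf.
rewrite !ray_Bmx -!Uf // => /ray_inj fab; apply: (@lift_inj _ (lift ord0 l)).
move: (nl a) (nl b) fab; rewrite /f.
have [a' ->|->] := unliftP ord0 (lift (lift ord0 l) a);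
have [b' ->|->] := unliftP ord0 (lift (lift ord0 l) b); rewrite ?liftK ?unlift_none //=.
- by move=> _ _ ->.
- by rewrite (inj_eq lift_inj) => + _ E0; rewrite E0 eqxx.
- by rewrite (inj_eq lift_inj) => _ + E0; rewrite E0 eqxx.
Qed.

Theorem theorem1p1 (k : closedFieldType) (n : nat)
    (Sigma : set (set 'rV[rat]_n)) (fan_Sigma : is_fan Sigma)
    (X_smooth : smooth (toric_variety k Sigma) n)
    (X_projective : projective (toric_variety k Sigma))
    (r : nat) (r_gt0 : (0 < r)%N)
    (E : omodule (toric_variety k Sigma))
    (E_vector_bundle : locally_free r E) (E_ample : ample E)
    (j : forall U : set (toric_variety k Sigma),
       sec E U -> sec (tangent (toric_variety k Sigma)) U)
    (j_morphism : omorphism j) (j_injective : oinjective j) :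
  exists phi : toric_variety k Sigma -> projective_space k n,
    sisomorphism phi /\
    (is_pullback phi (osum r (serre_twist k n)) E \/
     [/\ r = n, oisomorphism j &
         is_pullback phi (tangent (projective_space k n))
           (tangent (toric_variety k Sigma))]).
Proof.
have [m [N [H amp]]] := ample_data E_ample.
have n_pos := n_gt0 fan_Sigma X_smooth X_projective E_vector_bundle j_morphism r_gt0 j_injective.
have [B [mB mBr]] :=
  X_fan fan_Sigma X_smooth X_projective E_vector_bundle j_morphism amp r_gt0 j_injective.
have [U [U0 mU]] := simplex_rays mB mBr.
have [phi [phi_iso _ phiE]] := toric_isomorphism fan_Sigma X_smooth X_projective U0 mU n_pos.
have [phi_m [psi [psi_m phiK psiK]]] := phi_iso.
have chK i : ischart (kap fan_Sigma (Bmx U i) : _ -> toric_variety k Sigma) :=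
  kap_ischart fan_Sigma X_smooth X_projective (mU i).
have gen := generic_rank phiK psiK phi_m chK phiE j_morphism E_vector_bundle j_injective.
exists phi; split=> //.
have [[rn A0]|[w [w_free w_sub]]] :=
  subspace_ex psiK phi_m psi_m j_morphism E_vector_bundle amp gen r_gt0.
- right; split=> //; last exact: (tangent_pullback phiK psiK phi_m psi_m).
  exact: (J_iso phiK psiK phi_m chK phiE j_morphism E_vector_bundle j_injective rn A0).
- left; exact: (twist_pullback phiK psiK phi_m psi_m chK phiE j_morphism E_vector_bundle amp
    j_injective w_free w_sub).
Qed.
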